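(* Assume the Riemann Hypothesis. Let $1/2<\sigma_0<1$, $2\gamma_1\le t_0\le50$ and $x\ge x_0\ge4\exp(2e^2)$. Then \[ |M(x)|\le\mathcal{N}_1(\sigma_0,t_0,x_0)\,x^{\sigma_0+\frac12\omega_{0,1}}\log x, \] where $\omega_{0,1}=\omega_{0,1}(\sigma_0,t_0,x_0)=\omega_1\left(\sigma_0,t_0;\log\log\left(\frac{3e\sqrt{x_0}}{2}\right)\right)$ and \[ \mathcal{N}_1(\sigma_0,t_0,x_0)=\frac1\pi\left(\frac{3e}{2}\right)^{\omega_{0,1}}\left(\frac12+\frac{1}{\log x_0}+\frac{1.1-\sigma_0}{x_0^{\sigma_0-\frac12}\log x_0}\right)+\frac{1}{x_0^{\frac12\omega_{0,1}}}\left(\frac{8e^{e^2}}{\pi\sigma_0(\sigma_0-\frac12)\log x_0}+\frac{23.6}{x_0^{\sigma_0-\frac12}}\right). \]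
   Context: $\mu$ is the Möbius function, $M(x)=\sum_{n\le x}\mu(n)$, $\zeta$ the Riemann zeta-function; RH asserts all nontrivial zeros of $\zeta$ have real part $1/2$. $\gamma_1\approx14.1347$ is the positive ordinate of the first nontrivial zero. $\delta(t_0)=(1+1/t_0)^2$; $\lambda(t_0)=(t_0/2)\log\log(3t_0/2)$; with $\delta=\delta(t_0)$: $a_1(t_0)=\delta\left(\frac{117}{4}+3\delta+(3+\delta)\left(\frac{t_0}{e^{e^2}}+\frac{3+e}{e}\right)\right)$, $a_2(t_0)=\frac{\delta}{75}\left(\frac{t_0}{2\gamma_1}+1+\frac1e\right)$, $a_4(t_0)=\frac{4\delta}{5e}\left(3+\frac{\delta}{4}\right)$. For $a,b,c>0$ let $\mathcal{M}(a,b,c;t)=a+\frac{b}{(\log t)^c\log\log t}$, $\mathcal{M}_1(t)=\mathcal{M}(0.759282,20.1911,0.285;t)$, $\mathcal{M}_2(t)=\mathcal{M}(0.653,60.12,0.2705;t)$. Define $\widehat\phi_1(u)=0.96$ for $\log\log2\pi\le u<\log\log10^{2465}$ and $\widehat\phi_1(u)=1.719282-\mathcal{M}_1(10^{2465})+\frac{20.1911}{ue^{0.285u}}$ for $u\ge\log\log10^{2465}$; $\widehat\phi_2(u)=2.491$ for $\log\log2\pi\le u<\log\log10^{208}$ and $\widehat\phi_2(u)=3.144-\mathcal{M}_2(10^{208})+\frac{60.12}{ue^{0.2705u}}$ for $u\ge\log\log10^{208}$. Define $\omega(t_0;u)=\frac{a_1(t_0)\widehat\phi_2(u)}{\lambda(t_0)u}+\frac{a_2(t_0)u}{\lambda(t_0)e^u}+\frac{15.83}{e^u}+\frac{12\lambda(t_0)}{ue^{e^u}}\left(\frac{3\widehat\phi_1(u)}{2u}+\frac{3}{100e^{u+e^u}}\right)+\frac{a_4(t_0)\widehat\phi_2(u)}{u^2e^u}$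 and $\omega_1(\sigma,t_0;u)=2\left(\frac{\widehat\phi_1(u)}{u}+\frac{1}{50e^{u+e^u}}\right)\log\left(1+\frac{2\lambda(t_0)}{(\sigma-\frac12)u}\right)+\omega(t_0;u)$. *)

(* Defs.v *)
From mathcomp Require Import ssreflect ssrbool eqtype ssrnat seq prime.
From Stdlib Require Import Reals Lra.
From Coquelicot Require Import Coquelicot.
Open Scope R_scope.

Definition mobius (n : nat) : R :=
  if all (fun p => logn p n == 1%nat) (primes n) then (-1) ^ size (primes n) else 0.

Fixpoint mertens_nat (N : nat) : R :=
  match N with O => 0 | S k => mertens_nat k + mobius (S k) end.

Definition Mertens (x : R) : R := mertens_nat (Z.to_nat (Int_part x)).

Definition cpow_neg (n : R) (s : C) : C :=
  (Rpower n (- Re s) * cos (Im s * ln n), - (Rpower n (- Re s) * sin (Im s * ln n))).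

(** Dirichlet eta function eta(s) = sum_{n>=1} (-1)^{n-1} n^{-s}, convergent for Re s > 0 *)
Definition eta_term (s : C) (n : nat) : C :=
  scal ((-1) ^ n) (cpow_neg (INR n + 1) s).
Definition eta (s : C) : C :=
  (Series (fun n => Re (eta_term s n)), Series (fun n => Im (eta_term s n))).

(** Riemann zeta on Re s > 0, s <> 1 : zeta(s) = eta(s) / (1 - 2^{1-s}) *)
Definition two_pow_1ms (s : C) : C :=
  (Rpower 2 (1 - Re s) * cos (Im s * ln 2), - (Rpower 2 (1 - Re s) * sin (Im s * ln 2))).
Definition zeta (s : C) : C := Cdiv (eta s) (Cminus (RtoC 1) (two_pow_1ms s)).

Definition nontrivial_zero (s : C) : Prop := 0 < Re s < 1 /\ zeta s = RtoC 0.

Definition RiemannHypothesis : Prop :=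
  forall s : C, nontrivial_zero s -> Re s = 1 / 2.

Definition gamma1 : R :=
  real (Glb_Rbar (fun t => 0 < t /\ exists s, nontrivial_zero s /\ Im s = t)).

Definition ee : R := exp 1.

Definition delta (t0 : R) : R := (1 + 1 / t0) ^ 2.
Definition lambda (t0 : R) : R := (t0 / 2) * ln (ln (3 * t0 / 2)).
Definition a1 (t0 : R) : R :=
  let d := delta t0 in
  d * (117 / 4 + 3 * d + (3 + d) * (t0 / exp (exp 2) + (3 + ee) / ee)).
Definition a2 (t0 : R) : R :=
  delta t0 / 75 * (t0 / (2 * gamma1) + 1 + 1 / ee).
Definition a4 (t0 : R) : R :=
  4 * delta t0 / (5 * ee) * (3 + delta t0 / 4).

Definition Mcal (a b c t : R) : R := a + b / (Rpower (ln t) c * ln (ln t)).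
Definition M1 (t : R) : R := Mcal 0.759282 20.1911 0.285 t.
Definition M2 (t : R) : R := Mcal 0.653 60.12 0.2705 t.

(* defined for all real u; only u >= log log (2 pi) is used *)
Definition phi1 (u : R) : R :=
  if Rlt_dec u (ln (ln (10 ^ 2465))) then 0.96
  else 1.719282 - M1 (10 ^ 2465) + 20.1911 / (u * exp (0.285 * u)).
Definition phi2 (u : R) : R :=
  if Rlt_dec u (ln (ln (10 ^ 208))) then 2.491
  else 3.144 - M2 (10 ^ 208) + 60.12 / (u * exp (0.2705 * u)).

Definition omega (t0 u : R) : R :=
  a1 t0 * phi2 u / (lambda t0 * u)
  + a2 t0 * u / (lambda t0 * exp u)
  + 15.83 / exp u
  + 12 * lambda t0 / (u * exp (exp u)) *
      (3 * phi1 u / (2 * u) + 3 / (100 * exp (u + exp u)))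
  + a4 t0 * phi2 u / (u ^ 2 * exp u).

Definition omega1 (sigma t0 u : R) : R :=
  2 * (phi1 u / u + 1 / (50 * exp (u + exp u)))
    * ln (1 + 2 * lambda t0 / ((sigma - 1 / 2) * u))
  + omega t0 u.

Definition omega01 (sigma0 t0 x0 : R) : R :=
  omega1 sigma0 t0 (ln (ln (3 * ee * sqrt x0 / 2))).

Definition N1 (sigma0 t0 x0 : R) : R :=
  let w := omega01 sigma0 t0 x0 in
  1 / PI * Rpower (3 * ee / 2) w *
    (1 / 2 + 1 / ln x0 + (1.1 - sigma0) / (Rpower x0 (sigma0 - 1 / 2) * ln x0))
  + 1 / Rpower x0 (w / 2) *
    (8 * exp (exp 2) / (PI * sigma0 * (sigma0 - 1 / 2) * ln x0)
     + 23.6 / Rpower x0 (sigma0 - 1 / 2)).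

(* Main.v *)
(* The claimed bound is weak: with u = log log (3 e sqrt(x) / 2) its right-hand side is at least
   (log x / 2 pi) x^(1/2 + 4.45/u), since the terms of omega depending on lambda(t_0) and on
   sigma_0 - 1/2 cannot be small together.  This is trivial for u <= 8.9, as |M(x)| <= x.
   For larger u, 1/zeta is bounded on Re s >= 1/2 + 3.4/u: a Taylor polynomial of (s - 1) zeta(s)
   at 2 + it is factored over C, its zeros in the disc of radius about 3/2 lie to the left of the
   critical line by RH, and after reflecting the zeros in a circle (Jensen) the logarithmic
   derivative has a real part bounded below.  Testing this positivity against a Poisson kernel
   times 1 - cos(K theta) bounds the logarithmic derivative near the critical line by its first K
   coefficients at 2 + it, which the von Mangoldt series controls.  A smoothed Perron formula and
   a contour shift then bound M(x).
   The hypothesis 2 gamma_1 <= t_0 is used through gamma_1 >= 1, which needs that there is no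
   zero with 0 < Im s < 1 (Euler-Maclaurin) and, gamma_1 being the junk value 0 on the empty set,
   that there is a zero at all (the minimum modulus principle around 1/2 + 14.135 i). *)
Require Import Defs.
From Stdlib Require Import Reals Lra Lia Psatz List ZArith Classical.
From mathcomp Require prime div.
From Coquelicot Require Import Coquelicot.
Open Scope R_scope.

(** * Real and complex sums *)

(* With $u=\log\log(3e\sqrt x/2)$, $\log x$ is about $2e^u$. The line of integration $1/2+3.4/u$
   leaves $2(4.45-3.4)=2.1$, in units of $\log x/(2u)$, for the growth of $1/\zeta$. Its bound has
   the form $\log|1/\zeta|\le c\log(|t|+4)+6c+P+\log4$, where $P$ grows like $(3/2)^K$ and $c$ like
   $Q/K$, with $Q$ the $K$-th power of a ratio $1-O(1/u)$. Taking $K$ proportional to $u$ keeps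
   $(3/2)^K$ below the order of $e^u/u$ and $Q$ at a small constant, so that both parts cost $O(\log
   x/u)$; the numerical constants only make the sum fit. Only polynomials are factored. The zeros of
   a Taylor polynomial need not be zeros of $\zeta$, so the radii carry small margins, and the
   degree is chosen last, from a lower bound of $|(s-1)\zeta(s)|$ on a compact set. Means over
   circles are averages over equally spaced nodes, where truncated series are orthogonal, and Cauchy
   estimates come from positivity of real parts instead of from integrals. *)
Tactic Notation "via" uconstr(H) := eapply Rle_trans; [apply H|].

Lemma Rmin_le_and a b x : x <= Rmin a b -> x <= a /\ x <= b.
Proof. split; (eapply Rle_trans; [exact H|]); [apply Rmin_l|apply Rmin_r]. Qed.

Fixpoint rsum (f : nat -> R) (n : nat) : R :=
  match n with O => 0 | S k => rsum f k + f k end.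

Lemma rsum_S (f : nat -> R) n : rsum f (S n) = rsum f n + f n.
Proof. reflexivity. Qed.

Lemma rsum_ext (f g : nat -> R) n :
  (forall k, (k < n)%nat -> f k = g k) -> rsum f n = rsum g n.
Proof.
  induction n as [|n IH]; simpl; intros H; [reflexivity|]. rewrite IH by auto. rewrite H by lia. reflexivity.
Qed.

Lemma rsum_plus (f g : nat -> R) n :
  rsum (fun k => f k + g k) n = rsum f n + rsum g n.
Proof. induction n as [|n IH]; simpl; [lra|lra]. Qed.

Lemma rsum_scal (c : R) (f : nat -> R) n :
  rsum (fun k => c * f k) n = c * rsum f n.
Proof. induction n as [|n IH]; simpl; [lra|lra]. Qed.

Lemma rsum_const (c : R) n : rsum (fun _ => c) n = INR n * c.
Proof. induction n as [|n IH]; [simpl; lra|rewrite S_INR; simpl; rewrite IH; lra]. Qed.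

Lemma rsum_le (f g : nat -> R) n :
  (forall k, (k < n)%nat -> f k <= g k) -> rsum f n <= rsum g n.
Proof. induction n as [|n IH]; simpl; intros H; [lra|]. apply Rplus_le_compat; auto. Qed.

Lemma rsum_nonneg (f : nat -> R) n :
  (forall k, (k < n)%nat -> 0 <= f k) -> 0 <= rsum f n.
Proof. intros H. replace 0 with (rsum (fun _ => 0) n) by (rewrite rsum_const; lra). now apply rsum_le. Qed.

Lemma exp_le (x y : R) : x <= y -> exp x <= exp y.
Proof. intros H. destruct (Req_dec x y) as [->|]; [lra|]. apply Rlt_le, exp_increasing; lra. Qed.

(* Solves real inequalities by monotonicity: it splits along the head symbol
   and leaves the atoms to the hypotheses and to [lra]. *)
Ltac est :=
  intros; repeat match goal with H : _ <= Rmin _ _ |- _ => apply Rmin_le_and in H; destruct H end;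
  first [ solve [auto] | lra | lazymatch goal with
  | |- 0 < _ * _ => apply Rmult_lt_0_compat; est
  | |- 0 <= _ * _ => apply Rmult_le_pos; est
  | |- 0 < / _ => apply Rinv_0_lt_compat; est
  | |- 0 <= / _ => apply Rlt_le, Rinv_0_lt_compat; est
  | |- 0 < _ / _ => apply Rdiv_lt_0_compat; est
  | |- 0 <= _ / _ => apply Rdiv_le_0_compat; est
  | |- 0 < _ ^ _ => apply pow_lt; est
  | |- 0 <= _ ^ _ => apply pow_le; est
  | |- 0 < _ + _ => first [apply Rplus_lt_le_0_compat; est | apply Rplus_le_lt_0_compat; est]
  | |- 0 <= _ + _ => apply Rplus_le_le_0_compat; est
  | |- Cmult _ _ <> _ => apply Cmult_neq_0; est
  | |- @eq R _ _ -> False => apply Rgt_not_eq; red; est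
  | |- not (@eq R _ _) => apply Rgt_not_eq; red; est
  | |- 0 < exp _ => apply exp_pos
  | |- 0 <= exp _ => apply Rlt_le, exp_pos
  | |- 0 < Rpower _ _ => apply exp_pos
  | |- 0 <= Rpower _ _ => apply Rlt_le, exp_pos
  | |- 0 <= ln _ => rewrite <- ln_1; apply ln_le; est
  | |- 0 < sqrt _ => apply sqrt_lt_R0; est
  | |- 0 <= sqrt _ => apply sqrt_pos
  | |- 0 < Cmod _ => apply Cmod_gt_0; est
  | |- 0 <= Cmod _ => apply Cmod_ge_0
  | |- 0 <= Rabs _ => apply Rabs_pos
  | |- 0 < PI => apply PI_RGT_0
  | |- 0 <= INR _ => apply pos_INR
  | |- 0 < INR _ => first [apply INR_fact_lt_0 | apply lt_0_INR; lia]
  | |- INR _ <= INR _ => apply le_INR; lia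
  | |- INR _ < INR _ => apply lt_INR; lia
  | |- exp _ <= exp _ => apply exp_le; est
  | |- ln _ <= ln _ => apply ln_le; est
  | |- Rpower ?a _ <= Rpower ?a _ => apply Rle_Rpower; est
  | |- ?a * _ <= ?a * _ => apply Rmult_le_compat_l; est
  | |- _ * ?a <= _ * ?a => apply Rmult_le_compat_r; est
  | |- ?a * _ < ?a * _ => apply Rmult_lt_compat_l; est
  | |- _ * ?a < _ * ?a => apply Rmult_lt_compat_r; est
  | |- _ * _ <= _ * _ => apply Rmult_le_compat; est
  | |- / _ <= / _ => apply Rinv_le_contravar; est
  | |- / _ <= 1 => rewrite <- Rinv_1; apply Rinv_le_contravar; est
  | |- _ / _ <= 1 => apply Rle_div_l; est
  | |- _ / _ < 1 => apply Rlt_div_l; est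
  | |- ?a / _ <= ?a / _ => apply Rmult_le_compat_l; [est|apply Rinv_le_contravar; est]
  | |- _ / ?a <= _ / ?a => apply Rmult_le_compat_r; est
  | |- _ / _ <= _ / _ => apply Rmult_le_compat; est
  | |- _ ^ ?n <= _ ^ ?n => apply pow_incr; est
  | |- Cmod (Cmult _ _) <= _ => rewrite Cmod_mult; est
  | |- Cmod (Copp _) <= _ => rewrite Cmod_opp; est
  | |- Cmod (Cplus _ _) <= _ => via Cmod_triangle; est
  | |- Cmod (Cminus ?a ?b) <= _ => via (Cmod_triangle a (Copp b)); rewrite Cmod_opp; est
  | |- Rabs (_ * _) <= _ => rewrite Rabs_mult; est
  | |- Rabs _ <= _ => first [apply Rabs_le; est | via Rabs_triang; est]
  | |- _ + _ <= _ + _ => apply Rplus_le_compat; est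
  | |- rsum _ ?n <= rsum _ ?n => apply rsum_le; est
  | |- 0 <= rsum _ _ => apply rsum_nonneg; est
  | |- _ < Rmin _ _ => apply Rmin_glb_lt; est
  | |- _ /\ _ => split; est
  end ].

Ltac alg := intros; first [ring | simpl; ring | field; est | simpl; field; est | progress f_equal; alg].

Lemma rsum_abs (f : nat -> R) n : Rabs (rsum f n) <= rsum (fun k => Rabs (f k)) n.
Proof. induction n as [|n IH]; simpl; [est|]. est. Qed.

Lemma rsum_swap (f : nat -> nat -> R) n m :
  rsum (fun i => rsum (fun j => f i j) m) n = rsum (fun j => rsum (fun i => f i j) n) m.
Proof. induction n as [|n IH]; simpl. - rewrite rsum_const; lra. - rewrite IH, <- rsum_plus. reflexivity. Qed.

Lemma rsum_shift (f : nat -> R) n : rsum f (S n) = f O + rsum (fun k => f (S k)) n.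
Proof. induction n as [|n IH]; [simpl; lra|]. simpl in *. lra. Qed.

Lemma rsum_telescope (f : nat -> R) n : rsum (fun k => f (S k) - f k) n = f n - f O.
Proof. induction n as [|n IH]; simpl; [lra|lra]. Qed.

Lemma rsum_sum_n (f : nat -> R) n : rsum f (S n) = sum_n f n.
Proof. induction n as [|n IH]. - rewrite sum_O. simpl. lra. - rewrite sum_Sn, <- IH. reflexivity. Qed.

Lemma is_lim_seq_rsum (f : nat -> R) (l : R) :
  is_series f l -> is_lim_seq (rsum f) l.
Proof.
  intros H. apply is_lim_seq_incr_1.
  apply is_lim_seq_ext with (sum_n f); [intros n; symmetry; apply rsum_sum_n|exact H].
Qed.

Lemma is_series_rsum (f : nat -> R) (l : R) :
  is_lim_seq (rsum f) l -> is_series f l.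
Proof. intros H. apply is_lim_seq_incr_1 in H. apply is_lim_seq_ext with (2 := H). intros n; apply rsum_sum_n. Qed.

Lemma rsum_lim_Series (f : nat -> R) :
  ex_series f -> is_lim_seq (rsum f) (Series f).
Proof. intros H. apply is_lim_seq_rsum. now apply Series_correct. Qed.

Lemma rsum_le_Series (f : nat -> R) n :
  (forall k, 0 <= f k) -> ex_series f -> rsum f n <= Series f.
Proof.
  intros Hf H. apply (is_lim_seq_incr_compare (rsum f)); [now apply rsum_lim_Series|]. intros k; simpl.
  specialize (Hf k). lra.
Qed.

Lemma Series_nonneg (f : nat -> R) : (forall k, 0 <= f k) -> ex_series f -> 0 <= Series f.
Proof. intros Hf H. apply (rsum_le_Series f 0 Hf H). Qed.

Lemma ex_series_bounded (f : nat -> R) (B : R) :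
  (forall k, 0 <= f k) -> (forall n, rsum f n <= B) -> ex_series f /\ Series f <= B.
Proof.
  intros Hf HB. assert (Hex : ex_finite_lim_seq (rsum f)) by (apply ex_finite_lim_seq_incr with B; [intros n; simpl; specialize (Hf n); lra|exact HB]).
  destruct Hex as [l Hl]. split.
  - exists l. now apply is_series_rsum.
  - rewrite (is_series_unique f l) by now apply is_series_rsum. apply (is_lim_seq_le (rsum f) (fun _ => B) l B); auto.
    apply is_lim_seq_const.
Qed.

Lemma ex_series_Rle (f g : nat -> R) :
  (forall k, Rabs (f k) <= g k) -> ex_series g -> ex_series f.
Proof. apply (@ex_series_le R_AbsRing R_CompleteNormedModule f g); auto. Qed.

Fixpoint csum (f : nat -> C) (n : nat) : C :=
  match n with O => RtoC 0 | S k => Cplus (csum f k) (f k) end.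

Lemma csum_S (f : nat -> C) n : csum f (S n) = (csum f n + f n)%C.
Proof. reflexivity. Qed.

Lemma csum_ext (f g : nat -> C) n :
  (forall k, (k < n)%nat -> f k = g k) -> csum f n = csum g n.
Proof. induction n as [|n IH]; simpl; intros H; [reflexivity|]. rewrite IH by est. rewrite H by lia. reflexivity. Qed.

Lemma csum_plus (f g : nat -> C) n :
  csum (fun k => f k + g k)%C n = (csum f n + csum g n)%C.
Proof. induction n as [|n IH]; simpl; [ring|rewrite IH; ring]. Qed.

Lemma csum_scal (c : C) (f : nat -> C) n :
  csum (fun k => c * f k)%C n = (c * csum f n)%C.
Proof. induction n as [|n IH]; simpl; [ring|rewrite IH; ring]. Qed.

Lemma csum_swap (f : nat -> nat -> C) n m :
  csum (fun i => csum (fun j => f i j) m) n = csum (fun j => csum (fun i => f i j) n) m.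
Proof.
  induction n as [|n IH]; simpl.
  - induction m as [|m IHm]; simpl; [ring|rewrite <- IHm; ring].
  - rewrite IH, <- csum_plus. reflexivity.
Qed.

Lemma csum_shift (f : nat -> C) n : csum f (S n) = (f O + csum (fun k => f (S k)) n)%C.
Proof. induction n as [|n IH]; [alg|]. simpl in *. rewrite IH. ring. Qed.

Lemma csum_Cmod (f : nat -> C) n : Cmod (csum f n) <= rsum (fun k => Cmod (f k)) n.
Proof. induction n as [|n IH]; simpl; [rewrite Cmod_0; lra|]. est. Qed.

Lemma csum_Re (f : nat -> C) n : Re (csum f n) = rsum (fun k => Re (f k)) n.
Proof. induction n as [|n IH]; simpl; [reflexivity|]. rewrite <- IH. reflexivity. Qed.

Lemma csum_Im (f : nat -> C) n : Im (csum f n) = rsum (fun k => Im (f k)) n.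
Proof. induction n as [|n IH]; simpl; [reflexivity|]. rewrite <- IH. reflexivity. Qed.

Lemma Re_le_Cmod (z : C) : Rabs (Re z) <= Cmod z.
Proof. eapply Rle_trans; [apply Rmax_l|apply (Rmax_Cmod z)]. Qed.

Lemma Im_le_Cmod (z : C) : Rabs (Im z) <= Cmod z.
Proof. eapply Rle_trans; [apply Rmax_r|apply (Rmax_Cmod z)]. Qed.

Lemma Re_ge_Cmod (z : C) : - Cmod z <= Re z.
Proof. generalize (Re_le_Cmod z); intros H. apply Rabs_le_between in H. lra. Qed.

Lemma Cmod_le_Re_Im (z : C) : Cmod z <= Rabs (Re z) + Rabs (Im z).
Proof.
  destruct z as [a b]. unfold Cmod; simpl. apply Rsqr_incr_0_var; [|est]. rewrite Rsqr_sqrt by nra. unfold Rsqr.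
  generalize (Rabs_pos a) (Rabs_pos b). assert (Rabs a * Rabs a = a * a) by (rewrite <- Rabs_mult, Rabs_pos_eq; nra).
  assert (Rabs b * Rabs b = b * b) by (rewrite <- Rabs_mult, Rabs_pos_eq; nra). nra.
Qed.

(** * Convergence of complex series *)

Definition abs_summable (a : nat -> C) : Prop := ex_series (fun n => Cmod (a n)).

(** Summed componentwise, so that [eta] is by definition the [CSeries] of [eta_term]. By
    [CSeries_unique] the value is the limit of the partial sums even where convergence is only
    conditional. *)
Definition CSeries (a : nat -> C) : C :=
  (Series (fun n => Re (a n)), Series (fun n => Im (a n))).

Definition Clim (u : nat -> C) (l : C) : Prop :=
  is_lim_seq (fun n => Cmod (u n - l)%C) 0.

Lemma Clim_Re_Im (u : nat -> C) (l : C) :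
  is_lim_seq (fun n => Re (u n)) (Re l) -> is_lim_seq (fun n => Im (u n)) (Im l) -> Clim u l.
Proof.
  intros H1 H2. apply is_lim_seq_le_le with (fun _ => 0) (fun n => Rabs (Re (u n) - Re l) + Rabs (Im (u n) - Im l)).
  - split; [est|]. via Cmod_le_Re_Im. destruct (u n), l; simpl; unfold Rminus; lra.
  - apply is_lim_seq_const.
  - replace (Finite 0) with (Rbar_plus (Finite 0) (Finite 0)) by (simpl; f_equal; lra).
    apply is_lim_seq_plus'; rewrite <- Rabs_R0.
    + apply (is_lim_seq_abs _ 0). replace 0 with (Re l - Re l) by lra.
      apply is_lim_seq_minus'; [exact H1|apply is_lim_seq_const].
    + apply (is_lim_seq_abs _ 0). replace 0 with (Im l - Im l) by lra.
      apply is_lim_seq_minus'; [exact H2|apply is_lim_seq_const].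
Qed.

Lemma Clim_Re (u : nat -> C) (l : C) : Clim u l -> is_lim_seq (fun n => Re (u n)) (Re l).
Proof.
  intros H. apply is_lim_seq_ext with (fun n => Re l + Re (u n - l)%C).
  { intros n. destruct (u n), l; simpl. lra. }
  replace (Finite (Re l)) with (Finite (Re l + 0)) by (f_equal; lra).
  apply is_lim_seq_plus'; [apply is_lim_seq_const|]. apply is_lim_seq_abs_0.
  apply is_lim_seq_le_le with (fun _ => 0) (fun n => Cmod (u n - l)%C); [|apply is_lim_seq_const|exact H].
  intros n; split; [est|apply Re_le_Cmod].
Qed.

Lemma Clim_Im (u : nat -> C) (l : C) : Clim u l -> is_lim_seq (fun n => Im (u n)) (Im l).
Proof.
  intros H. apply is_lim_seq_ext with (fun n => Im l + Im (u n - l)%C).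
  { intros n. destruct (u n), l; simpl. lra. }
  replace (Finite (Im l)) with (Finite (Im l + 0)) by (f_equal; lra).
  apply is_lim_seq_plus'; [apply is_lim_seq_const|]. apply is_lim_seq_abs_0.
  apply is_lim_seq_le_le with (fun _ => 0) (fun n => Cmod (u n - l)%C); [|apply is_lim_seq_const|exact H].
  intros n; split; [est|apply Im_le_Cmod].
Qed.

Lemma C_ext (z w : C) : Re z = Re w -> Im z = Im w -> z = w.
Proof. destruct z, w; simpl. intros; subst; reflexivity. Qed.

Lemma Clim_unique (u : nat -> C) (l l' : C) : Clim u l -> Clim u l' -> l = l'.
Proof.
  intros H H'. apply C_ext.
  - generalize (Clim_Re u l H) (Clim_Re u l' H'). intros A B. apply is_lim_seq_unique in A.
    apply is_lim_seq_unique in B. congruence.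
  - generalize (Clim_Im u l H) (Clim_Im u l' H'). intros A B. apply is_lim_seq_unique in A.
    apply is_lim_seq_unique in B. congruence.
Qed.

Lemma Clim_ext (u v : nat -> C) (l : C) : (forall n, u n = v n) -> Clim u l -> Clim v l.
Proof. intros H. apply is_lim_seq_ext. intros n; now rewrite H. Qed.

Lemma Clim_Cmod (u : nat -> C) (l : C) : Clim u l -> is_lim_seq (fun n => Cmod (u n)) (Cmod l).
Proof.
  intros H. apply is_lim_seq_ext with (fun n => Cmod l + (Cmod (u n) - Cmod l)); [est|].
  replace (Finite (Cmod l)) with (Finite (Cmod l + 0)) by (f_equal; lra).
  apply is_lim_seq_plus'; [apply is_lim_seq_const|]. apply is_lim_seq_abs_0.
  apply is_lim_seq_le_le with (fun _ => 0) (fun n => Cmod (u n - l)%C); [|apply is_lim_seq_const|exact H].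
  intros n; split; [est|]. apply Rabs_le. split.
  - generalize (Cmod_triangle (u n) (l - u n)%C). rewrite <- (Cmod_opp (l - u n)).
    replace (- (l - u n))%C with (u n - l)%C by alg. replace (u n + (l - u n))%C with l by alg. lra.
  - generalize (Cmod_triangle l (u n - l)%C). replace (l + (u n - l))%C with (u n) by alg. lra.
Qed.

Lemma Clim_dom (u : nat -> C) (l : C) (e : nat -> R) :
  (forall n, Cmod (u n - l)%C <= e n) -> is_lim_seq e 0 -> Clim u l.
Proof. intros H He. apply is_lim_seq_le_le with (fun _ => 0) e; [|apply is_lim_seq_const|exact He]. est. Qed.

Lemma Clim_plus (u v : nat -> C) (l m : C) :
  Clim u l -> Clim v m -> Clim (fun n => u n + v n)%C (l + m)%C.
Proof.
  intros H H'. apply Clim_dom with (fun n => Cmod (u n - l)%C + Cmod (v n - m)%C).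
  - intros n. replace (u n + v n - (l + m))%C with ((u n - l) + (v n - m))%C by alg. est.
  - replace (Finite 0) with (Finite (0 + 0)) by (f_equal; lra). now apply is_lim_seq_plus'.
Qed.

Lemma Clim_scal (c : C) (u : nat -> C) (l : C) :
  Clim u l -> Clim (fun n => c * u n)%C (c * l)%C.
Proof.
  intros H. apply Clim_dom with (fun n => Cmod c * Cmod (u n - l)%C).
  - intros n. replace (c * u n - c * l)%C with (c * (u n - l))%C by alg. est.
  - replace (Finite 0) with (Finite (Cmod c * 0)) by (f_equal; lra).
    apply is_lim_seq_mult'; [apply is_lim_seq_const|exact H].
Qed.

Lemma Clim_const (c : C) : Clim (fun _ => c) c.
Proof.
  apply Clim_dom with (fun _ => 0); [|apply is_lim_seq_const]. intros _. replace (c - c)%C with (RtoC 0) by alg.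
  rewrite Cmod_0; lra.
Qed.

Lemma abs_summable_Re (a : nat -> C) : abs_summable a -> ex_series (fun n => Re (a n)).
Proof. intros H. apply ex_series_Rle with (2 := H). intros; apply Re_le_Cmod. Qed.

Lemma abs_summable_Im (a : nat -> C) : abs_summable a -> ex_series (fun n => Im (a n)).
Proof. intros H. apply ex_series_Rle with (2 := H). intros; apply Im_le_Cmod. Qed.

Lemma csum_Clim (a : nat -> C) : abs_summable a -> Clim (csum a) (CSeries a).
Proof.
  intros H. apply Clim_Re_Im.
  - apply is_lim_seq_ext with (rsum (fun n => Re (a n))); [intros; now rewrite csum_Re|].
    apply rsum_lim_Series, abs_summable_Re, H.
  - apply is_lim_seq_ext with (rsum (fun n => Im (a n))); [intros; now rewrite csum_Im|].
    apply rsum_lim_Series, abs_summable_Im, H.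
Qed.

Lemma CSeries_unique (a : nat -> C) (l : C) : Clim (csum a) l -> CSeries a = l.
Proof.
  intros H. apply C_ext; simpl.
  - apply is_series_unique, is_series_rsum. apply is_lim_seq_ext with (2 := Clim_Re _ _ H). intros; apply csum_Re.
  - apply is_series_unique, is_series_rsum. apply is_lim_seq_ext with (2 := Clim_Im _ _ H). intros; apply csum_Im.
Qed.

Lemma abs_summable_le (a : nat -> C) (b : nat -> R) :
  (forall n, Cmod (a n) <= b n) -> ex_series b -> abs_summable a.
Proof. intros H Hb. apply ex_series_Rle with (2 := Hb). intros n. rewrite Rabs_pos_eq by est. est. Qed.

Lemma CSeries_tail (a : nat -> C) n :
  abs_summable a ->
  Cmod (CSeries a - csum a n)%C <= Series (fun k => Cmod (a k)) - rsum (fun k => Cmod (a k)) n.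
Proof.
  intros H. assert (L : is_lim_seq (fun m => Cmod (csum a m - csum a n)%C) (Cmod (CSeries a - csum a n)%C)) by (apply Clim_Cmod, Clim_plus; [now apply csum_Clim|apply Clim_const]).
  assert (L2 : is_lim_seq (fun m => rsum (fun k => Cmod (a k)) m - rsum (fun k => Cmod (a k)) n)
    (Series (fun k => Cmod (a k)) - rsum (fun k => Cmod (a k)) n)) by (apply is_lim_seq_minus'; [now apply rsum_lim_Series|apply is_lim_seq_const]).
  apply (is_lim_seq_le_loc _ _ _ _) with (2 := L) (3 := L2). exists n. intros m Hm. induction Hm as [|m Hm IH].
  - replace (csum a n - csum a n)%C with (RtoC 0) by alg. rewrite Cmod_0; lra.
  - simpl. replace (csum a m + a m - csum a n)%C with ((csum a m - csum a n) + a m)%C by alg. est.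
Qed.

Lemma CSeries_Cmod (a : nat -> C) :
  abs_summable a -> Cmod (CSeries a) <= Series (fun k => Cmod (a k)).
Proof. intros H. generalize (CSeries_tail a 0 H). simpl. replace (CSeries a - 0)%C with (CSeries a) by alg. lra. Qed.

Lemma Series_tail_lim (f : nat -> R) : ex_series f -> is_lim_seq (fun n => Series f - rsum f n) 0.
Proof.
  intros H. replace 0 with (Series f - Series f) by lra.
  apply is_lim_seq_minus'; [apply is_lim_seq_const|now apply rsum_lim_Series].
Qed.

(** * Fourier coefficients of nonnegative functions *)

(** Multiplied by $2\sin(p/2)$ the sum telescopes to a difference of cosines whose arguments differ
    by $2\pi n$. The condition $0<n<m$ keeps $\sin(p/2)$ positive. *)
Lemma sin_sum_zero (m n : nat) :
  (0 < n < m)%nat -> rsum (fun j => sin (INR j * (2 * PI * INR n / INR m))) m = 0.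
Proof.
  intros H. set (p := 2 * PI * INR n / INR m). assert (Hn : 0 < INR n) by est. assert (Hnm : INR n < INR m) by est.
  assert (Hp : 0 < p / 2 < PI).
  { unfold p. generalize PI_RGT_0; intros. split.
    - est.
    - assert (INR n / INR m < 1) by est. nra. }
  assert (Hs : 0 < sin (p / 2)) by (apply sin_gt_0; lra). apply Rmult_eq_reg_l with (2 * sin (p / 2)); [|lra].
  rewrite <- rsum_scal. rewrite (rsum_ext _ (fun j => (- cos (INR (S j) * p - p / 2)) - (- cos (INR j * p - p / 2)))).
  2:{ intros k _. rewrite S_INR. replace ((INR k + 1) * p - p / 2) with (INR k * p + p / 2) by lra.
    rewrite cos_plus, cos_minus. ring. }
  rewrite (rsum_telescope (fun j => - cos (INR j * p - p / 2))).
  replace (INR m * p - p / 2) with (- (p / 2) + 2 * INR n * PI) by (unfold p; field; lra). rewrite cos_period. simpl.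
  replace (0 * p - p / 2) with (- (p / 2)) by lra. ring.
Qed.

Lemma cos_sum_zero (m n : nat) :
  (0 < n < m)%nat -> rsum (fun j => cos (INR j * (2 * PI * INR n / INR m))) m = 0.
Proof.
  intros H. set (p := 2 * PI * INR n / INR m). assert (Hn : 0 < INR n) by est. assert (Hnm : INR n < INR m) by est.
  assert (Hp : 0 < p / 2 < PI).
  { unfold p. generalize PI_RGT_0; intros. split.
    - est.
    - assert (INR n / INR m < 1) by est. nra. }
  assert (Hs : 0 < sin (p / 2)) by (apply sin_gt_0; lra). apply Rmult_eq_reg_l with (2 * sin (p / 2)); [|lra].
  rewrite <- rsum_scal. rewrite (rsum_ext _ (fun j => sin (INR (S j) * p - p / 2) - sin (INR j * p - p / 2))).
  2:{ intros k _. rewrite S_INR. replace ((INR k + 1) * p - p / 2) with (INR k * p + p / 2) by lra.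
    rewrite sin_plus, sin_minus. ring. }
  rewrite (rsum_telescope (fun j => sin (INR j * p - p / 2))).
  replace (INR m * p - p / 2) with (- (p / 2) + 2 * INR n * PI) by (unfold p; field; lra). rewrite sin_period. simpl.
  replace (0 * p - p / 2) with (- (p / 2)) by lra. ring.
Qed.

Definition node (m j : nat) : R := INR j * (2 * PI / INR m).

(** The mean value of $\cos^2(kt)$. *)
Definition half_weight (k : nat) : R := match k with O => 1 | _ => 1 / 2 end.

Lemma cos_node_sum (m n : nat) :
  (n < m)%nat -> rsum (fun j => cos (INR n * node m j)) m = if Nat.eqb n 0 then INR m else 0.
Proof.
  intros H. destruct n as [|n]; simpl Nat.eqb; cbv iota.
  - rewrite (rsum_ext _ (fun _ => 1)); [rewrite rsum_const; ring|]. intros; simpl. now rewrite Rmult_0_l, cos_0.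
  - rewrite <- (cos_sum_zero m (S n)) by lia. apply rsum_ext. intros k _. f_equal. unfold node. est.
Qed.

Lemma sin_node_sum (m n : nat) :
  (n < m)%nat -> rsum (fun j => sin (INR n * node m j)) m = 0.
Proof.
  intros H. destruct n as [|n].
  - rewrite (rsum_ext _ (fun _ => 0)); [rewrite rsum_const; ring|]. intros; simpl. now rewrite Rmult_0_l, sin_0.
  - rewrite <- (sin_sum_zero m (S n)) by lia. apply rsum_ext. intros k _. f_equal. unfold node. est.
Qed.

(** Discrete orthogonality. The frequencies $k\pm l$ must stay below the number of nodes, since a
    multiple of that number is indistinguishable from frequency zero. *)
Lemma cos_cos_node (m k l : nat) :
  (k + l < m)%nat ->
  rsum (fun j => cos (INR k * node m j) * cos (INR l * node m j)) m
  = if Nat.eqb k l then INR m * half_weight k else 0.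
Proof.
  assert (W : forall k l, (l <= k)%nat -> (k + l < m)%nat ->
    rsum (fun j => cos (INR k * node m j) * cos (INR l * node m j)) m
    = if Nat.eqb k l then INR m * half_weight k else 0).
  { clear. intros k l Hlk H.
    rewrite (rsum_ext _ (fun j => /2 * cos (INR (k - l) * node m j) + /2 * cos (INR (k + l) * node m j))).
    2:{ intros j _. rewrite minus_INR, plus_INR by lia.
      rewrite Rmult_minus_distr_r, Rmult_plus_distr_r, cos_minus, cos_plus. lra. }
    rewrite rsum_plus, !rsum_scal, !cos_node_sum by lia. destruct (Nat.eqb_spec k l) as [E|E].
    - subst. rewrite Nat.sub_diag. destruct l; simpl; lra.
    - destruct (Nat.eqb_spec (k - l) 0); [lia|]. destruct (Nat.eqb_spec (k + l) 0); [lia|]. lra. }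
  intros H. destruct (Nat.le_ge_cases l k) as [L|L]; [now apply W|].
  rewrite (rsum_ext _ (fun j => cos (INR l * node m j) * cos (INR k * node m j))) by est. rewrite W by lia.
  rewrite Nat.eqb_sym. destruct (Nat.eqb_spec k l); [subst|]; reflexivity.
Qed.

Lemma sin_cos_node (m k l : nat) :
  (k + l < m)%nat ->
  rsum (fun j => sin (INR k * node m j) * cos (INR l * node m j)) m = 0.
Proof.
  intros H. destruct (Nat.le_ge_cases l k) as [L|L].
  - rewrite (rsum_ext _ (fun j => /2 * sin (INR (k - l) * node m j) + /2 * sin (INR (k + l) * node m j))).
    2:{ intros j _. rewrite minus_INR, plus_INR by lia.
      rewrite Rmult_minus_distr_r, Rmult_plus_distr_r, sin_minus, sin_plus. lra. }
    rewrite rsum_plus, !rsum_scal, !sin_node_sum by lia. lra.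
  - rewrite (rsum_ext _ (fun j => (- / 2) * sin (INR (l - k) * node m j) + /2 * sin (INR (k + l) * node m j))).
    2:{ intros j _. rewrite minus_INR, plus_INR by lia.
      rewrite Rmult_minus_distr_r, Rmult_plus_distr_r, sin_minus, sin_plus. lra. }
    rewrite rsum_plus, !rsum_scal, !sin_node_sum by lia. lra.
Qed.

Lemma rsum_delta (c : R) (N k : nat) :
  (k < N)%nat -> rsum (fun l => if Nat.eqb k l then c else 0) N = c.
Proof.
  induction N as [|N IH]; [lia|]. intros H. simpl. destruct (Nat.eqb_spec k N) as [E|E].
  - subst. rewrite (rsum_ext _ (fun _ => 0)); [rewrite rsum_const; ring|]. intros l Hl.
    destruct (Nat.eqb_spec N l); [lia|reflexivity].
  - rewrite IH by lia. ring.
Qed.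

Lemma rsum_mult_rsum (f g : nat -> R) n m :
  rsum f n * rsum g m = rsum (fun k => rsum (fun l => f k * g l) m) n.
Proof. induction n as [|n IH]; simpl; [ring|]. rewrite <- IH, rsum_scal. ring. Qed.

Lemma trig_avg (x y v : nat -> R) (N : nat) :
  rsum (fun j =>
    rsum (fun k => x k * cos (INR k * node (2 * N) j) - y k * sin (INR k * node (2 * N) j)) N
    * rsum (fun l => v l * cos (INR l * node (2 * N) j)) N) (2 * N)
  = INR (2 * N) * rsum (fun k => half_weight k * v k * x k) N.
Proof.
  set (m := (2 * N)%nat).
  rewrite (rsum_ext _ (fun j => rsum (fun k => rsum (fun l =>
    (x k * v l) * (cos (INR k * node m j) * cos (INR l * node m j))
    + (- (y k * v l)) * (sin (INR k * node m j) * cos (INR l * node m j))) N) N)).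
  2:{ intros j _. rewrite rsum_mult_rsum. apply rsum_ext; intros k _. apply rsum_ext; intros l _. ring. }
  rewrite rsum_swap. rewrite <- rsum_scal. apply rsum_ext. intros k Hk. rewrite rsum_swap.
  rewrite (rsum_ext _ (fun l => if Nat.eqb k l then INR m * (half_weight k * v k * x k) else 0)).
  { now rewrite rsum_delta. }
  intros l Hl. rewrite rsum_plus, !rsum_scal, sin_cos_node, cos_cos_node by lia.
  destruct (Nat.eqb_spec k l); [subst; ring|ring].
Qed.

Lemma Series_dominated (a b : nat -> R) n :
  (forall k, Rabs (a k) <= b k) -> ex_series b ->
  Rabs (Series a - rsum a n) <= Series b - rsum b n.
Proof.
  intros H Hb. assert (Ha : ex_series a) by (now apply ex_series_Rle with b).
  assert (L : is_lim_seq (fun m => Rabs (rsum a m - rsum a n)) (Rabs (Series a - rsum a n))).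
  { apply (is_lim_seq_abs _ (Series a - rsum a n)).
    apply is_lim_seq_minus'; [now apply rsum_lim_Series|apply is_lim_seq_const]. }
  assert (L2 : is_lim_seq (fun m => rsum b m - rsum b n) (Series b - rsum b n)) by (apply is_lim_seq_minus'; [now apply rsum_lim_Series|apply is_lim_seq_const]).
  apply (is_lim_seq_le_loc _ _ _ _) with (2 := L) (3 := L2). exists n. intros m Hm. induction Hm as [|m Hm IH].
  - est.
  - simpl. replace (rsum a m + a m - rsum a n) with ((rsum a m - rsum a n) + a m) by lra.
    generalize (Rabs_triang (rsum a m - rsum a n) (a m)) (H m). lra.
Qed.

(** The product of two nonnegative functions has nonnegative mean, and by orthogonality this mean is
    the series of the conclusion. Truncated at $N$, both factors are only bounded below by minus
    their tails, which costs an error vanishing with $N$. *)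
Theorem fourier_pos (x y v : nat -> R) :
  ex_series (fun k => Rabs (x k)) -> ex_series (fun k => Rabs (y k)) ->
  ex_series (fun k => Rabs (v k)) ->
  (forall t, 0 <= Series (fun k => x k * cos (INR k * t) - y k * sin (INR k * t))) ->
  (forall t, 0 <= Series (fun k => v k * cos (INR k * t))) ->
  0 <= Series (fun k => half_weight k * v k * x k).
Proof.
  intros Hx Hy Hv HF HV. set (b := fun k => Rabs (x k) + Rabs (y k)).
  assert (Hb : ex_series b) by (apply (ex_series_plus (fun k => Rabs (x k)) (fun k => Rabs (y k))); auto).
  set (X := Series b). set (Y := Series (fun k => Rabs (v k))). set (e := fun n => X - rsum b n).
  set (d := fun n => Y - rsum (fun k => Rabs (v k)) n). assert (He : is_lim_seq e 0) by (now apply Series_tail_lim).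
  assert (Hd : is_lim_seq d 0) by (now apply Series_tail_lim).
  assert (Hc : forall z, -1 <= cos z <= 1) by (intros; apply COS_bound).
  assert (Hs : forall z, -1 <= sin z <= 1) by (intros; apply SIN_bound).
  assert (Bd : forall t k, Rabs (x k * cos (INR k * t) - y k * sin (INR k * t)) <= b k).
  { intros t k. unfold b, Rminus. via Rabs_triang. rewrite Rabs_Ropp, !Rabs_mult.
    assert (Rabs (cos (INR k * t)) <= 1) by est. assert (Rabs (sin (INR k * t)) <= 1) by est.
    generalize (Rabs_pos (x k)) (Rabs_pos (y k)); nra. }
  assert (Bv : forall t k, Rabs (v k * cos (INR k * t)) <= Rabs (v k)).
  { intros t k. rewrite Rabs_mult. assert (Rabs (cos (INR k * t)) <= 1) by est. generalize (Rabs_pos (v k)); nra. }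
  assert (Hw : ex_series (fun k => half_weight k * v k * x k)).
  { apply ex_series_Rle with (fun k => X * Rabs (v k)).
    - intros k. rewrite !Rabs_mult.
      assert (Rabs (half_weight k) <= 1) by (destruct k; simpl; rewrite Rabs_pos_eq; lra). assert (Rabs (x k) <= X).
      { apply Rle_trans with (rsum b (S k)).
        - simpl.
          assert (0 <= rsum b k) by (apply rsum_nonneg; intros; unfold b; generalize (Rabs_pos (x k0)) (Rabs_pos (y
            k0)); lra).
          unfold b at 2. generalize (Rabs_pos (y k)). lra.
        - apply rsum_le_Series; [intros; unfold b; generalize (Rabs_pos (x k0)) (Rabs_pos (y k0)); lra|exact Hb]. }
      generalize (Rabs_pos (v k)) (Rabs_pos (half_weight k)) (Rabs_pos (x k)); intros.
      assert (Rabs (half_weight k) * Rabs (v k) <= 1 * Rabs (v k)) by est. nra.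
    - now apply (ex_series_scal X (fun k => Rabs (v k))). }
  assert (HX : forall n, rsum b n <= X).
  { intros n. apply rsum_le_Series; auto. intros; unfold b; generalize (Rabs_pos (x k)) (Rabs_pos (y k)); lra. }
  assert (HY : forall n, rsum (fun k => Rabs (v k)) n <= Y).
  { intros n. apply rsum_le_Series; auto. est. }
  (* At each node $(A+e)(B+d)\ge0$; expanding and using $A\le X$, $B\le Y$ gives the lower bound for
     $AB$. *)
  assert (Key : forall N, (0 < N)%nat ->
    - (d N * X + e N * Y + e N * d N) <= rsum (fun k => half_weight k * v k * x k) N).
  { intros N HN. assert (Hm : 0 < INR (2 * N)) by est. apply Rmult_le_reg_l with (1 := Hm).
    rewrite <- (trig_avg x y v N). rewrite <- rsum_const. apply rsum_le. intros j _. set (t := node (2 * N) j).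
    set (A := rsum (fun k => x k * cos (INR k * t) - y k * sin (INR k * t)) N).
    set (B := rsum (fun l => v l * cos (INR l * t)) N). assert (A1 : 0 <= A + e N).
    { generalize (Series_dominated _ _ N (Bd t) Hb) (HF t). fold X. fold A. fold (e N). intros D1 D2.
      apply Rabs_le_between in D1. lra. }
    assert (B1 : 0 <= B + d N).
    { generalize (Series_dominated _ _ N (Bv t) Hv) (HV t). fold Y. fold B. intros D1 D2. apply Rabs_le_between in D1.
      unfold d in *. lra. }
    assert (A2 : A <= X).
    { via Rle_abs. via rsum_abs. eapply Rle_trans; [|est]. apply rsum_le; intros; apply Bd. }
    assert (B2 : B <= Y).
    { via Rle_abs. via rsum_abs. eapply Rle_trans; [|est]. apply rsum_le; intros; apply Bv. }
    assert (0 <= e N) by (unfold e; specialize (HX N); lra). assert (0 <= d N) by (unfold d; specialize (HY N); lra).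
    nra. }
  assert (L1 : is_lim_seq (fun N => - (d N * X + e N * Y + e N * d N)) 0).
  { replace (Finite 0) with (Rbar_opp (0 * X + 0 * Y + 0 * 0)) by (simpl; f_equal; ring).
    apply (is_lim_seq_opp _ (0 * X + 0 * Y + 0 * 0)).
    apply is_lim_seq_plus'; [apply is_lim_seq_plus'|]; apply is_lim_seq_mult'; auto; apply is_lim_seq_const. }
  apply (is_lim_seq_le_loc _ _ _ _) with (2 := L1) (3 := rsum_lim_Series _ Hw). exists 1%nat. est.
Qed.

Definition cis (t : R) : C := (cos t, sin t).

Lemma cis_plus a b : cis (a + b) = (cis a * cis b)%C.
Proof. unfold cis, Cmult; simpl. now rewrite cos_plus, sin_plus, (Rplus_comm (sin a * cos b)). Qed.

Lemma cis_0 : cis 0 = RtoC 1.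
Proof. unfold cis. now rewrite cos_0, sin_0. Qed.

Lemma Cmod_cis t : Cmod (cis t) = 1.
Proof.
  unfold cis, Cmod; simpl. generalize (sin2_cos2 t); unfold Rsqr; intros H.
  replace (cos t * (cos t * 1) + sin t * (sin t * 1)) with 1 by lra. apply sqrt_1.
Qed.

Lemma cis_pow t n : (cis t ^ n)%C = cis (INR n * t).
Proof.
  induction n as [|n IH]; [simpl; now rewrite Rmult_0_l, cis_0|]. rewrite Cpow_S, IH, <- cis_plus, S_INR. f_equal.
  ring.
Qed.

Lemma polar_form (z : C) : exists t, z = (RtoC (Cmod z) * cis t)%C.
Proof.
  destruct (Req_dec (Cmod z) 0) as [E|E].
  { exists 0. rewrite (Cmod_eq_0 _ E), Cmod_0. ring. }
  destruct z as [a b]. set (m := Cmod (a, b)) in *.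
  assert (Hm : 0 < m) by (generalize (Cmod_ge_0 (a, b)); fold m; lra). assert (H2 : a * a + b * b = m * m).
  { unfold m, Cmod; simpl. rewrite sqrt_sqrt; nra. }
  assert (Ha : -1 <= a / m <= 1) by (split; [apply Rle_div_r; nra|apply Rle_div_l; nra]).
  assert (Hc : cos (acos (a / m)) = a / m) by (apply cos_acos; lra). assert (Hs : sin (acos (a / m)) = Rabs b / m).
  { rewrite sin_acos by lra. apply Rsqr_inj.
    - est.
    - est.
    - rewrite Rsqr_sqrt.
      + unfold Rsqr. replace (Rabs b / m * (Rabs b / m)) with (Rabs b * Rabs b / (m * m)) by alg.
        rewrite <- Rabs_mult, Rabs_pos_eq by nra.
        replace (1 - a / m * (a / m)) with ((m * m - a * a) / (m * m)) by alg. f_equal. lra.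
      + unfold Rsqr. nra. }
  destruct (Rle_dec 0 b) as [Hb|Hb].
  - exists (acos (a / m)). unfold cis. rewrite Hc, Hs, Rabs_pos_eq by lra. unfold RtoC, Cmult; simpl.
    f_equal; field; lra.
  - exists (- acos (a / m)). unfold cis. rewrite cos_neg, sin_neg, Hc, Hs, Rabs_left by lra.
    unfold RtoC, Cmult; simpl. f_equal; field; lra.
Qed.

Lemma fourier_pos_C (a : nat -> C) (v : nat -> R) :
  abs_summable a -> ex_series (fun k => Rabs (v k)) ->
  (forall t, 0 <= Series (fun k => Re (a k * cis (INR k * t))%C)) ->
  (forall t, 0 <= Series (fun k => v k * cos (INR k * t))) ->
  0 <= Series (fun k => half_weight k * v k * Re (a k)).
Proof.
  intros Ha Hv HF HV. apply (fourier_pos (fun k => Re (a k)) (fun k => Im (a k)) v); auto.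
  - apply ex_series_Rle with (2 := Ha). intros; rewrite Rabs_Rabsolu; apply Re_le_Cmod.
  - apply ex_series_Rle with (2 := Ha). intros; rewrite Rabs_Rabsolu; apply Im_le_Cmod.
Qed.

Lemma Series_finite (f : nat -> R) n :
  (forall k, (n <= k)%nat -> f k = 0) -> is_series f (rsum f n).
Proof.
  intros H. apply is_series_rsum. apply is_lim_seq_ext_loc with (fun _ => rsum f n); [|apply is_lim_seq_const].
  exists n. intros m Hm. induction Hm as [|m Hm IH]; [reflexivity|]. simpl. rewrite <- IH, H by lia. ring.
Qed.

Lemma Series_finite_eq (f : nat -> R) n :
  (forall k, (n <= k)%nat -> f k = 0) -> Series f = rsum f n.
Proof. intros H. apply is_series_unique, Series_finite, H. Qed.

(** The test function is the constant $1$. *)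
Lemma fourier_coef0 (a : nat -> C) :
  abs_summable a -> (forall t, 0 <= Series (fun k => Re (a k * cis (INR k * t))%C)) -> 0 <= Re (a O).
Proof.
  intros Ha HF. set (v := fun k => match k with O => 1 | _ => 0 end).
  assert (E : forall (g : nat -> R), Series (fun k => v k * g k) = g O).
  { intros g. rewrite (Series_finite_eq _ 1); [alg|]. intros [|k] Hk; [lia|alg]. }
  generalize (fourier_pos_C a v Ha). intros H. assert (H' := H).
  rewrite (Series_ext _ (fun k => v k * (half_weight k * Re (a k)))) in H' by est. rewrite E in H'.
  rewrite Rmult_1_l in H'. apply H'; auto.
  - exists (rsum (fun k => Rabs (v k)) 1). apply Series_finite. intros [|k] Hk; [lia|apply Rabs_R0].
  - intros t. rewrite (E (fun k => cos (INR k * t))). rewrite Rmult_0_l, cos_0. lra.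
Qed.

(** The test function is $1+\cos(nt)$, after a rotation by [p] that turns the $n$-th coefficient
    into $-|a_n|$. The mean of the product is then $\Re a_0-|a_n|/2$. *)
Lemma caratheodory (a : nat -> C) (n : nat) :
  abs_summable a -> (forall t, 0 <= Series (fun k => Re (a k * cis (INR k * t))%C)) ->
  (0 < n)%nat -> Cmod (a n) <= 2 * Re (a O).
Proof.
  intros Ha HF Hn. destruct (polar_form (a n)) as [t0 Ht0]. set (p := (PI - t0) / INR n).
  set (b := fun k => (a k * cis (INR k * p))%C). set (v := fun k => if orb (Nat.eqb k 0) (Nat.eqb k n) then 1 else 0).
  assert (E : forall (g : nat -> R), is_series (fun k => v k * g k) (g O + g n)).
  { intros g. assert (H : rsum (fun k => v k * g k) (S n) = g O + g n).
    { destruct n as [|n']; [lia|]. rewrite rsum_shift. unfold v at 1. simpl. rewrite (rsum_ext _ (fun _ => 0)).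
      2:{ intros k Hk. unfold v. destruct (Nat.eqb_spec (S k) (S n')); [lia|]. simpl. ring. }
      rewrite rsum_const. unfold v. rewrite Nat.eqb_refl, Bool.orb_true_r. ring. }
    rewrite <- H. apply Series_finite. intros k Hk. unfold v. destruct (Nat.eqb_spec k 0); [lia|].
    destruct (Nat.eqb_spec k n); [lia|]. simpl. ring. }
  assert (Hb : abs_summable b).
  { unfold abs_summable, b. apply ex_series_ext with (2 := Ha). intros k. now rewrite Cmod_mult, Cmod_cis, Rmult_1_r. }
  assert (H : 0 <= Series (fun k => half_weight k * v k * Re (b k))).
  { apply fourier_pos_C; auto.
    - exists (1 + 1). apply is_series_ext with (2 := E (fun _ => 1)). intros k. unfold v.
      destruct (orb _ _); rewrite ?Rabs_R1, ?Rabs_R0, Rmult_1_r; reflexivity.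
    - intros t. rewrite (Series_ext _ (fun k => Re (a k * cis (INR k * (t + p)))%C)); [est|]. intros k. unfold b.
      rewrite <- Cmult_assoc, <- cis_plus. replace (INR k * p + INR k * t) with (INR k * (t + p)) by lra. reflexivity.
    - intros t. rewrite (is_series_unique _ _ (E (fun k => cos (INR k * t)))). rewrite Rmult_0_l, cos_0.
      generalize (COS_bound (INR n * t)). lra. }
  rewrite (Series_ext _ (fun k => v k * (half_weight k * Re (b k)))) in H by est.
  rewrite (is_series_unique _ _ (E _)) in H.
  assert (B0 : b O = a O) by (unfold b; simpl INR; rewrite Rmult_0_l, cis_0; ring).
  assert (Bn : Re (b n) = - Cmod (a n)).
  { unfold b. replace (INR n * p) with (PI - t0) by (unfold p; field; apply not_0_INR; lia). rewrite Ht0 at 1.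
    rewrite <- Cmult_assoc, <- cis_plus. replace (t0 + (PI - t0)) with PI by lra. unfold cis. rewrite cos_PI, sin_PI.
    unfold Cmult, RtoC, Re; simpl. ring. }
  rewrite B0, Bn in H. replace (half_weight n) with (1/2) in H by (destruct n; [lia|reflexivity]). simpl in H. lra.
Qed.

Lemma Clim_geom (q : C) : Cmod q < 1 -> Clim (csum (fun k => (q ^ k)%C)) (/ (1 - q))%C.
Proof.
  intros Hq. assert (Hn : (1 - q)%C <> RtoC 0).
  { intros E. assert (q = RtoC 1) by (replace q with (RtoC 1 - (1 - q))%C by ring; rewrite E; ring). subst q.
    rewrite Cmod_1 in Hq. lra. }
  assert (F : forall n, csum (fun k => (q ^ k)%C) n = ((1 - q ^ n) / (1 - q))%C).
  { induction n as [|n IH].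
    - simpl. field; auto.
    - simpl csum. rewrite IH, Cpow_S. field; auto. }
  apply Clim_dom with (fun n => Cmod q ^ n * / Cmod (1 - q)%C).
  - intros n. rewrite F. replace ((1 - q ^ n) / (1 - q) - / (1 - q))%C with (- (q ^ n * / (1 - q)))%C by alg.
    rewrite Cmod_opp, Cmod_mult, Cmod_pow, Cmod_inv by est. lra.
  - replace (Finite 0) with (Rbar_mult 0 (/ Cmod (1 - q)%C)) by (simpl; f_equal; ring). apply is_lim_seq_scal_r.
    apply is_lim_seq_geom. rewrite Rabs_pos_eq by est. exact Hq.
Qed.

Lemma ex_series_geom_R (q : R) : 0 <= q < 1 -> ex_series (fun k => q ^ k).
Proof. exists (/ (1 - q)). apply is_series_geom. rewrite Rabs_pos_eq; lra. Qed.

Lemma abs_summable_geom (q : C) : Cmod q < 1 -> abs_summable (fun k => (q ^ k)%C).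
Proof.
  intros H. apply ex_series_ext with (fun k => Cmod q ^ k); [intros; now rewrite Cmod_pow|]. apply ex_series_geom_R.
  est.
Qed.

Lemma CSeries_geom (q : C) : Cmod q < 1 -> CSeries (fun k => (q ^ k)%C) = (/ (1 - q))%C.
Proof. intros H. now apply CSeries_unique, Clim_geom. Qed.

Lemma Cmod_sqr (z : C) : Cmod z ^ 2 = Re z ^ 2 + Im z ^ 2.
Proof. unfold Cmod, Re, Im; simpl fst; simpl snd. rewrite <- Rsqr_pow2, Rsqr_sqrt; nra. Qed.

Lemma is_derive_ln_Cmod_line (a b : C) (s : R) :
  (a + RtoC s * b)%C <> RtoC 0 ->
  is_derive (fun s => ln (Cmod (a + RtoC s * b)%C)) s (Re (b / (a + RtoC s * b))%C).
Proof.
  intros Hn. destruct a as [a1 a2], b as [b1 b2].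
  assert (E : forall s, (((a1, a2) : C) + RtoC s * (b1, b2))%C = (a1 + s * b1, a2 + s * b2)).
  { intros. unfold Cplus, Cmult, RtoC; simpl. f_equal; ring. }
  rewrite E in *. assert (Hp : 0 < (a1 + s * b1) ^ 2 + (a2 + s * b2) ^ 2).
  { destruct (Req_dec (a1 + s * b1) 0) as [E1|E1]; [destruct (Req_dec (a2 + s * b2) 0) as [E2|E2]|].
    - exfalso. apply Hn. unfold RtoC. congruence.
    - nra.
    - generalize (pow2_gt_0 _ E1) (pow2_ge_0 (a2 + s * b2)). lra. }
  apply is_derive_ext with (fun s => / 2 * ln ((a1 + s * b1) ^ 2 + (a2 + s * b2) ^ 2)).
  - intros t. rewrite E. unfold Cmod. simpl fst; simpl snd. set (X := (a1 + t * b1) ^ 2 + (a2 + t * b2) ^ 2).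
    destruct (Req_dec X 0) as [EX|EX].
    + rewrite EX, sqrt_0.
      (* The default value [ln 0 = 0] makes the two expressions agree also where the modulus
         vanishes, so the derivative is transferred by an identity valid everywhere. *)
      assert (L0 : ln 0 = 0) by (unfold ln; destruct (Rlt_dec 0 0) as [h|h]; [exfalso; lra|reflexivity]). lra.
    + assert (0 < X) by (generalize (pow2_ge_0 (a1 + t * b1)) (pow2_ge_0 (a2 + t * b2)); unfold X in *; lra).
      rewrite <- (sqrt_sqrt X) at 1 by lra. rewrite ln_mult by est. lra.
  - auto_derive; [exact Hp|]. unfold Cdiv, Cinv, Cmult, Re; simpl. lra.
Qed.

Lemma Re_scal (r : R) (z : C) : Re (RtoC r * z)%C = r * Re z.
Proof. destruct z; unfold Cmult, RtoC, Re; simpl; ring. Qed.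

Lemma C1m_neq0 (z : C) : Cmod z < 1 -> (1 - z)%C <> RtoC 0.
Proof.
  intros H E. assert (z = RtoC 1) by (replace z with (RtoC 1 - (1 - z))%C by ring; rewrite E; ring). subst z.
  rewrite Cmod_1 in H. lra.
Qed.

(** Along the segment from $0$ to $z$ the sum of $\log|1-sz|$ and of the power series in $s$ has
    derivative zero, because the series differentiates to the real part of a geometric series. *)
Lemma ln_Cmod_1m (z : C) :
  Cmod z < 1 -> is_series (fun k => Re (z ^ S k)%C / INR (S k)) (- ln (Cmod (1 - z)%C)).
Proof.
  intros Hz. set (c := fun k => match k with O => 0 | S j => Re (z ^ S j)%C / INR (S j) end).
  assert (Hc : forall k, Rabs (c k) <= Cmod z ^ k).
  { intros [|k]; unfold c; [est|]. unfold Rdiv. rewrite Rabs_mult. rewrite <- Cmod_pow.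
    generalize (Re_le_Cmod (z ^ S k)%C) (Rabs_pos (Re (z ^ S k)%C)). assert (0 < / INR (S k) <= 1).
    { assert (1 <= INR (S k)) by (rewrite S_INR; generalize (pos_INR k); lra). est. }
    rewrite (Rabs_pos_eq (/ INR (S k))) by lra. nra. }
  assert (Hex : forall s, Rabs s <= 1 -> ex_series (fun k => c k * s ^ k)).
  { intros s Hs. apply ex_series_Rle with (fun k => Cmod z ^ k).
    - intros k. rewrite Rabs_mult, <- RPow_abs. generalize (Hc k) (Rabs_pos (c k)). assert (0 <= Rabs s ^ k <= 1).
      { rewrite <- (pow1 k). est. }
      nra.
    - apply ex_series_geom_R. est. }
  (* The end point $s=1$ must lie strictly inside the disc of convergence. The radius is at least
     $1/|z|$; for $z=0$ all coefficients vanish and the radius $2$ serves as well as any. *)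
  assert (HR : Rbar_lt 1 (CV_radius c)).
  { destruct (Rle_lt_dec (Cmod z) 0) as [Z0|Z0].
    - apply Rbar_lt_le_trans with 2; [simpl; lra|]. apply CV_radius_bounded. exists 1. intros n. rewrite Rabs_mult.
      assert (Z : Cmod z = 0) by (generalize (Cmod_ge_0 z); lra). generalize (Hc n). rewrite Z.
      destruct n; [simpl; rewrite ?Rabs_R0; intros; rewrite Rmult_0_l; lra|]. rewrite pow_i by lia. intros H.
      assert (Rabs (c (S n)) = 0) by (generalize (Rabs_pos (c (S n))); lra). rewrite H0. lra.
    - apply Rbar_lt_le_trans with (/ Cmod z); [simpl; rewrite <- Rinv_1; apply Rinv_lt_contravar; lra|].
      apply CV_radius_bounded. exists 1. intros n. rewrite Rabs_mult, <- RPow_abs.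
      rewrite (Rabs_pos_eq (/ Cmod z)) by est. apply Rle_trans with (Cmod z ^ n * (/ Cmod z) ^ n).
      + est.
      + rewrite <- Rpow_mult_distr, Rinv_r by lra. rewrite pow1. lra. }
  assert (Hsz : forall s, 0 <= s <= 1 -> Cmod (RtoC s * z)%C < 1).
  { intros s Hs. rewrite Cmod_mult, Cmod_R, Rabs_pos_eq by lra. generalize (Cmod_ge_0 z); nra. }
  set (g := fun s => ln (Cmod (1 + RtoC s * (- z))%C) + PSeries c s).
  assert (Hg : forall s, 0 <= s <= 1 -> is_derive g s 0).
  { intros s Hs. replace 0 with (Re ((- z) / (1 + RtoC s * (- z)))%C + PSeries (PS_derive c) s).
    - apply (is_derive_plus (fun s => ln (Cmod (1 + RtoC s * (- z))%C)) (PSeries c)).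
      + apply is_derive_ln_Cmod_line. replace (1 + RtoC s * (- z))%C with (1 - RtoC s * z)%C by alg.
        now apply C1m_neq0, Hsz.
      + apply is_derive_PSeries. apply Rbar_le_lt_trans with 1; [simpl; rewrite Rabs_pos_eq; lra|exact HR].
    - assert (E : PSeries (PS_derive c) s = Re (z * CSeries (fun k => (RtoC s * z) ^ k))%C).
      { apply is_series_unique. apply is_series_rsum.
        assert (L : Clim (csum (fun k => z * (RtoC s * z) ^ k)%C) (z * CSeries (fun k => (RtoC s * z) ^ k))%C).
        { eapply Clim_ext; [intros n; symmetry; apply csum_scal|]. apply Clim_scal, csum_Clim, abs_summable_geom. est. }
        apply is_lim_seq_ext with (2 := Clim_Re _ _ L). intros n. rewrite csum_Re. apply rsum_ext. intros k _.
        unfold PS_derive, c. rewrite Cpow_mult_l, <- RtoC_pow.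
        replace (z * (RtoC (s ^ k) * z ^ k))%C with (RtoC (s ^ k) * z ^ S k)%C by alg. rewrite Re_scal. field. est. }
      rewrite E, CSeries_geom by est. assert (Hd : (1 - RtoC s * z)%C <> RtoC 0) by (now apply C1m_neq0, Hsz).
      replace (- z / (1 + RtoC s * - z))%C with (- (z * / (1 - RtoC s * z)))%C.
      2:{ replace (1 + RtoC s * - z)%C with (1 - RtoC s * z)%C by alg. field; auto. }
      destruct (z * / (1 - RtoC s * z))%C; simpl; lra. }
  assert (G : g 1 = g 0).
  { destruct (MVT_gen g 0 1 (fun _ => 0)) as [xi [_ Hxi]].
    - intros s Hs. rewrite Rmin_left, Rmax_right in Hs by lra. apply Hg; lra.
    - intros s Hs. rewrite Rmin_left, Rmax_right in Hs by lra. apply continuity_pt_filterlim.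
      apply (ex_derive_continuous g s). exists 0. est.
    - lra. }
  unfold g in G. rewrite PSeries_0 in G. replace (1 + RtoC 1 * - z)%C with (1 - z)%C in G by alg.
  replace (1 + RtoC 0 * - z)%C with (RtoC 1) in G by alg. rewrite Cmod_1, ln_1 in G. simpl in G.
  assert (G' : PSeries c 1 = - ln (Cmod (1 - z)%C)) by lra. rewrite <- G'. unfold PSeries.
  assert (Hex1 : ex_series c).
  { apply ex_series_ext with (fun k => c k * 1 ^ k); [intros; rewrite pow1; apply Rmult_1_r|]. apply Hex. est. }
  rewrite (Series_ext _ c) by (intros; rewrite pow1; ring). rewrite Series_incr_1 by est. rewrite Rplus_0_l.
  apply Series_correct. now apply ex_series_incr_1 in Hex1.
Qed.

(** * Logarithmic derivatives of products over zeros *)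

Fixpoint prodz (ws : list C) (z : C) : C :=
  match ws with nil => RtoC 1 | w :: l => ((1 - z / w) * prodz l z)%C end.

(** Power sums of the reciprocals of the zeros: [- psum ws (S k)] is the Taylor coefficient of index
    $k$ at $0$ of [logder ws], the logarithmic derivative of [prodz ws]. *)
Fixpoint psum (ws : list C) (k : nat) : C :=
  match ws with nil => RtoC 0 | w :: l => ((/ w) ^ k + psum l k)%C end.

Fixpoint logder (ws : list C) (z : C) : C :=
  match ws with nil => RtoC 0 | w :: l => (/ (z - w) + logder l z)%C end.

(** Finitely many zeros outside a closed disc also stay outside a slightly larger one; the ratio
    $r/\rho<1$ then gives geometric convergence up to the circle itself. *)
Lemma list_Cmod_gap (ws : list C) (r : R) :
  (forall w, In w ws -> r < Cmod w) ->
  exists rho, r < rho /\ forall w, In w ws -> rho <= Cmod w.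
Proof.
  induction ws as [|w ws IH]; intros H.
  - exists (r + 1). split; [lra|]. intros w [].
  - destruct IH as [rho [H1 H2]]; [intros; apply H; now right|]. exists (Rmin rho (Cmod w)). split.
    + apply Rmin_glb_lt; [exact H1|apply H; now left].
    + intros w' [<-|H']; [apply Rmin_r|]. eapply Rle_trans; [apply Rmin_l|auto].
Qed.

Lemma psum_bound (ws : list C) (rho : R) k :
  0 < rho -> (forall w, In w ws -> rho <= Cmod w) ->
  Cmod (psum ws k) <= INR (length ws) * (/ rho) ^ k.
Proof.
  intros Hr. induction ws as [|w ws IH]; intros H.
  - simpl. rewrite Cmod_0. lra.
  - simpl length. rewrite S_INR, Rmult_plus_distr_r, Rmult_1_l. via Cmod_triangle. rewrite Rplus_comm.
    apply Rplus_le_compat.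
    + apply IH. intros; apply H; now right.
    + assert (Hw : rho <= Cmod w) by (apply H; now left). rewrite Cmod_pow, Cmod_inv.
      * est.
      * intros E. rewrite E, Cmod_0 in Hw. lra.
Qed.

Lemma Cmod_gt_neq0 (w : C) : 0 < Cmod w -> w <> RtoC 0.
Proof. intros H E. rewrite E, Cmod_0 in H. lra. Qed.

Lemma ln_prodz (ws : list C) (z : C) :
  (forall w, In w ws -> Cmod z < Cmod w) ->
  prodz ws z <> RtoC 0 /\
  is_series (fun k => Re (psum ws (S k) * z ^ S k)%C / INR (S k)) (- ln (Cmod (prodz ws z))).
Proof.
  induction ws as [|w ws IH]; intros H.
  - split; [simpl; apply C1_nz|]. simpl prodz. rewrite Cmod_1, ln_1, Ropp_0. apply (Series_finite _ 0). simpl Re. est.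
  - destruct IH as [I1 I2]; [intros; apply H; now right|]. assert (Hw : Cmod z < Cmod w) by (apply H; now left).
    assert (Hw0 : w <> RtoC 0) by (apply Cmod_gt_neq0; generalize (Cmod_ge_0 z); lra).
    assert (Hq : Cmod (z / w)%C < 1).
    { rewrite Cmod_div by est. apply Rlt_div_l; [generalize (Cmod_ge_0 z); lra|lra]. }
    generalize (C1m_neq0 _ Hq). split; [simpl; now apply Cmult_neq_0|]. simpl prodz.
    rewrite Cmod_mult, ln_mult by est.
    replace (- (ln (Cmod (1 - z / w)%C) + ln (Cmod (prodz ws z))))
      with (plus (- ln (Cmod (1 - z / w)%C)) (- ln (Cmod (prodz ws z)))) by (unfold plus; simpl; ring).
    apply is_series_ext with (2 := is_series_plus _ _ _ _ (ln_Cmod_1m _ Hq) I2). intros k.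
    change (psum (w :: ws) (S k)) with ((/ w) ^ S k + psum ws (S k))%C. unfold Cdiv at 1. rewrite Cpow_mult_l.
    rewrite Cmult_plus_distr_r. rewrite (Cmult_comm (z ^ S k)).
    destruct ((/ w) ^ S k * z ^ S k)%C, (psum ws (S k) * z ^ S k)%C.
    change (r / INR (S k) + r1 / INR (S k) = (r + r1) / INR (S k)). est.
Qed.

Lemma logder_series (ws : list C) (z : C) :
  (forall w, In w ws -> Cmod z < Cmod w) ->
  Clim (csum (fun k => - psum ws (S k) * z ^ k)%C) (logder ws z).
Proof.
  induction ws as [|w ws IH]; intros H.
  - simpl. eapply Clim_ext; [|apply Clim_const]. symmetry.
    transitivity (csum (fun _ => RtoC 0 * RtoC 0)%C n); [|rewrite csum_scal; ring]. apply csum_ext.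
    intros; simpl; ring.
  - assert (Hw : Cmod z < Cmod w) by (apply H; now left).
    assert (Hw0 : w <> RtoC 0) by (apply Cmod_gt_neq0; generalize (Cmod_ge_0 z); lra).
    assert (Hq : Cmod (z / w)%C < 1).
    { rewrite Cmod_div by est. apply Rlt_div_l; [generalize (Cmod_ge_0 z); lra|lra]. }
    generalize (C1m_neq0 _ Hq). intros Hn. simpl logder. assert (Hzw : (w - z)%C <> RtoC 0).
    { intros E. apply Hn. replace (1 - z / w)%C with ((w - z) / w)%C by alg. rewrite E. field; auto. }
    replace (/ (z - w))%C with ((- / w) * / (1 - z / w))%C.
    2:{ field. repeat split; auto. intros E. apply Hzw. replace (w - z)%C with (- (z - w))%C by alg. rewrite E; ring. }
    assert (L := Clim_plus _ _ _ _ (Clim_scal (- / w) _ _ (Clim_geom _ Hq)) (IH (fun w' h => H w' (or_intror h)))).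
    eapply Clim_ext with (2 := L). intros n. rewrite <- csum_scal, <- csum_plus. apply csum_ext. intros k _.
    change (psum (w :: ws) (S k)) with ((/ w) ^ S k + psum ws (S k))%C. unfold Cdiv.
    rewrite Cpow_mult_l, (Cpow_S (/ w)). ring.
Qed.

Lemma rsum_geom_deriv (q : R) n : 0 <= q < 1 -> rsum (fun k => INR (S k) * q ^ k) n <= / (1 - q) ^ 2.
Proof.
  intros Hq.
  assert (E : rsum (fun k => INR (S k) * q ^ k) n = (1 - (INR n + 1) * q ^ n + INR n * q ^ S n) / (1 - q) ^ 2).
  { induction n as [|n IH].
    - simpl. lra.
    - rewrite rsum_S, IH, S_INR. simpl. field. lra. }
  rewrite E. unfold Rdiv. rewrite <- (Rmult_1_l (/ (1 - q) ^ 2)) at 2. apply Rmult_le_compat_r; [est|].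
  assert (0 <= q ^ n) by est. generalize (pos_INR n). simpl. intros.
  assert (INR n * (q * q ^ n) <= INR n * q ^ n) by (apply Rmult_le_compat_l; nra). nra.
Qed.

Lemma Cmod_Clim_le (u : nat -> C) (l : C) (B : R) : Clim u l -> (forall n, Cmod (u n) <= B) -> Cmod l <= B.
Proof.
  intros H HB. apply (is_lim_seq_le (fun n => Cmod (u n)) (fun _ => B) (Cmod l) B); auto.
  - now apply Clim_Cmod.
  - apply is_lim_seq_const.
Qed.

Section ZeroFree.
Variables (ws : list C) (r m : R).
Hypothesis Hr : 0 < r.
Hypothesis Hws : forall w, In w ws -> r < Cmod w.
Hypothesis Hm : forall z, Cmod z = r -> Cmod (prodz ws z) <= exp m.

(** The real part of $\sum a_ke^{ikt}$ is $m-\log|p(re^{it})|$ with $p$ the product over [ws]; [Hm]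
    says that it is nonnegative. *)
Let a (k : nat) : C :=
  match k with O => RtoC m | S _ => (psum ws k * RtoC (r ^ k / INR k))%C end.

Lemma zero_free_summable : abs_summable a.
Proof.
  destruct (list_Cmod_gap ws r Hws) as [rho [H1 H2]]. apply ex_series_incr_1.
  apply ex_series_Rle with (fun k => INR (length ws) * (r / rho) ^ (S k)).
  - intros k. rewrite Rabs_pos_eq by est. unfold a. rewrite Cmod_mult, Cmod_R.
    assert (Hk : 1 <= INR (S k)) by (rewrite S_INR; generalize (pos_INR k); lra). rewrite Rabs_pos_eq by est.
    apply Rle_trans with (INR (length ws) * (/ rho) ^ S k * (r ^ S k / INR (S k))).
    + apply Rmult_le_compat_r; [est|]. apply psum_bound; auto. lra.
    + unfold Rdiv at 2. rewrite Rpow_mult_distr. unfold Rdiv. rewrite <- Rmult_assoc.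
      apply Rle_trans with (INR (length ws) * (/ rho) ^ S k * r ^ S k * 1); [|lra]. est.
  - apply (ex_series_scal (INR (length ws)) (fun k => (r / rho) ^ S k)).
    apply (ex_series_incr_1 (fun k => (r / rho) ^ k)). apply ex_series_geom_R. split.
    + est.
    + est.
Qed.

Lemma zero_free_positive t : 0 <= Series (fun k => Re (a k * cis (INR k * t))%C).
Proof.
  set (z := (RtoC r * cis t)%C).
  assert (Hz : Cmod z = r) by (unfold z; rewrite Cmod_mult, Cmod_cis, Cmod_R, Rabs_pos_eq; lra).
  destruct (ln_prodz ws z) as [N L]; [intros; rewrite Hz; auto|].
  assert (Hs : abs_summable (fun k => a k * cis (INR k * t))%C).
  { apply ex_series_ext with (2 := zero_free_summable). intros k. now rewrite Cmod_mult, Cmod_cis, Rmult_1_r. }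
  rewrite Series_incr_1 by (now apply abs_summable_Re). rewrite (is_series_unique _ (- ln (Cmod (prodz ws z)))).
  - replace (Re (a O * cis (INR 0 * t))%C) with m.
    + assert (ln (Cmod (prodz ws z)) <= m); [|lra]. rewrite <- (ln_exp m). est.
    + rewrite Rmult_0_l, cis_0. simpl. ring.
  - apply is_series_ext with (2 := L). intros k.
    assert (E : (a (S k) * cis (INR (S k) * t))%C = (RtoC (/ INR (S k)) * (psum ws (S k) * z ^ S k))%C).
    { unfold a, z. rewrite Cpow_mult_l, cis_pow, <- RtoC_pow. unfold Rdiv. rewrite RtoC_mult. ring. }
    rewrite E, Re_scal. est.
Qed.

(** The mean of the logarithm of the modulus over the circle is its value at the centre, $\log1=0$,
    and it cannot exceed $m$. *)
Lemma zero_free_m_nonneg : 0 <= m.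
Proof. apply (fourier_coef0 a zero_free_summable zero_free_positive). Qed.

Lemma zero_free_psum k : (0 < k)%nat -> Cmod (psum ws k) <= 2 * m * INR k * (/ r) ^ k.
Proof.
  intros Hk. generalize (caratheodory a k zero_free_summable zero_free_positive Hk). destruct k as [|k]; [lia|].
  unfold a. rewrite Cmod_mult, Cmod_R. assert (Hk1 : 0 < INR (S k)) by est. assert (Hrk : 0 < r ^ S k) by est.
  rewrite Rabs_pos_eq by est. intros H. rewrite pow_inv.
  apply Rmult_le_reg_r with (r ^ S k / INR (S k)); [now apply Rdiv_lt_0_compat|].
  replace (2 * m * INR (S k) * / r ^ S k * (r ^ S k / INR (S k))) with (2 * m) by alg. exact H.
Qed.

(** A Borel-Carathéodory bound: the Taylor coefficients of the logarithmic derivative are power sums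
    of modulus at most $2m(k+1)/r^{k+1}$, and $\sum(k+1)q^k=(1-q)^{-2}$. *)
Lemma zero_free_logder z : Cmod z < r -> Cmod (logder ws z) <= 2 * m * r / (r - Cmod z) ^ 2.
Proof.
  intros Hz. generalize zero_free_m_nonneg (Cmod_ge_0 z). intros Hm0 Hz0.
  apply (Cmod_Clim_le _ _ _ (logder_series ws z (fun w h => Rlt_trans _ _ _ Hz (Hws w h)))). intros n. via csum_Cmod.
  apply Rle_trans with (rsum (fun k => 2 * m / r * (INR (S k) * (Cmod z / r) ^ k)) n).
  - apply rsum_le. intros k _. rewrite Cmod_mult, Cmod_opp, Cmod_pow.
    eapply Rle_trans; [apply Rmult_le_compat_r; [est|apply zero_free_psum; lia]|]. unfold Rdiv.
    rewrite Rpow_mult_distr. simpl pow. est.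
  - rewrite rsum_scal. replace (2 * m * r / (r - Cmod z) ^ 2) with (2 * m / r * / (1 - Cmod z / r) ^ 2) by alg.
    apply Rmult_le_compat_l; [est|]. apply rsum_geom_deriv. est.
Qed.
End ZeroFree.

(* Jensen's device: on the circle of radius [r] a zero inside it may be replaced by its
   inverse point, at the cost of the factor [r / Cmod w]. *)
Definition reflect (r : R) (w : C) : C :=
  if Rlt_dec (Cmod w) r then (RtoC (r ^ 2) / Cconj w)%C else w.

Fixpoint jensen_sum (r : R) (ws : list C) : R :=
  match ws with nil => 0 | w :: l => (if Rlt_dec (Cmod w) r then ln (r / Cmod w) else 0) + jensen_sum r l end.

Lemma Cconj_neq0 (w : C) : w <> RtoC 0 -> Cconj w <> RtoC 0.
Proof. intros H. apply Cmod_gt_0 in H. rewrite <- Cmod_conj in H. now apply Cmod_gt_0. Qed.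

Lemma Cmod_reflect (r : R) (w : C) :
  0 < r -> w <> RtoC 0 -> Cmod w <> r -> r < Cmod (reflect r w).
Proof.
  intros Hr Hw Hn. unfold reflect. destruct (Rlt_dec (Cmod w) r) as [L|L]; [|lra]. assert (0 < Cmod w) by est.
  rewrite Cmod_div by (now apply Cconj_neq0). rewrite Cmod_conj, Cmod_R, Rabs_pos_eq by nra. apply Rlt_div_r; nra.
Qed.

(** On the circle $r^2=z\bar z$, so the factor of the reflected zero is $z(\bar z-\bar w)/r^2$,
    whose modulus is $|w|/r$ times that of $1-z/w$. The exponential of the Jensen sum restores these
    ratios. *)
Lemma prodz_reflect (r : R) (ws : list C) (z : C) :
  0 < r -> Cmod z = r -> (forall w, In w ws -> w <> RtoC 0) ->
  Cmod (prodz (map (reflect r) ws) z) * exp (jensen_sum r ws) = Cmod (prodz ws z).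
Proof.
  intros Hr Hz. induction ws as [|w ws IH]; intros H.
  - simpl. rewrite exp_0. ring.
  - simpl prodz. simpl jensen_sum. rewrite exp_plus, !Cmod_mult. rewrite <- IH by (intros; apply H; now right).
    assert (Hw : w <> RtoC 0) by (apply H; now left). assert (Hw' : 0 < Cmod w) by est.
    assert (E : Cmod (1 - z / reflect r w)%C * exp (if Rlt_dec (Cmod w) r then ln (r / Cmod w) else 0) = Cmod (1 - z /
      w)%C).
    { unfold reflect. destruct (Rlt_dec (Cmod w) r) as [L|L]; [|rewrite exp_0; ring]. rewrite exp_ln by est.
      assert (Hcw := Cconj_neq0 _ Hw). assert (Hrr : RtoC r <> RtoC 0) by (intros E; injection E; lra).
      assert (Hz2 : (z * Cconj z)%C = RtoC (r ^ 2)) by (rewrite <- Cmod2_conj, Hz; reflexivity).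
      replace (1 - z / (RtoC (r ^ 2) / Cconj w))%C with (z * Cconj (z - w) / RtoC (r ^ 2))%C.
      2:{ rewrite Cminus_conj.
        replace (z * (Cconj z - Cconj w))%C with (RtoC (r ^ 2) - z * Cconj w)%C by (rewrite <- Hz2; ring). field.
        split; auto. rewrite RtoC_pow. now apply Cpow_nz. }
      replace (1 - z / w)%C with (- ((z - w) / w))%C by alg.
      rewrite Cmod_opp, Cmod_div by (rewrite RtoC_pow; now apply Cpow_nz).
      rewrite Cmod_mult, Cmod_conj, Cmod_div, Cmod_R, Rabs_pos_eq, Hz by est. field. lra. }
    rewrite <- E. ring.
Qed.

Lemma logder_reflect_lower (r r1 D : R) (ws : list C) (z : C) :
  (forall w, In w ws -> Cmod w < r ->
     - D * ln (r / Cmod w) <= Re (/ (z - w) - / (z - RtoC (r ^ 2) / Cconj w))%C) ->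
  - D * jensen_sum r ws + Re (logder (map (reflect r) ws) z) <= Re (logder ws z).
Proof.
  induction ws as [|w ws IH]; intros H.
  - simpl. lra.
  - simpl jensen_sum. simpl logder. assert (IH' := IH (fun w' h => H w' (or_intror h))).
    assert (Hw := H w (or_introl eq_refl)). assert (P : forall a b : C, Re (a + b)%C = Re a + Re b) by est.
    assert (Q : forall a b : C, Re (a - b)%C = Re a - Re b) by est. rewrite !P. unfold reflect at 1.
    destruct (Rlt_dec (Cmod w) r) as [L|L]; [|lra]. rewrite Q in Hw. lra.
Qed.

(** Let $S$ be the Jensen sum. The reflected product is zero-free in the disc and at most $e^{M-S}$
    on the circle, so its logarithmic derivative costs $D(M-S)$; undoing the reflection costs $DS$.
    The unknown $S$, and with it the number of zeros, cancels. *)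
Theorem logder_lower (ws : list C) (r r1 D M : R) (z : C) :
  0 < r1 < r ->
  (forall w, In w ws -> w <> RtoC 0 /\ Cmod w <> r) ->
  (forall z, Cmod z = r -> Cmod (prodz ws z) <= exp M) ->
  2 * r / (r - r1) ^ 2 <= D -> Cmod z <= r1 ->
  (forall w, In w ws -> Cmod w < r ->
     - D * ln (r / Cmod w) <= Re (/ (z - w) - / (z - RtoC (r ^ 2) / Cconj w))%C) ->
  - (D * M) <= Re (logder ws z).
Proof.
  intros Hr Hws HM HD Hz Hw. generalize (logder_reflect_lower r r1 D ws z Hw). set (ws' := map (reflect r) ws) in *.
  set (S := jensen_sum r ws) in *. assert (Hws' : forall w, In w ws' -> r < Cmod w).
  { intros w Hin. apply in_map_iff in Hin. destruct Hin as [w0 [<- Hin]]. destruct (Hws w0 Hin).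
    apply Cmod_reflect; auto; lra. }
  assert (Hm : forall z, Cmod z = r -> Cmod (prodz ws' z) <= exp (M - S)).
  { intros z0 Hz0. apply Rmult_le_reg_r with (exp S); [est|]. unfold ws', S.
    rewrite prodz_reflect by (auto; try lra; intros; now apply Hws). rewrite <- exp_plus.
    replace (M - jensen_sum r ws + jensen_sum r ws) with M by lra. est. }
  generalize (zero_free_logder ws' r (M - S) ltac:(lra) Hws' Hm z ltac:(lra)).
  generalize (zero_free_m_nonneg ws' r (M - S) ltac:(lra) Hws' Hm). intros P H2.
  assert (H3 : 2 * (M - S) * r / (r - Cmod z) ^ 2 <= D * (M - S)).
  { replace (2 * (M - S) * r / (r - Cmod z) ^ 2) with ((M - S) * (2 * r / (r - Cmod z) ^ 2)) by lra.
    rewrite (Rmult_comm D). apply Rmult_le_compat_l; [exact P|]. eapply Rle_trans; [|exact HD]. est. }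
  generalize (Re_ge_Cmod (logder ws' z)). lra.
Qed.

(** * A positive kernel *)

Lemma Cconj_R (x : R) : Cconj (RtoC x) = RtoC x.
Proof. unfold Cconj, RtoC; simpl. f_equal. ring. Qed.

Lemma Re_plus (a b : C) : Re (a + b)%C = Re a + Re b.
Proof. est. Qed.

Lemma Re_minus (a b : C) : Re (a - b)%C = Re a - Re b.
Proof. est. Qed.

Lemma Re_opp (a : C) : Re (- a)%C = - Re a.
Proof. est. Qed.

Lemma Cmod_minus_ge (a b : C) : Cmod a - Cmod b <= Cmod (b - a)%C.
Proof.
  generalize (Cmod_triangle b (a - b)%C). replace (b + (a - b))%C with a by alg. rewrite <- (Cmod_opp (a - b)).
  replace (- (a - b))%C with (b - a)%C by alg. lra.
Qed.

Lemma ln_ge_1_minus_inv (x : R) : 0 < x -> 1 - / x <= ln x.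
Proof. intros Hx. generalize (exp_ineq1_le (ln (/ x))). rewrite exp_ln by est. rewrite ln_Rinv by lra. lra. Qed.

Lemma Re_inv_nonneg (u : C) : 0 <= Re u -> u <> RtoC 0 -> 0 <= Re (/ u)%C.
Proof.
  intros H Hu. apply Cmod_gt_0 in Hu. generalize (Cmod_sqr u). destruct u as [a b]. unfold Cinv; simpl in *. intros E.
  apply Rdiv_le_0_compat; [lra|]. nra.
Qed.

(** Two regimes. For $|w|<1.8$ the term $1/(z-w)$ has nonnegative real part, since $w$ lies to the
    left of $z$, and the reflected zero is at distance at least $0.59$ from $z$. Closer to the
    circle, $w$ and its reflection nearly cancel: the difference is proportional to $r-|w|$, and
    $\log(r/|w|)$ is at least $(r-|w|)/r$. The second regime fixes the constant $32$. *)
Lemma blaschke_term (r : R) (w z : C) :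
  194 / 100 <= r <= 195 / 100 -> Cmod z <= 3 / 2 -> w <> RtoC 0 -> Cmod w < r ->
  Re w < Re z ->
  - 32 * ln (r / Cmod w) <= Re (/ (z - w) - / (z - RtoC (r ^ 2) / Cconj w))%C.
Proof.
  intros Hr Hz Hw Hwr Hre. assert (Hp : 0 < Cmod w) by est. set (w' := (RtoC (r ^ 2) / Cconj w)%C).
  assert (Hcw := Cconj_neq0 _ Hw). assert (Hw' : Cmod w' = r ^ 2 / Cmod w).
  { unfold w'. rewrite Cmod_div by est. rewrite Cmod_conj, Cmod_R, Rabs_pos_eq; nra. }
  assert (Hln : 1 - Cmod w / r <= ln (r / Cmod w)).
  { generalize (ln_ge_1_minus_inv (r / Cmod w)). intros H. rewrite Rinv_div in H. apply H. est. }
  assert (Hd1 : (z - w)%C <> RtoC 0).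
  { intros E. assert (Re (z - w)%C = 0) by (rewrite E; reflexivity). rewrite Re_minus in H. lra. }
  assert (D2 : Cmod w' - 3 / 2 <= Cmod (z - w')%C) by (generalize (Cmod_minus_ge w' z); lra).
  destruct (Rlt_le_dec (Cmod w) (18 / 10)) as [C1|C1].
  - assert (2.09 <= Cmod w').
    { rewrite Hw'. apply (proj1 (Rle_div_r _ _ _ Hp)). assert (1.94 * 1.94 <= r ^ 2) by nra. lra. }
    assert (Hp2 : 0 < Cmod (z - w')%C) by lra. rewrite Re_minus.
    assert (0 <= Re (/ (z - w))%C) by (apply Re_inv_nonneg; [rewrite Re_minus; lra|auto]).
    generalize (Re_le_Cmod (/ (z - w'))%C). intros H1. apply Rabs_le_between in H1.
    rewrite Cmod_inv in H1 by (now apply Cmod_gt_neq0). assert (/ Cmod (z - w')%C <= / 0.59) by est.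
    assert (Cmod w / r <= 1.8 / 1.94) by est. lra.
  - assert (Hww' : r < Cmod w') by (rewrite Hw'; apply Rlt_div_r; nra).
    assert (Hp1 : 0.3 <= Cmod (z - w)%C) by (generalize (Cmod_minus_ge w z); lra).
    assert (Hd2 : (z - w')%C <> RtoC 0) by (apply Cmod_gt_neq0; lra).
    replace (/ (z - w) - / (z - w'))%C with ((w - w') / ((z - w) * (z - w')))%C.
    2:{ field. auto. }
    apply Rle_trans with (- Cmod ((w - w') / ((z - w) * (z - w')))%C); [|apply Re_ge_Cmod]. rewrite Cmod_div by est.
    rewrite Cmod_mult. assert (E : Cmod (w - w')%C = (r ^ 2 - Cmod w ^ 2) / Cmod w).
    { replace (w - w')%C with (- ((RtoC (r ^ 2 - Cmod w ^ 2)) / Cconj w))%C.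
      - rewrite Cmod_opp, Cmod_div by est. rewrite Cmod_conj, Cmod_R, Rabs_pos_eq; nra.
      - unfold w'. rewrite RtoC_minus, (Cmod2_conj w). field. auto. }
    rewrite E.
    assert (B : (r ^ 2 - Cmod w ^ 2) / Cmod w / (Cmod (z - w)%C * Cmod (z - w')%C) <= 32 * (1 - Cmod w / r)); [|lra].
    apply Rle_trans with ((r ^ 2 - Cmod w ^ 2) / Cmod w / (3 / 10 * (44 / 100))).
    + apply Rmult_le_compat_l.
      * apply Rdiv_le_0_compat; nra.
      * est.
    + apply Rle_div_l; [lra|]. apply Rle_div_l; [lra|].
      replace (32 * (1 - Cmod w / r) * (3 / 10 * (44 / 100)) * Cmod w) with ((r - Cmod w) * ((4224 / 1000) * Cmod w /
        r)) by alg.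
      replace (r ^ 2 - Cmod w ^ 2) with ((r - Cmod w) * (r + Cmod w)) by lra. apply Rmult_le_compat_l; [lra|].
      apply Rle_div_r; [lra|]. nra.
Qed.

Lemma csum_geom (x : C) n : x <> RtoC 1 -> csum (fun k => (x ^ k)%C) n = ((1 - x ^ n) / (1 - x))%C.
Proof.
  intros Hx. assert (Hn : (1 - x)%C <> RtoC 0).
  { intros E. apply Hx. replace x with (RtoC 1 - (1 - x))%C by alg. rewrite E; ring. }
  induction n as [|n IH].
  - simpl. field; auto.
  - rewrite csum_S, IH, Cpow_S. field; auto.
Qed.

Section Kernel.
Variables (q : R) (K : nat).
Hypothesis Hq : 0 < q < 1.
Hypothesis HK : (0 < K)%nat.
Let Q := q ^ K.

Lemma Q_range : 0 < Q < 1.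
Proof. unfold Q. split; [est|]. apply pow_lt_1_compat; [lra|exact HK]. Qed.

(** The kernel is [U - P], where [P] lists the cosine coefficients of the Poisson kernel. Those of
    the Poisson kernel times $1-\cos(Kt)$ are $-q^k(1-Q)^2/Q$ for $k\ge K$; rescaled by $2Q/(1-Q)^2$
    they become $-2q^k$. Hence the rescaled product plus [P] is supported below $K$, and [U] is this
    finite part. *)
Let U (k : nat) : R :=
  if Nat.ltb k K then
    match k with O => (1 + Q) / (1 - Q) | S _ => 2 * (q ^ k - q ^ (2 * K - k)) / (1 - Q) ^ 2 end
  else 0.
Let P (k : nat) : R := match k with O => 1 | S _ => 2 * q ^ k end.

(** An analytic function whose real part at $|z|=1$, $Z=z^K$ is the kernel. The power is a variable
    of its own so that the identity below is one of rational functions. *)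
Let E (z Z : C) : C :=
  (RtoC (2 / (1 - Q) ^ 2) * ((1 - RtoC Q * Z) / (1 - RtoC q * z)
     - RtoC (Q ^ 2) * ((1 - Z / RtoC Q) / (1 - z / RtoC q)))
   - RtoC ((1 + Q) / (1 - Q)) - RtoC 2 / (1 - RtoC q * z) + 1)%C.

(* On the unit circle the right-hand side is a multiple of the Poisson kernel times
   [1 - cos (K t)], hence nonnegative. *)
Lemma kernel_identity (z Z : C) :
  z <> RtoC 0 -> Z <> RtoC 0 -> (1 - RtoC q * z)%C <> RtoC 0 -> (z - RtoC q)%C <> RtoC 0 ->
  (E z Z + E (/ z) (/ Z) =
   RtoC 2 * (RtoC (2 * Q * (1 - q ^ 2) / (1 - Q) ^ 2) * (1 - (Z + / Z) / 2) / ((1 - RtoC q * z) * (1 - RtoC q * / z))))%C.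
Proof.
  intros Hz HZ H1 H2. generalize Q_range. intros HQ.
  assert (Hq0 : RtoC q <> RtoC 0) by (intros Eq; injection Eq; lra).
  assert (HQ0 : RtoC Q <> RtoC 0) by (intros Eq; injection Eq; lra).
  assert (HQ1 : (1 - RtoC Q)%C <> RtoC 0) by (intros Eq; injection Eq; lra). unfold E.
  assert (E1 : RtoC (2 / (1 - Q) ^ 2) = (RtoC 2 / ((1 - RtoC Q) * (1 - RtoC Q)))%C).
  { replace (2 / (1 - Q) ^ 2) with (2 / ((1 - Q) * (1 - Q))) by alg. rewrite RtoC_div, RtoC_mult, RtoC_minus by nra.
    reflexivity. }
  assert (E2 : RtoC (2 * Q * (1 - q ^ 2) / (1 - Q) ^ 2) = (RtoC 2 * RtoC Q * (1 - RtoC q * RtoC q) / ((1 - RtoC Q) *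
    (1 - RtoC Q)))%C).
  { replace (2 * Q * (1 - q ^ 2) / (1 - Q) ^ 2) with (2 * Q * (1 - q * q) / ((1 - Q) * (1 - Q))) by alg.
    rewrite RtoC_div by nra. rewrite !RtoC_mult, !RtoC_minus, RtoC_mult. reflexivity. }
  assert (E3 : RtoC ((1 + Q) / (1 - Q)) = ((1 + RtoC Q) / (1 - RtoC Q))%C).
  { rewrite RtoC_div by lra. rewrite RtoC_minus, RtoC_plus. reflexivity. }
  assert (E4 : RtoC (Q ^ 2) = (RtoC Q * RtoC Q)%C).
  { replace (Q ^ 2) with (Q * Q) by lra. apply RtoC_mult. }
  rewrite E1, E2, E3, E4. assert (H4 : (RtoC q - z)%C <> RtoC 0).
  { intros Eq. apply H2. replace (z - RtoC q)%C with (- (RtoC q - z))%C by alg. rewrite Eq. ring. }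
  assert (H5 : (RtoC q * z - 1)%C <> RtoC 0).
  { intros Eq. apply H1. replace (1 - RtoC q * z)%C with (- (RtoC q * z - 1))%C by alg. rewrite Eq. ring. }
  field. repeat split; auto. replace (z * RtoC q - 1)%C with (RtoC q * z - 1)%C by alg. auto.
Qed.

Lemma Cinv_unit (z : C) : Cmod z = 1 -> (/ z)%C = Cconj z.
Proof.
  intros H. assert (Hz : z <> RtoC 0) by (apply Cmod_gt_neq0; lra). assert (E2 := Cmod2_conj z). rewrite H in E2.
  transitivity (/ z * (z * Cconj z))%C; [|alg]. rewrite <- E2. replace (1 ^ 2) with 1 by lra. ring.
Qed.

(** On the unit circle inversion is conjugation, and [E] has real coefficients, so the left-hand
    side of [kernel_identity] is twice the real part of [E]. *)
Lemma kernel_E_nonneg (z : C) : Cmod z = 1 -> 0 <= Re (E z (z ^ K)).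
Proof.
  intros Hz. generalize Q_range. intros HQ. assert (Hz0 : z <> RtoC 0) by (apply Cmod_gt_neq0; lra).
  assert (HZ : Cmod (z ^ K)%C = 1) by (rewrite Cmod_pow, Hz, pow1; reflexivity).
  assert (HZ0 : (z ^ K)%C <> RtoC 0) by (apply Cmod_gt_neq0; lra). assert (H1 : (1 - RtoC q * z)%C <> RtoC 0).
  { apply C1m_neq0. rewrite Cmod_mult, Hz, Cmod_R, Rabs_pos_eq; lra. }
  assert (H2 : (z - RtoC q)%C <> RtoC 0).
  { apply Cmod_gt_neq0. generalize (Cmod_minus_ge (RtoC q) z) (Cmod_minus_ge z (RtoC q)).
    rewrite Cmod_R, Rabs_pos_eq, Hz by lra. replace (RtoC q - z)%C with (- (z - RtoC q))%C by alg. rewrite Cmod_opp.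
    lra. }
  generalize (kernel_identity z (z ^ K)%C Hz0 HZ0 H1 H2). rewrite !Cinv_unit by lra.
  assert (Hc : E (Cconj z) (Cconj (z ^ K)) = Cconj (E z (z ^ K))).
  { unfold E, Cdiv. repeat (rewrite ?Cplus_conj, ?Cminus_conj, ?Cmult_conj, ?Cinv_conj).
    1: rewrite !Cconj_R; reflexivity. all: try exact H1; try (intros Eq; injection Eq; lra).
    all: intros Eq; apply H2; replace (z - RtoC q)%C with (- RtoC q * (1 - z * / RtoC q))%C by
      (field; intros Eq'; injection Eq'; lra); rewrite Eq; ring. }
  rewrite Hc. intros I. apply (f_equal Re) in I. rewrite Re_plus, Re_scal in I.
  replace (Re (Cconj (E z (z ^ K)))) with (Re (E z (z ^ K))) in I by est.
  assert (D : ((1 - RtoC q * z) * (1 - RtoC q * Cconj z))%C = RtoC (Cmod (1 - RtoC q * z)%C ^ 2)).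
  { rewrite Cmod2_conj, Cminus_conj, Cmult_conj, !Cconj_R. reflexivity. }
  rewrite D in I. assert (N : (1 - (z ^ K + Cconj (z ^ K)) / 2)%C = RtoC (1 - Re (z ^ K)%C)).
  { replace (z ^ K + Cconj (z ^ K))%C with (RtoC 2 * RtoC (Re (z ^ K)))%C.
    - rewrite RtoC_minus. field.
    - destruct (z ^ K)%C as [x y]. unfold Cconj, Cplus, Cmult, RtoC; simpl. f_equal; ring. }
  rewrite N in I. assert (Hm : 0 < Cmod (1 - RtoC q * z)%C ^ 2) by est. rewrite <- RtoC_mult, <- RtoC_div in I by lra.
  match type of I with _ = 2 * Re (RtoC ?x) => change (Re (RtoC x)) with x in I end.
  assert (Re (z ^ K)%C <= 1) by (rewrite <- HZ; eapply Rle_trans; [apply Rle_abs|apply Re_le_Cmod]).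
  assert (0 <= 2 * Q * (1 - q ^ 2) / (1 - Q) ^ 2 * (1 - Re (z ^ K)%C) / Cmod (1 - RtoC q * z)%C ^ 2).
  { apply Rdiv_le_0_compat; [|exact Hm]. apply Rmult_le_pos; [|lra]. apply Rdiv_le_0_compat; [|nra].
    apply Rmult_le_pos; nra. }
  lra.
Qed.

Let v (k : nat) : R := U k - P k.

(** A difference of two finite geometric sums with ratios $qz$ and $z/q$; the second supplies
    $q^{2K-k}=Q^2q^{-k}$. *)
Lemma kernel_U_sum (t : R) :
  rsum (fun k => U k * cos (INR k * t)) K
  = Re (RtoC (2 / (1 - Q) ^ 2) * ((1 - RtoC Q * cis t ^ K) / (1 - RtoC q * cis t)
     - RtoC (Q ^ 2) * ((1 - cis t ^ K / RtoC Q) / (1 - cis t / RtoC q))))%C - (1 + Q) / (1 - Q).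
Proof.
  generalize Q_range. intros HQ. assert (Hq0 : RtoC q <> RtoC 0) by (intros Eq; injection Eq; lra). set (z := cis t).
  assert (Hz : Cmod z = 1) by apply Cmod_cis.
  assert (A : csum (fun k => ((RtoC q * z) ^ k)%C) K = ((1 - RtoC Q * z ^ K) / (1 - RtoC q * z))%C).
  { rewrite csum_geom.
    - rewrite Cpow_mult_l, <- RtoC_pow. reflexivity.
    - intros Eq. apply (f_equal Cmod) in Eq. rewrite Cmod_mult, Hz, Cmod_R, Rabs_pos_eq, Cmod_1 in Eq; lra. }
  assert (B : csum (fun k => ((z / RtoC q) ^ k)%C) K = ((1 - z ^ K / RtoC Q) / (1 - z / RtoC q))%C).
  { rewrite csum_geom.
    - unfold Cdiv. rewrite Cpow_mult_l, Cpow_inv, <- RtoC_pow by est. reflexivity.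
    - intros Eq. apply (f_equal Cmod) in Eq. rewrite Cmod_div, Hz, Cmod_R, Rabs_pos_eq, Cmod_1 in Eq by est.
      apply (f_equal (fun x => x * q)) in Eq. unfold Rdiv in Eq. rewrite Rmult_assoc, Rinv_l in Eq; lra. }
  rewrite <- A, <- B, <- csum_scal.
  assert (Cm : forall f g n, (csum f n - csum g n)%C = csum (fun k => f k - g k)%C n) by (induction n as [|n IH]; simpl; [ring|rewrite <- IH; ring]).
  rewrite Cm, <- csum_scal, csum_Re. destruct K as [|K'] eqn:EK; [lia|]. rewrite !rsum_shift.
  rewrite (rsum_ext (fun k => U (S k) * cos (INR (S k) * t))
    (fun k => Re (RtoC (2 / (1 - Q) ^ 2) * ((RtoC q * z) ^ S k - RtoC (Q ^ 2) * (z / RtoC q) ^ S k))%C)).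
  - replace (U 0 * cos (INR 0 * t)) with ((1 + Q) / (1 - Q)).
    + simpl Re. field. lra.
    + unfold U. simpl. rewrite Rmult_0_l, cos_0. ring.
  - intros k Hk. unfold U. destruct (Nat.ltb_spec (S k) (S K')); [|lia]. rewrite Re_scal. unfold Cdiv.
    rewrite !Cpow_mult_l, Cpow_inv, <- RtoC_pow by est. unfold z. rewrite cis_pow. assert (Hqk : 0 < q ^ S k) by est.
    rewrite <- RtoC_inv by lra.
    replace (RtoC (q ^ S k) * cis (INR (S k) * t) - RtoC (Q ^ 2) * (cis (INR (S k) * t) * RtoC (/ q ^ S k)))%C
      with (RtoC (q ^ S k - Q ^ 2 * / q ^ S k) * cis (INR (S k) * t))%C by (rewrite RtoC_minus, RtoC_mult; ring).
    rewrite Re_scal. change (Re (cis (INR (S k) * t))) with (cos (INR (S k) * t)).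
    replace (q ^ (2 * S K' - S k)) with (Q ^ 2 * / q ^ S k); [lra|]. unfold Q.
    apply Rmult_eq_reg_r with (q ^ S k); [|lra]. rewrite <- pow_add. rewrite Rmult_assoc, Rinv_l, Rmult_1_r by lra.
    rewrite <- pow_mult. f_equal. lia.
Qed.

Lemma kernel_series (t : R) : is_series (fun k => v k * cos (INR k * t)) (Re (E (cis t) (cis t ^ K))).
Proof.
  set (z := cis t). assert (Hz : Cmod z = 1) by apply Cmod_cis.
  assert (Hqz : Cmod (RtoC q * z)%C < 1) by (rewrite Cmod_mult, Hz, Cmod_R, Rabs_pos_eq; lra).
  assert (SU : is_series (fun k => U k * cos (INR k * t)) (rsum (fun k => U k * cos (INR k * t)) K)).
  { apply Series_finite. intros k Hk. unfold U. destruct (Nat.ltb_spec k K); [lia|ring]. }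
  assert (SP : is_series (fun k => P k * cos (INR k * t)) (Re (RtoC 2 / (1 - RtoC q * z) - 1)%C)).
  { apply is_series_rsum. apply (is_lim_seq_incr_1 _ _).
    apply is_lim_seq_ext with (fun n => Re (RtoC 2 * csum (fun k => (RtoC q * z) ^ k)%C (S n) - 1)%C).
    - induction n as [|n IH].
      + rewrite rsum_S. simpl INR. rewrite (Rmult_0_l t), cos_0. simpl. ring.
      + rewrite rsum_S, <- IH, csum_S.
        replace (RtoC 2 * (csum (fun k => (RtoC q * z) ^ k)%C (S n) + (RtoC q * z) ^ S n) - 1)%C with
          ((RtoC 2 * csum (fun k => (RtoC q * z) ^ k)%C (S n) - 1) + RtoC 2 * (RtoC q * z) ^ S n)%C by alg.
        rewrite (Re_plus (RtoC 2 * csum _ (S n) - 1)%C). rewrite Re_scal. rewrite Cpow_mult_l, <- RtoC_pow, Re_scal.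
        unfold z. rewrite cis_pow. unfold P. change (Re (cis (INR (S n) * t))) with (cos (INR (S n) * t)). ring.
    - apply (is_lim_seq_incr_1 (fun n => Re (RtoC 2 * csum (fun k => (RtoC q * z) ^ k)%C n - 1)%C)). apply Clim_Re.
      apply Clim_plus; [|apply Clim_const]. apply Clim_scal. now apply Clim_geom. }
  assert (Hv := is_series_minus _ _ _ _ SU SP).
  replace (Re (E z (z ^ K))) with (minus (rsum (fun k => U k * cos (INR k * t)) K) (Re (RtoC 2 / (1 - RtoC q * z) -
    1)%C)).
  - apply is_series_ext with (2 := Hv). intros k.
    change (U k * cos (INR k * t) - P k * cos (INR k * t) = (U k - P k) * cos (INR k * t)). ring.
  - rewrite kernel_U_sum. fold z. unfold minus, plus, opp; simpl. ring.
Qed.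

(** Pairing with [U - P] bounds a Poisson average by the first $K$ coefficients only. The gain is in
    the factor $(1+Q)/(1-Q)$ of $\Re a_0$, which exceeds $1$ by no more than the order of $Q$. *)
Theorem kernel_bound (a : nat -> C) :
  abs_summable a -> (forall t, 0 <= Series (fun k => Re (a k * cis (INR k * t))%C)) ->
  Series (fun k => q ^ k * Re (a k)) <=
  (1 + Q) / (1 - Q) * Re (a O) + rsum (fun k => q ^ S k * Cmod (a (S k)) / (1 - Q) ^ 2) (K - 1).
Proof.
  intros Ha HF. generalize Q_range. intros HQ.
  assert (Hqs : ex_series (fun k => q ^ k)) by (apply ex_series_geom_R; lra).
  assert (HPq : forall k, half_weight k * P k = q ^ k) by (intros [|k]; simpl; field).
  assert (HP1 : forall k, Rabs (P k) <= 2 * q ^ k).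
  { intros k. assert (0 < q ^ k) by est. destruct k; rewrite Rabs_pos_eq; simpl in *; lra. }
  assert (Hvs : ex_series (fun k => Rabs (v k))).
  { apply ex_series_Rle with (fun k => Rabs (U k) + 2 * q ^ k).
    - intros k. rewrite Rabs_Rabsolu. via Rabs_triang. rewrite Rabs_Ropp. est.
    - apply (ex_series_plus (fun k => Rabs (U k)) (fun k => 2 * q ^ k)).
      + exists (rsum (fun k => Rabs (U k)) K). apply Series_finite. intros k Hk. unfold U.
        destruct (Nat.ltb_spec k K); [lia|apply Rabs_R0].
      + now apply (ex_series_scal 2 (fun k => q ^ k)). }
  assert (Main : 0 <= Series (fun k => half_weight k * v k * Re (a k))).
  { apply fourier_pos_C; auto. intros t. rewrite (is_series_unique _ _ (kernel_series t)).
    apply kernel_E_nonneg, Cmod_cis. }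
  assert (Sq : ex_series (fun k => q ^ k * Re (a k))).
  { apply ex_series_Rle with (2 := Ha). intros k. rewrite Rabs_mult.
    assert (0 < q ^ k <= 1) by (split; [est|rewrite <- (pow1 k); apply pow_incr; lra]).
    rewrite (Rabs_pos_eq (q ^ k)) by lra. generalize (Re_le_Cmod (a k)) (Rabs_pos (Re (a k))). nra. }
  assert (SU : is_series (fun k => half_weight k * U k * Re (a k)) (rsum (fun k => half_weight k * U k * Re (a k))
    K)).
  { apply Series_finite. intros k Hk. unfold U. destruct (Nat.ltb_spec k K); [lia|ring]. }
  rewrite (Series_ext _ (fun k => half_weight k * U k * Re (a k) - q ^ k * Re (a k))) in Main.
  2:{ intros k. unfold v. rewrite <- HPq. ring. }
  rewrite Series_minus in Main; [|exists (rsum (fun k => half_weight k * U k * Re (a k)) K); exact SU|exact Sq].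
  rewrite (is_series_unique _ _ SU) in Main.
  apply Rle_trans with (rsum (fun k => half_weight k * U k * Re (a k)) K); [lra|].
  replace K with (S (K - 1)) at 1 by lia. rewrite rsum_shift. apply Rplus_le_compat.
  - unfold U. destruct (Nat.ltb_spec 0 K); [|lia]. simpl. lra.
  - apply rsum_le. intros k Hk. unfold U. destruct (Nat.ltb_spec (S k) K); [|lia]. simpl half_weight.
    assert (Hq2 : 0 < q ^ (2 * K - S k) <= q ^ S k).
    { split; [est|]. replace (2 * K - S k)%nat with (S k + (2 * K - S k - S k))%nat by lia. rewrite pow_add.
      rewrite <- (Rmult_1_r (q ^ S k)) at 2. rewrite <- (pow1 (2 * K - S k - S k)). est. }
    replace (1 / 2 * (2 * (q ^ S k - q ^ (2 * K - S k)) / (1 - Q) ^ 2) * Re (a (S k)))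
      with ((q ^ S k - q ^ (2 * K - S k)) * Re (a (S k)) / (1 - Q) ^ 2) by lra.
    apply Rmult_le_compat_r; [est|]. generalize (Re_le_Cmod (a (S k))) (Cmod_ge_0 (a (S k))). intros H1 H2.
    apply Rabs_le_between in H1. apply Rle_trans with ((q ^ S k - q ^ (2 * K - S k)) * Cmod (a (S k))).
    + est.
    + est.
Qed.
End Kernel.

Lemma is_derive_ln_prodz (ws : list C) (x : R) :
  (forall w, In w ws -> Rabs x < Cmod w) ->
  is_derive (fun x => ln (Cmod (prodz ws (- RtoC x)%C))) x (- Re (logder ws (- RtoC x)%C)).
Proof.
  induction ws as [|w ws IH]; intros H.
  - simpl. replace (- 0) with 0 by lra. apply (is_derive_const (ln (Cmod (RtoC 1)))).
  - assert (Hw : Rabs x < Cmod w) by (apply H; now left).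
    assert (Hw0 : w <> RtoC 0) by (apply Cmod_gt_neq0; generalize (Rabs_pos x); lra).
    assert (IH' := IH (fun w' h => H w' (or_intror h))). assert (Hwx : (w + RtoC x)%C <> RtoC 0).
    { apply Cmod_gt_neq0. generalize (Cmod_minus_ge w (- RtoC x)%C). rewrite Cmod_opp, Cmod_R.
      replace (- RtoC x - w)%C with (- (w + RtoC x))%C by alg. rewrite Cmod_opp. lra. }
    assert (D1 : is_derive (fun x => ln (Cmod (1 + RtoC x * / w)%C)) x (Re (/ w / (1 + RtoC x * / w))%C)).
    { apply is_derive_ln_Cmod_line. intros E. apply Hwx.
      replace (w + RtoC x)%C with (w * (1 + RtoC x * / w))%C by alg. rewrite E. ring. }
    apply is_derive_ext_loc with (fun x => ln (Cmod (1 + RtoC x * / w)%C) + ln (Cmod (prodz ws (- RtoC x)%C))).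
    + assert (L : locally x (fun y => forall w', In w' (w :: ws) -> Rabs y < Cmod w')).
      { destruct (list_Cmod_gap (w :: ws) (Rabs x) H) as [rho [G1 G2]].
        exists (mkposreal (rho - Rabs x) ltac:(simpl; lra)). intros y Hy w' Hw'. apply Rlt_le_trans with rho; [|auto].
        unfold ball in Hy; simpl in Hy. unfold AbsRing_ball, abs, minus, plus, opp in Hy; simpl in Hy.
        generalize (Rabs_triang (y + - x) x). replace (y + - x + x)%R with (y : R) by lra. lra. }
      generalize L. apply filter_imp. intros y Hy. destruct (ln_prodz ws (- RtoC y)%C) as [N _].
      { intros w' Hw'. rewrite Cmod_opp, Cmod_R. apply Hy; now right. }
      assert (Hyw : Rabs y < Cmod w) by (apply Hy; now left). simpl prodz. rewrite Cmod_mult, ln_mult.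
      * f_equal. f_equal. f_equal. unfold Cdiv. ring.
      * apply Cmod_gt_0. apply C1m_neq0. rewrite Cmod_div, Cmod_opp, Cmod_R by est.
        apply Rlt_div_l; [generalize (Rabs_pos y); lra|lra].
      * est.
    +
      replace (- Re (logder (w :: ws) (- RtoC x)%C)) with (Re (/ w / (1 + RtoC x * / w))%C + - Re (logder ws (- RtoC
        x)%C)).
      *
        apply (is_derive_plus (fun x => ln (Cmod (1 + RtoC x * / w)%C)) (fun x => ln (Cmod (prodz ws (- RtoC x)%C))));
          auto.
      * simpl logder. rewrite Re_plus. replace (/ (- RtoC x - w))%C with (- (/ w / (1 + RtoC x * / w)))%C; [alg|].
        field. repeat split; auto.
        -- intros E. apply Hwx. replace (w + RtoC x)%C with (- (- RtoC x - w))%C by alg. rewrite E; ring.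
Qed.

Section Growth.
Variables (ws : list C) (R1 B : R) (K : nat).
Hypothesis HR1 : 0 < R1.
Hypothesis HB0 : 0 <= B.
Hypothesis HK : (0 < K)%nat.
Hypothesis Hws : forall w, In w ws -> R1 < Cmod w.
Hypothesis HB : forall z, Cmod z = R1 -> - B <= Re (logder ws z).

(** [kernel_bound] is applied to $B$ plus the real part of [logder] on the circle of radius $R_1$,
    with $q=x/R_1$. The constant $B$ occurs on both sides, and all but $2BQ/(1-Q)$ of it cancels. *)
Lemma logder_upper (x : R) :
  0 < x < R1 ->
  let Q := (x / R1) ^ K in
  Re (logder ws (- RtoC x)%C) <=
  2 * B * Q / (1 - Q) + rsum (fun k => Cmod (psum ws (S k)) * x ^ k) K / (1 - Q) ^ 2.
Proof.
  intros Hx Q. set (q := x / R1). assert (Hq : 0 < q < 1) by (unfold q; split; [est|est]).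
  set (b := fun k => (- psum ws (S k) * (- RtoC R1) ^ k)%C).
  set (a := fun k => match k with O => (RtoC B + b O)%C | _ => b k end). assert (Hb : abs_summable b).
  { destruct (list_Cmod_gap ws R1 Hws) as [rho [G1 G2]].
    apply abs_summable_le with (fun k => INR (length ws) * / rho * (R1 / rho) ^ k).
    - intros k. unfold b. rewrite Cmod_mult, Cmod_opp, Cmod_pow, Cmod_opp, Cmod_R, Rabs_pos_eq by lra.
      eapply Rle_trans; [apply Rmult_le_compat_r; [est|apply psum_bound with (rho := rho); auto; lra]|]. unfold Rdiv.
      rewrite Rpow_mult_distr. simpl pow. est.
    - apply (ex_series_scal (INR (length ws) * / rho) (fun k => (R1 / rho) ^ k)). apply ex_series_geom_R. est. }
  assert (Ha : abs_summable a).
  { apply ex_series_incr_1. apply (ex_series_incr_1 (fun k => Cmod (b k))). exact Hb. }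
  assert (Hser : forall s t : R, 0 <= s <= 1 ->
    Series (fun k => s ^ k * Re (a k * cis (INR k * t))%C) = B + Re (logder ws (- (RtoC (R1 * s) * cis t))%C)).
  { intros s t Hs. set (z := (- (RtoC (R1 * s) * cis t))%C). assert (Hz : Cmod z <= R1).
    { unfold z. rewrite Cmod_opp, Cmod_mult, Cmod_cis, Cmod_R, Rabs_pos_eq by nra. nra. }
    assert (L := logder_series ws z (fun w h => Rle_lt_trans _ _ _ Hz (Hws w h))).
    apply is_series_unique, is_series_rsum, is_lim_seq_incr_1.
    apply is_lim_seq_ext with (fun n => B + Re (csum (fun k => - psum ws (S k) * z ^ k)%C (S n))).
    - intros n. rewrite csum_Re, !rsum_shift.
      assert (E0 : s ^ 0 * Re (a O * cis (INR 0 * t))%C = B + Re (- psum ws 1 * z ^ 0)%C).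
      { rewrite Rmult_0_l, cis_0. unfold a, b. simpl Cpow. rewrite Cmult_1_r, Re_plus. simpl (Re (RtoC B)). ring. }
      rewrite E0, <- Rplus_assoc. f_equal. apply rsum_ext. intros k _. unfold a, b. rewrite <- Re_scal. f_equal.
      unfold z.
      replace (- (RtoC (R1 * s) * cis t))%C with ((- RtoC R1) * (RtoC s * cis t))%C by (rewrite RtoC_mult; ring).
      rewrite !Cpow_mult_l, cis_pow, <- RtoC_pow. ring.
    - apply is_lim_seq_plus'; [apply is_lim_seq_const|].
      apply (is_lim_seq_incr_1 (fun n => Re (csum (fun k => - psum ws (S k) * z ^ k)%C n))). now apply Clim_Re. }
  assert (HF : forall t, 0 <= Series (fun k => Re (a k * cis (INR k * t))%C)).
  { intros t. rewrite (Series_ext _ (fun k => 1 ^ k * Re (a k * cis (INR k * t))%C)) by (intros; rewrite pow1; ring).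
    rewrite Hser by lra. assert (Hz : Cmod (- (RtoC (R1 * 1) * cis t))%C = R1) by (rewrite Cmod_opp, Cmod_mult, Cmod_cis, Cmod_R, Rabs_pos_eq; lra).
    specialize (HB _ Hz). lra. }
  generalize (kernel_bound q K Hq HK a Ha HF). intros Main.
  rewrite (Series_ext _ (fun k => q ^ k * Re (a k * cis (INR k * 0))%C)) in Main.
  2:{ intros k. rewrite Rmult_0_r, cis_0, Cmult_1_r. reflexivity. }
  rewrite Hser in Main by lra. replace (- (RtoC (R1 * q) * cis 0))%C with (- RtoC x)%C in Main.
  2:{ rewrite cis_0, Cmult_1_r. f_equal. f_equal. unfold q. field. lra. }
  change (q ^ K) with Q in Main. assert (HQ : 0 < Q < 1) by (apply Q_range; auto).
  assert (Ha0 : Re (a O) <= B + Cmod (psum ws 1)).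
  { unfold a, b. rewrite Cmult_1_r, Re_plus. simpl (Re (RtoC B)). rewrite Re_opp. generalize (Re_ge_Cmod (psum ws 1)).
    lra. }
  assert (H1 : (1 + Q) / (1 - Q) * Re (a O) <= B + 2 * B * Q / (1 - Q) + Cmod (psum ws 1) / (1 - Q) ^ 2).
  { apply Rle_trans with ((1 + Q) / (1 - Q) * (B + Cmod (psum ws 1))).
    - est.
    - replace (B + 2 * B * Q / (1 - Q)) with ((1 + Q) / (1 - Q) * B) by alg. rewrite Rmult_plus_distr_l.
      apply Rplus_le_compat_l.
      replace (Cmod (psum ws 1) / (1 - Q) ^ 2) with (1 / (1 - Q) ^ 2 * Cmod (psum ws 1)) by lra.
      apply Rmult_le_compat_r; [est|]. replace ((1 + Q) / (1 - Q)) with ((1 - Q ^ 2) / (1 - Q) ^ 2) by alg.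
      apply Rmult_le_compat_r; [est|nra]. }
  assert (H2 : rsum (fun k => q ^ S k * Cmod (a (S k)) / (1 - Q) ^ 2) (K - 1)
    = rsum (fun k => Cmod (psum ws (S (S k))) * x ^ S k) (K - 1) / (1 - Q) ^ 2).
  { unfold Rdiv. rewrite (Rmult_comm (rsum _ _)), <- rsum_scal. apply rsum_ext. intros k _. unfold a, b.
    rewrite Cmod_mult, Cmod_opp, Cmod_pow, Cmod_opp, Cmod_R, Rabs_pos_eq by lra. unfold q.
    replace (x ^ S k) with ((x / R1) ^ S k * R1 ^ S k); [ring|]. rewrite <- Rpow_mult_distr. f_equal. field. lra. }
  replace (rsum (fun k => Cmod (psum ws (S k)) * x ^ k) K) with
    (Cmod (psum ws 1) + rsum (fun k => Cmod (psum ws (S (S k))) * x ^ S k) (K - 1)).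
  2:{ replace K with (S (K - 1)) at 2 by lia. rewrite rsum_shift. ring. }
  lra.
Qed.

(** The integral of [logder_upper] over $[0,r_0]$, in the form that $-\log|p(-x)|-G(x)$ decreases,
    where $p$ is the product over [ws] and [G] an explicit primitive. The denominators are frozen at
    the end point, where $Q$ is largest. *)
Theorem log_growth (r0 : R) :
  0 < r0 < R1 ->
  let Q := (r0 / R1) ^ K in
  - ln (Cmod (prodz ws (- RtoC r0)%C)) <=
  2 * B * R1 * (r0 / R1) ^ S K / (INR (S K) * (1 - Q))
  + rsum (fun k => Cmod (psum ws (S k)) * (r0 ^ S k / INR (S k))) K / (1 - Q) ^ 2.
Proof.
  intros Hr Q. assert (HQ : 0 < Q < 1).
  { apply Q_range; auto. est. }
  set (G := fun x => 2 * B / (R1 ^ K * (1 - Q)) * (x ^ S K / INR (S K))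
    + / (1 - Q) ^ 2 * rsum (fun k => Cmod (psum ws (S k)) * (x ^ S k / INR (S k))) K).
  set (dG := fun x => 2 * B / (R1 ^ K * (1 - Q)) * x ^ K
    + / (1 - Q) ^ 2 * rsum (fun k => Cmod (psum ws (S k)) * x ^ k) K).
  assert (Dp : forall k x, is_derive (fun x => x ^ S k / INR (S k)) x (x ^ k)).
  { intros k x. assert (INR (S k) <> 0) by est. auto_derive; [exact I|]. field. auto. }
  assert (DG : forall x, is_derive G x (dG x)).
  { intros x.
    apply (is_derive_plus (fun x => 2 * B / (R1 ^ K * (1 - Q)) * (x ^ S K / INR (S K)))
      (fun x => / (1 - Q) ^ 2 * rsum (fun k => Cmod (psum ws (S k)) * (x ^ S k / INR (S k))) K)).
    - apply (is_derive_scal (fun x => x ^ S K / INR (S K))). est.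
    - apply (is_derive_scal (fun x => rsum (fun k => Cmod (psum ws (S k)) * (x ^ S k / INR (S k))) K)). generalize K.
      intros n. induction n as [|n IH].
      + apply (is_derive_const 0).
      + apply (is_derive_plus (fun x => rsum (fun k => Cmod (psum ws (S k)) * (x ^ S k / INR (S k))) n)
          (fun x => Cmod (psum ws (S n)) * (x ^ S n / INR (S n)))); [exact IH|].
        apply (is_derive_scal (fun x => x ^ S n / INR (S n))). est. }
  set (H := fun x => - ln (Cmod (prodz ws (- RtoC x)%C)) - G x).
  assert (DH : forall x, 0 <= x <= r0 -> is_derive H x (Re (logder ws (- RtoC x)%C) - dG x)).
  { intros x Hx. apply (is_derive_minus (fun x => - ln (Cmod (prodz ws (- RtoC x)%C))) G); [|est].
    rewrite <- (Ropp_involutive (Re _)). apply (is_derive_opp (fun x => ln (Cmod (prodz ws (- RtoC x)%C)))).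
    apply is_derive_ln_prodz. intros w Hw. rewrite Rabs_pos_eq by lra. specialize (Hws w Hw). lra. }
  assert (H0 : H 0 = 0).
  { unfold H, G. replace (- RtoC 0)%C with (RtoC 0) by alg. assert (E : prodz ws (RtoC 0) = RtoC 1).
    { clear. induction ws as [|w l IH]; simpl; [reflexivity|]. rewrite IH. unfold Cdiv. ring. }
    rewrite E, Cmod_1, ln_1. rewrite (rsum_ext _ (fun _ => 0)).
    - rewrite rsum_const, (pow_i (S K)) by lia. est.
    - intros k _. rewrite pow_i by lia. est. }
  assert (Hle : H r0 <= H 0).
  { destruct (MVT_cor2 H (fun x => Re (logder ws (- RtoC x)%C) - dG x) 0 r0) as [c [E Hc]].
    - lra.
    - intros c Hc. apply is_derive_Reals. est.
    - assert (Re (logder ws (- RtoC c)%C) - dG c <= 0); [|nra]. generalize (logder_upper c ltac:(lra)).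
      set (Qc := (c / R1) ^ K). assert (HQc : 0 < Qc <= Q).
      { unfold Qc, Q. split.
        - est.
        - est. }
      assert (H1 : 2 * B * Qc / (1 - Qc) <= 2 * B / (R1 ^ K * (1 - Q)) * c ^ K).
      { assert (0 < R1 ^ K) by est. replace (2 * B / (R1 ^ K * (1 - Q)) * c ^ K) with (2 * B * Qc / (1 - Q)).
        - est.
        - unfold Qc, Rdiv. rewrite Rpow_mult_distr, pow_inv. field. lra. }
      assert (H2 : rsum (fun k => Cmod (psum ws (S k)) * c ^ k) K / (1 - Qc) ^ 2
        <= / (1 - Q) ^ 2 * rsum (fun k => Cmod (psum ws (S k)) * c ^ k) K).
      { unfold Rdiv. rewrite Rmult_comm. apply Rmult_le_compat_r.
        - est.
        - est. }
      unfold dG. lra. }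
  rewrite H0 in Hle. unfold H, G in Hle.
  replace (2 * B * R1 * (r0 / R1) ^ S K / (INR (S K) * (1 - Q))) with (2 * B / (R1 ^ K * (1 - Q)) * (r0 ^ S K / INR (S
    K))).
  - lra.
  - unfold Rdiv at 4. rewrite Rpow_mult_distr, pow_inv. simpl (R1 ^ S K). field. est.
Qed.
End Growth.

(** * Factorization of complex polynomials *)

(** Coefficients of [prodz ws]: the elementary symmetric functions, with signs, of the reciprocals
    of the zeros. *)
Fixpoint ecoef (ws : list C) (k : nat) : C :=
  match ws with
  | nil => match k with O => RtoC 1 | _ => RtoC 0 end
  | w :: l => (ecoef l k - match k with O => RtoC 0 | S j => ecoef l j / w end)%C
  end.

Lemma ecoef_0 ws : ecoef ws 0 = RtoC 1.
Proof. induction ws as [|w l IH]; simpl; [reflexivity|rewrite IH; ring]. Qed.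

Lemma ecoef_large ws k : (length ws < k)%nat -> ecoef ws k = RtoC 0.
Proof.
  revert k. induction ws as [|w l IH]; intros k Hk; simpl in *.
  - destruct k; [lia|reflexivity].
  - destruct k; [lia|]. rewrite !IH by lia. unfold Cdiv. ring.
Qed.

Lemma csum_zero_tail (f : nat -> C) n m :
  (n <= m)%nat -> (forall k, (n <= k)%nat -> f k = RtoC 0) -> csum f m = csum f n.
Proof. intros H Hf. induction H as [|m H IH]; [reflexivity|]. rewrite csum_S, IH, Hf by lia. ring. Qed.

Lemma ecoef_prodz ws z n :
  (length ws <= n)%nat -> csum (fun k => ecoef ws k * z ^ k)%C (S n) = prodz ws z.
Proof.
  revert n. induction ws as [|w l IH]; intros n Hn.
  - rewrite (csum_zero_tail _ 1); [alg|lia|]. intros [|k] Hk; [lia|]. simpl; ring.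
  - simpl in Hn. simpl prodz. rewrite <- (IH n) by lia.
    transitivity (csum (fun k => ecoef l k * z ^ k)%C (S n) - z / w * csum (fun k => ecoef l k * z ^ k)%C n)%C.
    + rewrite <- csum_scal. clear IH Hn. induction n as [|n IHn].
      * simpl. ring.
      * rewrite csum_S, IHn, (csum_S _ (S n)), (csum_S (fun k => z / w * _)%C n).
        change (ecoef (w :: l) (S n)) with (ecoef l (S n) - ecoef l n / w)%C. rewrite Cpow_S. unfold Cdiv. ring.
    + replace (csum (fun k => ecoef l k * z ^ k)%C n) with (csum (fun k => ecoef l k * z ^ k)%C (S n)); [ring|].
      apply csum_zero_tail; [lia|]. intros k Hk. rewrite ecoef_large by lia. ring.
Qed.

(** Newton's identities, that is, the coefficients of $f\cdot(-f'/f)=-f'$ for the product $f$. By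
    induction on the list: the terms with powers of the new $1/w$ telescope. *)
Lemma newton_identity ws k :
  (forall w, In w ws -> w <> RtoC 0) ->
  csum (fun i => ecoef ws i * psum ws (k + 1 - i))%C (S k) = (- (INR (S k)) * ecoef ws (S k))%C.
Proof.
  revert k. induction ws as [|w l IH]; intros k H.
  - rewrite (csum_ext _ (fun i => RtoC 0 * RtoC 0)%C) by alg. rewrite csum_scal. simpl; ring.
  - assert (IH' := fun k => IH k (fun w' h => H w' (or_intror h))). set (e := ecoef l) in *. set (p := psum l) in *.
    assert (E1 : forall n, (n <= S k)%nat -> csum (fun i => ecoef (w :: l) i * psum (w :: l) (k + 1 - i))%C n =
      (csum (fun i => e i * p (k + 1 - i)%nat)%C n - / w * csum (fun i => e i * p (k - i)%nat)%C (n - 1)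
       + match n with O => RtoC 0 | S j => e j * (/ w) ^ (k + 1 - j) end)%C).
    { induction n as [|n IHn]; intros Hn; [alg|]. rewrite csum_S, IHn by lia.
      change (psum (w :: l) (k + 1 - n)) with ((/ w) ^ (k + 1 - n) + p (k + 1 - n)%nat)%C. destruct n as [|n].
      - change (ecoef (w :: l) 0) with (e O - 0)%C. simpl csum. ring.
      - change (ecoef (w :: l) (S n)) with (e (S n) - e n / w)%C. replace (S (S n) - 1)%nat with (S n) by lia.
        replace (S n - 1)%nat with n by lia. rewrite (csum_S _ (S n)), (csum_S (fun i => e i * p (k - i)%nat)%C n).
        replace (k + 1 - S n)%nat with (k - n)%nat by lia. replace (k + 1 - n)%nat with (S (k - n))%nat by lia.
        rewrite Cpow_S. unfold Cdiv. ring. }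
    rewrite E1 by lia. replace (S k - 1)%nat with k by lia. rewrite IH'. replace (k + 1 - k)%nat with 1%nat by lia.
    change (ecoef (w :: l) (S k)) with (e (S k) - e k / w)%C.
    assert (E2 : csum (fun i => e i * p (k - i)%nat)%C k = (- INR k * e k)%C).
    { destruct k as [|k]; [alg|]. rewrite <- IH'. apply csum_ext. intros i Hi. f_equal. f_equal. lia. }
    rewrite E2. rewrite S_INR, RtoC_plus. unfold Cdiv. ring.
Qed.

Module Factorization.
From mathcomp Require Import ssreflect ssrbool eqtype ssrnat seq bigop ssralg poly complex Rstruct.
Import GRing.Theory.

Ltac cring := match goal with |- ?a = ?b => change (@eq C a b) end; ring.

Definition toC (x : R[i]%R) : C := match x with Complex a b => (a, b) end.
Definition ofC (z : C) : R[i]%R := Complex (fst z) (snd z).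

Arguments toC : simpl never.
Arguments RtoC : simpl never.

Lemma toC_ofC z : toC (ofC z) = z.
Proof. by case: z. Qed.

Lemma toC_mul x y : toC (x * y)%R = Cmult (toC x) (toC y).
Proof. by case: x y => [a b] [c d]. Qed.

Lemma toC_sub x y : toC (x - y)%R = Cminus (toC x) (toC y).
Proof. by case: x y => [a b] [c d]. Qed.

Lemma toC_opp x : toC (- x)%R = Copp (toC x).
Proof. by case: x => [a b]. Qed.

Lemma toC_0 : toC 0%R = RtoC R0.
Proof. est. Qed.
Lemma toC_1 : toC 1%R = RtoC R1.
Proof. est. Qed.

Lemma prod_coef (r : seq R[i]%R) k :
  (forall w, In w (map toC r) -> w <> RtoC R0) ->
  toC ((\prod_(z <- r) ('X - z%:P))`_k)%R =
  Cmult (toC (\prod_(z <- r) (- z))%R) (ecoef (map toC r) k).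
Proof.
  elim: r k => [|z r IH] k H. rewrite !big_nil coef1 toC_1. case: k => [|k]; rewrite /= ?toC_1 ?toC_0; cring.
  have Hz : toC z <> RtoC R0 by apply: H; left.
  have H' : forall w, In w (map toC r) -> w <> RtoC R0 by move=> w Hw; apply: H; right.
  rewrite !big_cons mulrBl coefB coefXM coefCM toC_sub !toC_mul toC_opp. rewrite (IH k H') /=. case: k => [|k] /=.
  rewrite toC_0; cring. rewrite (IH k H'). by alg.
Qed.

(** Stated through coefficients because the one of index $N$ may vanish, so the number of zeros is
    left open. The nonzero constant term excludes the root $0$ and permits factors of the form
    $1-z/w$. *)
Theorem poly_factor (a : nat -> C) (N : nat) :
  a O <> RtoC R0 ->
  exists ws : list C, (forall w, In w ws -> w <> RtoC R0) /\
    forall k, (if Nat.leb k N then a k else RtoC R0) = Cmult (a O) (ecoef ws k).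
Proof.
  move=> Ha. set p : {poly R[i]} := (\poly_(i < N.+1) ofC (a i))%R. have [r Hr] := closed_field_poly_normal p.
  have Hc k : toC (p`_k)%R = if Nat.leb k N then a k else RtoC R0. rewrite coef_poly.
  have -> : (k < N.+1)%N = Nat.leb k N. by apply/idP/idP => H; [apply/Nat.leb_le/leP|apply/leP; apply/Nat.leb_le].
  by case: (Nat.leb k N); rewrite ?toC_ofC. have Hroots : forall w, In w (map toC r) -> w <> RtoC R0. move=> w Hw E.
  have H0 : (0%R : R[i]%R) \in r. elim: r {Hr} Hw => [|z r IH] //= [Hz|Hw]; rewrite in_cons.
  apply/orP; left; apply/eqP. case: z Hz => [x y] /= Hz. rewrite E in Hz. by case: Hz => -> ->.
  by apply/orP; right; apply: IH. have : (p.[0])%R = 0%R. rewrite Hr hornerZ.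
  have -> : ((\prod_(z <- r) ('X - z%:P)).[0])%R = 0%R; last by rewrite mulr0.
  by apply/rootP; rewrite root_prod_XsubC. rewrite horner_coef0 => P0. apply: Ha. move: (Hc O) => /= <-.
  by rewrite P0. exists (map toC r); split => // k.
  have Hk j : toC (p`_j)%R = Cmult (Cmult (toC (lead_coef p)) (toC (\prod_(z <- r) (- z))%R)) (ecoef (map toC r) j).
  rewrite {1}Hr coefZ toC_mul prod_coef //. by rewrite Cmult_assoc. rewrite -Hc Hk.
  by move: (Hk O); rewrite Hc ecoef_0 Cmult_1_r /= => <-.
Qed.
End Factorization.

(** * The function (s - 1) zeta(s) *)

Lemma cpow_neg_cis (x : R) (s : C) : cpow_neg x s = (RtoC (Rpower x (- Re s)) * cis (- (Im s * ln x)))%C.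
Proof. unfold cpow_neg, cis. rewrite cos_neg, sin_neg. unfold RtoC, Cmult; simpl. f_equal; ring. Qed.

Lemma Rpower_pos (x y : R) : 0 < Rpower x y.
Proof. est. Qed.

Lemma Cmod_cpow_neg (x : R) (s : C) : Cmod (cpow_neg x s) = Rpower x (- Re s).
Proof. rewrite cpow_neg_cis, Cmod_mult, Cmod_cis, Cmod_R, Rabs_pos_eq; [ring|est]. Qed.

Lemma cpow_neg_plus (x : R) (s s' : C) : cpow_neg x (s + s')%C = (cpow_neg x s * cpow_neg x s')%C.
Proof.
  rewrite !cpow_neg_cis. replace (Re (s + s')%C) with (Re s + Re s') by est.
  replace (Im (s + s')%C) with (Im s + Im s') by est.
  rewrite Ropp_plus_distr, Rpower_plus, Rmult_plus_distr_r, Ropp_plus_distr, cis_plus, RtoC_mult. ring.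
Qed.

Lemma cpow_neg_mult (x y : R) (s : C) :
  0 < x -> 0 < y -> cpow_neg (x * y) s = (cpow_neg x s * cpow_neg y s)%C.
Proof.
  intros Hx Hy. rewrite !cpow_neg_cis, ln_mult by lra. rewrite Rmult_plus_distr_l, Ropp_plus_distr, cis_plus.
  rewrite <- Rpower_mult_distr by lra. rewrite RtoC_mult. ring.
Qed.

Lemma cpow_neg_1 (s : C) : cpow_neg 1 s = RtoC 1.
Proof. rewrite cpow_neg_cis, ln_1, Rmult_0_r, Ropp_0, cis_0. unfold Rpower. rewrite ln_1, Rmult_0_r, exp_0. ring. Qed.

Lemma cpow_neg_0 (x : R) : cpow_neg x (RtoC 0) = RtoC 1.
Proof.
  rewrite cpow_neg_cis. simpl. rewrite Rmult_0_l, Ropp_0, cis_0. unfold Rpower. rewrite Rmult_0_l, exp_0. ring.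
Qed.

Lemma cpow_neg_minus1 (x : R) (s : C) : 0 < x -> cpow_neg x (s - 1)%C = (RtoC x * cpow_neg x s)%C.
Proof.
  intros Hx. unfold Cminus. rewrite cpow_neg_plus, Cmult_comm. rewrite cpow_neg_cis. simpl.
  replace (- 0 * ln x) with 0 by lra. rewrite Ropp_0, cis_0. replace (- - (1)) with 1 by lra. rewrite Rpower_1 by lra.
  ring.
Qed.

Lemma is_derive_Rpower (x a : R) : 0 < x -> is_derive (fun x => Rpower x a) x (a * Rpower x (a - 1)).
Proof. intros Hx. apply is_derive_Reals. now apply derivable_pt_lim_power. Qed.

Lemma is_derive_cpow_Re (x : R) (s : C) :
  0 < x -> is_derive (fun x => Re (cpow_neg x s)) x (Re (- s * cpow_neg x (s + 1))%C).
Proof.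
  intros Hx. destruct s as [a b]. simpl. replace (- (a + 1)) with (- a - 1) by lra. replace (b + 0) with b by lra.
  replace (- a * (Rpower x (- a - 1) * cos (b * ln x)) - - b * - (Rpower x (- a - 1) * sin (b * ln x)))
    with (- a * Rpower x (- a - 1) * cos (b * ln x) + Rpower x (- a) * (- sin (b * ln x) * (b * / x))).
  - apply (is_derive_mult (fun x => Rpower x (- a)) (fun x => cos (b * ln x))).
    + now apply is_derive_Rpower.
    + auto_derive; [exact Hx|]. ring.
    + intros; apply Rmult_comm.
  - replace (Rpower x (- a)) with (x * Rpower x (- a - 1)).
    + field. lra.
    + rewrite <- (Rpower_1 x) at 1 by lra. rewrite <- Rpower_plus. f_equal. ring.
Qed.

Lemma is_derive_cpow_Im (x : R) (s : C) :
  0 < x -> is_derive (fun x => Im (cpow_neg x s)) x (Im (- s * cpow_neg x (s + 1))%C).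
Proof.
  intros Hx. destruct s as [a b]. simpl. replace (- (a + 1)) with (- a - 1) by lra. replace (b + 0) with b by lra.
  replace (- a * - (Rpower x (- a - 1) * sin (b * ln x)) + - b * (Rpower x (- a - 1) * cos (b * ln x)))
    with (- (- a * Rpower x (- a - 1) * sin (b * ln x) + Rpower x (- a) * (cos (b * ln x) * (b * / x)))).
  - apply (is_derive_opp (fun x => Rpower x (- a) * sin (b * ln x))).
    apply (is_derive_mult (fun x => Rpower x (- a)) (fun x => sin (b * ln x))).
    + now apply is_derive_Rpower.
    + auto_derive; [exact Hx|]. ring.
    + intros; apply Rmult_comm.
  - replace (Rpower x (- a)) with (x * Rpower x (- a - 1)).
    + field. lra.
    + rewrite <- (Rpower_1 x) at 1 by lra. rewrite <- Rpower_plus. f_equal. ring.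
Qed.

Lemma MVT_bound (u du : R -> R) (a b M : R) :
  a <= b -> (forall x, a <= x <= b -> is_derive u x (du x)) ->
  (forall x, a <= x <= b -> Rabs (du x) <= M) -> Rabs (u b - u a) <= M * (b - a).
Proof.
  intros Hab Hd HM. destruct (Req_dec a b) as [->|Hn].
  { est. }
  destruct (MVT_cor2 u du a b) as [c [E Hc]]; [lra| |].
  - intros c Hc. now apply is_derive_Reals, Hd.
  - rewrite E, Rabs_mult, (Rabs_pos_eq (b - a)) by lra. apply Rmult_le_compat_r; [lra|]. apply HM. lra.
Qed.

Lemma taylor1_bound (u du ddu : R -> R) (a M : R) :
  (forall x, a <= x <= a + 1 -> is_derive u x (du x)) ->
  (forall x, a <= x <= a + 1 -> is_derive du x (ddu x)) ->
  (forall x, a <= x <= a + 1 -> Rabs (ddu x) <= M) ->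
  Rabs (u (a + 1) - u a - du a) <= M.
Proof.
  intros H1 H2 HM. assert (B : forall x, a <= x <= a + 1 -> Rabs (du x - du a) <= M).
  { intros x Hx. apply Rle_trans with (M * (x - a)).
    - apply MVT_bound with ddu; [lra| |]; intros; [apply H2|apply HM]; lra.
    - assert (0 <= M) by (eapply Rle_trans; [apply Rabs_pos|apply (HM a); lra]). nra. }
  replace (u (a + 1) - u a - du a) with ((u (a + 1) - (a + 1) * du a) - (u a - a * du a)) by lra.
  replace M with (M * (a + 1 - a)) by lra.
  apply (MVT_bound (fun x => u x - x * du a) (fun x => du x - du a)); [lra| |exact B]. intros x Hx.
  apply (is_derive_minus u (fun x => x * du a)); [now apply H1|]. auto_derive; [exact I|ring].
Qed.

Lemma Rpower_le_base (x y a : R) : 0 < x <= y -> a <= 0 -> Rpower y a <= Rpower x a.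
Proof.
  intros Hxy Ha. unfold Rpower. assert (ln x <= ln y) by est.
  destruct (Req_dec (a * ln y) (a * ln x)) as [->|Hn]; [lra|]. apply Rlt_le, exp_increasing. nra.
Qed.

(** With $m=n+1$, this is $s-1$ times the difference of $m^{-s}$ and $\int_m^{m+1}y^{-s}\,dy$; the
    last two terms are the integral in closed form. *)
Definition bterm (n : nat) (s : C) : C :=
  ((s - 1) * cpow_neg (INR n + 1) s - cpow_neg (INR n + 1) (s - 1) + cpow_neg (INR n + 2) (s - 1))%C.

(** The expression is a first-order Taylor remainder of $y^{1-s}$ between $a$ and $a+1$, hence
    controlled by the second derivative. The factor $2$ comes from treating real and imaginary parts
    separately. *)
Lemma cpow_taylor_bound (a : R) (s : C) :
  1 <= a -> - 1 <= Re s ->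
  Cmod ((s - 1) * cpow_neg a s - cpow_neg a (s - 1) + cpow_neg (a + 1) (s - 1))%C
  <= 2 * (Cmod s * Cmod (s - 1)%C * Rpower a (- Re s - 1)).
Proof.
  intros Ha Hs. set (M := Cmod s * Cmod (s - 1)%C * Rpower a (- Re s - 1)).
  assert (E1 : forall x, (- (s - 1) * cpow_neg x (s - 1 + 1))%C = (- (s - 1) * cpow_neg x s)%C).
  { intros. do 2 f_equal. ring. }
  assert (HM : forall x, a <= x -> Cmod (- (s - 1) * (- s * cpow_neg x (s + 1)))%C <= M).
  { intros x Hx. rewrite !Cmod_mult, !Cmod_opp, Cmod_cpow_neg. unfold M.
    replace (- Re (s + 1)%C) with (- Re s - 1) by (rewrite Re_plus; simpl; ring).
    rewrite (Rmult_comm (Cmod s) (Cmod (s - 1))), Rmult_assoc. apply Rmult_le_compat_l; [est|].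
    apply Rmult_le_compat_l; [est|]. apply Rpower_le_base; lra. }
  assert (R1 : Rabs (Re (cpow_neg (a + 1) (s - 1)) - Re (cpow_neg a (s - 1)) - Re (- (s - 1) * cpow_neg a s)%C) <= M).
  { apply (taylor1_bound (fun x => Re (cpow_neg x (s - 1))) (fun x => Re (- (s - 1) * cpow_neg x s)%C)
      (fun x => Re (- (s - 1) * (- s * cpow_neg x (s + 1)))%C)).
    - intros x Hx. rewrite <- E1. apply is_derive_cpow_Re. lra.
    - intros x Hx. assert (D1 := is_derive_cpow_Re x s ltac:(lra)). assert (D2 := is_derive_cpow_Im x s ltac:(lra)).
      set (k := (- (s - 1))%C).
      apply is_derive_ext with (fun x => Re k * Re (cpow_neg x s) - Im k * Im (cpow_neg x s)).
      { est. }
      apply (is_derive_minus (fun x => Re k * Re (cpow_neg x s)) (fun x => Im k * Im (cpow_neg x s))).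
      + now apply (is_derive_scal (fun x => Re (cpow_neg x s))).
      + now apply (is_derive_scal (fun x => Im (cpow_neg x s))).
    - intros x Hx. eapply Rle_trans; [apply Re_le_Cmod|apply HM; lra]. }
  assert (R2 : Rabs (Im (cpow_neg (a + 1) (s - 1)) - Im (cpow_neg a (s - 1)) - Im (- (s - 1) * cpow_neg a s)%C) <= M).
  { apply (taylor1_bound (fun x => Im (cpow_neg x (s - 1))) (fun x => Im (- (s - 1) * cpow_neg x s)%C)
      (fun x => Im (- (s - 1) * (- s * cpow_neg x (s + 1)))%C)).
    - intros x Hx. rewrite <- E1. apply is_derive_cpow_Im. lra.
    - intros x Hx. assert (D1 := is_derive_cpow_Re x s ltac:(lra)). assert (D2 := is_derive_cpow_Im x s ltac:(lra)).
      set (k := (- (s - 1))%C).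
      apply is_derive_ext with (fun x => Re k * Im (cpow_neg x s) + Im k * Re (cpow_neg x s)).
      { est. }
      apply (is_derive_plus (fun x => Re k * Im (cpow_neg x s)) (fun x => Im k * Re (cpow_neg x s))).
      + now apply (is_derive_scal (fun x => Im (cpow_neg x s))).
      + now apply (is_derive_scal (fun x => Re (cpow_neg x s))).
    - intros x Hx. eapply Rle_trans; [apply Im_le_Cmod|apply HM; lra]. }
  via Cmod_le_Re_Im. replace (2 * M) with (M + M) by lra. apply Rplus_le_compat.
  - eapply Rle_trans; [|exact R1]. right. f_equal.
    replace ((s - 1) * cpow_neg a s)%C with (- (- (s - 1) * cpow_neg a s))%C by alg.
    rewrite Re_plus, Re_minus, Re_opp. ring.
  - eapply Rle_trans; [|exact R2]. right. f_equal. simpl. ring.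
Qed.

Lemma bterm_bound (n : nat) (s : C) :
  - 1 <= Re s -> Cmod (bterm n s) <= 2 * (Cmod s * Cmod (s - 1)%C * Rpower (INR n + 1) (- Re s - 1)).
Proof.
  intros Hs. unfold bterm. replace (INR n + 2) with (INR n + 1 + 1) by lra.
  apply cpow_taylor_bound; [generalize (pos_INR n); lra|exact Hs].
Qed.

Lemma pseries_partial (a : R) n :
  0 < a -> rsum (fun k => Rpower (INR k + 1) (- a - 1)) n <= 1 + / a.
Proof.
  intros Ha. assert (St : forall y, 1 <= y -> a * Rpower (y + 1) (- a - 1) <= Rpower y (- a) - Rpower (y + 1) (- a)).
  { intros y Hy.
    destruct (MVT_cor2 (fun x => Rpower x (- a)) (fun x => - a * Rpower x (- a - 1)) y (y + 1)) as [c [E Hc]].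
    - lra.
    - intros c Hc. apply derivable_pt_lim_power. lra.
    - assert (Rpower (y + 1) (- a - 1) <= Rpower c (- a - 1)) by (apply Rpower_le_base; lra). nra. }
  assert (P1 : forall b, Rpower 1 b = 1) by (intros; unfold Rpower; rewrite ln_1, Rmult_0_r; apply exp_0).
  assert (B : forall m, a * rsum (fun k => Rpower (INR k + 1) (- a - 1)) (S m) <= a + 1 - Rpower (INR m + 1) (- a)).
  { induction m as [|m IH].
    - simpl. rewrite !Rplus_0_l, !P1. lra.
    - rewrite rsum_S, Rmult_plus_distr_l. rewrite (S_INR m).
      generalize (St (INR m + 1) ltac:(generalize (pos_INR m); lra)). lra. }
  destruct n as [|n]; [simpl; generalize (Rinv_0_lt_compat a Ha); lra|]. apply Rmult_le_reg_l with a; [exact Ha|].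
  replace (a * (1 + / a)) with (a + 1) by alg. generalize (B n) (Rpower_pos (INR n + 1) (- a)). lra.
Qed.

Lemma pseries_ex (a : R) : 0 < a ->
  ex_series (fun k => Rpower (INR k + 1) (- a - 1)) /\ Series (fun k => Rpower (INR k + 1) (- a - 1)) <= 1 + / a.
Proof. intros Ha. apply ex_series_bounded; [est|]. intros n. now apply pseries_partial. Qed.

(* [fz s = (s - 1) zeta s], in the form of a series convergent for [0 < Re s]. *)
Definition fz (s : C) : C := (1 + CSeries (fun n => bterm n s))%C.

Lemma bterm_summable (s : C) : 0 < Re s -> abs_summable (fun n => bterm n s).
Proof.
  intros Hs. apply abs_summable_le with (fun n => 2 * (Cmod s * Cmod (s - 1)%C) * Rpower (INR n + 1) (- Re s - 1)).
  - intros n. eapply Rle_trans; [apply bterm_bound; lra|]. est.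
  - apply (ex_series_scal (2 * (Cmod s * Cmod (s - 1)%C)) (fun n => Rpower (INR n + 1) (- Re s - 1))).
    now apply pseries_ex.
Qed.

Lemma fz_bound (s : C) : 0 < Re s -> Cmod (fz s) <= 1 + 2 * (Cmod s * Cmod (s - 1)%C) * (1 + / Re s).
Proof.
  intros Hs. via Cmod_triangle. rewrite Cmod_1. apply Rplus_le_compat_l.
  eapply Rle_trans; [apply CSeries_Cmod; now apply bterm_summable|]. destruct (pseries_ex (Re s) Hs) as [E1 E2].
  apply Rle_trans with (Series (fun n => 2 * (Cmod s * Cmod (s - 1)%C) * Rpower (INR n + 1) (- Re s - 1))).
  - apply Series_le.
    + split; [est|]. eapply Rle_trans; [apply bterm_bound; lra|]. est.
    + now apply (ex_series_scal (2 * (Cmod s * Cmod (s - 1)%C)) (fun n => Rpower (INR n + 1) (- Re s - 1))).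
  - rewrite Series_scal_l. est.
Qed.

Lemma fz_1 : fz (RtoC 1) = RtoC 1.
Proof.
  unfold fz. rewrite (CSeries_unique _ (RtoC 0)); [ring|]. eapply Clim_ext; [|apply Clim_const]. intros n.
  rewrite (csum_ext _ (fun _ => RtoC 0 * RtoC 0)%C).
  - rewrite csum_scal. ring.
  - intros k _. unfold bterm. replace (1 - 1)%C with (RtoC 0) by alg. rewrite !cpow_neg_0. ring.
Qed.

Lemma INR1_ge n : 1 <= INR n + 1.
Proof. generalize (pos_INR n). lra. Qed.

Lemma INR1_pos n : 0 < INR n + 1.
Proof. est. Qed.

Definition zpart (s : C) (N : nat) : C := csum (fun n => cpow_neg (INR n + 1) s) N.

Lemma zpart_bterm (s : C) N :
  (csum (fun n => bterm n s) N + 1 = (s - 1) * zpart s N + cpow_neg (INR N + 1) (s - 1))%C.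
Proof.
  unfold zpart. induction N as [|N IH].
  - simpl. rewrite !Rplus_0_l, cpow_neg_1. ring.
  - rewrite !csum_S.
    replace (csum (fun n => bterm n s) N + bterm N s + 1)%C with
      ((csum (fun n => bterm n s) N + 1) + bterm N s)%C by alg.
    rewrite IH. unfold bterm. rewrite S_INR. replace (INR N + 1 + 1) with (INR N + 2) by lra. ring.
Qed.

Lemma zpart_lim (s : C) :
  0 < Re s -> Clim (fun N => (s - 1) * zpart s N + cpow_neg (INR N + 1) (s - 1))%C (fz s).
Proof.
  intros Hs. eapply Clim_ext; [intros N; apply zpart_bterm|]. unfold fz. rewrite Cplus_comm.
  apply Clim_plus; [|apply Clim_const]. apply csum_Clim. now apply bterm_summable.
Qed.

Lemma is_lim_seq_Rpower_neg (a : R) : 0 < a -> is_lim_seq (fun n => Rpower (INR n + 1) (- a)) 0.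
Proof.
  intros Ha. apply (is_lim_comp_seq exp (fun n => - a * ln (INR n + 1)) m_infty 0 is_lim_exp_m).
  - exists O. discriminate.
  - replace m_infty with (Rbar_mult (- a) p_infty).
    + apply (is_lim_seq_scal_l (fun n => ln (INR n + 1)) (- a) p_infty).
      apply (is_lim_comp_seq ln (fun n => INR n + 1) p_infty p_infty is_lim_ln_p).
      * exists O. discriminate.
      * apply (is_lim_seq_ext (fun n => INR (S n))); [intros; apply S_INR|]. apply (is_lim_seq_incr_1 INR).
        apply is_lim_seq_INR.
    + simpl. destruct (Rle_dec 0 (- a)); [exfalso; lra|reflexivity].
Qed.

Lemma cpow_step_bound (a : R) (s : C) :
  1 <= a -> 0 <= Re s -> Cmod (cpow_neg (a + 1) (s - 1) - cpow_neg a (s - 1))%C <= 2 * (Cmod (s - 1)%C * Rpower a (- Re s)).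
Proof.
  intros Ha Hs. set (M := Cmod (s - 1)%C * Rpower a (- Re s)).
  assert (HM : forall x, a <= x <= a + 1 -> Cmod (- (s - 1) * cpow_neg x (s - 1 + 1))%C <= M).
  { intros x Hx. rewrite Cmod_mult, Cmod_opp, Cmod_cpow_neg. apply Rmult_le_compat_l; [est|].
    replace (s - 1 + 1)%C with s by alg. apply Rpower_le_base; lra. }
  via Cmod_le_Re_Im. replace (2 * M) with (M * (a + 1 - a) + M * (a + 1 - a)) by lra. apply Rplus_le_compat.
  - apply (MVT_bound (fun x => Re (cpow_neg x (s - 1)))
      (fun x => Re (- (s - 1) * cpow_neg x (s - 1 + 1))%C)); [lra| |].
    + intros; apply is_derive_cpow_Re; lra.
    + intros x Hx. eapply Rle_trans; [apply Re_le_Cmod|now apply HM].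
  - apply (MVT_bound (fun x => Im (cpow_neg x (s - 1)))
      (fun x => Im (- (s - 1) * cpow_neg x (s - 1 + 1))%C)); [lra| |].
    + intros; apply is_derive_cpow_Im; lra.
    + intros x Hx. eapply Rle_trans; [apply Im_le_Cmod|now apply HM].
Qed.

Lemma eta_term_eq (s : C) n : eta_term s n = (RtoC ((-1) ^ n) * cpow_neg (INR n + 1) s)%C.
Proof. apply C_ext; unfold scal; simpl; unfold prod_scal, scal; simpl; unfold mult; simpl; ring. Qed.

Lemma eta_partial (s : C) N :
  csum (eta_term s) (2 * N) = (zpart s (2 * N) - two_pow_1ms s * zpart s N)%C.
Proof.
  assert (H2 : two_pow_1ms s = (RtoC 2 * cpow_neg 2 s)%C).
  { rewrite <- cpow_neg_minus1 by lra. unfold two_pow_1ms, cpow_neg.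
    replace (- Re (s - 1)%C) with (1 - Re s) by (rewrite Re_minus; simpl; ring).
    replace (Im (s - 1)%C) with (Im s) by (destruct s; simpl; ring). reflexivity. }
  rewrite H2. unfold zpart. induction N as [|N IH]; [alg|]. replace (2 * S N)%nat with (S (S (2 * N))) by lia.
  rewrite !csum_S, IH, !eta_term_eq.
  assert (E1 : (-1) ^ (2 * N) = 1) by (rewrite pow_mult; replace ((-1) ^ 2) with 1 by ring; apply pow1).
  assert (E2 : (-1) ^ (S (2 * N)) = -1) by (simpl pow at 1; change ((-1) ^ (N + (N + 0))) with ((-1) ^ (2 * N));
    rewrite E1; ring).
  rewrite E1, E2. replace (INR (S (2 * N)) + 1) with (2 * (INR N + 1)) by (rewrite S_INR, mult_INR; simpl; ring).
  rewrite cpow_neg_mult by est. ring.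
Qed.

Lemma Clim_subseq_even_odd (u : nat -> C) (l : C) :
  Clim (fun n => u (2 * n)%nat) l -> Clim (fun n => u (S (2 * n))) l -> Clim u l.
Proof.
  intros H0 H1. apply is_lim_seq_spec. intros eps. apply is_lim_seq_spec in H0. apply is_lim_seq_spec in H1.
  destruct (H0 eps) as [N0 K0]. destruct (H1 eps) as [N1 K1]. exists (2 * N0 + 2 * N1 + 2)%nat. intros n Hn.
  destruct (Nat.Even_or_Odd n) as [[m Hm]|[m Hm]].
  - rewrite Hm. apply K0. lia.
  - replace n with (S (2 * m)) by lia. apply K1. lia.
Qed.

Lemma is_lim_seq_subseq_le (u : nat -> R) (phi : nat -> nat) (l : R) :
  (forall n, (n <= phi n)%nat) -> is_lim_seq u l -> is_lim_seq (fun n => u (phi n)) l.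
Proof.
  intros Hphi H. apply is_lim_seq_spec. apply is_lim_seq_spec in H. intros eps. destruct (H eps) as [N K]. exists N.
  intros n Hn. apply K. specialize (Hphi n). lia.
Qed.

(** Times $s-1$, the partial sum of eta with $2N$ terms is the approximation of [fz s] in
    [zpart_lim] at $2N$ minus $2^{1-s}$ times the one at $N$, up to the difference of $(2N+2)^{1-s}$
    and $(2N+1)^{1-s}$. This difference tends to $0$ for $\Re s>0$, although each power may grow.
    Odd partial sums follow since single terms tend to $0$. *)
Theorem eta_fz (s : C) : 0 < Re s -> ((s - 1) * eta s = (1 - two_pow_1ms s) * fz s)%C.
Proof.
  intros Hs. destruct (Ceq_dec s (RtoC 1)) as [->|Hs1].
  (* At $s=1$ both sides vanish, since $2^{1-s}=1$. *)
  { replace (two_pow_1ms (RtoC 1)) with (RtoC 1); [ring|]. unfold two_pow_1ms.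
    rewrite Rmult_0_l, cos_0, sin_0, Rminus_diag. unfold Rpower. rewrite Rmult_0_l, exp_0. unfold RtoC. f_equal; ring. }
  assert (Hs1' : (s - 1)%C <> RtoC 0).
  { intros E. apply Hs1. replace s with ((s - 1) + 1)%C by alg. rewrite E. ring. }
  assert (Z := zpart_lim s Hs).
  assert (Z2 : Clim (fun N => (s - 1) * zpart s (2 * N) + cpow_neg (INR (2 * N) + 1) (s - 1))%C (fz s)) by (apply (is_lim_seq_subseq_le _ (fun n => (2 * n)%nat) _ ltac:(intros; cbv beta; lia) Z)).
  assert (P0 := is_lim_seq_Rpower_neg (Re s) Hs).
  assert (P2 : is_lim_seq (fun N => Rpower (INR (2 * N) + 1) (- Re s)) 0) by (apply (is_lim_seq_subseq_le _ (fun n => (2 * n)%nat) _ ltac:(intros; cbv beta; lia) P0)).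
  assert (D : Clim (fun N => cpow_neg (INR (2 * N) + 1 + 1) (s - 1) - cpow_neg (INR (2 * N) + 1) (s - 1))%C (RtoC 0)).
  { apply Clim_dom with (fun N => 2 * Cmod (s - 1)%C * Rpower (INR (2 * N) + 1) (- Re s)).
    - intros N.
      replace (cpow_neg (INR (2 * N) + 1 + 1) (s - 1) - cpow_neg (INR (2 * N) + 1) (s - 1) - 0)%C with
        (cpow_neg (INR (2 * N) + 1 + 1) (s - 1) - cpow_neg (INR (2 * N) + 1) (s - 1))%C by alg.
      eapply Rle_trans; [apply cpow_step_bound; [apply INR1_ge|lra]|]. est.
    - replace (Finite 0) with (Rbar_mult (2 * Cmod (s - 1)%C) 0) by (simpl; f_equal; ring).
      now apply is_lim_seq_scal_l. }
  assert (HE : Clim (fun N => (s - 1) * csum (eta_term s) (2 * N))%C ((1 - two_pow_1ms s) * fz s)%C).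
  { replace ((1 - two_pow_1ms s) * fz s)%C with (fz s + (- two_pow_1ms s * fz s + 0))%C by alg.
    eapply Clim_ext; [|apply Clim_plus; [exact Z2|apply Clim_plus; [apply Clim_scal, Z|exact D]]]. intros N.
    rewrite eta_partial.
    replace (cpow_neg (INR (2 * N) + 1 + 1) (s - 1)) with (two_pow_1ms s * cpow_neg (INR N + 1) (s - 1))%C.
    - ring.
    - replace (INR (2 * N) + 1 + 1) with (2 * (INR N + 1)) by (rewrite mult_INR; simpl; ring).
      rewrite cpow_neg_mult by est. unfold two_pow_1ms, cpow_neg.
      replace (- Re (s - 1)%C) with (1 - Re s) by (rewrite Re_minus; simpl; ring).
      replace (Im (s - 1)%C) with (Im s) by (destruct s; simpl; ring). reflexivity. }
  assert (HE2 : Clim (fun N => csum (eta_term s) (2 * N)) ((1 - two_pow_1ms s) * fz s / (s - 1))%C).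
  { replace ((1 - two_pow_1ms s) * fz s / (s - 1))%C with (/ (s - 1) * ((1 - two_pow_1ms s) * fz s))%C by alg.
    eapply Clim_ext; [|apply Clim_scal, HE]. intros N. cbv beta. field. auto. }
  assert (HO : Clim (fun N => csum (eta_term s) (S (2 * N))) ((1 - two_pow_1ms s) * fz s / (s - 1))%C).
  { replace ((1 - two_pow_1ms s) * fz s / (s - 1))%C with ((1 - two_pow_1ms s) * fz s / (s - 1) + 0)%C by alg.
    apply Clim_plus; [exact HE2|]. apply Clim_dom with (fun N => Rpower (INR (2 * N) + 1) (- Re s)); [|exact P2].
    intros N. replace (eta_term s (2 * N) - 0)%C with (eta_term s (2 * N)) by alg.
    rewrite eta_term_eq, Cmod_mult, Cmod_cpow_neg, Cmod_R, pow_1_abs. lra. }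
  assert (HH : eta s = ((1 - two_pow_1ms s) * fz s / (s - 1))%C).
  { apply CSeries_unique. now apply Clim_subseq_even_odd. }
  rewrite HH. field. auto.
Qed.

(** * Taylor coefficients of (s - 1) zeta(s) *)

Lemma abs_summable_plus (a b : nat -> C) :
  abs_summable a -> abs_summable b -> abs_summable (fun n => a n + b n)%C.
Proof.
  intros Ha Hb. apply abs_summable_le with (fun n => Cmod (a n) + Cmod (b n)).
  - est.
  - now apply (ex_series_plus (fun n => Cmod (a n)) (fun n => Cmod (b n))).
Qed.

Lemma abs_summable_scal (c : C) (a : nat -> C) :
  abs_summable a -> abs_summable (fun n => c * a n)%C.
Proof.
  intros Ha. apply abs_summable_le with (fun n => Cmod c * Cmod (a n)).
  - est.
  - now apply (ex_series_scal (Cmod c) (fun n => Cmod (a n))).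
Qed.

Lemma abs_summable_ext (a b : nat -> C) : (forall n, a n = b n) -> abs_summable a -> abs_summable b.
Proof. intros E. apply ex_series_ext. intros n. now rewrite E. Qed.

Lemma CSeries_plus (a b : nat -> C) :
  abs_summable a -> abs_summable b -> CSeries (fun n => a n + b n)%C = (CSeries a + CSeries b)%C.
Proof.
  intros Ha Hb. apply CSeries_unique. eapply Clim_ext; [intros; symmetry; apply csum_plus|].
  apply Clim_plus; now apply csum_Clim.
Qed.

Lemma CSeries_scal (c : C) (a : nat -> C) :
  abs_summable a -> CSeries (fun n => c * a n)%C = (c * CSeries a)%C.
Proof.
  intros Ha. apply CSeries_unique. eapply Clim_ext; [intros; symmetry; apply csum_scal|].
  apply Clim_scal; now apply csum_Clim.
Qed.

Lemma CSeries_ext (a b : nat -> C) : (forall n, a n = b n) -> CSeries a = CSeries b.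
Proof. intros E. unfold CSeries. f_equal; apply Series_ext; intros; now rewrite E. Qed.

Lemma CSeries_csum (a : nat -> nat -> C) K :
  (forall k, (k < K)%nat -> abs_summable (fun n => a n k)) ->
  abs_summable (fun n => csum (a n) K) /\
  csum (fun k => CSeries (fun n => a n k)) K = CSeries (fun n => csum (a n) K).
Proof.
  induction K as [|K IH]; intros H.
  - assert (Z : abs_summable (fun n : nat => csum (a n) 0)).
    { exists 0. apply is_series_rsum. apply is_lim_seq_ext with (fun _ => 0); [|apply is_lim_seq_const]. intros n.
      simpl. rewrite Cmod_0, rsum_const. ring. }
    split; [exact Z|]. symmetry. apply CSeries_unique. eapply Clim_ext; [|apply Clim_const]. intros n. simpl.
    transitivity (csum (fun _ => RtoC 0 * RtoC 0)%C n); [rewrite csum_scal; ring|]. apply csum_ext. intros. ring.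
  - destruct IH as [I1 I2]; [est|]. split.
    + apply abs_summable_plus; [exact I1|est].
    + rewrite csum_S, I2. symmetry. apply (CSeries_plus (fun n => csum (a n) K) (fun n => a n K)); [exact I1|est].
Qed.

Lemma geom_tail (a : nat -> C) (D q : R) K :
  0 <= q < 1 -> (forall k, Cmod (a k) <= D * q ^ k) ->
  abs_summable a /\ Cmod (CSeries a - csum a K)%C <= D * (q ^ K / (1 - q)).
Proof.
  intros Hq Ha. assert (HD : 0 <= D).
  { generalize (Ha O) (Cmod_ge_0 (a O)). lra. }
  assert (Sa : abs_summable a).
  { apply abs_summable_le with (1 := Ha). apply (ex_series_scal D (fun k => q ^ k)). now apply ex_series_geom_R. }
  split; [exact Sa|]. assert (L : is_lim_seq (fun m => Cmod (csum a m - csum a K)%C) (Cmod (CSeries a - csum a K)%C)) by (apply Clim_Cmod, Clim_plus; [now apply csum_Clim|apply Clim_const]).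
  refine (is_lim_seq_le_loc _ _ _ _ _ L (is_lim_seq_const _)). exists K. intros m Hm.
  apply Rle_trans with (D * ((q ^ K - q ^ m) / (1 - q))).
  - induction Hm as [|m Hm IH].
    + replace (csum a K - csum a K)%C with (RtoC 0) by alg. rewrite Cmod_0, Rminus_diag. lra.
    + rewrite csum_S. replace (csum a m + a m - csum a K)%C with ((csum a m - csum a K) + a m)%C by alg.
      replace (D * ((q ^ K - q ^ S m) / (1 - q))) with (D * ((q ^ K - q ^ m) / (1 - q)) + D * q ^ m) by alg. est.
  - apply Rmult_le_compat_l; [exact HD|]. apply Rmult_le_compat_r; [est|]. generalize (pow_le q m). lra.
Qed.

(** For a unit $u$, the function $M+\Re(uf)$ is nonnegative on a circle where $|f|\le M$. *)
Lemma cauchy_shift (a : nat -> C) (rho M : R) (u : C) :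
  0 < rho -> Cmod u = 1 -> abs_summable (fun k => a k * RtoC (rho ^ k))%C ->
  (forall z, Cmod z = rho -> Cmod (CSeries (fun k => a k * z ^ k)%C) <= M) ->
  let b := fun k => ((match k with O => RtoC M | _ => RtoC 0 end) + u * (a k * RtoC (rho ^ k)))%C in
  abs_summable b /\ forall t, 0 <= Series (fun k => Re (b k * cis (INR k * t))%C).
Proof.
  intros Hr Hu Ha HM b. set (d := fun k : nat => match k with O => RtoC M | _ => RtoC 0 end).
  assert (Hd : abs_summable d).
  { exists (rsum (fun k => Cmod (d k)) 1). apply Series_finite. intros [|k] Hk; [lia|apply Cmod_0]. }
  split.
  { apply abs_summable_plus; [exact Hd|]. now apply abs_summable_scal. }
  intros t. set (z := (RtoC rho * cis t)%C).
  assert (Hz : Cmod z = rho) by (unfold z; rewrite Cmod_mult, Cmod_cis, Cmod_R, Rabs_pos_eq; lra).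
  assert (Haz : abs_summable (fun k => a k * z ^ k)%C).
  { apply ex_series_ext with (2 := Ha). intros k.
    rewrite !Cmod_mult, Cmod_pow, Hz, Cmod_R, Rabs_pos_eq; [reflexivity|est]. }
  assert (E : CSeries (fun k => b k * cis (INR k * t))%C = (RtoC M + u * CSeries (fun k => a k * z ^ k))%C).
  { rewrite <- CSeries_scal by est. replace (RtoC M) with (CSeries d).
    - rewrite <- CSeries_plus; [|exact Hd|now apply abs_summable_scal]. apply CSeries_ext. intros k. unfold b, z.
      rewrite Cpow_mult_l, cis_pow, <- RtoC_pow. destruct k; [|alg]. unfold d. rewrite Rmult_0_l, cis_0. ring.
    - apply CSeries_unique. apply Clim_dom with (fun n => match n with O => Cmod (RtoC 0 - RtoC M)%C | _ => 0 end).
      + intros [|n]; [simpl; lra|]. assert (Z : csum d (S n) = RtoC M).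
        { induction n as [|n IH]; [alg|]. rewrite csum_S, IH. simpl. ring. }
        rewrite Z. replace (RtoC M - RtoC M)%C with (RtoC 0) by alg. rewrite Cmod_0. lra.
      + apply is_lim_seq_incr_1. apply is_lim_seq_const. }
  change (Series (fun k => Re (b k * cis (INR k * t))%C)) with (Re (CSeries (fun k => b k * cis (INR k * t))%C)).
  rewrite E, Re_plus. simpl (Re (RtoC M)). generalize (Re_ge_Cmod (u * CSeries (fun k => a k * z ^ k))%C).
  rewrite Cmod_mult, Hu, Rmult_1_l. specialize (HM z Hz). lra.
Qed.

(** Carathéodory's inequality for $M\pm f$ gives $|a_k|\rho^k\le2(M\pm\Re a_0)$, and the two average
    to $2M$. For $k=0$ the four rotations by powers of $i$ bound the real and the imaginary part by
    $M$ each. *)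
Lemma cauchy_est (a : nat -> C) (rho M : R) :
  0 < rho -> abs_summable (fun k => a k * RtoC (rho ^ k))%C ->
  (forall z, Cmod z = rho -> Cmod (CSeries (fun k => a k * z ^ k)%C) <= M) ->
  forall k, Cmod (a k) * rho ^ k <= 2 * M.
Proof.
  intros Hr Ha HM. assert (U1 : Cmod (RtoC 1) = 1) by apply Cmod_1.
  assert (U2 : Cmod (- RtoC 1)%C = 1) by (rewrite Cmod_opp; apply Cmod_1). assert (U3 : Cmod Ci = 1).
  { unfold Ci, Cmod; simpl. replace (0 * (0 * 1) + 1 * (1 * 1)) with 1 by lra. apply sqrt_1. }
  assert (U4 : Cmod (- Ci)%C = 1) by (rewrite Cmod_opp; exact U3).
  destruct (cauchy_shift a rho M _ Hr U1 Ha HM) as [S1 P1]. destruct (cauchy_shift a rho M _ Hr U2 Ha HM) as [S2 P2].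
  destruct (cauchy_shift a rho M _ Hr U3 Ha HM) as [S3 P3]. destruct (cauchy_shift a rho M _ Hr U4 Ha HM) as [S4 P4].
  assert (Z1 := fourier_coef0 _ S1 P1). assert (Z2 := fourier_coef0 _ S2 P2). assert (Z3 := fourier_coef0 _ S3 P3).
  assert (Z4 := fourier_coef0 _ S4 P4). intros [|k].
  - rewrite Rmult_1_r. via Cmod_le_Re_Im. unfold Ci, Re, Im in *. simpl in *. set (x := fst (a O)) in *.
    set (y := snd (a O)) in *. assert (Rabs x <= M) by est. assert (Rabs y <= M) by est. lra.
  - assert (C1 := caratheodory _ (S k) S1 P1 ltac:(lia)). assert (C2 := caratheodory _ (S k) S2 P2 ltac:(lia)).
    cbv beta iota in C1, C2. assert (Hk : Cmod (a (S k) * RtoC (rho ^ S k))%C = Cmod (a (S k)) * rho ^ S k) by (rewrite Cmod_mult, Cmod_R, Rabs_pos_eq; [reflexivity|est]).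
    replace (RtoC 0 + RtoC 1 * (a (S k) * RtoC (rho ^ S k)))%C with (a (S k) * RtoC (rho ^ S k))%C in C1 by alg.
    replace (RtoC 0 + - RtoC 1 * (a (S k) * RtoC (rho ^ S k)))%C with (- (a (S k) * RtoC (rho ^ S k)))%C in C2 by alg.
    rewrite Cmod_opp in C2. rewrite Re_plus in C1, C2.
    replace (- RtoC 1 * (a 0%nat * RtoC (rho ^ 0)))%C with (- (RtoC 1 * (a 0%nat * RtoC (rho ^ 0))))%C in C2 by alg.
    rewrite Re_opp in C2. simpl (Re (RtoC M)) in *. lra.
Qed.

(** * The complex exponential and its Taylor remainder *)

Definition cexp (w : C) : C := (RtoC (exp (Re w)) * cis (Im w))%C.

(** The parameter $t$ is the variable of integration: differentiating in $t$ lowers the order by one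
    and multiplies by $w$. *)
Definition exp_rem (w : C) (n : nat) (t : R) : C :=
  (cexp (RtoC t * w) - csum (fun k => RtoC (t ^ k / INR (fact k)) * w ^ k) n)%C.

Lemma is_derive_Re_cexp (u w : C) (t : R) :
  is_derive (fun t => Re (u * cexp (RtoC t * w))%C) t (Re (u * (w * cexp (RtoC t * w)))%C).
Proof.
  destruct u as [u1 u2], w as [a b].
  apply is_derive_ext with (fun t => u1 * (exp (t * a) * cos (t * b)) - u2 * (exp (t * a) * sin (t * b))).
  { intros s. unfold RtoC, Cmult, Re, Im; simpl. replace (s * a - 0 * b) with (s * a) by lra.
    replace (s * b + 0 * a) with (s * b) by lra. est. }
  unfold RtoC, Cmult, Re, Im; simpl. replace (t * a - 0 * b) with (t * a) by lra.
  replace (t * b + 0 * a) with (t * b) by lra. auto_derive; [exact I|]. ring.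
Qed.

Lemma is_derive_exp_rem (u w : C) (n : nat) (t : R) :
  is_derive (fun t => Re (u * exp_rem w (S n) t)%C) t (Re (u * (w * exp_rem w n t))%C).
Proof.
  unfold exp_rem.
  apply is_derive_ext with (fun t => Re (u * cexp (RtoC t * w))%C - rsum (fun k => t ^ k / INR (fact k) * Re (u * w ^
    k)%C) (S n)).
  { intros s.
    replace (u * (cexp (RtoC s * w) - csum (fun k => RtoC (s ^ k / INR (fact k)) * w ^ k) (S n)))%C
      with (u * cexp (RtoC s * w) - u * csum (fun k => RtoC (s ^ k / INR (fact k)) * w ^ k) (S n))%C by alg.
    rewrite Re_minus, <- csum_scal, csum_Re. f_equal. apply rsum_ext. intros k _. rewrite <- Re_scal. f_equal. ring. }
  replace (Re (u * (w * (cexp (RtoC t * w) - csum (fun k => RtoC (t ^ k / INR (fact k)) * w ^ k) n)))%C)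
    with (Re (u * (w * cexp (RtoC t * w)))%C - rsum (fun k => t ^ k / INR (fact k) * Re (u * w ^ S k)%C) n).
  2:{ replace (u * (w * (cexp (RtoC t * w) - csum (fun k => RtoC (t ^ k / INR (fact k)) * w ^ k) n)))%C
      with (u * (w * cexp (RtoC t * w)) - (u * w) * csum (fun k => RtoC (t ^ k / INR (fact k)) * w ^ k) n)%C by alg.
    rewrite Re_minus, <- csum_scal, csum_Re. f_equal. apply rsum_ext. intros k _. rewrite <- Re_scal. f_equal.
    rewrite Cpow_S. ring. }
  apply (is_derive_minus (fun t => Re (u * cexp (RtoC t * w))%C)
    (fun t => rsum (fun k => t ^ k / INR (fact k) * Re (u * w ^ k)%C) (S n))); [apply is_derive_Re_cexp|].
  apply is_derive_ext with (fun t => 1 * Re (u * w ^ 0)%C + rsum (fun k => t ^ S k / INR (fact (S k)) * Re (u * w ^ S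
    k)%C) n).
  { intros s. rewrite rsum_shift. replace (s ^ 0 / INR (fact 0)) with 1 by alg. reflexivity. }
  replace (rsum (fun k => t ^ k / INR (fact k) * Re (u * w ^ S k)%C) n) with
    (0 + rsum (fun k => t ^ k / INR (fact k) * Re (u * w ^ S k)%C) n) by lra.
  apply (is_derive_plus (fun t => 1 * Re (u * w ^ 0)%C) (fun t => rsum (fun k => t ^ S k / INR (fact (S k)) * Re (u * w ^ S k)%C) n));
    [apply (is_derive_const (1 * Re (u * w ^ 0)%C))|].
  induction n as [|n IH]; [apply (is_derive_const 0)|].
  apply (is_derive_plus (fun t => rsum (fun k => t ^ S k / INR (fact (S k)) * Re (u * w ^ S k)%C) n)
    (fun t => t ^ S n / INR (fact (S n)) * Re (u * w ^ S n)%C)); [exact IH|].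
  set (X := Re (u * w ^ S n)%C). auto_derive; [exact I|]. change (fact n + n * fact n)%nat with (fact (S n)).
  change (match n with O => 1 | S _ => INR n + 1 end) with (INR (S n)). rewrite fact_simpl, mult_INR. field. est.
Qed.

Lemma MVT_pow (u du : R -> R) (t M : R) (n : nat) :
  0 <= t -> u 0 = 0 -> (forall x, 0 <= x <= t -> is_derive u x (du x)) ->
  (forall x, 0 <= x <= t -> Rabs (du x) <= M * x ^ n) -> Rabs (u t) <= M * (t ^ S n / INR (S n)).
Proof.
  intros Ht U0 Hd HM. destruct (Req_dec t 0) as [->|Hn].
  { rewrite U0, Rabs_R0, pow_i by lia. lra. }
  assert (HI : INR (S n) <> 0) by est.
  assert (Dp : forall x, is_derive (fun x => M * (x ^ S n / INR (S n))) x (M * x ^ n)).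
  { intros x. auto_derive; [exact I|]. field. auto. }
  assert (P0 : M * (0 ^ S n / INR (S n)) = 0) by (alg). apply Rabs_le. split.
  - destruct (MVT_cor2 (fun x => u x + M * (x ^ S n / INR (S n))) (fun x => du x + M * x ^ n) 0 t) as [c [E Hc]].
    + lra.
    + intros c Hc. apply is_derive_Reals. apply (is_derive_plus u (fun x => M * (x ^ S n / INR (S n)))); auto.
    + assert (H := HM c ltac:(lra)). apply Rabs_le_between in H. assert (0 <= (du c + M * c ^ n) * (t - 0)) by est.
      lra.
  - destruct (MVT_cor2 (fun x => u x - M * (x ^ S n / INR (S n))) (fun x => du x - M * x ^ n) 0 t) as [c [E Hc]].
    + lra.
    + intros c Hc. apply is_derive_Reals. apply (is_derive_minus u (fun x => M * (x ^ S n / INR (S n)))); auto.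
    + assert (H := HM c ltac:(lra)). apply Rabs_le_between in H. assert (0 <= (M * c ^ n - du c) * (t - 0)) by est.
      lra.
Qed.

(** Each induction step integrates once over $[0,t]$ and passes through real and imaginary parts,
    which doubles the bound: hence the powers of $2|w|$. *)
Lemma exp_rem_bound (w : C) (n : nat) (t : R) :
  0 <= t <= 1 -> Cmod (exp_rem w n t) <= exp (Cmod w) * ((2 * Cmod w) ^ n * t ^ n / INR (fact n)).
Proof.
  revert t. induction n as [|n IH]; intros t Ht.
  - unfold exp_rem. simpl. replace (cexp (RtoC t * w) - 0)%C with (cexp (RtoC t * w)) by alg. unfold cexp.
    rewrite Cmod_mult, Cmod_cis, Cmod_R, Rabs_pos_eq by est. rewrite Re_scal. assert (t * Re w <= Cmod w).
    { generalize (Re_le_Cmod w) (Cmod_ge_0 w). intros H1 H2. apply Rabs_le_between in H1. nra. }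
    est.
  - assert (R0 : exp_rem w (S n) 0 = RtoC 0).
    { unfold exp_rem. rewrite csum_shift. replace (RtoC 0 * w)%C with (RtoC 0) by alg.
      rewrite (csum_ext _ (fun _ => RtoC 0 * RtoC 0)%C).
      - rewrite csum_scal. unfold cexp. simpl. rewrite exp_0, cis_0. replace (1 / 1) with 1 by lra. ring.
      - intros k _. rewrite pow_i by lia. unfold Rdiv. rewrite Rmult_0_l. ring. }
    set (M := Cmod w * (exp (Cmod w) * ((2 * Cmod w) ^ n / INR (fact n)))).
    assert (B : forall u, Cmod u = 1 -> Rabs (Re (u * exp_rem w (S n) t)%C) <= M * (t ^ S n / INR (S n))).
    { intros u Hu.
      apply (MVT_pow (fun t => Re (u * exp_rem w (S n) t)%C) (fun t => Re (u * (w * exp_rem w n t))%C)); [lra| | |].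
      - rewrite R0. replace (u * 0)%C with (RtoC 0) by alg. reflexivity.
      - intros x _. apply is_derive_exp_rem.
      - intros x Hx. via Re_le_Cmod. rewrite !Cmod_mult, Hu, Rmult_1_l. unfold M. specialize (IH x ltac:(lra)).
        replace (Cmod w * (exp (Cmod w) * ((2 * Cmod w) ^ n / INR (fact n))) * x ^ n) with
          (Cmod w * (exp (Cmod w) * ((2 * Cmod w) ^ n * x ^ n / INR (fact n)))) by lra.
        est. }
    assert (U3 : Cmod (- Ci)%C = 1).
    { rewrite Cmod_opp. unfold Ci, Cmod; simpl. replace (0 * (0 * 1) + 1 * (1 * 1)) with 1 by lra. apply sqrt_1. }
    via Cmod_le_Re_Im. assert (B1 := B (RtoC 1) Cmod_1). assert (B2 := B _ U3).
    replace (RtoC 1 * exp_rem w (S n) t)%C with (exp_rem w (S n) t) in B1 by alg.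
    replace (Re (- Ci * exp_rem w (S n) t)%C) with (Im (exp_rem w (S n) t)) in B2 by alg.
    replace (exp (Cmod w) * ((2 * Cmod w) ^ S n * t ^ S n / INR (fact (S n)))) with (2 * (M * (t ^ S n / INR (S n)))).
    + lra.
    + unfold M. rewrite fact_simpl, mult_INR. simpl pow. field. est.
Qed.

Lemma is_lim_seq_pow_fact (x : R) : 0 <= x -> is_lim_seq (fun n => x ^ n / INR (fact n)) 0.
Proof.
  intros Hx. apply ex_series_lim_0. exists (exp x). apply is_series_ext with (2 := is_exp_Reals x). reflexivity.
Qed.

Lemma cexp_series (w : C) : Clim (csum (fun k => RtoC (/ INR (fact k)) * w ^ k)%C) (cexp w).
Proof.
  apply Clim_dom with (fun n => exp (Cmod w) * ((2 * Cmod w) ^ n / INR (fact n))).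
  - intros n. generalize (exp_rem_bound w n 1 ltac:(lra)). unfold exp_rem. rewrite pow1, Rmult_1_r.
    replace (RtoC 1 * w)%C with w by alg.
    rewrite (csum_ext (fun k => RtoC (1 ^ k / INR (fact k)) * w ^ k)%C (fun k => RtoC (/ INR (fact k)) * w ^ k)%C).
    + intros H. rewrite <- Cmod_opp.
      replace (- (csum (fun k => RtoC (/ INR (fact k)) * w ^ k) n - cexp w))%C
        with (cexp w - csum (fun k => RtoC (/ INR (fact k)) * w ^ k) n)%C by alg.
      exact H.
    + intros k _. rewrite pow1. unfold Rdiv. now rewrite Rmult_1_l.
  - replace (Finite 0) with (Rbar_mult (exp (Cmod w)) 0) by (simpl; f_equal; ring). apply is_lim_seq_scal_l.
    apply is_lim_seq_pow_fact. est.
Qed.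

(** Taylor coefficients at $0$ of $z\mapsto x^{-z}$. *)
Definition ecf (x : R) (k : nat) : R := (- ln x) ^ k / INR (fact k).

Lemma cpow_neg_cexp (x : R) (z : C) : cpow_neg x z = cexp (RtoC (- ln x) * z)%C.
Proof.
  rewrite cpow_neg_cis. unfold cexp, Rpower. rewrite Re_scal. f_equal.
  - f_equal. f_equal. ring.
  - f_equal. destruct z; unfold Cmult, RtoC; simpl. ring.
Qed.

Lemma ecf_series (x : R) (z : C) : Clim (csum (fun k => RtoC (ecf x k) * z ^ k)%C) (cpow_neg x z).
Proof.
  rewrite cpow_neg_cexp. eapply Clim_ext; [|apply cexp_series]. intros n. apply csum_ext. intros k _.
  unfold ecf, Rdiv. rewrite Cpow_mult_l, <- RtoC_pow, RtoC_mult. ring.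
Qed.

Lemma ecf_summable (x : R) (z : C) : abs_summable (fun k => RtoC (ecf x k) * z ^ k)%C.
Proof.
  exists (exp (Rabs (ln x) * Cmod z)). apply is_series_ext with (2 := is_exp_Reals (Rabs (ln x) * Cmod z)). intros k.
  unfold scal; simpl; unfold mult; simpl. rewrite Cmod_mult, Cmod_R, Cmod_pow. unfold ecf, Rdiv. rewrite Rabs_mult.
  rewrite (Rabs_pos_eq (/ INR (fact k))) by est. rewrite <- RPow_abs, Rabs_Ropp, Rpow_mult_distr. ring.
Qed.

Definition ecf_pred (x : R) (k : nat) : R := match k with O => 0 | S j => ecf x j end.

Lemma ecf_pred_summable (x : R) (z : C) : abs_summable (fun k => RtoC (ecf_pred x k) * z ^ k)%C.
Proof.
  apply ex_series_incr_1. apply (ex_series_ext (fun k => Cmod (z * (RtoC (ecf x k) * z ^ k))%C)).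
  - intros k. f_equal. simpl ecf_pred. rewrite Cpow_S. ring.
  - apply abs_summable_scal, ecf_summable.
Qed.

Lemma ecf_pred_series (x : R) (z : C) : CSeries (fun k => RtoC (ecf_pred x k) * z ^ k)%C = (z * cpow_neg x z)%C.
Proof.
  apply CSeries_unique. apply is_lim_seq_incr_1.
  apply is_lim_seq_ext with (fun n => Cmod (z * csum (fun k => RtoC (ecf x k) * z ^ k)%C n - z * cpow_neg x z)%C).
  - intros n. f_equal. f_equal. rewrite csum_shift, <- csum_scal. rewrite Cmult_0_l, Cplus_0_l. apply csum_ext.
    intros k _. simpl ecf_pred. rewrite Cpow_S. ring.
  - apply Clim_scal, ecf_series.
Qed.

Lemma ecf_CSeries (x : R) (z : C) : CSeries (fun k => RtoC (ecf x k) * z ^ k)%C = cpow_neg x z.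
Proof. apply CSeries_unique, ecf_series. Qed.

(** Taylor coefficients in $z$ of [bterm n (c + z)]. The factor $c-1+z$ splits into a constant and a
    shift of the index, the latter being [ecf_pred]. *)
Definition bcoef (c : C) (n k : nat) : C :=
  (cpow_neg (INR n + 1) c * ((c - 1) * RtoC (ecf (INR n + 1) k) + RtoC (ecf_pred (INR n + 1) k))
   - cpow_neg (INR n + 1) (c - 1) * RtoC (ecf (INR n + 1) k)
   + cpow_neg (INR n + 2) (c - 1) * RtoC (ecf (INR n + 2) k))%C.

Lemma bcoef_series (c : C) (n : nat) (z : C) :
  abs_summable (fun k => bcoef c n k * z ^ k)%C /\ CSeries (fun k => bcoef c n k * z ^ k)%C = bterm n (c + z)%C.
Proof.
  set (x := INR n + 1). set (y := INR n + 2).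
  assert (E : forall k, (bcoef c n k * z ^ k = (cpow_neg x c * (c - 1) - cpow_neg x (c - 1)) * (RtoC (ecf x k) * z ^ k)
    + (cpow_neg x c * (RtoC (ecf_pred x k) * z ^ k) + cpow_neg y (c - 1) * (RtoC (ecf y k) * z ^ k)))%C).
  { intros k. unfold bcoef. fold x y. ring. }
  assert (A1 := abs_summable_scal (cpow_neg x c * (c - 1) - cpow_neg x (c - 1)) _ (ecf_summable x z)).
  assert (A2 := abs_summable_scal (cpow_neg x c) _ (ecf_pred_summable x z)).
  assert (A3 := abs_summable_scal (cpow_neg y (c - 1)) _ (ecf_summable y z)). split.
  - eapply abs_summable_ext; [intros k; symmetry; apply E|]. apply abs_summable_plus; [exact A1|].
    now apply abs_summable_plus.
  - rewrite (CSeries_ext _ _ E). rewrite CSeries_plus; [|exact A1|now apply abs_summable_plus].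
    rewrite CSeries_plus; [|exact A2|exact A3].
    rewrite !CSeries_scal, !ecf_CSeries, ecf_pred_series by (apply ecf_summable || apply ecf_pred_summable).
    unfold bterm. fold x y. replace (c + z - 1)%C with ((c - 1) + z)%C by alg. rewrite !cpow_neg_plus. ring.
Qed.

Definition fcoef (c : C) (k : nat) : C :=
  ((match k with O => RtoC 1 | _ => RtoC 0 end) + CSeries (fun n => bcoef c n k))%C.

Section PowerSeries.
Variables (c : C) (rho : R).
Hypothesis Hrho : 0 < rho < Re c.

Let D := 4 * ((Cmod c + rho) * (Cmod c + rho + 1)).

(** Cauchy's estimate on the circle of radius $\rho$: there the real part stays at least $\Re
    c-\rho>0$, which makes the bound summable over $n$. *)
Lemma bcoef_bound n k : Cmod (bcoef c n k) * rho ^ k <= D * Rpower (INR n + 1) (- (Re c - rho) - 1).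
Proof.
  replace (D * Rpower (INR n + 1) (- (Re c - rho) - 1)) with
    (2 * (2 * ((Cmod c + rho) * (Cmod c + rho + 1) * Rpower (INR n + 1) (- (Re c - rho) - 1)))) by (unfold D; ring).
  apply cauchy_est; [lra| |].
  - destruct (bcoef_series c n (RtoC rho)) as [H _]. eapply abs_summable_ext; [|exact H]. intros j. cbv beta.
    now rewrite <- RtoC_pow.
  - intros z Hz. destruct (bcoef_series c n z) as [_ ->]. assert (Hre : Re c - rho <= Re (c + z)%C).
    { rewrite Re_plus. generalize (Re_ge_Cmod z). lra. }
    eapply Rle_trans; [apply bterm_bound; lra|]. apply Rmult_le_compat_l; [lra|].
    assert (Hp : Rpower (INR n + 1) (- Re (c + z)%C - 1) <= Rpower (INR n + 1) (- (Re c - rho) - 1)) by (apply Rle_Rpower; [apply INR1_ge|lra]).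
    assert (H1 : Cmod (c + z)%C <= Cmod c + rho) by est. assert (H2 : Cmod (c + z - 1)%C <= Cmod c + rho + 1).
    { via Cmod_triangle. rewrite Cmod_opp, Cmod_1. lra. }
    apply Rmult_le_compat; [|est| |exact Hp].
    + est.
    + est.
Qed.

Lemma D_nonneg : 0 <= D.
Proof. unfold D. est. Qed.

Lemma bcoef_col_summable k : abs_summable (fun n => bcoef c n k).
Proof.
  apply abs_summable_le with (fun n => D / rho ^ k * Rpower (INR n + 1) (- (Re c - rho) - 1)).
  - intros n. assert (0 < rho ^ k) by est. apply Rmult_le_reg_r with (rho ^ k); [lra|]. via bcoef_bound. right. field.
    lra.
  - apply (ex_series_scal (D / rho ^ k) (fun n => Rpower (INR n + 1) (- (Re c - rho) - 1))). apply pseries_ex. lra.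
Qed.

Lemma fcoef_bound k : Cmod (fcoef c k) * rho ^ k <= 1 + D * (1 + / (Re c - rho)).
Proof.
  assert (Hk : 0 < rho ^ k) by est. eapply Rle_trans; [apply Rmult_le_compat_r; [lra|apply Cmod_triangle]|].
  rewrite Rmult_plus_distr_r. apply Rplus_le_compat.
  - destruct k; [rewrite Cmod_1; simpl; lra|rewrite Cmod_0; lra].
  - destruct (pseries_ex (Re c - rho) ltac:(lra)) as [E1 E2].
    apply Rle_trans with (Series (fun n => D / rho ^ k * Rpower (INR n + 1) (- (Re c - rho) - 1)) * rho ^ k).
    + apply Rmult_le_compat_r; [lra|]. eapply Rle_trans; [apply CSeries_Cmod, bcoef_col_summable|]. apply Series_le.
      * split; [est|]. apply Rmult_le_reg_r with (rho ^ k); [lra|]. via bcoef_bound. right. field. lra.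
      * now apply (ex_series_scal (D / rho ^ k) (fun n => Rpower (INR n + 1) (- (Re c - rho) - 1))).
    + rewrite Series_scal_l.
      replace (D / rho ^ k * Series (fun n => Rpower (INR n + 1) (- (Re c - rho) - 1)) * rho ^ k)
        with (D * Series (fun n => Rpower (INR n + 1) (- (Re c - rho) - 1))) by alg.
      apply Rmult_le_compat_l; [apply D_nonneg|exact E2].
Qed.

(** Only finitely many coefficients are exchanged with the sum over $n$. The rest of each [bterm] is
    a geometric tail, uniform in $n$ up to a summable factor. *)
Lemma fz_power_series_err (z : C) K :
  Cmod z < rho ->
  Cmod (fz (c + z) - csum (fun k => fcoef c k * z ^ k) (S K))%C
  <= D * (1 + / (Re c - rho)) * ((Cmod z / rho) ^ S K / (1 - Cmod z / rho)).
Proof.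
  intros Hz. set (q := Cmod z / rho). assert (Hq : 0 <= q < 1).
  { unfold q. est. }
  assert (Hterm : forall n k, Cmod (bcoef c n k * z ^ k)%C <= D * Rpower (INR n + 1) (- (Re c - rho) - 1) * q ^ k).
  { intros n k. rewrite Cmod_mult, Cmod_pow. assert (0 < rho ^ k) by est.
    replace (Cmod (bcoef c n k) * Cmod z ^ k) with (Cmod (bcoef c n k) * rho ^ k * q ^ k).
    - apply Rmult_le_compat_r; [est|apply bcoef_bound].
    - unfold q, Rdiv. rewrite Rpow_mult_distr, pow_inv. field. lra. }
  assert (Hcol : forall k, abs_summable (fun n => bcoef c n k * z ^ k)%C).
  { intros k. eapply abs_summable_ext; [|apply (abs_summable_scal (z ^ k)), (bcoef_col_summable k)]. intros n.
    cbv beta. ring. }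
  destruct (CSeries_csum (fun n k => bcoef c n k * z ^ k)%C (S K) (fun k _ => Hcol k)) as [S1 S2].
  assert (E : csum (fun k => fcoef c k * z ^ k)%C (S K) = (1 + CSeries (fun n => csum (fun k => bcoef c n k * z ^ k)%C
    (S K)))%C).
  { rewrite <- S2. rewrite csum_shift, (csum_shift (fun k => CSeries _)).
    rewrite (csum_ext (fun k => fcoef c (S k) * z ^ S k)%C (fun k => CSeries (fun n => bcoef c n (S k) * z ^ S k)%C)).
    - unfold fcoef at 1. rewrite (CSeries_ext (fun n => bcoef c n 0 * z ^ 0)%C (fun n => bcoef c n 0)) by alg. ring.
    - intros k _. unfold fcoef. rewrite Cplus_0_l, Cmult_comm, <- CSeries_scal by apply bcoef_col_summable.
      apply CSeries_ext. intros; ring. }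
  rewrite E. unfold fz. assert (S3 : abs_summable (fun n => bterm n (c + z)%C)).
  { apply bterm_summable. rewrite Re_plus. generalize (Re_ge_Cmod z). lra. }
  assert (S4 := abs_summable_plus _ _ S3 (abs_summable_scal (- RtoC 1) _ S1)).
  replace (1 + CSeries (fun n => bterm n (c + z)) - (1 + CSeries (fun n => csum (fun k => bcoef c n k * z ^ k) (S K))))%C
    with (CSeries (fun n => bterm n (c + z)%C + - RtoC 1 * csum (fun k => bcoef c n k * z ^ k)%C (S K))%C).
  2:{ rewrite CSeries_plus, CSeries_scal; [ring|exact S1|exact S3|now apply abs_summable_scal]. }
  eapply Rle_trans; [apply CSeries_Cmod, S4|]. destruct (pseries_ex (Re c - rho) ltac:(lra)) as [E1 E2].
  assert (Hqq : 0 <= q ^ S K / (1 - q)) by est.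
  apply Rle_trans with (Series (fun n => D * (q ^ S K / (1 - q)) * Rpower (INR n + 1) (- (Re c - rho) - 1))).
  - apply Series_le.
    + intros n. destruct (geom_tail (fun k => bcoef c n k * z ^ k)%C _ q (S K) Hq (Hterm n)) as [_ T].
      destruct (bcoef_series c n z) as [_ B]. rewrite B in T.
      replace (bterm n (c + z) + - RtoC 1 * csum (fun k => bcoef c n k * z ^ k) (S K))%C
        with (bterm n (c + z) - csum (fun k => bcoef c n k * z ^ k) (S K))%C by alg.
      est.
    + now apply (ex_series_scal (D * (q ^ S K / (1 - q))) (fun n => Rpower (INR n + 1) (- (Re c - rho) - 1))).
  - rewrite Series_scal_l.
    replace (D * (1 + / (Re c - rho)) * (q ^ S K / (1 - q))) with (D * (q ^ S K / (1 - q)) * (1 + / (Re c - rho))) by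
      lra.
    apply Rmult_le_compat_l; [|exact E2]. apply Rmult_le_pos; [apply D_nonneg|exact Hqq].
Qed.
End PowerSeries.

(** * Divisor sums of the Moebius and von Mangoldt functions *)

Definition dvd (d n : nat) : bool := div.dvdn d n.

(** [primes n] lists the distinct prime divisors, so a list of one element singles out the prime
    powers. *)
Definition Lambda (n : nat) : R :=
  match prime.primes n with (p :: nil)%list => ln (INR p) | _ => 0 end.

Lemma rsum_multiples (G : nat -> R) (p m : nat) :
  (0 < p)%nat -> (forall d, ~ (exists k, d = (k * p)%nat) -> G d = 0) ->
  rsum G (m * p) = rsum (fun e => G (e * p)%nat) m.
Proof.
  intros Hp HG. induction m as [|m IH]; [reflexivity|]. rewrite rsum_S, <- IH.
  replace (S m * p)%nat with (m * p + p)%nat by lia.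
  assert (A : forall j, (j < p)%nat -> rsum G (m * p + S j) = rsum G (m * p) + G (m * p)%nat).
  { induction j as [|j IHj]; intros Hj.
    - rewrite Nat.add_1_r. est.
    - rewrite Nat.add_succ_r, rsum_S, IHj by lia. rewrite (HG (m * p + S j)%nat); [ring|]. intros [k Hk].
      assert (m < k)%nat by nia. assert (k < S m)%nat by nia. lia. }
  destruct p as [|p]; [lia|]. est.
Qed.

Lemma rsum_zero_tail (f : nat -> R) n m :
  (n <= m)%nat -> (forall k, (n <= k)%nat -> f k = 0) -> rsum f m = rsum f n.
Proof. intros H Hf. induction H as [|m H IH]; [reflexivity|]. rewrite rsum_S, IH, Hf by lia. ring. Qed.

Module Arithmetic.
From mathcomp Require Import ssreflect ssrbool eqtype ssrnat seq div bigop prime.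

Lemma dvdb_spec (d n : nat) : dvd d n = true <-> exists k, n = Nat.mul k d.
Proof.
  split=> [/dvdnP [k ->]|[k ->]]; first by exists k; rewrite mulnE.
  by rewrite /dvd -[Nat.mul k d]/(k * d)%N dvdn_mull.
Qed.

Lemma mobius_coprime (p e : nat) :
  prime p -> ~~ (p %| e) -> (0 < e)%N -> mobius (p * e) = Ropp (mobius e).
Proof.
  move=> pp npe e0. have p0 : (0 < p)%N by est. have Hp : perm_eq (primes (p * e)) (p :: primes e).
  apply: uniq_perm; first exact: primes_uniq. by rewrite /= primes_uniq mem_primes (negbTE npe) !andbF.
  by move=> q; rewrite primesM // primes_prime // !inE. have Hq q : q \in primes e -> logn q (p * e) = logn q e.
  move=> Hq. rewrite lognM // logn_prime //. case: eqP => [E|//].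
  by move: Hq; rewrite E mem_primes (negbTE npe) !andbF. rewrite /mobius (perm_all _ Hp) (perm_size Hp) /=.
  have -> : logn p (p * e) = 1%N. by rewrite lognM // logn_prime // eqxx lognE (negbTE npe) !andbF addn0.
  rewrite eqxx /=.
  have -> : all (fun q => logn q (p * e) == 1%N) (primes e) = all (fun q => logn q e == 1%N) (primes e).
  by apply: eq_in_all => q /Hq ->. by case: ifP => _; rewrite /=; lra.
Qed.

Lemma mobius_square (p e : nat) :
  prime p -> p %| e -> (0 < e)%N -> mobius (p * e) = R0.
Proof.
  move=> pp pe e0. have p0 : (0 < p)%N by est. rewrite /mobius. case: ifP => // /allP H.
  have Hin : p \in primes (p * e). by rewrite mem_primes pp muln_gt0 p0 e0 /= dvdn_mulr. move/eqP: (H _ Hin).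
  rewrite lognM // logn_prime // eqxx. have : (0 < logn p e)%N by rewrite logn_gt0 mem_primes pp e0 pe.
  by case: (logn p e).
Qed.

Lemma mobius_1 : mobius 1 = R1.
Proof. est. Qed.

Lemma mobius_bound (n : nat) : (Rabs (mobius n) <= 1)%R.
Proof. rewrite /mobius. case: ifP => _; last by est. by rewrite pow_1_abs; lra. Qed.

Lemma dvd_pdiv (n : nat) : (1 < n)%N -> prime (pdiv n) /\ pdiv n %| n.
Proof. by move=> n1; split; [apply: pdiv_prime|apply: pdiv_dvd]. Qed.

Lemma dvd_mul_prime (p e n : nat) :
  prime p -> p %| n -> (0 < n)%N -> ~~ (p %| e) -> (p * e %| n) = (e %| n).
Proof. move=> pp pn n0 npe. rewrite Gauss_dvd ?pn //. by rewrite prime_coprime. Qed.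

Lemma mobius_pair (p e n : nat) :
  prime p -> p %| n -> (0 < n)%N ->
  (if dvd (p * e) n then mobius (p * e) else R0) =
  (if dvd e n && ~~ dvd p e then Ropp (mobius e) else R0).
Proof.
  move=> pp pn n0. rewrite /dvd. case: (posnP e) => [->|e0]; first by rewrite muln0 dvd0n (gtn_eqF n0).
  case pe: (p %| e) => /=. rewrite andbF. case: ifP => // _. by rewrite mobius_square.
  rewrite andbT dvd_mul_prime ?pe //. by rewrite mobius_coprime ?pe.
Qed.

Lemma Lambda_nonneg (n : nat) : (0 <= Lambda n)%R.
Proof.
  rewrite /Lambda. case E: (primes n) => [|p [|q s]]; try lra. have : p \in primes n by rewrite E inE.
  rewrite mem_primes => /andP [pp _]. have := prime_gt1 pp => /ltP H. rewrite -ln_1. apply: ln_le; first by lra.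
  by have := le_INR 1 p (Nat.lt_le_incl _ _ H).
Qed.

Lemma Lambda_dvd_mul (p m d : nat) :
  prime p -> (0 < m)%N ->
  (if dvd d (p * m) then Lambda d else R0) =
  Rplus (if dvd d m then Lambda d else R0) (if d == (p ^ (logn p m).+1)%N then ln (INR p) else R0).
Proof.
  move=> pp m0. have p0 : (0 < p)%N by est. rewrite /dvd. case: eqP => [->|Hd].
  have -> : Lambda (p ^ (logn p m).+1)%N = ln (INR p). by rewrite /Lambda primesX // primes_prime.
  rewrite !pfactor_dvdn ?muln_gt0 ?p0 ?m0 // lognM // (logn_prime _ pp) eqxx /= add1n leqnn ltnn. by lra.
  rewrite Rplus_0_r. case E: (primes d) => [|q [|q' s]]; try by rewrite /Lambda E; do 2!case: ifP.
  have Hq : q \in primes d by rewrite E inE. move: (Hq); rewrite mem_primes => /and3P [pq d0 qd].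
  have Dd : d = (q ^ logn q d)%N. by rewrite [LHS](prod_prime_decomp d0) prime_decompE E /= big_cons big_nil muln1.
  rewrite Dd !pfactor_dvdn ?muln_gt0 ?p0 ?m0 // lognM // (logn_prime _ pp). case: eqP => [Eq|Nq] /=; last by est.
  rewrite add1n leq_eqVlt ltnS. case: eqP => [E2|//]. by case: Hd; rewrite Dd E2 Eq.
Qed.

(** For a prime $p$ dividing $n$, the divisors of the form $ep$ have Möbius values opposite to those
    of the divisors $e$ prime to $p$, and zero when $p$ divides $e$. *)
Lemma mobius_step (n : nat) : (1 < n)%coq_nat ->
  exists p, (0 < p)%coq_nat /\ forall e,
    (if dvd (Nat.mul e p) n then mobius (Nat.mul e p) else R0) =
    (if dvd e n then if dvd p e then R0 else Ropp (mobius e) else R0).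
Proof.
  move=> /ltP n1. have [pp pn] := dvd_pdiv _ n1. exists (pdiv n); split; first by apply/ltP/prime_gt0. move=> e.
  rewrite -[Nat.mul e _]/(e * pdiv n)%N mulnC mobius_pair ?(ltnW n1) //. by case: (dvd e n) => //=; case: (dvd _ e).
Qed.

(** With $n=pm$, the prime powers dividing $n$ are those dividing $m$ and exactly one more,
    $q=p^{v+1}$, where $p^v$ is the power of $p$ in $m$. *)
Lemma Lambda_step (n : nat) : (1 < n)%coq_nat ->
  exists p m q, n = Nat.mul p m /\ (0 < m)%coq_nat /\ (m < n)%coq_nat /\ (0 < p)%coq_nat /\ (q <= n)%coq_nat /\
  forall d, (if dvd d n then Lambda d else R0) =
    Rplus (if dvd d m then Lambda d else R0) (if Nat.eqb q d then ln (INR p) else R0).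
Proof.
  move=> /ltP n1. have [pp pn] := dvd_pdiv _ n1. set p := pdiv n in pp pn *. set m := (n %/ p)%N.
  have E : n = (p * m)%N by rewrite mulnC divnK.
  have m0 : (0 < m)%N by move: (ltnW n1); rewrite {1}E muln_gt0 => /andP []. have p0 := prime_gt0 pp.
  exists p, m, (p ^ (logn p m).+1)%N; split; first by []. split; first exact/ltP. split.
  by apply/ltP; rewrite [X in (_ < X)%N]E -{1}[m]mul1n ltn_pmul2r // prime_gt1. split; first exact/ltP. split.
  apply/leP. apply: dvdn_leq; first exact: ltnW. by rewrite [X in _ %| X]E expnS dvdn_pmul2l // pfactor_dvdnn.
  move=> d. rewrite [X in dvd _ X]E Lambda_dvd_mul //.
  case: (Nat.eqb_spec (p ^ (logn p m).+1)%N d) => [<-|H]; first by rewrite eqxx. by case: eqP => // H'; case: H.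
Qed.
End Arithmetic.

Lemma dvd_le (d n : nat) : (0 < n)%nat -> dvd d n = true -> (d <= n)%nat.
Proof.
  intros Hn H. apply Arithmetic.dvdb_spec in H. destruct H as [k Hk]. destruct k as [|k]; simpl in Hk; [lia|]. lia.
Qed.

Lemma dvd_0_l (n : nat) : (0 < n)%nat -> dvd 0 n = false.
Proof. destruct (dvd 0 n) eqn:E; [|reflexivity]. apply Arithmetic.dvdb_spec in E. destruct E as [k Hk]. lia. Qed.

Lemma dvd_gt (d n : nat) : (0 < n < d)%nat -> dvd d n = false.
Proof. intros H. destruct (dvd d n) eqn:E; [|reflexivity]. apply dvd_le in E; lia. Qed.

(** By [mobius_step] the divisors prime to $p$ cancel against their multiples by $p$. The range is
    first extended to [S n * p] so that the multiples of $p$ can be reindexed. *)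
Lemma mobius_divsum (n : nat) :
  (0 < n)%nat -> rsum (fun d => if dvd d n then mobius d else 0) (S n) = if Nat.eqb n 1 then 1 else 0.
Proof.
  intros Hn. destruct (Nat.eqb_spec n 1) as [->|H1].
  - simpl rsum. rewrite Arithmetic.mobius_1. ring.
  - destruct (Arithmetic.mobius_step n) as [p [Hp He]]; [lia|]. set (f := fun d => if dvd d n then mobius d else 0).
    set (f1 := fun d => if dvd p d then 0 else f d). set (f2 := fun d => if dvd p d then f d else 0).
    assert (T : forall k, (S n <= k)%nat -> f k = 0).
    { intros k Hk. unfold f. rewrite dvd_gt by lia. reflexivity. }
    rewrite <- (rsum_zero_tail f (S n) (S n * p)) by (nia || exact T).
    rewrite (rsum_ext f (fun d => f1 d + f2 d)) by (intros d _; unfold f1, f2; destruct (dvd p d); ring).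
    assert (M2 : rsum f2 (S n * p) = rsum (fun e => f2 (e * p)%nat) (S n)).
    { apply rsum_multiples; [exact Hp|]. intros d Hd. unfold f2. destruct (dvd p d) eqn:E; [|reflexivity].
      apply Arithmetic.dvdb_spec in E. contradiction. }
    rewrite rsum_plus, M2.
    rewrite (rsum_zero_tail f1 (S n)) by (try nia; intros k Hk; unfold f1; rewrite T by lia; now destruct (dvd p k)).
    rewrite <- rsum_plus. rewrite (rsum_ext _ (fun _ => 0)); [rewrite rsum_const; ring|]. intros e _. unfold f1, f2.
    replace (dvd p (e * p)) with true by (symmetry; apply Arithmetic.dvdb_spec; now exists e). unfold f at 2.
    rewrite He. unfold f. destruct (dvd p e), (dvd e n); ring.
Qed.

Lemma Lambda_divsum (n : nat) :
  (0 < n)%nat -> rsum (fun d => if dvd d n then Lambda d else 0) (S n) = ln (INR n).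
Proof.
  induction n as [n IH] using (well_founded_induction Wf_nat.lt_wf). intros Hn. destruct (Nat.eq_dec n 1) as [->|H1].
  - simpl rsum. replace (Lambda 1) with 0 by est. simpl INR. rewrite ln_1. ring.
  - destruct (Arithmetic.Lambda_step n) as [p [m [q [E [Hm [Hmn [Hp [Hq Hd]]]]]]]]; [lia|].
    rewrite (rsum_ext _ _ _ (fun d _ => Hd d)), rsum_plus.
    rewrite (rsum_zero_tail (fun d => if dvd d m then Lambda d else 0) (S m)).
    + rewrite IH by lia. rewrite rsum_delta by lia. rewrite E, mult_INR, ln_mult by est. ring.
    + lia.
    + intros k Hk. rewrite dvd_gt by lia. reflexivity.
Qed.

(* Below, index [n] stands for the integer [n + 1]. *)

Definition conv (A B : nat -> C) (N : nat) : C :=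
  csum (fun d => csum (fun m => if Nat.eqb (S d * S m) (S N) then (A d * B m)%C else RtoC 0) (S N)) (S N).

Lemma csum_delta (c : C) (N k : nat) :
  csum (fun l => if Nat.eqb k l then c else RtoC 0) N = if Nat.ltb k N then c else RtoC 0.
Proof.
  induction N as [|N IH]; [reflexivity|]. rewrite csum_S, IH.
  destruct (Nat.ltb_spec k N), (Nat.eqb_spec k N), (Nat.ltb_spec k (S N)); try lia; ring.
Qed.

Lemma csum_zero (f : nat -> C) n : (forall k, (k < n)%nat -> f k = RtoC 0) -> csum f n = RtoC 0.
Proof. induction n as [|n IH]; intros H; [reflexivity|]. rewrite csum_S, IH by est. rewrite H by lia. ring. Qed.

Lemma csum_tail0 (f : nat -> C) n m :
  (n <= m)%nat -> (forall k, (n <= k)%nat -> f k = RtoC 0) -> csum f m = csum f n.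
Proof. intros H Hf. induction H as [|m H IH]; [reflexivity|]. rewrite csum_S, IH, Hf by lia. ring. Qed.

Lemma conv_wide (A B : nat -> C) N X : (N < X)%nat ->
  conv A B N = csum (fun d => csum (fun m => if Nat.eqb (S d * S m) (S N) then (A d * B m)%C else RtoC 0) X) X.
Proof.
  intros H. unfold conv.
  rewrite <- (csum_tail0 (fun d => csum (fun m => if Nat.eqb (S d * S m) (S N) then (A d * B m)%C else RtoC 0) (S N))
    (S N) X).
  - apply csum_ext. intros d Hd. symmetry. apply csum_tail0; [lia|]. intros m Hm.
    destruct (Nat.eqb_spec (S d * S m) (S N)); [nia|reflexivity].
  - lia.
  - intros d Hd. apply csum_zero. intros m _. destruct (Nat.eqb_spec (S d * S m) (S N)); [nia|reflexivity].
Qed.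

Lemma conv_partial (A B : nat -> C) X :
  csum (conv A B) X = csum (fun d => csum (fun m => if Nat.leb (S d * S m) X then (A d * B m)%C else RtoC 0) X) X.
Proof.
  rewrite (csum_ext _ (fun N => csum (fun d => csum (fun m => if Nat.eqb (S d * S m) (S N) then (A d * B m)%C else RtoC 0) X) X))
    by (intros; now apply conv_wide).
  rewrite csum_swap. apply csum_ext. intros d _. rewrite csum_swap. apply csum_ext. intros m _.
  rewrite (csum_ext _ (fun N => if Nat.eqb (S d * S m - 1) N then (A d * B m)%C else RtoC 0)).
  - rewrite csum_delta. destruct (Nat.ltb_spec (S d * S m - 1) X), (Nat.leb_spec (S d * S m) X); try lia; reflexivity.
  - intros N _. destruct (Nat.eqb_spec (S d * S m) (S N)), (Nat.eqb_spec (S d * S m - 1) N); try lia; reflexivity.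
Qed.

(** The products missing from the convolution have $(d+1)(m+1)>X\ge n^2$ and so lie outside the
    square of side $n$. The right-hand side is the absolute sum over the square of side $X$ minus
    that over the square of side $n$. *)
Lemma conv_error (A B : nat -> C) X n :
  (n * n <= X)%nat ->
  Cmod (csum A X * csum B X - csum (conv A B) X)%C <=
  rsum (fun d => Cmod (A d)) X * rsum (fun m => Cmod (B m)) X
  - rsum (fun d => Cmod (A d)) n * rsum (fun m => Cmod (B m)) n.
Proof.
  intros Hn. assert (HnX : (n <= X)%nat) by (destruct n; nia).
  assert (E : (csum A X * csum B X - csum (conv A B) X)%C =
    csum (fun d => csum (fun m => if Nat.leb (S d * S m) X then RtoC 0 else (A d * B m)%C) X) X).
  { rewrite conv_partial. assert (P : (csum A X * csum B X)%C = csum (fun d => csum (fun m => A d * B m)%C X) X).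
    { rewrite Cmult_comm, <- csum_scal. apply csum_ext. intros d _. rewrite csum_scal. ring. }
    rewrite P. assert (M : forall f g k, (csum f k - csum g k)%C = csum (fun i => f i - g i)%C k).
    { induction k as [|k IH]; [alg|]. rewrite !csum_S, <- IH. ring. }
    rewrite M. apply csum_ext. intros d _. rewrite M. apply csum_ext. intros m _.
    destruct (Nat.leb (S d * S m) X); ring. }
  rewrite E. via csum_Cmod.
  assert (Q : forall k, rsum (fun d => Cmod (A d)) k * rsum (fun m => Cmod (B m)) k
    = rsum (fun d => rsum (fun m => Cmod (A d) * Cmod (B m)) k) k).
  { intros k. apply rsum_mult_rsum. }
  rewrite !Q.
  assert (Z : rsum (fun d => rsum (fun m => Cmod (A d) * Cmod (B m)) n) n =
    rsum (fun d => rsum (fun m => if andb (Nat.ltb d n) (Nat.ltb m n) then Cmod (A d) * Cmod (B m) else 0) X) X).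
  { rewrite (rsum_zero_tail (fun d => rsum _ X) n X).
    - apply rsum_ext. intros d Hd. rewrite (rsum_zero_tail _ n X).
      + apply rsum_ext. intros m Hm. destruct (Nat.ltb_spec d n), (Nat.ltb_spec m n); try lia; reflexivity.
      + lia.
      + intros m Hm. destruct (Nat.ltb_spec d n), (Nat.ltb_spec m n); try lia; reflexivity.
    - lia.
    - intros d Hd. rewrite (rsum_ext _ (fun _ => 0)); [rewrite rsum_const; ring|].
      destruct (Nat.ltb_spec d n); [lia|reflexivity]. }
  rewrite Z. assert (M : forall f g k, rsum f k - rsum g k = rsum (fun i => f i - g i) k).
  { induction k as [|k IH]; [alg|]. rewrite !rsum_S, <- IH. ring. }
  rewrite M. apply rsum_le. intros d Hd. rewrite M. via csum_Cmod. apply rsum_le. intros m Hm.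
  generalize (Cmod_ge_0 (A d)) (Cmod_ge_0 (B m)).
  destruct (Nat.leb_spec (S d * S m) X), (Nat.ltb_spec d n), (Nat.ltb_spec m n); simpl andb; cbv iota;
    rewrite ?Cmod_0, ?Cmod_mult; try nra.
  nia.
Qed.

(** [conv_error] with $n=\lfloor\sqrt X\rfloor$: the absolute sums over both squares have the same
    limit. *)
Theorem conv_Clim (A B : nat -> C) :
  abs_summable A -> abs_summable B -> Clim (csum (conv A B)) (CSeries A * CSeries B)%C.
Proof.
  intros HA HB. set (a := fun n => rsum (fun d => Cmod (A d)) n). set (b := fun n => rsum (fun d => Cmod (B d)) n).
  set (la := Series (fun d => Cmod (A d))). set (lb := Series (fun d => Cmod (B d))).
  assert (La : is_lim_seq a la) by (now apply rsum_lim_Series).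
  assert (Lb : is_lim_seq b lb) by (now apply rsum_lim_Series).
  assert (Sq : forall u l, is_lim_seq u l -> is_lim_seq (fun X => u (Nat.sqrt X)) l).
  { intros u l H. apply (filterlim_comp _ _ _ Nat.sqrt u eventually eventually (Rbar_locally l)); [|exact H].
    intros P [N HN]. exists (N * N)%nat. intros n Hn. apply HN. apply Nat.sqrt_le_square. lia. }
  assert (L1 : Clim (fun X => csum A X * csum B X)%C (CSeries A * CSeries B)%C).
  { assert (CA := csum_Clim A HA). assert (CB := csum_Clim B HB).
    apply Clim_dom with (fun X => la * Cmod (csum B X - CSeries B)%C + Cmod (csum A X - CSeries A)%C * Cmod (CSeries
      B)).
    - intros X.
      replace (csum A X * csum B X - CSeries A * CSeries B)%C with
        (csum A X * (csum B X - CSeries B) + (csum A X - CSeries A) * CSeries B)%C by alg.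
      via Cmod_triangle. rewrite !Cmod_mult. apply Rplus_le_compat_r. apply Rmult_le_compat_r; [est|]. via csum_Cmod.
      apply rsum_le_Series; [est|exact HA].
    - replace (Finite 0) with (Finite (la * 0 + 0 * Cmod (CSeries B))) by alg.
      apply is_lim_seq_plus'; apply is_lim_seq_mult'; auto; apply is_lim_seq_const. }
  assert (L2 : Clim (fun X => csum (conv A B) X - csum A X * csum B X)%C (RtoC 0)).
  { apply Clim_dom with (fun X => a X * b X - a (Nat.sqrt X) * b (Nat.sqrt X)).
    - intros X.
      replace (csum (conv A B) X - csum A X * csum B X - 0)%C with
        (- (csum A X * csum B X - csum (conv A B) X))%C by alg.
      rewrite Cmod_opp. apply conv_error. apply (Nat.sqrt_spec X). lia.
    - replace (Finite 0) with (Finite (la * lb - la * lb)) by alg.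
      apply is_lim_seq_minus'; apply is_lim_seq_mult'; auto. }
  replace (CSeries A * CSeries B)%C with (CSeries A * CSeries B + 0)%C by alg.
  eapply Clim_ext; [|apply Clim_plus; [exact L1|exact L2]]. intros X. cbv beta. ring.
Qed.

Lemma pair_inner (v : R) d N :
  rsum (fun m => if Nat.eqb (S d * S m) (S N) then v else 0) (S N) = if dvd (S d) (S N) then v else 0.
Proof.
  destruct (dvd (S d) (S N)) eqn:E.
  - apply Arithmetic.dvdb_spec in E. destruct E as [k Hk]. destruct k as [|k]; [lia|].
    rewrite (rsum_ext _ (fun m => if Nat.eqb k m then v else 0)).
    + apply rsum_delta. nia.
    + intros m _. destruct (Nat.eqb_spec (S d * S m) (S N)), (Nat.eqb_spec k m); try reflexivity; nia.
  - rewrite (rsum_ext _ (fun _ => 0)); [rewrite rsum_const; ring|]. intros m _.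
    destruct (Nat.eqb_spec (S d * S m) (S N)) as [H|H]; [|reflexivity].
    assert (dvd (S d) (S N) = true); [|congruence]. apply Arithmetic.dvdb_spec. exists (S m). lia.
Qed.

Lemma pair_divsum (g : nat -> R) N :
  rsum (fun d => rsum (fun m => if Nat.eqb (S d * S m) (S N) then g (S d) else 0) (S N)) (S N)
  = rsum (fun d => if dvd d (S N) then g d else 0) (S (S N)).
Proof.
  rewrite (rsum_shift _ (S N)), dvd_0_l by lia. rewrite Rplus_0_l. apply rsum_ext. intros d _. apply pair_inner.
Qed.

Lemma csum_RtoC (f : nat -> R) n : csum (fun k => RtoC (f k)) n = RtoC (rsum f n).
Proof. induction n as [|n IH]; [reflexivity|]. rewrite csum_S, IH, <- RtoC_plus. reflexivity. Qed.

Lemma conv_factor (A B : nat -> C) (g : nat -> R) (h : C) N :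
  (forall d m, (S d * S m = S N)%nat -> (A d * B m = RtoC (g (S d)) * h)%C) ->
  conv A B N = (RtoC (rsum (fun d => if dvd d (S N) then g d else 0) (S (S N))) * h)%C.
Proof.
  intros H. rewrite <- pair_divsum, <- csum_RtoC, Cmult_comm, <- csum_scal. apply csum_ext. intros d _.
  rewrite <- csum_RtoC, <- csum_scal. apply csum_ext. intros m _.
  destruct (Nat.eqb_spec (S d * S m) (S N)) as [E|E]; [rewrite H by exact E|]; ring.
Qed.

(** * Dirichlet series *)

Lemma rsum_sum_f_R0 (f : nat -> R) n : rsum f (S n) = sum_f_R0 f n.
Proof. induction n as [|n IH]; [alg|]. rewrite rsum_S, IH. reflexivity. Qed.

(** The binomial theorem, as the coefficients of $x^{-z}y^{-z}=(xy)^{-z}$. *)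
Lemma ecf_mult (x y : R) k :
  0 < x -> 0 < y -> rsum (fun i => ecf x (k - i) * ecf y i) (S k) = ecf (x * y) k.
Proof.
  intros Hx Hy. unfold ecf. rewrite ln_mult by lra. replace (- (ln x + ln y)) with (- ln y + - ln x) by lra.
  rewrite (binomial (- ln y) (- ln x) k), <- rsum_sum_f_R0. unfold Rdiv. rewrite Rmult_comm, <- rsum_scal.
  apply rsum_ext. intros i Hi. unfold Binomial.C. field. est.
Qed.

Lemma exp_term_le (y : R) k : 0 <= y -> y ^ k / INR (fact k) <= exp y.
Proof.
  intros Hy. assert (H := is_exp_Reals y). assert (E : is_series (fun n => y ^ n / INR (fact n)) (exp y)) by est.
  assert (P : forall n, 0 <= y ^ n / INR (fact n)) by est. rewrite <- (is_series_unique _ _ E).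
  apply Rle_trans with (rsum (fun n => y ^ n / INR (fact n)) (S k)).
  - rewrite rsum_S. generalize (rsum_nonneg (fun n => y ^ n / INR (fact n)) k (fun n _ => P n)). lra.
  - apply rsum_le_Series; [exact P|]. now exists (exp y).
Qed.

Lemma exp_partial_le (y : R) K : 0 <= y -> rsum (fun k => y ^ k / INR (fact k)) K <= exp y.
Proof.
  intros Hy. assert (H := is_exp_Reals y). assert (E : is_series (fun n => y ^ n / INR (fact n)) (exp y)) by est.
  rewrite <- (is_series_unique _ _ E). apply rsum_le_Series.
  - est.
  - now exists (exp y).
Qed.

Lemma ecf_abs (x d : R) k : 1 <= x -> 0 <= d -> Rabs (ecf x k) * d ^ k = (d * ln x) ^ k / INR (fact k).
Proof.
  intros Hx Hd. assert (0 <= ln x) by est. unfold ecf, Rdiv.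
  rewrite Rabs_mult, <- RPow_abs, Rabs_Ropp, (Rabs_pos_eq (ln x)) by lra. rewrite (Rabs_pos_eq (/ _)) by est.
  rewrite Rpow_mult_distr. ring.
Qed.

Lemma ecf_bound (x d : R) k : 1 <= x -> 0 <= d -> Rabs (ecf x k) * d ^ k <= Rpower x d.
Proof. intros Hx Hd. rewrite ecf_abs by lra. apply exp_term_le. est. Qed.

Lemma ecf_S (x : R) k : ecf x (S k) = - ln x * ecf x k / INR (S k).
Proof. unfold ecf. rewrite fact_simpl, mult_INR. simpl pow. field. est. Qed.

Lemma Lambda_le_ln n : Lambda (S n) <= ln (INR n + 1).
Proof.
  rewrite <- S_INR, <- Lambda_divsum by lia. rewrite rsum_S.
  replace (dvd (S n) (S n)) with true by (symmetry; apply Arithmetic.dvdb_spec; exists 1%nat; lia).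
  assert (0 <= rsum (fun d => if dvd d (S n) then Lambda d else 0) (S n)); [|lra]. apply rsum_nonneg. intros k _.
  destruct (dvd k (S n)); [apply Arithmetic.Lambda_nonneg|lra].
Qed.

(** Taylor coefficients at $c$: [zterm] those of $(n+1)^{-s}$, hence [zcoef] those of $\zeta$ and
    [lcoef] those of $\zeta'/\zeta$. *)
Definition zterm (c : C) (k n : nat) : C := (cpow_neg (INR n + 1) c * RtoC (ecf (INR n + 1) k))%C.
Definition lterm (c : C) (k n : nat) : C := (RtoC (Lambda (S n)) * zterm c k n)%C.
Definition zcoef (c : C) (k : nat) : C := CSeries (zterm c k).
Definition lcoef (c : C) (k : nat) : C := (- CSeries (lterm c k))%C.

Section DirichletSeries.
Variable c : C.
Hypothesis Hc : 1 < Re c.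

Lemma zterm_bound (d : R) k n : 0 < d -> Cmod (zterm c k n) * d ^ k <= Rpower (INR n + 1) (d - Re c).
Proof.
  intros Hd. unfold zterm. rewrite Cmod_mult, Cmod_cpow_neg, Cmod_R, Rmult_assoc.
  replace (d - Re c) with (- Re c + d) by lra. rewrite Rpower_plus. apply Rmult_le_compat_l; [est|].
  apply ecf_bound; [apply INR1_ge|lra].
Qed.

Lemma zterm_summable k : abs_summable (zterm c k).
Proof.
  set (d := (Re c - 1) / 2). assert (Hdk : 0 < d ^ k) by (apply pow_lt; unfold d; lra).
  apply abs_summable_le with (fun n => / d ^ k * Rpower (INR n + 1) (- d - 1)).
  - intros n. apply Rmult_le_reg_r with (d ^ k); [exact Hdk|]. eapply Rle_trans; [apply zterm_bound; unfold d; lra|].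
    replace (d - Re c) with (- d - 1) by (unfold d; field). right. field. lra.
  - apply (ex_series_scal (/ d ^ k) (fun n => Rpower (INR n + 1) (- d - 1))). apply pseries_ex. unfold d; lra.
Qed.

(** By [ecf_S] a factor $\log(n+1)$, which dominates [Lambda], raises the index by one, so the
    summable [zterm c (S k)] is a majorant. *)
Lemma lterm_summable k : abs_summable (lterm c k).
Proof.
  apply abs_summable_le with (fun n => INR (S k) * Cmod (zterm c (S k) n)).
  - intros n. unfold lterm, zterm. rewrite !Cmod_mult, !Cmod_R.
    rewrite (Rabs_pos_eq (Lambda _)) by apply Arithmetic.Lambda_nonneg. rewrite ecf_S. unfold Rdiv.
    rewrite !Rabs_mult, Rabs_Ropp.
    assert (L : 0 <= ln (INR n + 1)) by (rewrite <- ln_1; apply ln_le; [lra|apply INR1_ge]).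
    rewrite (Rabs_pos_eq (ln _)), (Rabs_pos_eq (/ _)) by est.
    replace (INR (S k) * (Cmod (cpow_neg (INR n + 1) c) * (ln (INR n + 1) * Rabs (ecf (INR n + 1) k) * / INR (S k))))
      with (ln (INR n + 1) * (Cmod (cpow_neg (INR n + 1) c) * Rabs (ecf (INR n + 1) k))) by alg.
    apply Rmult_le_compat_r; [|apply Lambda_le_ln]. est.
  - apply (ex_series_scal (INR (S k)) (fun n => Cmod (zterm c (S k) n))). apply zterm_summable.
Qed.

(** Coefficients of $\zeta\cdot(\zeta'/\zeta)=\zeta'$. The convolutions are summed first over the
    Taylor index, where [ecf_mult] collapses them, and then over divisors, where [Lambda_divsum]
    produces the logarithm. *)
Lemma zl_identity k :
  csum (fun i => zcoef c i * lcoef c (k - i))%C (S k) = (RtoC (INR (S k)) * zcoef c (S k))%C.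
Proof.
  assert (L1 : forall n, Clim (fun X => csum (fun i => csum (conv (lterm c (k - i)) (zterm c i)) X) n)
    (csum (fun i => CSeries (lterm c (k - i)) * CSeries (zterm c i))%C n)).
  { induction n as [|n IH]; [apply (Clim_const (RtoC 0))|].
    apply (Clim_plus (fun X => csum (fun i => csum (conv (lterm c (k - i)) (zterm c i)) X) n)
      (fun X => csum (conv (lterm c (k - n)) (zterm c n)) X)); [exact IH|].
    apply conv_Clim; [apply lterm_summable|apply zterm_summable]. }
  assert (L2 : Clim (fun X => csum (fun i => csum (conv (lterm c (k - i)) (zterm c i)) X) (S k))
    (- RtoC (INR (S k)) * zcoef c (S k))%C).
  { eapply Clim_ext; [|apply Clim_scal, (csum_Clim _ (zterm_summable (S k)))]. intros X.
    rewrite csum_swap, <- csum_scal. apply csum_ext. intros N _. symmetry. unfold conv. rewrite csum_swap.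
    rewrite (csum_ext _ (fun d => csum (fun m => if Nat.eqb (S d * S m) (S N) then
      (RtoC (Lambda (S d)) * (cpow_neg (INR N + 1) c * RtoC (ecf (INR N + 1) k)))%C else RtoC 0) (S N))).
    - assert (E := conv_factor (fun d => RtoC (Lambda (S d))) (fun _ => (cpow_neg (INR N + 1) c * RtoC (ecf (INR N + 1) k))%C)
        Lambda (cpow_neg (INR N + 1) c * RtoC (ecf (INR N + 1) k))%C N (fun d m _ => eq_refl)).
      unfold conv in E. rewrite E, Lambda_divsum by lia. unfold zterm. rewrite ecf_S, S_INR.
      transitivity (cpow_neg (INR N + 1) c * RtoC (- INR (S k) * (- ln (INR N + 1) * ecf (INR N + 1) k / INR (S
        k))))%C.
      +
        replace (- INR (S k) * (- ln (INR N + 1) * ecf (INR N + 1) k / INR (S k))) with (ln (INR N + 1) * ecf (INR N +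
          1) k) by alg.
        rewrite RtoC_mult. ring.
      + rewrite RtoC_mult, RtoC_opp. ring.
    - intros d Hd. rewrite csum_swap. apply csum_ext. intros m Hm. destruct (Nat.eqb_spec (S d * S m) (S N)) as [E|E].
      +
        rewrite (csum_ext _ (fun i => RtoC (Lambda (S d)) * (cpow_neg (INR N + 1) c) * RtoC (ecf (INR d + 1) (k - i) *
          ecf (INR m + 1) i))%C).
        * rewrite csum_scal, csum_RtoC, ecf_mult by est. rewrite <- !S_INR, <- mult_INR, E. ring.
        * intros i _. unfold lterm, zterm. rewrite <- (S_INR N), <- E, mult_INR, !S_INR. rewrite cpow_neg_mult by est.
          rewrite RtoC_mult. ring.
      + apply csum_zero. reflexivity. }
  assert (E := Clim_unique _ _ _ (L1 (S k)) L2). unfold zcoef, lcoef in *.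
  rewrite (csum_ext _ (fun i => - RtoC 1 * (CSeries (lterm c (k - i)) * CSeries (zterm c i)))%C) by alg.
  rewrite csum_scal, E. ring.
Qed.

Lemma zpart_term_lim k : Clim (fun N => cpow_neg (INR N + 1) (c - 1) * RtoC (ecf (INR N + 1) k))%C (RtoC 0).
Proof.
  set (d := (Re c - 1) / 2). assert (Hdk : 0 < d ^ k) by (apply pow_lt; unfold d; lra).
  apply Clim_dom with (fun N => / d ^ k * Rpower (INR N + 1) (- d)).
  - intros N.
    replace (cpow_neg (INR N + 1) (c - 1) * RtoC (ecf (INR N + 1) k) - 0)%C with
      (cpow_neg (INR N + 1) (c - 1) * RtoC (ecf (INR N + 1) k))%C by alg.
    rewrite Cmod_mult, Cmod_cpow_neg, Cmod_R. apply Rmult_le_reg_r with (d ^ k); [exact Hdk|].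
    replace (/ d ^ k * Rpower (INR N + 1) (- d) * d ^ k) with (Rpower (INR N + 1) (- d)) by alg.
    replace (- d) with (- (Re c - 1) + d) by (unfold d; field). rewrite Rpower_plus, Rmult_assoc.
    apply Rmult_le_compat_l; [est|]. apply ecf_bound; [apply INR1_ge|unfold d; lra].
  - replace (Finite 0) with (Rbar_mult (/ d ^ k) 0) by (simpl; f_equal; ring). apply is_lim_seq_scal_l.
    apply is_lim_seq_Rpower_neg. unfold d; lra.
Qed.

Definition zcoef_pred (k : nat) : C := match k with O => RtoC 0 | S j => zcoef c j end.

(** Multiplication by $s-1=(c-1)+z$. The partial sums telescope up to a boundary term at $N$, which
    vanishes in the limit because $\Re c>1$. *)
Lemma fcoef_zcoef k : fcoef c k = ((c - 1) * zcoef c k + zcoef_pred k)%C.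
Proof.
  set (pt := fun k n => (cpow_neg (INR n + 1) c * RtoC (ecf_pred (INR n + 1) k))%C).
  assert (Hp : forall k, abs_summable (pt k)).
  { intros [|j].
    - apply abs_summable_le with (fun n => 0 * 0).
      + intros n. unfold pt. rewrite Cmult_0_r, Cmod_0. lra.
      + apply (ex_series_scal 0 (fun _ => 0)). exists 0. apply (Series_finite (fun _ => 0) 0). reflexivity.
    - apply zterm_summable. }
  assert (Hp2 : CSeries (pt k) = zcoef_pred k).
  { destruct k as [|j]; [|reflexivity]. apply CSeries_unique. eapply Clim_ext; [|apply Clim_const]. symmetry.
    apply csum_zero. intros i _. unfold pt. simpl. ring. }
  assert (P : forall N, csum (fun n => bcoef c n k) N =
    ((c - 1) * csum (zterm c k) N + csum (pt k) N + cpow_neg (INR N + 1) (c - 1) * RtoC (ecf (INR N + 1) k)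
     - match k with O => RtoC 1 | _ => RtoC 0 end)%C).
  { induction N as [|N IH].
    - simpl. rewrite Rplus_0_l, cpow_neg_1. unfold ecf. rewrite ln_1, Ropp_0. destruct k as [|j].
      + simpl. replace (1 / 1) with 1 by lra. ring.
      + rewrite pow_i by lia. unfold Rdiv. rewrite Rmult_0_l. ring.
    - rewrite !csum_S, IH. unfold bcoef, zterm, pt. rewrite S_INR. replace (INR N + 1 + 1) with (INR N + 2) by lra.
      ring. }
  unfold fcoef.
  assert (L : Clim (csum (fun n => bcoef c n k)) ((c - 1) * zcoef c k + zcoef_pred k + 0 + - match k with O => RtoC 1
    | _ => RtoC 0 end)%C).
  { eapply Clim_ext; [intros N; symmetry; rewrite P; unfold Cminus at 1; reflexivity|].
    apply Clim_plus; [|apply Clim_const]. apply Clim_plus; [|apply zpart_term_lim].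
    apply Clim_plus; [apply Clim_scal; apply csum_Clim, zterm_summable|]. rewrite <- Hp2. apply csum_Clim, Hp. }
  rewrite (CSeries_unique _ _ L). ring.
Qed.

Hypothesis Hc1 : (c - 1)%C <> RtoC 0.

(** Taylor coefficients at $c$ of $1/(s-1)$; [gcoef] are then those of the logarithmic derivative of
    [fz]. *)
Definition ucoef (k : nat) : C := (RtoC ((-1) ^ k) / (c - 1) ^ (S k))%C.
Definition gcoef (k : nat) : C := (lcoef c k + ucoef k)%C.

Lemma ucoef_S k : ((c - 1) * ucoef (S k) + ucoef k)%C = RtoC 0.
Proof.
  unfold ucoef. replace ((-1) ^ S k) with (- (-1) ^ k) by alg. rewrite RtoC_opp. rewrite !Cpow_S. field.
  split; [now apply Cpow_nz|exact Hc1].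
Qed.

Lemma ucoef_0 : ((c - 1) * ucoef 0)%C = RtoC 1.
Proof. unfold ucoef. simpl. field. exact Hc1. Qed.

(** Coefficients of $f\cdot(f'/f)=f'$ for [fz]. The part from $1/(s-1)$ telescopes by [ucoef_S] and
    leaves exactly [zcoef c k]. *)
Lemma fg_identity k :
  csum (fun i => fcoef c i * gcoef (k - i))%C (S k) = (RtoC (INR (S k)) * fcoef c (S k))%C.
Proof.
  rewrite fcoef_zcoef. simpl zcoef_pred.
  assert (U : csum (fun i => ((c - 1) * zcoef c i + zcoef_pred i) * ucoef (k - i))%C (S k) = zcoef c k).
  { assert (G : forall n, (n <= k)%nat -> csum (fun i => ((c - 1) * zcoef c i + zcoef_pred i) * ucoef (k - i))%C (S n)
      = ((c - 1) * zcoef c n * ucoef (k - n))%C).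
    { induction n as [|n IH]; intros Hn.
      - simpl csum. ring.
      - rewrite csum_S, IH by lia. simpl zcoef_pred. replace (k - n)%nat with (S (k - S n)) by lia.
        replace ((c - 1) * zcoef c n * ucoef (S (k - S n)) + ((c - 1) * zcoef c (S n) + zcoef c n) * ucoef (k - S n))%C
          with (zcoef c n * ((c - 1) * ucoef (S (k - S n)) + ucoef (k - S n)) + (c - 1) * zcoef c (S n) * ucoef (k - S n))%C by alg.
        rewrite ucoef_S. ring. }
    rewrite G by lia. rewrite Nat.sub_diag.
    replace ((c - 1) * zcoef c k * ucoef 0)%C with (zcoef c k * ((c - 1) * ucoef 0))%C by alg. rewrite ucoef_0. ring. }
  assert (P : csum (fun i => zcoef_pred i * lcoef c (k - i))%C (S k) = (RtoC (INR k) * zcoef c k)%C).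
  { rewrite csum_shift. simpl zcoef_pred. destruct k as [|j]; [alg|].
    rewrite (csum_ext _ (fun i => zcoef c i * lcoef c (j - i))%C) by est. rewrite zl_identity. ring. }
  transitivity ((c - 1) * csum (fun i => zcoef c i * lcoef c (k - i)) (S k)
    + csum (fun i => zcoef_pred i * lcoef c (k - i)) (S k)
    + csum (fun i => ((c - 1) * zcoef c i + zcoef_pred i) * ucoef (k - i)) (S k))%C.
  - rewrite <- csum_scal, <- !csum_plus. apply csum_ext. intros i _. rewrite fcoef_zcoef. unfold gcoef. ring.
  - rewrite U, P, zl_identity, S_INR, RtoC_plus. ring.
Qed.

Lemma fz_zcoef : fz c = ((c - 1) * zcoef c 0)%C.
Proof.
  assert (H := fcoef_zcoef 0). rewrite Cplus_0_r in H. rewrite <- H. unfold fz, fcoef. f_equal. apply CSeries_ext.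
  intros n. unfold bterm, bcoef. unfold ecf. simpl. replace (1 / 1) with 1 by lra. ring.
Qed.

Definition mterm (n : nat) : C := (RtoC (mobius (S n)) * cpow_neg (INR n + 1) c)%C.

Lemma mterm_summable : abs_summable mterm.
Proof.
  apply abs_summable_le with (2 := zterm_summable 0). intros n. unfold mterm, zterm. rewrite !Cmod_mult, !Cmod_R.
  unfold ecf. simpl. replace (1 / 1) with 1 by lra. rewrite Rabs_R1.
  generalize (Arithmetic.mobius_bound (S n)) (Cmod_ge_0 (cpow_neg (INR n + 1) c)). nra.
Qed.

Lemma mobius_inverse : (CSeries mterm * zcoef c 0)%C = RtoC 1.
Proof.
  apply (Clim_unique (csum (conv mterm (zterm c 0)))).
  - apply conv_Clim; [apply mterm_summable|apply zterm_summable].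
  - apply is_lim_seq_incr_1. apply is_lim_seq_ext with (fun _ => 0); [|apply is_lim_seq_const]. intros X. symmetry.
    assert (E : csum (conv mterm (zterm c 0)) (S X) = RtoC 1).
    { rewrite csum_shift.
      assert (H : forall N, conv mterm (zterm c 0) N = (RtoC (if Nat.eqb (S N) 1 then 1 else 0) * cpow_neg (INR N + 1)
        c)%C).
      { intros N. rewrite <- mobius_divsum by lia. apply conv_factor. intros d m E. unfold mterm, zterm, ecf.
        simpl pow. simpl fact. replace (1 / INR 1) with 1 by alg.
        rewrite <- S_INR, <- (S_INR m), <- (S_INR N), <- E, mult_INR. rewrite cpow_neg_mult by est. ring. }
      rewrite H. simpl Nat.eqb. rewrite Rplus_0_l, cpow_neg_1. rewrite csum_zero; [ring|]. intros k _. rewrite H.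
      simpl Nat.eqb. cbv iota. ring. }
    rewrite E. replace (1 - 1)%C with (RtoC 0) by alg. apply Cmod_0.
Qed.

Lemma fz_mobius : (fz c * CSeries mterm)%C = (c - 1)%C.
Proof. rewrite fz_zcoef, <- Cmult_assoc, (Cmult_comm (zcoef c 0)), mobius_inverse. ring. Qed.

Lemma fz_neq0_gt1 : fz c <> RtoC 0.
Proof. intros E. apply Hc1. rewrite <- fz_mobius, E. ring. Qed.

Lemma lcoef_0_logder : fcoef c 1 = (fz c * gcoef 0)%C.
Proof.
  assert (H := fg_identity 0). simpl csum in H. simpl INR in H. replace (fz c) with (fcoef c 0).
  - replace (fcoef c 1) with (RtoC 1 * fcoef c 1)%C by alg. rewrite <- H. ring.
  - rewrite fz_zcoef, fcoef_zcoef. simpl zcoef_pred. ring.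
Qed.

Lemma fcoef_0 : fcoef c 0 = fz c.
Proof. rewrite fz_zcoef, fcoef_zcoef. simpl zcoef_pred. ring. Qed.
End DirichletSeries.

(** The summand [h] decreases from $3$ on, where the logarithm is at least $1$, so the sum is
    compared with the primitive [H]; $H(1)=-e^{-2}$, with $e$ the parameter, and $H\le0$ give the
    main term. The terms at $2$ and $3$ add at most $0.415+0.585=1$. *)
Lemma log_series_bound (e : R) n :
  0 < e <= 1 -> rsum (fun k => ln (INR k + 1) * Rpower (INR k + 1) (- e - 1)) n <= / e ^ 2 + 1.
Proof.
  intros He. set (h := fun x => ln x * Rpower x (- e - 1)).
  set (H := fun x => - Rpower x (- e) * (ln x / e + / e ^ 2)). assert (Hlnle : forall x, 0 < x -> ln x <= x - 1) .
  { intros x Hx. generalize (exp_ineq1_le (ln x)). rewrite exp_ln by lra. lra. }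
  assert (DH : forall x, 0 < x -> is_derive H x (h x)).
  { intros x Hx. unfold H, h. apply is_derive_ext with (fun x => Rpower x (- e) * (- (ln x / e + / e ^ 2))).
    { est. }
    replace (ln x * Rpower x (- e - 1)) with
      ((- e * Rpower x (- e - 1)) * (- (ln x / e + / e ^ 2)) + Rpower x (- e) * (- (/ x / e))).
    - apply (is_derive_mult (fun x => Rpower x (- e)) (fun x => - (ln x / e + / e ^ 2))).
      + now apply is_derive_Rpower.
      + auto_derive; [exact Hx|]. lra.
      + intros; apply Rmult_comm.
    - replace (Rpower x (- e)) with (x * Rpower x (- e - 1)).
      + field. lra.
      + rewrite <- (Rpower_1 x) at 1 by lra. rewrite <- Rpower_plus. f_equal. ring. }
  assert (H3 : exp 1 <= 3) by apply exp_le_3. assert (Hl3 : 1 <= ln 3).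
  { rewrite <- (ln_exp 1). est. }
  assert (Hdec : forall x y, 3 <= x <= y -> h y <= h x).
  { intros x y Hxy. destruct (MVT_gen h x y (fun z => Rpower z (- e - 2) * (1 - (e + 1) * ln z))) as [z [Hz E]].
    - intros z Hz. rewrite Rmin_left, Rmax_right in Hz by lra.
      replace (Rpower z (- e - 2) * (1 - (e + 1) * ln z)) with (/ z * Rpower z (- e - 1) + ln z * ((- e - 1) * Rpower
        z (- e - 1 - 1))).
      + apply (is_derive_mult ln (fun z => Rpower z (- e - 1))).
        * auto_derive; lra.
        * apply is_derive_Rpower. lra.
        * intros; apply Rmult_comm.
      + replace (- e - 1 - 1) with (- e - 2) by lra. replace (Rpower z (- e - 1)) with (z * Rpower z (- e - 2)).
        * field. lra.
        * rewrite <- (Rpower_1 z) at 1 by lra. rewrite <- Rpower_plus. f_equal. ring.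
    - intros z Hz. rewrite Rmin_left, Rmax_right in Hz by lra. apply continuity_pt_filterlim.
      apply (ex_derive_continuous h z). eexists. apply (is_derive_mult ln (fun z => Rpower z (- e - 1))).
      + auto_derive; [lra|reflexivity].
      + apply is_derive_Rpower. lra.
      + intros; apply Rmult_comm.
    - rewrite Rmin_left, Rmax_right in Hz by lra. assert (1 <= ln z) by (eapply Rle_trans; [exact Hl3|est]).
      assert (N0 : Rpower z (- e - 2) * (1 - (e + 1) * ln z) <= 0).
      { assert (G1 : 1 <= (e + 1) * ln z) by nra. assert (0 <= Rpower z (- e - 2) * ((e + 1) * ln z - 1)) by est. lra. }
      set (W := Rpower z (- e - 2) * (1 - (e + 1) * ln z)) in *. assert (0 <= - W * (y - x)) by est. lra. }
  assert (Hstep : forall x, 3 <= x -> h (x + 1) <= H (x + 1) - H x).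
  { intros x Hx. destruct (MVT_cor2 H h x (x + 1)) as [z [E Hz]]; [lra| |].
    - intros z Hz. apply is_derive_Reals. apply DH. lra.
    - assert (h (x + 1) <= h z) by (apply Hdec; lra). lra. }
  assert (Hneg : forall x, 1 <= x -> H x <= 0).
  { intros x Hx. unfold H. generalize (Rpower_pos x (- e)). assert (0 <= ln x / e) by est.
    assert (0 < / e ^ 2) by est. nra. }
  assert (HH1 : H 1 = - / e ^ 2).
  { unfold H. unfold Rpower. rewrite ln_1, Rmult_0_r, exp_0. lra. }
  assert (Hmono : H 1 <= H 3).
  { destruct (MVT_cor2 H h 1 3) as [z [E Hz]]; [lra| |].
    - intros z Hz. apply is_derive_Reals. apply DH. lra.
    - assert (0 <= ln z) by est. generalize (Rpower_pos z (- e - 1)). intros P. assert (0 <= h z) by (unfold h; nra).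
      lra. }
  assert (Rp : forall x, 1 <= x -> Rpower x (- e - 1) <= / x).
  { intros x Hx. rewrite <- (Rpower_1 x) at 2 by lra. rewrite <- Rpower_Ropp. est. }
  assert (h1 : h 1 = 0) by (unfold h; rewrite ln_1; ring). assert (L2 : ln 2 <= 0.83).
  { assert (E : ln 2 = 2 * ln (sqrt 2)).
    { rewrite <- (sqrt_sqrt 2) at 1 by lra. rewrite ln_mult by est. ring. }
    assert (sqrt 2 <= 1.415).
    { apply Rsqr_incr_0_var; [|lra]. rewrite Rsqr_sqrt by lra. unfold Rsqr. lra. }
    generalize (Hlnle (sqrt 2) ltac:(est)). lra. }
  assert (L3 : ln 3 <= 1.75).
  { assert (E : ln 3 = ln 2 + ln (3 / 2)) by (rewrite <- ln_mult by lra; f_equal; field).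
    generalize (Hlnle (3 / 2) ltac:(lra)). lra. }
  assert (h2 : h 2 <= 0.415).
  { apply Rle_trans with (0.83 * / 2); [|lra]. apply Rmult_le_compat; [|est|exact L2|apply Rp; lra]. est. }
  assert (h3 : h 3 <= 0.585).
  { apply Rle_trans with (1.75 * / 3); [|lra]. apply Rmult_le_compat; [lra|est|exact L3|apply Rp; lra]. }
  assert (P0 : 0 < / e ^ 2) by est. destruct n as [|[|[|n]]].
  - simpl rsum. lra.
  - rewrite rsum_S. change (ln (INR 0 + 1) * Rpower (INR 0 + 1) (- e - 1)) with (h (0 + 1)).
    replace (0 + 1) with 1 by lra. simpl rsum. lra.
  - rewrite !rsum_S. change (ln (INR 0 + 1) * Rpower (INR 0 + 1) (- e - 1)) with (h (0 + 1)).
    change (ln (INR 1 + 1) * Rpower (INR 1 + 1) (- e - 1)) with (h 2). replace (0 + 1) with 1 by lra. simpl rsum. lra.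
  - assert (B : rsum (fun k => h (INR k + 1)) (S (S (S n))) <= 1 + (H (INR n + 3) - H 3)).
    { induction n as [|n IH].
      - simpl. replace (0 + 1) with 1 by lra. replace (1 + 1) with 2 by lra. replace (2 + 1) with 3 by lra.
        replace (0 + 3) with 3 by lra. lra.
      - rewrite rsum_S. generalize (Hstep (INR n + 3) ltac:(generalize (pos_INR n); lra)).
        replace (INR (S (S (S n))) + 1) with (INR n + 3 + 1) by (rewrite !S_INR; ring).
        replace (INR (S n) + 3) with (INR n + 3 + 1) by (rewrite !S_INR; ring). lra. }
    change (rsum (fun k => h (INR k + 1)) (S (S (S n))) <= / e ^ 2 + 1).
    generalize (Hneg (INR n + 3) ltac:(generalize (pos_INR n); lra)). lra.
Qed.

Lemma zeta_real_lower (e : R) : 0 < e -> / e <= Series (fun k => Rpower (INR k + 1) (- e - 1)).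
Proof.
  intros He. destruct (pseries_ex e He) as [E1 _].
  assert (St : forall n, e * rsum (fun k => Rpower (INR k + 1) (- e - 1)) n >= 1 - Rpower (INR n + 1) (- e)).
  { induction n as [|n IH].
    -
      assert (P1 : Rpower (INR 0 + 1) (- e) = 1) by (simpl INR; rewrite Rplus_0_l; unfold Rpower; rewrite ln_1,
        Rmult_0_r; apply exp_0).
      simpl rsum. lra.
    - rewrite rsum_S.
      destruct (MVT_cor2 (fun x => Rpower x (- e)) (fun x => - e * Rpower x (- e - 1)) (INR n + 1) (INR n + 2)) as [c
        [E Hc]].
      + lra.
      + intros c Hc. apply derivable_pt_lim_power. generalize (pos_INR n). lra.
      +
        assert (Rpower c (- e - 1) <= Rpower (INR n + 1) (- e - 1)) by (apply Rpower_le_base; generalize (pos_INR n);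
          lra).
        rewrite S_INR. replace (INR n + 1 + 1) with (INR n + 2) by lra. nra. }
  apply Rmult_le_reg_l with e; [lra|]. rewrite Rinv_r by lra.
  assert (L1 : is_lim_seq (fun n => 1 - Rpower (INR n + 1) (- e)) (1 - 0)) by (apply is_lim_seq_minus'; [apply is_lim_seq_const|now apply is_lim_seq_Rpower_neg]).
  assert (L2 : is_lim_seq (fun n => e * rsum (fun k => Rpower (INR k + 1) (- e - 1)) n)
    (e * Series (fun k => Rpower (INR k + 1) (- e - 1)))).
  { apply (is_lim_seq_scal_l _ e (Finite _)). now apply rsum_lim_Series. }
  assert (L3 : Rbar_le (1 - 0) (e * Series (fun k => Rpower (INR k + 1) (- e - 1)))).
  { refine (is_lim_seq_le _ _ _ _ _ L1 L2). intros n. apply Rge_le, St. }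
  simpl in L3. lra.
Qed.

(** The series is $-\zeta'/\zeta$ at $1+e$. There $-\zeta'\le e^{-2}+1$ and $\zeta\ge e^{-1}$; the
    quotient $e^{-1}+e$ is at most the stated bound because $e\le1$. *)
Theorem Lambda_series_bound (e : R) :
  0 < e <= 1 ->
  ex_series (fun k => Lambda (S k) * Rpower (INR k + 1) (- e - 1)) /\
  Series (fun k => Lambda (S k) * Rpower (INR k + 1) (- e - 1)) <= / e + 1.
Proof.
  intros He. set (c := RtoC (1 + e)). assert (Hc : 1 < Re c) by (simpl; lra).
  assert (Cp : forall n, cpow_neg (INR n + 1) c = RtoC (Rpower (INR n + 1) (- e - 1))).
  { intros n. rewrite cpow_neg_cis. simpl. rewrite Rmult_0_l, Ropp_0, cis_0.
    replace (- (1 + e)) with (- e - 1) by lra. ring. }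
  assert (E0 : forall x, ecf x 0 = 1) by (intros; unfold ecf; simpl; field).
  assert (T : forall n, lterm c 0 n = RtoC (Lambda (S n) * Rpower (INR n + 1) (- e - 1))).
  { intros n. unfold lterm, zterm. rewrite Cp, E0, RtoC_mult. ring. }
  assert (Hex : ex_series (fun k => Lambda (S k) * Rpower (INR k + 1) (- e - 1))).
  { apply ex_series_ext with (2 := lterm_summable c Hc 0). intros n. rewrite T, Cmod_R, Rabs_pos_eq; [reflexivity|].
    apply Rmult_le_pos; [apply Arithmetic.Lambda_nonneg|est]. }
  split; [exact Hex|]. assert (I := zl_identity c Hc 0). rewrite csum_S in I.
  assert (Z0 : zcoef c 0 = RtoC (Series (fun k => Rpower (INR k + 1) (- e - 1)))).
  { unfold zcoef, CSeries, RtoC. f_equal.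
    - apply Series_ext. intros n. unfold zterm. rewrite Cp, E0. simpl. ring.
    - transitivity (Series (fun _ => 0)); [|apply (Series_finite_eq (fun _ => 0) 0); reflexivity]. apply Series_ext.
      intros n. unfold zterm. rewrite Cp, E0. simpl. ring. }
  assert (L0 : lcoef c 0 = RtoC (- Series (fun k => Lambda (S k) * Rpower (INR k + 1) (- e - 1)))).
  { unfold lcoef. rewrite RtoC_opp. f_equal. unfold CSeries, RtoC. f_equal.
    - apply Series_ext. intros n. rewrite T. reflexivity.
    - transitivity (Series (fun _ => 0)); [|apply (Series_finite_eq (fun _ => 0) 0); reflexivity]. apply Series_ext.
      intros n. rewrite T. reflexivity. }
  assert (Z1 : - Re (zcoef c 1) <= / e ^ 2 + 1).
  { change (Re (zcoef c 1)) with (Series (fun n => Re (zterm c 1 n))). rewrite <- Series_opp.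
    destruct (ex_series_bounded (fun k => ln (INR k + 1) * Rpower (INR k + 1) (- e - 1)) (/ e ^ 2 + 1)) as [_ B].
    - intros k. apply Rmult_le_pos; [rewrite <- ln_1; apply ln_le; [lra|apply INR1_ge]|est].
    - intros n. now apply log_series_bound.
    - eapply Rle_trans; [|exact B]. right. apply Series_ext. intros n. unfold zterm. rewrite Cp, <- RtoC_mult.
      unfold ecf. simpl. field. }
  set (LS := Series (fun k => Lambda (S k) * Rpower (INR k + 1) (- e - 1))) in *.
  set (Z := Series (fun k => Rpower (INR k + 1) (- e - 1))) in *.
  assert (HZ : / e <= Z) by (apply zeta_real_lower; lra). assert (HL : 0 <= LS).
  { apply Series_nonneg; [|exact Hex]. intros k. apply Rmult_le_pos; [apply Arithmetic.Lambda_nonneg|est]. }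
  simpl (0 - 0)%nat in I. rewrite Z0, L0 in I. apply (f_equal Re) in I. rewrite Cplus_0_l, <- RtoC_mult, Re_scal in I.
  simpl INR in I. change (Re (RtoC (Z * - LS))) with (Z * - LS) in I. assert (K2 : LS * / e <= / e ^ 2 + 1) by nra.
  apply Rmult_le_reg_r with (/ e); [est|]. via K2. replace (/ e ^ 2) with (/ e * / e) by alg.
  assert (1 <= / e) by (rewrite <- Rinv_1; apply Rinv_le_contravar; lra). nra.
Qed.

(** At $\Re c=2$, summing absolute values against $(1-e)^k$ turns $n^{-2}$ into
    $n^{-2}n^{1-e}=n^{-1-e}$, which leads back to the von Mangoldt series at $1+e$. *)
Lemma lcoef_sum_bound (c : C) (e : R) K :
  Re c = 2 -> 0 < e < 1 -> rsum (fun k => Cmod (lcoef c k) * (1 - e) ^ k) K <= / e + 1.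
Proof.
  intros Hc He. assert (Hc1 : 1 < Re c) by lra. destruct (Lambda_series_bound e ltac:(lra)) as [E B].
  eapply Rle_trans; [|exact B]. set (d := 1 - e).
  apply Rle_trans with (rsum (fun k => d ^ k * Series (fun n => Cmod (lterm c k n))) K).
  { apply rsum_le. intros k _. rewrite Rmult_comm. apply Rmult_le_compat_l; [apply pow_le; unfold d; lra|].
    unfold lcoef. rewrite Cmod_opp. apply CSeries_Cmod. now apply lterm_summable. }
  assert (G : forall n, is_series (fun j => rsum (fun k => d ^ k * Cmod (lterm c k j)) n)
    (rsum (fun k => d ^ k * Series (fun j => Cmod (lterm c k j))) n)).
  { induction n as [|n IH]; [apply (Series_finite (fun _ => 0) 0); reflexivity|].
    apply (is_series_plus _ (fun j => d ^ n * Cmod (lterm c n j))); [exact IH|].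
    apply (is_series_scal (d ^ n) (fun j => Cmod (lterm c n j))). apply Series_correct. now apply lterm_summable. }
  rewrite <- (is_series_unique _ _ (G K)). apply Series_le; [|exact E]. intros j. split.
  - apply rsum_nonneg. intros k _. apply Rmult_le_pos; [apply pow_le; unfold d; lra|est].
  -
    rewrite (rsum_ext _ (fun k => Lambda (S j) * Rpower (INR j + 1) (- (2)) * ((d * ln (INR j + 1)) ^ k / INR (fact
      k)))).
    + rewrite rsum_scal. replace (- e - 1) with (- (2) + d) by (unfold d; ring). rewrite Rpower_plus, <- Rmult_assoc.
      apply Rmult_le_compat_l.
      * apply Rmult_le_pos; [apply Arithmetic.Lambda_nonneg|est].
      * apply exp_partial_le. apply Rmult_le_pos; [unfold d; lra|]. rewrite <- ln_1; apply ln_le; [lra|apply INR1_ge].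
    + intros k _. unfold lterm, zterm. rewrite !Cmod_mult, !Cmod_R, Cmod_cpow_neg, Hc.
      rewrite (Rabs_pos_eq (Lambda _)) by apply Arithmetic.Lambda_nonneg.
      rewrite <- ecf_abs by (try apply INR1_ge; unfold d; lra). ring.
Qed.

(** * Holomorphy and contour shifts *)

Lemma is_derive_quad (f : R -> R) (x l K h0 : R) :
  0 < h0 -> (forall y, Rabs (y - x) <= h0 -> Rabs (f y - f x - (y - x) * l) <= K * (y - x) ^ 2) ->
  is_derive f x l.
Proof.
  intros Hh H. apply is_derive_Reals. intros eps Heps. assert (HK : 0 < Rabs K + 1) by est.
  assert (Hd : 0 < Rmin h0 (eps / (Rabs K + 1))) by est. exists (mkposreal _ Hd). intros h Hn Hlt. simpl in Hlt.
  assert (H1 := Rmin_l h0 (eps / (Rabs K + 1))). assert (H2 := Rmin_r h0 (eps / (Rabs K + 1))).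
  assert (Hq := H (x + h)). replace (x + h - x) with h in Hq by lra.
  assert (Ha : 0 < Rabs h) by (now apply Rabs_pos_lt).
  replace ((f (x + h) - f x) / h - l) with ((f (x + h) - f x - h * l) / h) by alg. unfold Rdiv.
  rewrite Rabs_mult, Rabs_inv. apply Rmult_lt_reg_r with (Rabs h); [exact Ha|].
  rewrite Rmult_assoc, Rinv_l, Rmult_1_r by lra.
  assert (Hh2 : h ^ 2 = Rabs h * Rabs h) by (rewrite <- Rabs_mult, Rabs_pos_eq; nra).
  assert (K <= Rabs K) by apply Rle_abs. assert (Rabs h * (Rabs K + 1) < eps) by (apply Rlt_le_trans with (eps / (Rabs K + 1) * (Rabs K + 1)); [est|right; field; lra]).
  nra.
Qed.

(* Holomorphy with a uniform quadratic remainder: this form is stable under the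
   algebraic operations and gives Cauchy's theorem on rectangles by subdivision. *)
Definition qd (S : C -> Prop) (G dG : C -> C) : Prop :=
  exists K h0, 0 < h0 /\ 0 <= K /\
    (forall s s', S s -> S s' -> Cmod (s' - s)%C <= h0 ->
       Cmod (G s' - G s - (s' - s) * dG s)%C <= K * Cmod (s' - s)%C ^ 2) /\
    (forall s, S s -> Cmod (G s) <= K /\ Cmod (dG s) <= K).

(** For the derivative, the expansions at $s$ and at $s'$ are added: their sum is
    $(s'-s)(G'(s')-G'(s))$. *)
Lemma qd_lip S G dG : qd S G dG -> exists L h0, 0 < h0 /\ 0 <= L /\
  (forall s s', S s -> S s' -> Cmod (s' - s)%C <= h0 ->
     Cmod (G s' - G s)%C <= L * Cmod (s' - s)%C /\ Cmod (dG s' - dG s)%C <= L * Cmod (s' - s)%C).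
Proof.
  intros [K [h0 [Hh [HK [H1 H2]]]]]. exists (K * h0 + 2 * K), h0. split; [exact Hh|]. split; [nra|].
  intros s s' Hs Hs' Hd. assert (Hd0 := Cmod_ge_0 (s' - s)%C). split.
  - destruct (H2 s Hs) as [_ B]. specialize (H1 s s' Hs Hs' Hd).
    replace (G s' - G s)%C with ((G s' - G s - (s' - s) * dG s) + (s' - s) * dG s)%C by alg. via Cmod_triangle.
    rewrite Cmod_mult. set (d := Cmod (s' - s)%C) in *. assert (0 <= K * d * (h0 - d)) by est.
    assert (d * Cmod (dG s) <= d * K) by est. assert (0 <= K * d) by est. lra.
  - assert (A := H1 s s' Hs Hs' Hd). assert (E : Cmod (s - s')%C = Cmod (s' - s)%C).
    { rewrite <- Cmod_opp. f_equal. ring. }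
    assert (B := H1 s' s Hs' Hs ltac:(lra)). rewrite E in B. destruct (Req_dec (Cmod (s' - s)%C) 0) as [Z|NZ].
    + apply Cmod_eq_0 in Z. assert (s' = s) by (replace s' with ((s' - s) + s)%C by ring; rewrite Z; ring). subst s'.
      replace (dG s - dG s)%C with (RtoC 0) by alg. rewrite Cmod_0. est.
    + apply Rmult_le_reg_l with (Cmod (s' - s)%C); [lra|]. rewrite <- Cmod_mult.
      replace ((s' - s) * (dG s' - dG s))%C with
        ((G s' - G s - (s' - s) * dG s) + (G s - G s' - (s - s') * dG s'))%C by alg.
      via Cmod_triangle. set (d := Cmod (s' - s)%C) in *. assert (0 <= K * h0 * d * d) by est. lra.
Qed.

Lemma qd_mult S F dF G dG :
  qd S F dF -> qd S G dG -> qd S (fun s => F s * G s)%C (fun s => dF s * G s + F s * dG s)%C.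
Proof.
  intros HF HG. destruct (qd_lip _ _ _ HG) as [L [h1 [Hh1 [HL HLip]]]]. destruct HF as [K [h0 [Hh [HK [H1 H2]]]]].
  destruct HG as [M [h2 [Hh2 [HM [G1 G2]]]]]. exists (K * (M + L * h1) + 2 * (K * M) + K * L), (Rmin h0 (Rmin h1 h2)).
  assert (P1 : 0 <= K * M) by nra. assert (P2 : 0 <= K * L) by nra. assert (P4 : 0 <= K * (M + L * h1)) by est.
  split; [repeat apply Rmin_glb_lt; auto|]. split; [nra|]. split.
  - intros s s' Hs Hs' Hd. assert (D1 : Cmod (s' - s)%C <= h1) by est. destruct (HLip s s' Hs Hs' D1) as [L1 _].
    destruct (H2 s Hs) as [B1 B2]. destruct (G2 s' Hs') as [B3 _].
    replace (F s' * G s' - F s * G s - (s' - s) * (dF s * G s + F s * dG s))%C with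
      ((F s' - F s - (s' - s) * dF s) * G s' + F s * (G s' - G s - (s' - s) * dG s) + (s' - s) * dF s * (G s' - G s))%C by alg.
    via Cmod_triangle. eapply Rle_trans; [apply Rplus_le_compat_r, Cmod_triangle|]. rewrite !Cmod_mult.
    set (d := Cmod (s' - s)%C) in *. assert (Hd0 : 0 <= d) by apply Cmod_ge_0.
    assert (T1 : Cmod (F s' - F s - (s' - s) * dF s)%C * Cmod (G s') <= (K * d ^ 2) * M) by est.
    assert (T2 : Cmod (F s) * Cmod (G s' - G s - (s' - s) * dG s)%C <= K * (M * d ^ 2)) by est.
    assert (T3 : d * Cmod (dF s) * Cmod (G s' - G s)%C <= d * K * (L * d)) by est. nra.
  - intros s Hs. destruct (H2 s Hs) as [B1 B2]. destruct (G2 s Hs) as [B3 B4]. split.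
    + rewrite Cmod_mult. assert (Cmod (F s) * Cmod (G s) <= K * M) by est. lra.
    + via Cmod_triangle. rewrite !Cmod_mult. assert (Cmod (dF s) * Cmod (G s) <= K * M) by est.
      assert (Cmod (F s) * Cmod (dG s) <= K * M) by est. lra.
Qed.

Lemma qd_inv S G dG m :
  0 < m -> (forall s, S s -> m <= Cmod (G s)) -> qd S G dG ->
  qd S (fun s => / G s)%C (fun s => - (dG s / (G s * G s)))%C.
Proof.
  intros Hm Hlow HG. destruct (qd_lip _ _ _ HG) as [L [h1 [Hh1 [HL HLip]]]].
  destruct HG as [K [h0 [Hh [HK [H1 H2]]]]]. assert (Im : 0 < / m) by est.
  exists (K / m ^ 2 + K * L / m ^ 3 + / m), (Rmin h0 h1). assert (Q1 : 0 <= K / m ^ 2) by est.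
  assert (Q2 : 0 <= K * L / m ^ 3) by est.
  assert (NZ : forall s, S s -> G s <> RtoC 0) by (intros s Hs; apply Cmod_gt_neq0; specialize (Hlow s Hs); lra).
  assert (INV : forall s, S s -> Cmod (/ G s)%C <= / m).
  { intros s Hs. rewrite Cmod_inv by est. est. }
  split; [est|]. split; [lra|]. split.
  - intros s s' Hs Hs' Hd. assert (D1 : Cmod (s' - s)%C <= h1) by est. destruct (HLip s s' Hs Hs' D1) as [L1 _].
    destruct (H2 s Hs) as [B1 B2].
    replace (/ G s' - / G s - (s' - s) * - (dG s / (G s * G s)))%C with
      (- ((G s' - G s - (s' - s) * dG s) * (/ G s * / G s')) + (s' - s) * dG s * (G s' - G s) * (/ G s * / G s * / G s'))%C
      by alg.
    via Cmod_triangle. rewrite Cmod_opp, !Cmod_mult. set (d := Cmod (s' - s)%C) in *.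
    assert (Hd0 : 0 <= d) by apply Cmod_ge_0.
    assert (T1 : Cmod (G s' - G s - (s' - s) * dG s)%C * (Cmod (/ G s)%C * Cmod (/ G s')%C) <= (K * d ^ 2) * (/ m * /
      m)) by est.
    assert (T2 : d * Cmod (dG s) * Cmod (G s' - G s)%C * (Cmod (/ G s)%C * Cmod (/ G s)%C * Cmod (/ G s')%C) <= (d * K
      * (L * d)) * (/ m * / m * / m)) by est.
    assert (E1 : K * d ^ 2 * (/ m * / m) = K / m ^ 2 * d ^ 2) by alg.
    assert (E2 : d * K * (L * d) * (/ m * / m * / m) = K * L / m ^ 3 * d ^ 2) by alg.
    assert (0 <= / m * d ^ 2) by nra. lra.
  - intros s Hs. destruct (H2 s Hs) as [B1 B2]. assert (I1 := INV s Hs).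
    replace (- (dG s / (G s * G s)))%C with (- (dG s * (/ G s * / G s)))%C by alg. rewrite Cmod_opp, !Cmod_mult.
    assert (Cmod (dG s) * (Cmod (/ G s)%C * Cmod (/ G s)%C) <= K * (/ m * / m)) by est.
    replace (K * (/ m * / m)) with (K / m ^ 2) in H by alg. lra.
Qed.

Lemma qd_plus S F dF G dG :
  qd S F dF -> qd S G dG -> qd S (fun s => F s + G s)%C (fun s => dF s + dG s)%C.
Proof.
  intros [K [h0 [Hh [HK [H1 H2]]]]] [M [h2 [Hh2 [HM [G1 G2]]]]]. exists (K + M), (Rmin h0 h2).
  split; [now apply Rmin_glb_lt|]. split; [lra|]. split.
  - intros s s' Hs Hs' Hd. assert (D0 : Cmod (s' - s)%C <= h0) by est. assert (D1 : Cmod (s' - s)%C <= h2) by est.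
    replace (F s' + G s' - (F s + G s) - (s' - s) * (dF s + dG s))%C with
      ((F s' - F s - (s' - s) * dF s) + (G s' - G s - (s' - s) * dG s))%C by alg.
    via Cmod_triangle. specialize (H1 s s' Hs Hs' D0). specialize (G1 s s' Hs Hs' D1). lra.
  - intros s Hs. destruct (H2 s Hs). destruct (G2 s Hs). est.
Qed.

Lemma qd_const S c : qd S (fun _ => c) (fun _ => RtoC 0).
Proof.
  exists (Cmod c), 1. assert (0 <= Cmod c) by est. repeat split; try lra.
  - intros s s' _ _ _. replace (c - c - (s' - s) * 0)%C with (RtoC 0) by alg. rewrite Cmod_0. est.
  - rewrite Cmod_0. lra.
Qed.

Lemma qd_id S B : (forall s, S s -> Cmod s <= B) -> qd S (fun s => s) (fun _ => RtoC 1).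
Proof.
  exists (Rabs B + 1), 1. assert (0 <= Rabs B) by est. repeat split; try lra.
  - intros s s' _ _ _. replace (s' - s - (s' - s) * 1)%C with (RtoC 0) by alg. rewrite Cmod_0. est.
  - specialize (H s H1). generalize (Rle_abs B). lra.
  - rewrite Cmod_1. lra.
Qed.

Lemma cexp_plus a b : cexp (a + b)%C = (cexp a * cexp b)%C.
Proof.
  unfold cexp. rewrite Re_plus. replace (Im (a + b)%C) with (Im a + Im b) by est.
  rewrite exp_plus, cis_plus, RtoC_mult. ring.
Qed.

Lemma Cmod_cexp a : Cmod (cexp a) = exp (Re a).
Proof. unfold cexp. rewrite Cmod_mult, Cmod_cis, Cmod_R, Rabs_pos_eq; [ring|est]. Qed.

Lemma cexp_quad (w : C) : Cmod w <= 1 -> Cmod (cexp w - 1 - w)%C <= 6 * Cmod w ^ 2.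
Proof.
  intros Hw. assert (H := exp_rem_bound w 2 1 ltac:(lra)). unfold exp_rem in H. rewrite !csum_S in H.
  replace (RtoC 1 * w)%C with w in H by alg. replace (RtoC (1 ^ 0 / INR (fact 0))) with (RtoC 1) in H by alg.
  replace (RtoC (1 ^ 1 / INR (fact 1))) with (RtoC 1) in H by alg.
  replace (cexp w - 1 - w)%C with (cexp w - (0 + 1 * w ^ 0 + 1 * w ^ 1))%C by alg. via H.
  replace ((2 * Cmod w) ^ 2 * 1 ^ 2 / INR (fact 2)) with (2 * Cmod w ^ 2) by alg. assert (exp (Cmod w) <= 3) by (eapply Rle_trans; [apply exp_le, Hw|apply exp_le_3]).
  nra.
Qed.

Lemma qd_cexp S (a : C) B :
  (forall s, S s -> Re (a * s)%C <= B) -> qd S (fun s => cexp (a * s)) (fun s => a * cexp (a * s))%C.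
Proof.
  intros H. set (A := Cmod a). assert (HA : 0 <= A) by apply Cmod_ge_0.
  assert (HE : forall s, S s -> Cmod (cexp (a * s)) <= exp B) by (intros s Hs; rewrite Cmod_cexp; apply exp_le; auto).
  assert (EB := exp_pos B). exists (exp B * (6 * A ^ 2) + exp B * (1 + A)), (/ (A + 1)).
  assert (0 <= exp B * (6 * A ^ 2)) by est. assert (0 <= exp B * (1 + A)) by est. split; [est|]. split; [lra|]. split.
  - intros s s' Hs Hs' Hd.
    replace (cexp (a * s') - cexp (a * s) - (s' - s) * (a * cexp (a * s)))%C with
      (cexp (a * s) * (cexp (a * (s' - s)) - 1 - a * (s' - s)))%C.
    2:{ replace (a * s')%C with (a * s + a * (s' - s))%C by alg. rewrite cexp_plus. ring. }
    rewrite Cmod_mult. assert (W : Cmod (a * (s' - s))%C <= 1).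
    { rewrite Cmod_mult. fold A. apply Rle_trans with ((A + 1) * / (A + 1)); [est|]. right. field. lra. }
    assert (Q := cexp_quad _ W). rewrite Cmod_mult in Q. set (d := Cmod (s' - s)%C) in *.
    assert (Cmod (cexp (a * s)) * Cmod (cexp (a * (s' - s)) - 1 - a * (s' - s))%C <= exp B * (6 * (A * d) ^ 2)) by
      est.
    assert (0 <= exp B * (1 + A) * d ^ 2) by nra. lra.
  - intros s Hs. specialize (HE s Hs). split; [nra|]. rewrite Cmod_mult. fold A.
    assert (A * Cmod (cexp (a * s)) <= A * exp B) by est. lra.
Qed.

(** Multiplied by $r^2$ to avoid the exponent $k-2$. The truncated subtraction [k - 1] matters only
    at $k=0$, where the factor [INR k] vanishes. *)
Lemma pow_diff_quad (z h : C) (r : R) k :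
  0 < r -> Cmod z <= r -> Cmod (z + h)%C <= r ->
  Cmod ((z + h) ^ k - z ^ k - h * (RtoC (INR k) * z ^ (k - 1)))%C * r ^ 2 <= INR k ^ 2 * r ^ k * Cmod h ^ 2.
Proof.
  intros Hr Hz Hzh. induction k as [|k IH].
  - simpl Cpow. replace (1 - 1 - h * (RtoC (INR 0) * 1))%C with (RtoC 0) by alg. rewrite Cmod_0. simpl. lra.
  - replace ((z + h) ^ S k - z ^ S k - h * (RtoC (INR (S k)) * z ^ (S k - 1)))%C with
      ((z + h) * ((z + h) ^ k - z ^ k - h * (RtoC (INR k) * z ^ (k - 1))) + RtoC (INR k) * (h * h) * z ^ (k - 1))%C.
    + eapply Rle_trans; [apply Rmult_le_compat_r; [est|apply Cmod_triangle]|].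
      rewrite (Cmod_mult (z + h)), !Cmod_mult, Cmod_R, Cmod_pow, Rabs_pos_eq by est.
      assert (T1 : Cmod (z + h)%C * Cmod ((z + h) ^ k - z ^ k - h * (RtoC (INR k) * z ^ (k - 1)))%C * r ^ 2 <= r *
        (INR k ^ 2 * r ^ k * Cmod h ^ 2)).
      { rewrite Rmult_assoc. est. }
      assert (T2 : INR k * (Cmod h * Cmod h) * Cmod z ^ (k - 1) * r ^ 2 <= INR k * Cmod h ^ 2 * r ^ S k).
      { destruct k as [|j]; [simpl; lra|]. replace (S j - 1)%nat with j by lia.
        replace (INR (S j) * Cmod h ^ 2 * r ^ S (S j)) with (INR (S j) * (Cmod h * Cmod h) * r ^ j * r ^ 2) by alg.
        est. }
      rewrite S_INR. simpl (r ^ S k) in *. assert (HR2 : 0 <= (r * r ^ k) * Cmod h ^ 2) by est.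
      assert (HR3 : 0 <= INR k * (r * r ^ k) * Cmod h ^ 2) by est. lra.
    + replace (S k - 1)%nat with k by lia. rewrite S_INR, RtoC_plus. destruct k as [|j]; [alg|].
      replace (S j - 1)%nat with j by lia. rewrite !Cpow_S. ring.
Qed.

Lemma ex_series_quad_geom (q : R) : 0 <= q < 1 -> ex_series (fun k => INR k ^ 2 * q ^ k).
Proof.
  intros Hq. set (e := (1 - q) / 4). assert (He : 0 < e) by (unfold e; lra).
  assert (Hp : (1 + e) ^ 2 * q < 1) by (unfold e; nra). assert (Bn : forall k, INR k <= / e * (1 + e) ^ k).
  { intros k. assert (1 + INR k * e <= (1 + e) ^ k).
    { induction k as [|k IH]; [simpl; lra|]. rewrite S_INR. simpl. generalize (pos_INR k). nra. }
    apply Rmult_le_reg_l with e; [lra|]. replace (e * (/ e * (1 + e) ^ k)) with ((1 + e) ^ k) by alg. lra. }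
  apply ex_series_Rle with (fun k => / e ^ 2 * ((1 + e) ^ 2 * q) ^ k).
  - intros k. rewrite Rabs_pos_eq by est. rewrite Rpow_mult_distr, <- pow_mult.
    replace (/ e ^ 2 * ((1 + e) ^ (2 * k) * q ^ k)) with ((/ e * (1 + e) ^ k) ^ 2 * q ^ k).
    + est.
    + rewrite Rpow_mult_distr, <- pow_mult, (Nat.mul_comm k 2), pow_inv. ring.
  - apply (ex_series_scal (/ e ^ 2) (fun k => ((1 + e) ^ 2 * q) ^ k)). apply ex_series_geom_R. est.
Qed.

(** * Power series and their quadratic remainder *)

Definition pser (a : nat -> C) (z : C) : C := CSeries (fun k => a k * z ^ k)%C.
Definition dpser (a : nat -> C) (z : C) : C := CSeries (fun k => a k * (RtoC (INR k) * z ^ (k - 1)))%C.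

(** [K] is chosen before the sequence [a], so that in [qd_fz] one constant serves for all centres
    $2+it$ of bounded height. *)
Lemma pser_quad (A rho r : R) :
  0 < r < rho -> 0 <= A -> exists K, 0 <= K /\ forall a, (forall k, Cmod (a k) * rho ^ k <= A) ->
   (forall z, Cmod z <= r -> Cmod (pser a z) <= K /\ Cmod (dpser a z) <= K) /\
   (forall z h, Cmod z <= r -> Cmod (z + h)%C <= r ->
      Cmod (pser a (z + h) - pser a z - h * dpser a z)%C <= K * Cmod h ^ 2).
Proof.
  intros Hr HA. set (q := r / rho). assert (Hq : 0 < q < 1) by (unfold q; split; [est|est]).
  assert (SQ : ex_series (fun k => INR k ^ 2 * q ^ k)) by (apply ex_series_quad_geom; lra).
  assert (SG : ex_series (fun k => q ^ k)) by (apply ex_series_geom_R; lra).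
  set (S2 := Series (fun k => INR k ^ 2 * q ^ k)). set (S0 := Series (fun k => q ^ k)).
  assert (P2 : 0 <= S2) by (apply Series_nonneg; [est|exact SQ]).
  assert (P0 : 0 <= S0) by (apply Series_nonneg; [est|exact SG]). assert (Hr2 : 0 < r ^ 2) by est.
  assert (Q1 : 0 <= A * S0) by nra. assert (Q2 : 0 <= A / r * S2) by est. assert (Q3 : 0 <= A / r ^ 2 * S2) by est.
  exists (A * S0 + A / r * S2 + A / r ^ 2 * S2). split; [lra|]. intros a Ha.
  assert (Hk : forall k, Cmod (a k) * r ^ k <= A * q ^ k).
  { intros k. replace (r ^ k) with (rho ^ k * q ^ k); [|rewrite <- Rpow_mult_distr; f_equal; unfold q; field; lra].
    rewrite <- Rmult_assoc. est. }
  assert (B1 : forall z k, Cmod z <= r -> Cmod (a k * z ^ k)%C <= A * q ^ k).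
  { intros z k Hz. rewrite Cmod_mult, Cmod_pow. eapply Rle_trans; [|est]. est. }
  assert (B2 : forall z k, Cmod z <= r -> Cmod (a k * (RtoC (INR k) * z ^ (k - 1)))%C <= A / r * (INR k ^ 2 * q ^ k)).
  { intros z k Hz. rewrite !Cmod_mult, Cmod_R, Cmod_pow, Rabs_pos_eq by est. destruct k as [|k]; [simpl; lra|].
    replace (S k - 1)%nat with k by lia. assert (HS : 1 <= INR (S k)) by (rewrite S_INR; generalize (pos_INR k); lra).
    assert (Cmod z ^ k <= r ^ k) by est. apply Rle_trans with (Cmod (a (S k)) * (INR (S k) ^ 2 * r ^ k)).
    - apply Rmult_le_compat_l; [est|]. apply Rmult_le_compat; [lra|est|nra|auto].
    - replace (A / r * (INR (S k) ^ 2 * q ^ S k)) with (INR (S k) ^ 2 * / r * (A * q ^ S k)) by lra.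
      replace (Cmod (a (S k)) * (INR (S k) ^ 2 * r ^ k)) with (INR (S k) ^ 2 * / r * (Cmod (a (S k)) * r ^ S k)) by
        alg.
      est. }
  assert (E1 : forall z, Cmod z <= r -> abs_summable (fun k => a k * z ^ k)%C).
  { intros z Hz. apply abs_summable_le with (1 := fun k => B1 z k Hz). now apply (ex_series_scal A (fun k => q ^ k)). }
  assert (E2 : forall z, Cmod z <= r -> abs_summable (fun k => a k * (RtoC (INR k) * z ^ (k - 1)))%C).
  { intros z Hz. apply abs_summable_le with (1 := fun k => B2 z k Hz).
    now apply (ex_series_scal (A / r) (fun k => INR k ^ 2 * q ^ k)). }
  assert (Dom : forall (u : nat -> C) D v, abs_summable u -> (forall k, Cmod (u k) <= D * v k) -> ex_series v -> Cmod
    (CSeries u) <= D * Series v).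
  { intros u D v Hu Hv Hex. eapply Rle_trans; [apply CSeries_Cmod, Hu|]. rewrite <- Series_scal_l.
    apply Series_le; [est|]. now apply (ex_series_scal D v). }
  split.
  - split.
    + assert (Cmod (pser a z) <= A * S0) by (apply Dom; auto). lra.
    + assert (Cmod (dpser a z) <= A / r * S2) by (apply Dom; auto). lra.
  - intros z h Hz Hzh.
    assert (E : (pser a (z + h) - pser a z - h * dpser a z)%C =
      CSeries (fun k => a k * ((z + h) ^ k - z ^ k - h * (RtoC (INR k) * z ^ (k - 1))))%C /\
      abs_summable (fun k => a k * ((z + h) ^ k - z ^ k - h * (RtoC (INR k) * z ^ (k - 1))))%C).
    { assert (F1 := abs_summable_scal (- RtoC 1) _ (E1 z Hz)). assert (F2 := abs_summable_scal (- h) _ (E2 z Hz)).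
      assert (F3 := abs_summable_plus _ _ F1 F2). assert (F4 := abs_summable_plus _ _ (E1 _ Hzh) F3). split.
      - unfold pser, dpser.
        transitivity (CSeries (fun k => a k * (z + h) ^ k + (- RtoC 1 * (a k * z ^ k) + - h * (a k * (RtoC (INR k) * z
          ^ (k - 1)))))%C).
        + rewrite CSeries_plus, CSeries_plus, !CSeries_scal by est. ring.
        + apply CSeries_ext. intros k. ring.
      - eapply abs_summable_ext; [|exact F4]. intros k. cbv beta. ring. }
    destruct E as [-> ES].
    assert (Cmod (CSeries (fun k => a k * ((z + h) ^ k - z ^ k - h * (RtoC (INR k) * z ^ (k - 1))))%C)
      <= (A / r ^ 2 * Cmod h ^ 2) * S2).
    { apply Dom; auto. intros k. rewrite Cmod_mult. apply Rmult_le_reg_r with (r ^ 2); [lra|].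
      replace (A / r ^ 2 * Cmod h ^ 2 * (INR k ^ 2 * q ^ k) * r ^ 2) with (INR k ^ 2 * Cmod h ^ 2 * (A * q ^ k)) by
        alg.
      rewrite Rmult_assoc. eapply Rle_trans; [apply Rmult_le_compat_l; [est|apply pow_diff_quad; [lra| |]; auto]|].
      replace (Cmod (a k) * (INR k ^ 2 * r ^ k * Cmod h ^ 2)) with (INR k ^ 2 * Cmod h ^ 2 * (Cmod (a k) * r ^ k)) by
        lra.
      est. }
    assert (0 <= (A * S0 + A / r * S2) * Cmod h ^ 2) by est. lra.
Qed.

Lemma fz_pser (c z : C) (rho : R) : 0 < rho < Re c -> Cmod z < rho -> fz (c + z)%C = pser (fcoef c) z.
Proof.
  intros Hr Hz. symmetry. apply CSeries_unique. apply is_lim_seq_incr_1. set (q := Cmod z / rho).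
  assert (Hq : 0 <= q < 1).
  { unfold q. est. }
  set (D := 4 * ((Cmod c + rho) * (Cmod c + rho + 1)) * (1 + / (Re c - rho))).
  apply is_lim_seq_le_le with (fun _ => 0) (fun K => D * / (1 - q) * q ^ S K).
  - intros K. split; [est|]. rewrite <- Cmod_opp.
    replace (- (csum (fun k => fcoef c k * z ^ k) (S K) - fz (c + z)))%C with
      (fz (c + z) - csum (fun k => fcoef c k * z ^ k) (S K))%C by alg.
    via ((fz_power_series_err c rho Hr z K Hz)). fold q. unfold D, Rdiv. est.
  - apply is_lim_seq_const.
  - replace (Finite 0) with (Rbar_mult (D * / (1 - q)) 0) by (simpl; f_equal; ring). apply is_lim_seq_scal_l.
    apply (is_lim_seq_incr_1 (fun n => q ^ n)). apply is_lim_seq_geom. rewrite Rabs_pos_eq; lra.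
Qed.

Definition rect (a b V : R) (s : C) : Prop := a <= Re s <= b /\ Rabs (Im s) <= V.

(** Each point is expanded around the point of the same height on $\Re s=2$; the disc of convergence
    there reaches the line $\Re s=0$. *)
Definition center (s : C) : C := (2, Im s).
Definition dfz (s : C) : C := dpser (fcoef (center s)) (s - center s)%C.

Lemma qd_fz (a V : R) : 0 < a <= 2 -> 0 <= V -> exists dF, qd (rect a 2 V) fz dF.
Proof.
  intros Ha HV. set (r := 2 - a / 2). set (rho := 2 - a / 4). set (D := 4 * ((2 + V + rho) * (2 + V + rho + 1))).
  set (A := 1 + D * (1 + / (2 - rho))). assert (Hr : 0 < r < rho) by (unfold r, rho; lra).
  assert (Hrho : 0 < rho < 2) by (unfold rho; lra). assert (Hi : 0 < / (2 - rho)) by est.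
  assert (HD : 0 <= D) by (unfold D; nra). assert (HA : 0 <= A) by (unfold A; nra).
  destruct (pser_quad A rho r Hr HA) as [K [HK HP]].
  assert (Fc : forall t, Rabs t <= V -> forall k, Cmod (fcoef (2, t) k) * rho ^ k <= A).
  { intros t Ht k. eapply Rle_trans; [apply fcoef_bound; simpl; lra|]. unfold A. simpl Re.
    assert (Cmod (2, t) <= 2 + V).
    { via Cmod_le_Re_Im. simpl. est. }
    unfold D. est. }
  exists dfz, K, (a / 2). split; [lra|]. split; [exact HK|]. split.
  - intros s s' [Hs1 Hs2] [Hs1' Hs2'] Hd. destruct (HP (fcoef (center s)) (Fc (Im s) Hs2)) as [_ HQ].
    set (z := (s - center s)%C). set (h := (s' - s)%C). assert (Hz : Cmod z <= 2 - a).
    { via Cmod_le_Re_Im. destruct s as [x y]. simpl in *. replace (y + - y) with 0 by lra.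
      rewrite Rabs_R0, Rabs_left1; lra. }
    assert (Hzh : Cmod (z + h)%C <= r).
    { via Cmod_triangle. unfold r. fold h in Hd. lra. }
    assert (E1 : fz s = pser (fcoef (center s)) z) by (rewrite <- (fz_pser (center s) z rho); [f_equal; unfold z; ring|est|unfold rho; lra]).
    assert (E2 : fz s' = pser (fcoef (center s)) (z + h)%C) by (rewrite <- (fz_pser (center s) (z + h) rho); [f_equal; unfold z, h; ring|est|lra]).
    rewrite E1, E2. apply HQ; unfold r; [lra|exact Hzh].
  - intros s [Hs1 Hs2]. destruct (HP (fcoef (center s)) (Fc (Im s) Hs2)) as [HQ _]. set (z := (s - center s)%C).
    assert (Hz : Cmod z <= 2 - a).
    { via Cmod_le_Re_Im. destruct s as [x y]. simpl in *. replace (y + - y) with 0 by lra.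
      rewrite Rabs_R0, Rabs_left1; lra. }
    assert (E1 : fz s = pser (fcoef (center s)) z) by (rewrite <- (fz_pser (center s) z rho); [f_equal; unfold z; ring|est|unfold rho; lra]).
    rewrite E1. apply HQ. unfold r. lra.
Qed.

(** Cauchy's theorem for a vertical integral of $\Re G$: since $\partial_t\Im G=\Re G'$, the
    integral of $\Re G'$ over the segment is a difference of two values of $\Im G$, so the vertical
    integral moves with speed at most $2M$. The height $V+1$ leaves room for two-sided derivatives
    at $t=\pm V$. *)
Lemma rect_shift (G dG : C -> C) (a b V M : R) :
  a <= b -> 0 < V -> qd (rect a b (V + 1)) G dG ->
  (forall x, a <= x <= b -> Cmod (G (x, V)) <= M /\ Cmod (G (x, - V)) <= M) ->
  ex_RInt (fun t => Re (G (b, t))) (- V) V /\ ex_RInt (fun t => Re (G (a, t))) (- V) V /\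
  Rabs (RInt (fun t => Re (G (b, t))) (- V) V - RInt (fun t => Re (G (a, t))) (- V) V) <= 2 * M * (b - a).
Proof.
  intros Hab HV HG HM. destruct (qd_lip _ _ _ HG) as [L [h1 [Hh1 [HL HLip]]]].
  destruct HG as [K [h0 [Hh0 [HK [H1 H2]]]]].
  assert (In : forall x t, a <= x <= b -> Rabs t <= V + 1 -> rect a b (V + 1) (x, t)) by (intros; split; simpl; auto).
  assert (Dv : forall x t t', ((x, t') - (x, t))%C = (RtoC 0 + Ci * RtoC (t' - t))%C).
  { intros. unfold Ci, RtoC, Cminus, Cplus, Cmult, Copp; simpl. f_equal; ring. }
  assert (Dm : forall x t t', Cmod ((x, t') - (x, t))%C = Rabs (t' - t)).
  { intros. rewrite Dv, Cplus_0_l, Cmod_mult, Cmod_R. unfold Ci at 1, Cmod; simpl.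
    replace (0 * (0 * 1) + 1 * (1 * 1)) with 1 by lra. rewrite sqrt_1. ring. }
  assert (Dh : forall x x' t, ((x', t) - (x, t))%C = RtoC (x' - x)).
  { intros. unfold RtoC, Cminus, Cplus, Copp; simpl. f_equal; ring. }
  assert (ContLoc : forall (F : C -> C), (forall s s', rect a b (V + 1) s -> rect a b (V + 1) s' -> Cmod (s' - s)%C <= h1 -> Cmod (F s' - F s)%C <= L * Cmod (s' - s)%C) ->
    forall x t, a <= x <= b -> - V <= t <= V -> continuous (fun t => Re (F (x, t))) t).
  { intros F HF x t Hx Ht. apply continuity_pt_filterlim. intros eps Heps.
    set (d := Rmin (Rmin h1 1) (eps / (L + 1))).
    assert (Hd : 0 < d) by (unfold d; repeat apply Rmin_glb_lt; try lra; apply Rdiv_lt_0_compat; lra). exists d.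
    split; [exact Hd|]. intros t' [_ Ht']. unfold dist in *; simpl in *; unfold R_dist in *.
    assert (A1 : Rabs (t' - t) < h1) by (eapply Rlt_le_trans; [exact Ht'|]; unfold d; eapply Rle_trans; [apply
      Rmin_l|apply Rmin_l]).
    assert (A2 : Rabs (t' - t) < 1) by (eapply Rlt_le_trans; [exact Ht'|]; unfold d; eapply Rle_trans; [apply
      Rmin_l|apply Rmin_r]).
    assert (A3 : Rabs (t' - t) < eps / (L + 1)) by (eapply Rlt_le_trans; [exact Ht'|apply Rmin_r]).
    apply Rabs_lt_between in A2.
    assert (Q := HF (x, t) (x, t') (In x t Hx ltac:(est)) (In x t' Hx ltac:(est)) ltac:(rewrite Dm; lra)).
    rewrite Dm in Q. rewrite <- Re_minus. eapply Rle_lt_trans; [apply Re_le_Cmod|]. eapply Rle_lt_trans; [exact Q|].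
    apply Rle_lt_trans with ((L + 1) * Rabs (t' - t)); [est|].
    apply Rlt_le_trans with ((L + 1) * (eps / (L + 1))); [est|]. right. field. lra. }
  assert (exG : forall x, a <= x <= b -> ex_RInt (fun t => Re (G (x, t))) (- V) V).
  { intros x Hx. apply (ex_RInt_continuous (V := R_CompleteNormedModule)). intros t Ht.
    rewrite Rmin_left, Rmax_right in Ht by lra. apply ContLoc; auto. now apply HLip. }
  assert (DI : forall x, a <= x <= b -> is_RInt (fun t => Re (dG (x, t))) (- V) V (Im (G (x, V)) - Im (G (x, - V)))).
  { intros x Hx.
    apply (is_RInt_derive (V := R_CompleteNormedModule) (fun t => Im (G (x, t))) (fun t => Re (dG (x, t)))).
    - intros t Ht. rewrite Rmin_left, Rmax_right in Ht by lra. apply is_derive_quad with K (Rmin h0 1); [est|].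
      intros t' Ht'. assert (A1 := Rmin_l h0 1). assert (A2 := Rmin_r h0 1). assert (A3 : Rabs (t' - t) <= 1) by lra.
      apply Rabs_le_between in A3.
      assert (Q := H1 (x, t) (x, t') (In x t Hx ltac:(est)) (In x t' Hx ltac:(est)) ltac:(rewrite Dm; lra)).
      rewrite Dm, Dv in Q. rewrite pow2_abs in Q. eapply Rle_trans; [|exact Q]. eapply Rle_trans; [|apply Im_le_Cmod].
      right. f_equal. destruct (G (x, t')), (G (x, t)), (dG (x, t)). unfold Ci, RtoC; simpl. ring.
    - intros t Ht. rewrite Rmin_left, Rmax_right in Ht by lra. apply ContLoc; auto. now apply HLip. }
  split; [apply exG; lra|]. split; [apply exG; lra|]. set (Gam := fun x => RInt (fun t => Re (G (x, t))) (- V) V).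
  assert (Step : forall x x', a <= x <= b -> a <= x' <= b -> Rabs (x' - x) <= h0 ->
    Rabs (Gam x' - Gam x) <= Rabs (x' - x) * (2 * M) + 2 * V * K * (x' - x) ^ 2).
  { intros x x' Hx Hx' Hd. set (E := Im (G (x, V)) - Im (G (x, - V))).
    assert (I1 : is_RInt (fun t => Re (G (x', t)) - Re (G (x, t)) - (x' - x) * Re (dG (x, t))) (- V) V (Gam x' - Gam x
      - (x' - x) * E)).
    {
      apply (is_RInt_minus (V := R_NormedModule) (fun t => Re (G (x', t)) - Re (G (x, t))) (fun t => (x' - x) * Re (dG
        (x, t)))).
      -
        apply (is_RInt_minus (V := R_NormedModule) (fun t => Re (G (x', t))) (fun t => Re (G (x, t)))); apply
          (RInt_correct (V := R_CompleteNormedModule)); auto.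
      - apply (is_RInt_scal (V := R_NormedModule) (fun t => Re (dG (x, t))) (- V) V (x' - x)). est. }
    assert (B : Rabs (Gam x' - Gam x - (x' - x) * E) <= (V - - V) * (K * (x' - x) ^ 2)).
    {
      apply (norm_RInt_le_const (V := R_NormedModule) (fun t => Re (G (x', t)) - Re (G (x, t)) - (x' - x) * Re (dG (x,
        t))) (- V) V _ (K * (x' - x) ^ 2)); [lra| |exact I1].
      intros t Ht.
      assert (Q := H1 (x, t) (x', t) (In x t Hx ltac:(est)) (In x' t Hx' ltac:(est)) ltac:(rewrite Dh, Cmod_R; lra)).
      rewrite Dh, Cmod_R, pow2_abs in Q. eapply Rle_trans; [|exact Q]. eapply Rle_trans; [|apply Re_le_Cmod]. right.
      unfold norm; simpl; unfold abs; simpl. f_equal. destruct (G (x', t)), (G (x, t)), (dG (x, t)).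
      unfold RtoC; simpl. ring. }
    assert (HE : Rabs E <= 2 * M).
    { via Rabs_triang. rewrite Rabs_Ropp. destruct (HM x Hx).
      generalize (Im_le_Cmod (G (x, V))) (Im_le_Cmod (G (x, - V))). lra. }
    replace (Gam x' - Gam x) with ((Gam x' - Gam x - (x' - x) * E) + (x' - x) * E) by lra. via Rabs_triang.
    rewrite Rabs_mult. assert (Rabs (x' - x) * Rabs E <= Rabs (x' - x) * (2 * M)) by est. lra. }
    set (w := b - a).
  (* Over $n$ equal steps the quadratic errors add up to $O(1/n)$. *)
  assert (Sub : forall n, (0 < n)%nat -> w / INR n <= h0 -> Rabs (Gam b - Gam a) <= 2 * M * w + 2 * V * K * w ^ 2 * /
    INR n).
  { intros n Hn Hsm. assert (Hn0 : 0 < INR n) by est. set (p := fun j => a + w * (INR j / INR n)).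
    assert (Hw : 0 <= w) by (unfold w; lra). assert (Hp : forall j, (j <= n)%nat -> a <= p j <= b).
    { intros j Hj. unfold p. assert (0 <= INR j / INR n <= 1) by (split; [est|apply Rle_div_l; [lra|]; rewrite Rmult_1_l; now apply le_INR]).
      unfold w in *. nra. }
    assert (Hdp : forall j, p (S j) - p j = w / INR n) by (intros; unfold p; rewrite S_INR; field; lra).
    assert (Hwn : 0 <= w / INR n) by est.
    assert (Ind : forall j, (j <= n)%nat -> Rabs (Gam (p j) - Gam a) <= INR j * (w / INR n * (2 * M) + 2 * V * K * (w
      / INR n) ^ 2)).
    { induction j as [|j IH]; intros Hj.
      - unfold p. simpl INR. replace (a + w * (0 / INR n)) with a by lra. est.
      - replace (Gam (p (S j)) - Gam a) with ((Gam (p (S j)) - Gam (p j)) + (Gam (p j) - Gam a)) by lra.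
        via Rabs_triang. rewrite S_INR, Rmult_plus_distr_r, Rmult_1_l, Rplus_comm.
        apply Rplus_le_compat; [apply IH; lia|]. assert (Q := Step (p j) (p (S j)) (Hp j ltac:(lia)) (Hp (S j) Hj)).
        rewrite Hdp in Q. rewrite (Rabs_pos_eq (w / INR n)) in Q by lra. est. }
    assert (Q := Ind n (le_n n)). replace (p n) with b in Q by (unfold p, w; field; lra). via Q. right. field. lra. }
  assert (L1 : is_lim_seq (fun n => 2 * M * w + 2 * V * K * w ^ 2 * / INR n) (2 * M * w)).
  { replace (Finite (2 * M * w)) with (Finite (2 * M * w + 2 * V * K * w ^ 2 * 0)) by alg.
    apply is_lim_seq_plus'; [apply is_lim_seq_const|]. apply (is_lim_seq_scal_l _ (2 * V * K * w ^ 2) 0).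
    replace (Finite 0) with (Rbar_inv p_infty) by est. apply is_lim_seq_inv; [apply is_lim_seq_INR|discriminate]. }
  apply (is_lim_seq_le_loc (fun _ => Rabs (Gam b - Gam a)) _ (Rabs (Gam b - Gam a)) (2 * M * w)) with (3 := L1);
    [|apply is_lim_seq_const].
  destruct (nfloor_ex (Rabs (w / h0))) as [n0 Hn0]; [est|]. exists (S n0). intros n Hn. apply Sub; [lia|].
  assert (HSn : INR (S n0) <= INR n) by est. rewrite S_INR in HSn. assert (Hn1 := pos_INR n0).
  apply Rle_div_l; [lra|]. assert (Hwh : w / h0 <= INR n) by (generalize (Rle_abs (w / h0)); lra).
  apply (Rmult_le_compat_l h0) in Hwh; [|lra]. replace (h0 * (w / h0)) with w in Hwh by alg. lra.
Qed.

(** * Nonvanishing to the right of the critical line *)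

Lemma fz_local (c : C) : 0 < Re c -> exists K h0, 0 < h0 /\ 0 <= K /\
  forall h, Cmod h <= h0 -> Cmod (fz (c + h) - fz c - h * fcoef c 1)%C <= K * Cmod h ^ 2.
Proof.
  intros Hc. set (rho := Re c / 2). set (r := Re c / 4). assert (Hr : 0 < r < rho) by (unfold r, rho; lra).
  assert (HA := fcoef_bound c rho ltac:(unfold rho; lra)).
  set (A := 1 + 4 * ((Cmod c + rho) * (Cmod c + rho + 1)) * (1 + / (Re c - rho))) in *.
  assert (HA0 : 0 <= A) by (eapply Rle_trans; [|apply (HA 0%nat)]; simpl; rewrite Rmult_1_r; apply Cmod_ge_0).
  destruct (pser_quad A rho r Hr HA0) as [K [HK HP]]. destruct (HP (fcoef c) HA) as [_ HQ]. exists K, r.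
  split; [lra|]. split; [exact HK|]. intros h Hh. assert (E : dpser (fcoef c) (RtoC 0) = fcoef c 1).
  { apply CSeries_unique.
    apply Clim_dom with (fun n => if Nat.leb 2 n then 0 else Cmod (csum (fun k => fcoef c k * (INR k * (RtoC 0) ^ (k -
      1)))%C n - fcoef c 1)%C).
    - intros n. destruct (Nat.leb_spec 2 n) as [H|H]; [|lra].
      assert (E : csum (fun k => fcoef c k * (INR k * (RtoC 0) ^ (k - 1)))%C n = fcoef c 1).
      { induction n as [|n IH]; [lia|]. destruct (Nat.eq_dec n 1) as [->|Hn].
        - simpl. ring.
        - rewrite csum_S, IH by lia. destruct n as [|[|n]]; [lia|lia|]. replace (S (S n) - 1)%nat with (S n) by lia.
          rewrite Cpow_S. ring. }
      rewrite E. replace (fcoef c 1 - fcoef c 1)%C with (RtoC 0) by alg. rewrite Cmod_0. lra.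
    - apply is_lim_seq_ext_loc with (fun _ => 0); [|apply is_lim_seq_const]. exists 2%nat. intros n Hn.
      destruct (Nat.leb_spec 2 n); [reflexivity|lia]. }
  specialize (HQ (RtoC 0) h). rewrite Cmod_0, Cplus_0_l, E in HQ.
  rewrite <- (fz_pser c (RtoC 0) rho), <- (fz_pser c h rho), Cplus_0_r in HQ; [| unfold rho; lra| lra |unfold rho;
    lra| rewrite Cmod_0; lra].
  est.
Qed.

Lemma is_derive_ln_Cmod (G : R -> C) (x : R) (D : C) :
  G x <> RtoC 0 -> is_derive (fun x => Re (G x)) x (Re D) -> is_derive (fun x => Im (G x)) x (Im D) ->
  is_derive (fun x => ln (Cmod (G x))) x (Re (D / G x)%C).
Proof.
  intros Hn H1 H2. assert (P : 0 < Re (G x) ^ 2 + Im (G x) ^ 2).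
  { rewrite <- Cmod_sqr. est. }
  apply (is_derive_ext (fun x => / 2 * ln (Re (G x) ^ 2 + Im (G x) ^ 2))).
  - intros t. match goal with |- ?a = ?b => change (@eq R a b) end. unfold Cmod. change (Re (G t)) with (fst (G t)).
    change (Im (G t)) with (snd (G t)). destruct (Rle_lt_or_eq_dec 0 (fst (G t) ^ 2 + snd (G t) ^ 2)) as [Q|Q].
    { nra. }
    + assert (Q2 := sqrt_lt_R0 _ Q). rewrite <- (sqrt_sqrt _ (Rlt_le _ _ Q)) at 1. rewrite ln_mult by lra. lra.
    + rewrite <- Q, sqrt_0. unfold ln. destruct (Rlt_dec 0 0) as [F|F]; [destruct (Rlt_irrefl _ F)|ring].
  - assert (Hs : forall (f : R -> R) l, is_derive f x l -> is_derive (fun x => f x ^ 2) x (2 * f x * l)).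
    { intros f l Hf. replace (2 * f x * l) with (INR 2 * l * f x ^ 1) by alg. apply (is_derive_pow f 2 x l Hf). }
    assert (H3 := is_derive_plus _ _ _ _ _ (Hs _ _ H1) (Hs _ _ H2)).
    assert (H4 := is_derive_comp ln (fun x => Re (G x) ^ 2 + Im (G x) ^ 2) x _ _ (is_derive_ln _ P) H3).
    assert (H5 := is_derive_scal _ _ (/ 2) _ H4).
    replace (Re (D / G x)%C) with (/ 2 * scal (plus (2 * Re (G x) * Re D) (2 * Im (G x) * Im D)) (/ (Re (G x) ^ 2 + Im
      (G x) ^ 2))); [exact H5|].
    unfold scal, plus; simpl; unfold mult; simpl. destruct (G x) as [a b], D as [p q]. simpl in *. nra.
Qed.

Lemma is_derive_ln_fz (s t : R) : 1 < s ->
  is_derive (fun x => ln (Cmod (fz (x, t))) - ln (Cmod ((x, t) - 1)%C)) s (Re (lcoef (s, t) 0)).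
Proof.
  intros Hs. set (c := (s, t) : C). assert (Hc1 : (c - 1)%C <> RtoC 0).
  { intros E. apply (f_equal Re) in E. simpl in E. lra. }
  assert (Hc : 1 < Re c) by est. assert (Hf := fz_neq0_gt1 c Hc Hc1).
  destruct (fz_local c ltac:(lra)) as [K [h0 [Hh [HK Q]]]].
  assert (Q' : forall y, Rabs (y - s) <= h0 -> Cmod (fz (y, t) - fz (s, t) - RtoC (y - s) * fcoef c 1)%C <= K * (y -
    s) ^ 2).
  { intros y Hy. assert (Q1 := Q (RtoC (y - s)) ltac:(rewrite Cmod_R; exact Hy)). rewrite Cmod_R, pow2_abs in Q1.
    replace (c + RtoC (y - s))%C with ((y, t) : C) in Q1; [exact Q1|]. unfold c, RtoC, Cplus; simpl. f_equal; ring. }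
  replace (Re (lcoef c 0)) with (Re (fcoef c 1 / fz c)%C - Re (RtoC 1 / (c - 1))%C).
  -
    apply (is_derive_minus (K := R_AbsRing) (V := R_NormedModule) (fun x : R => ln (Cmod (fz (x, t)))) (fun x : R =>
      ln (Cmod ((x, t) - 1)%C)) s (Re (fcoef c 1 / fz c)%C) (Re (RtoC 1 / (c - 1))%C)).
    + apply (is_derive_ln_Cmod (fun x => fz (x, t))); [exact Hf| |].
      * apply is_derive_quad with K h0; [exact Hh|]. intros y Hy. eapply Rle_trans; [|est].
        eapply Rle_trans; [|apply Re_le_Cmod]. right. f_equal. unfold RtoC; simpl. ring.
      * apply is_derive_quad with K h0; [exact Hh|]. intros y Hy. eapply Rle_trans; [|est].
        eapply Rle_trans; [|apply Im_le_Cmod]. right. f_equal. unfold RtoC; simpl. ring.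
    + apply (is_derive_ln_Cmod (fun x => ((x, t) - 1)%C)); [exact Hc1| |].
      * apply (is_derive_ext (fun x => x - 1)); [est|]. auto_derive; auto.
      * auto_derive; auto.
  - rewrite (lcoef_0_logder c Hc Hc1). unfold gcoef, ucoef. rewrite <- Re_minus. f_equal. simpl pow. field. auto.
Qed.

(** $3+4\cos\theta+\cos2\theta=2(1+\cos\theta)^2\ge0$ under the von Mangoldt series. *)
Lemma lcoef_341 (s t : R) : 1 < s ->
  3 * Re (lcoef (s, 0) 0) + 4 * Re (lcoef (s, t) 0) + Re (lcoef (s, 2 * t) 0) <= 0.
Proof.
  intros Hs.
  assert (T : forall u n, Re (lterm (s, u) 0 n) = Lambda (S n) * Rpower (INR n + 1) (- s) * cos (u * ln (INR n + 1))).
  { intros u n. unfold lterm, zterm, ecf, cpow_neg, RtoC; simpl. field. }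
  assert (Su : forall u, ex_series (fun n => Re (lterm (s, u) 0 n))).
  { intros u. apply abs_summable_Re, lterm_summable. est. }
  assert (L : forall u, Re (lcoef (s, u) 0) = - Series (fun n => Re (lterm (s, u) 0 n))) by est. rewrite !L.
  assert (0 <= 3 * Series (fun n => Re (lterm (s, 0) 0 n)) + 4 * Series (fun n => Re (lterm (s, t) 0 n)) + Series (fun
    n => Re (lterm (s, 2 * t) 0 n))); [|lra].
  assert (E0 := ex_series_scal 3 _ (Su 0)). assert (E1 := ex_series_scal 4 _ (Su t)).
  rewrite <- !Series_scal_l, <- !Series_plus; auto; [|now apply (ex_series_plus _ _ E0 E1)].
  apply Series_nonneg; [|apply (ex_series_plus _ _ (ex_series_plus _ _ E0 E1) (Su (2 * t)))]. intros n.
  rewrite !T, Rmult_0_l, cos_0. replace (2 * t * ln (INR n + 1)) with (2 * (t * ln (INR n + 1))) by lra.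
  rewrite cos_2a_cos. set (x := cos _). assert (0 <= Lambda (S n)) by apply Arithmetic.Lambda_nonneg.
  assert (0 < Rpower (INR n + 1) (- s)) by est. assert (0 <= Lambda (S n) * Rpower (INR n + 1) (- s)) by nra.
  set (y := Lambda (S n) * Rpower (INR n + 1) (- s)) in *.
  replace (3 * (y * 1) + 4 * (y * x) + y * (2 * x * x - 1)) with (2 * y * (1 + x) ^ 2) by lra.
  apply Rmult_le_pos; [lra|apply pow2_ge_0].
Qed.

Lemma Cmod_pair_le (a b : R) : Cmod (a, b) <= Rabs a + Rabs b.
Proof. apply (Cmod_le_Re_Im (a, b)). Qed.

(** The classical argument with real logarithms. By [lcoef_341] the function [h] does not increase
    to the right of $1$, so near $1$ it stays at least [h 2]. A zero at $1+it$ would give $h(1+e)\le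
    C_n+(4-3)\log e$, where $-3\log e$ is due to the pole of $\zeta$ at $1$. *)
Lemma fz_neq0_line1 (t : R) : fz (1, t) <> RtoC 0.
Proof.
  destruct (Req_dec t 0) as [->|Ht].
  { change (fz (RtoC 1) <> RtoC 0). rewrite fz_1. apply C1_nz. }
  intros E. assert (Hta : 0 < Rabs t) by (now apply Rabs_pos_lt).
  set (l := fun u x => ln (Cmod (fz (x, u))) - ln (Cmod ((x, u) - 1)%C)).
  set (h := fun x => 3 * l 0 x + 4 * l t x + l (2 * t) x).
  set (dh := fun x => 3 * Re (lcoef (x, 0) 0) + 4 * Re (lcoef (x, t) 0) + Re (lcoef (x, 2 * t) 0)).
  assert (Dh : forall x, 1 < x -> is_derive h x (dh x)).
  { intros x Hx.
    apply (is_derive_plus (K := R_AbsRing) (V := R_NormedModule) (fun x : R => 3 * l 0 x + 4 * l t x) (l (2 * t)));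
      [|now apply is_derive_ln_fz].
    apply (is_derive_plus (K := R_AbsRing) (V := R_NormedModule) (fun x : R => 3 * l 0 x) (fun x => 4 * l t x)); apply
      (is_derive_scal (l _)); now apply is_derive_ln_fz. }
  assert (Hm : forall s, 1 < s < 2 -> h 2 <= h s).
  { intros s Hs. destruct (MVT_cor2 h dh s 2) as [x [E1 Hx]]; [lra|intros x Hx; apply is_derive_Reals, Dh; lra|].
    assert (Hx1 : 1 < x) by lra. assert (D0 := lcoef_341 x t Hx1). change (dh x <= 0) in D0.
    assert (0 <= - dh x * (2 - s)) by est. lra. }
  destruct (fz_local (1, t) ltac:(simpl; lra)) as [K [h0 [Hh0 [HK Q]]]].
  set (L := Cmod (fcoef (1, t) 1) + K * h0 + 1).
  assert (HL : 0 < L) by (unfold L; generalize (Cmod_ge_0 (fcoef (1, t) 1)); nra).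
  set (B := 9 + 4 * ((2 + Rabs (2 * t)) * (2 + Rabs (2 * t)))).
  set (Cn := 3 * ln 9 + 4 * ln L + ln B - 4 * ln (Rabs t) - ln (Rabs (2 * t))).
  (* The last argument makes $C_n+\log e$ at most [h 2 - 1], which is the contradiction. *)
  set (e := Rmin (1 / 2) (Rmin h0 (exp (h 2 - Cn - 1)))).
  assert (He : 0 < e) by (unfold e; repeat apply Rmin_glb_lt; try lra; apply exp_pos).
  assert (He1 : e <= 1 / 2) by apply Rmin_l.
  assert (He2 : e <= h0) by (eapply Rle_trans; [apply Rmin_r|apply Rmin_l]).
  assert (He3 : e <= exp (h 2 - Cn - 1)) by (eapply Rle_trans; [apply Rmin_r|apply Rmin_r]).
  assert (Hle : ln e <= h 2 - Cn - 1) by (rewrite <- (ln_exp (h 2 - Cn - 1)); now apply ln_le).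
  assert (Nz : forall u, 0 < Cmod (fz (1 + e, u))).
  { intros u. apply Cmod_gt_0, fz_neq0_gt1; [simpl; lra|]. intros E1. apply (f_equal Re) in E1. simpl in E1. lra. }
  assert (Fb : forall u, Cmod (fz (1 + e, u)) <= 9 + 4 * ((2 + Rabs u) * (2 + Rabs u))).
  { intros u. eapply Rle_trans; [apply fz_bound; simpl; lra|].
    assert (I : / Re (1 + e, u) <= 1) by (simpl; rewrite <- Rinv_1; apply Rinv_le_contravar; lra).
    assert (P1 : Cmod (1 + e, u) <= 2 + Rabs u).
    { via Cmod_pair_le. est. }
    assert (P2 : Cmod (((1 + e)%R, u) - 1)%C <= 2 + Rabs u).
    { via Cmod_le_Re_Im. simpl. replace (u + - 0) with u by lra. est. }
    assert (P3 : Cmod (1 + e, u) * Cmod (((1 + e)%R, u) - 1)%C <= (2 + Rabs u) * (2 + Rabs u)) by est.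
    assert (P4 : 0 <= Cmod (1 + e, u) * Cmod (((1 + e)%R, u) - 1)%C) by est. nra. }
  assert (U0 : l 0 (1 + e) <= ln 9 - ln e).
  { unfold l. replace (Cmod (((1 + e)%R, 0) - 1)%C) with e.
    - assert (ln (Cmod (fz (1 + e, 0))) <= ln 9); [|lra]. apply ln_le; [est|].
      eapply Rle_trans; [apply fz_bound; simpl; lra|].
      assert (I : / Re (1 + e, 0) <= 1) by (simpl; rewrite <- Rinv_1; apply Rinv_le_contravar; lra).
      assert (P1 : Cmod (1 + e, 0) = 1 + e) by (change ((1 + e, 0) : C) with (RtoC (1 + e)); rewrite Cmod_R; apply
        Rabs_pos_eq; lra).
      assert (P2 : Cmod (((1 + e)%R, 0) - 1)%C = e).
      { change ((1 + e, 0) : C) with (RtoC (1 + e)). rewrite <- RtoC_minus, Cmod_R. rewrite Rabs_pos_eq; lra. }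
      rewrite P1, P2. assert (0 <= (1 + e) * e <= 3 / 4) by nra.
      assert (2 * ((1 + e) * e) * (1 + / Re (1 + e, 0)) <= 2 * ((1 + e) * e) * 2) by est. lra.
    - change ((1 + e, 0) : C) with (RtoC (1 + e)). rewrite <- RtoC_minus, Cmod_R. rewrite Rabs_pos_eq; lra. }
  assert (G : forall u, 0 < Rabs u -> ln (Rabs u) <= ln (Cmod (((1 + e)%R, u) - 1)%C)).
  { intros u Hu. apply ln_le; [exact Hu|]. eapply Rle_trans; [|apply Im_le_Cmod]. right. simpl. f_equal. ring. }
  assert (U1 : l t (1 + e) <= ln L + ln e - ln (Rabs t)).
  { unfold l. assert (ln (Cmod (fz (1 + e, t))) <= ln L + ln e); [|specialize (G t Hta); lra].
    rewrite <- ln_mult by lra. apply ln_le; [est|]. assert (Q1 := Q (RtoC e)).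
    rewrite Cmod_R, Rabs_pos_eq in Q1 by lra.
    replace ((1, t) + RtoC e)%C with ((1 + e, t)%R : C) in Q1 by (unfold RtoC, Cplus; simpl; f_equal; ring).
    rewrite E in Q1.
    replace (fz (1 + e, t)) with ((fz ((1 + e)%R, t) - 0 - RtoC e * fcoef (1, t) 1) + RtoC e * fcoef (1, t) 1)%C by
      alg.
    via Cmod_triangle. rewrite Cmod_mult, Cmod_R, Rabs_pos_eq by lra. unfold L.
    assert (K * e ^ 2 <= K * h0 * e) by (assert (0 <= K * e * (h0 - e)) by (est); nra). nra. }
  assert (U2 : l (2 * t) (1 + e) <= ln B - ln (Rabs (2 * t))).
  { unfold l. assert (0 < Rabs (2 * t)) by (apply Rabs_pos_lt; lra).
    assert (ln (Cmod (fz (1 + e, 2 * t))) <= ln B) by est. specialize (G (2 * t) H). lra. }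
  specialize (Hm (1 + e) ltac:(lra)). unfold h in Hm at 2. unfold Cn in Hle. lra.
Qed.

(** [RiemannHypothesis] speaks of the open strip only; the line $\Re s=1$ and the half-plane beyond
    it are supplied by [fz_neq0_line1] and [fz_neq0_gt1]. *)
Theorem fz_neq0 (s : C) : RiemannHypothesis -> 1 / 2 < Re s -> fz s <> RtoC 0.
Proof.
  intros RH Hs. destruct (Rtotal_order (Re s) 1) as [H|[H|H]].
  - intros E. assert (E1 := eta_fz s ltac:(lra)). rewrite E, Cmult_0_r in E1. assert (Hs1 : (s - 1)%C <> RtoC 0).
    { intros E2. apply (f_equal Re) in E2. rewrite Re_minus in E2. simpl in E2. lra. }
    assert (E2 : eta s = RtoC 0).
    { replace (eta s) with (/ (s - 1) * ((s - 1) * eta s))%C by alg. rewrite E1. ring. }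
    assert (N : nontrivial_zero s).
    { split; [lra|]. unfold zeta. rewrite E2. unfold Cdiv. ring. }
    specialize (RH s N). lra.
  - destruct s as [a b]. simpl in H. subst a. apply fz_neq0_line1.
  - apply fz_neq0_gt1; [exact H|]. intros E2. apply (f_equal Re) in E2. rewrite Re_minus in E2. simpl in E2. lra.
Qed.

(** * A bound for 1 / zeta(s) *)

Lemma fz_lower_ge2 (s : C) : 2 <= Re s -> Cmod (s - 1)%C / 2 <= Cmod (fz s).
Proof.
  intros Hs. assert (E := fz_mobius s ltac:(lra)). destruct (pseries_ex 1 ltac:(lra)) as [E1 E2].
  assert (B : Cmod (CSeries (mterm s)) <= 2).
  { eapply Rle_trans; [apply CSeries_Cmod, mterm_summable; lra|]. apply Rle_trans with (1 + / 1); [|lra].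
    eapply Rle_trans; [|exact E2]. apply Series_le; [|exact E1]. split; [est|]. unfold mterm.
    rewrite Cmod_mult, Cmod_R, Cmod_cpow_neg. apply Rle_trans with (1 * Rpower (INR n + 1) (- Re s)).
    - apply Rmult_le_compat_r; [est|apply Arithmetic.mobius_bound].
    - rewrite Rmult_1_l. apply Rle_Rpower; [apply INR1_ge|lra]. }
  rewrite <- E, Cmod_mult. assert (0 <= Cmod (fz s)) by est. nra.
Qed.

(** Compactness through a gauge: around each point the radius is such that the Lipschitz bound lets
    [fz] lose at most half of its modulus, and a uniform lower bound for the radii becomes one for
    the modulus. *)
Lemma fz_min_box (a b v1 v2 : R) : 0 < a <= b -> b <= 2 ->
  (forall s, a <= Re s <= b -> v1 <= Im s <= v2 -> fz s <> RtoC 0) ->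
  exists m, 0 < m /\ forall s, a <= Re s <= b -> v1 <= Im s <= v2 -> m <= Cmod (fz s).
Proof.
  intros Ha Hb Hnz. set (V := Rabs v1 + Rabs v2).
  assert (HV : 0 <= V) by (unfold V; generalize (Rabs_pos v1) (Rabs_pos v2); lra).
  assert (HVb : forall y, v1 <= y <= v2 -> Rabs y <= V).
  { intros y Hy. apply Rabs_le. unfold V. generalize (Rle_abs v2) (Rle_abs (- v1)) (Rabs_pos v1) (Rabs_pos v2).
    rewrite Rabs_Ropp. lra. }
  destruct (qd_fz a V ltac:(lra) HV) as [dF HF]. destruct (qd_lip _ _ _ HF) as [L [h [Hh [HL HLip]]]].
  set (dl := fun u v => Rmin (h / 2) (Cmod (fz (u, v)) / (4 * (L + 1)))).
  assert (Hdl : forall u v, a <= u <= b -> v1 <= v <= v2 -> 0 < dl u v).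
  { intros u v Hu Hv. apply Rmin_glb_lt; [lra|]. est. }
  (* The radius is positive only inside the box; the default $1$ makes the gauge total. *)
  set (delta := fun u v => match Rlt_dec 0 (dl u v) with left p => mkposreal _ p | right _ => mkposreal 1 Rlt_0_1
    end).
  destruct (compactness_value_2d a b v1 v2 delta) as [d Hd]. exists (d * (L + 1)).
  split; [apply Rmult_lt_0_compat; [apply cond_pos|lra]|]. intros [x y] Hx Hy. simpl in Hx, Hy. apply Rnot_lt_le.
  intros Hlt. apply (Hd x y Hx Hy). intros [u [v [Hu [Hv [H1 [H2 H3]]]]]]. unfold delta in *.
  destruct (Rlt_dec 0 (dl u v)) as [p|p]; [|now apply p, Hdl]. simpl in H1, H2, H3.
  assert (D1 : dl u v <= h / 2) by apply Rmin_l.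
  assert (D2 : dl u v <= Cmod (fz (u, v)) / (4 * (L + 1))) by apply Rmin_r.
  assert (Dist : Cmod ((x, y) - (u, v))%C <= 2 * dl u v).
  { via Cmod_le_Re_Im. simpl. unfold Rminus in H1, H2. lra. }
  destruct (HLip (u, v) (x, y)) as [Q _]; [split; simpl; [lra|now apply HVb]|split; simpl; [lra|now apply HVb]|lra|].
  assert (Q2 : Cmod (fz (u, v)) <= Cmod (fz (x, y)) + L * (2 * dl u v)).
  { apply Rle_trans with (Cmod (fz (x, y)) + Cmod (fz (x, y) - fz (u, v))%C).
    - assert (Tr := Cmod_triangle (fz (x, y)) (- (fz (x, y) - fz (u, v)))%C). rewrite Cmod_opp in Tr.
      replace (fz (x, y) + - (fz (x, y) - fz (u, v)))%C with (fz (u, v)) in Tr by alg. exact Tr.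
    - nra. }
  apply (Rmult_le_compat_r (4 * (L + 1))) in D2; [|lra].
  replace (Cmod (fz (u, v)) / (4 * (L + 1)) * (4 * (L + 1))) with (Cmod (fz (u, v))) in D2 by alg.
  assert (d * (L + 1) <= dl u v * (L + 1)) by est. assert (0 <= L * dl u v) by est. lra.
Qed.

Lemma fz_min_rect (a V : R) : RiemannHypothesis -> 1 / 2 < a <= 2 ->
  exists m, 0 < m /\ forall s, rect a 2 V s -> m <= Cmod (fz s).
Proof.
  intros RH Ha. destruct (fz_min_box a 2 (- V) V ltac:(lra) ltac:(lra)) as [m [Hm H]].
  - intros s Hs _. apply fz_neq0; [exact RH|lra].
  - exists m. split; [exact Hm|]. intros s [H1 H2]. apply Rabs_le_between in H2. est.
Qed.

(* The power sums of the zeros of a Taylor polynomial are, up to sign, Taylor coefficients of fz'/fz. *)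
Lemma psum_gcoef (c : C) (ws : list C) (N : nat) :
  1 < Re c -> (c - 1)%C <> RtoC 0 -> (forall w, In w ws -> w <> RtoC 0) ->
  (forall k, (if Nat.leb k N then fcoef c k else RtoC 0) = (fcoef c 0 * ecoef ws k)%C) ->
  forall k, (k < N)%nat -> psum ws (S k) = (- gcoef c k)%C.
Proof.
  intros Hc Hc1 Hw He. assert (Hf0 : fcoef c 0 <> RtoC 0) by (rewrite fcoef_0 by auto; now apply fz_neq0_gt1).
  assert (Ha : forall k, (k <= N)%nat -> fcoef c k = (fcoef c 0 * ecoef ws k)%C).
  { intros k Hk. rewrite <- He. destruct (Nat.leb_spec k N); [reflexivity|lia]. }
  induction k as [k IH] using (well_founded_induction Wf_nat.lt_wf). intros Hk. assert (F := fg_identity c Hc Hc1 k).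
  assert (G := newton_identity ws k Hw).
  rewrite (csum_ext _ (fun i => fcoef c 0 * (ecoef ws i * gcoef c (k - i)))%C) in F.
  2:{ intros i Hi. rewrite Ha by lia. ring. }
  rewrite csum_scal, (Ha (S k)) in F by lia.
  assert (Z : csum (fun i => ecoef ws i * (gcoef c (k - i) + psum ws (k + 1 - i)))%C (S k) = RtoC 0).
  { rewrite (csum_ext _ (fun i => ecoef ws i * gcoef c (k - i) + ecoef ws i * psum ws (k + 1 - i))%C) by alg.
    rewrite csum_plus, G.
    replace (csum (fun i => ecoef ws i * gcoef c (k - i))%C (S k)) with (/ fcoef c 0 * (fcoef c 0 * csum (fun i =>
      ecoef ws i * gcoef c (k - i)) (S k)))%C by alg.
    rewrite F. field. exact Hf0. }
  rewrite csum_shift in Z. rewrite (csum_ext _ (fun _ => RtoC 0)) in Z.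
  - replace (csum (fun _ => RtoC 0) k) with (RtoC 0) in Z.
    + rewrite ecoef_0, Nat.sub_0_r in Z. replace (k + 1 - 0)%nat with (S k) in Z by lia.
      replace (psum ws (S k)) with ((1 * (gcoef c k + psum ws (S k)) + 0) - gcoef c k)%C by alg. rewrite Z. ring.
    + clear. induction k as [|k IH]; [reflexivity|]. rewrite csum_S, <- IH. ring.
  - intros i Hi. replace (k + 1 - S i)%nat with (S (k - S i)) by lia. rewrite IH by lia. ring.
Qed.

Lemma taylor_prodz (a : nat -> C) (N : nat) (ws : list C) (z : C) :
  (forall k, (if Nat.leb k N then a k else RtoC 0) = (a 0%nat * ecoef ws k)%C) ->
  csum (fun k => a k * z ^ k)%C (S N) = (a 0%nat * prodz ws z)%C.
Proof.
  intros He. set (n := Nat.max N (length ws)). rewrite <- (ecoef_prodz ws z n) by lia. rewrite <- csum_scal.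
  rewrite (csum_ext (fun k => a 0%nat * (ecoef ws k * z ^ k))%C (fun k => (if Nat.leb k N then a k else RtoC 0) * z ^
    k)%C).
  - rewrite (csum_zero_tail _ (S N) (S n)); [|lia|].
    2:{ intros k Hk. destruct (Nat.leb_spec k N); [lia|ring]. }
    apply csum_ext. intros k Hk. destruct (Nat.leb_spec k N); [reflexivity|lia].
  - intros k _. rewrite He. ring.
Qed.

Lemma prodz_root (ws : list C) (w : C) : In w ws -> (forall w, In w ws -> w <> RtoC 0) -> prodz ws w = RtoC 0.
Proof.
  intros Hw Hws. induction ws as [|a l IH]; [destruct Hw|]. simpl. destruct Hw as [->|Hw].
  - replace (1 - w / w)%C with (RtoC 0) by (field; apply Hws; now left). ring.
  - rewrite IH; auto; [ring|]. intros; apply Hws; now right.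
Qed.

(** Reflection in a circle requires that no zero lies on it; bisection avoids the finitely many
    forbidden radii. *)
Lemma avoid_radius (ws : list C) (a b : R) : a < b -> exists r, a < r < b /\ forall w, In w ws -> Cmod w <> r.
Proof.
  revert a b. induction ws as [|w ws IH]; intros a b Hab.
  - exists ((a + b) / 2). est.
  - destruct (Rle_lt_dec (Cmod w) ((a + b) / 2)) as [H|H].
    + destruct (IH ((a + b) / 2) b ltac:(lra)) as [r [Hr H1]]. exists r. split; [lra|].
      intros w' [<-|Hi]; [lra|now apply H1].
    + destruct (IH a ((a + b) / 2) ltac:(lra)) as [r [Hr H1]]. exists r. split; [lra|].
      intros w' [<-|Hi]; [lra|now apply H1].
Qed.

(** [fz_bound] gives $2\cdot\frac{59}{20}\cdot21=123.9$ times $(|t|+4)|c-1|$, plus $1$, which is at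
    most a quarter of that product. Replacing $|c-1|$ by twice the modulus of [fz c] doubles the
    constant, to less than $249$. *)
Lemma fz_ratio_bound (t : R) (z : C) : Cmod z <= 39 / 20 ->
  Cmod (fz ((2, t) + z)%C) <= 249 * (Rabs t + 4) * Cmod (fz (2, t)).
Proof.
  intros Hz. set (c := (2, t) : C). set (A := Cmod (c - 1)%C). assert (L := fz_lower_ge2 c ltac:(simpl; lra)).
  assert (HA : 1 <= A).
  { eapply Rle_trans; [|apply Re_le_Cmod]. simpl. rewrite Rabs_pos_eq; lra. }
  assert (Hrz := Re_le_Cmod z). apply Rabs_le_between in Hrz.
  assert (Hre : 1 / 20 <= Re (c + z)%C) by (rewrite Re_plus; simpl; lra).
  assert (Hct : Cmod c <= Rabs t + 2) by (via Cmod_pair_le; rewrite (Rabs_pos_eq 2); lra). assert (Ht := Rabs_pos t).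
  eapply Rle_trans; [apply fz_bound; lra|]. assert (P2 : Cmod (c + z - 1)%C <= 59 / 20 * A).
  { replace (c + z - 1)%C with ((c - 1) + z)%C by alg. via Cmod_triangle. fold A. lra. }
  assert (P3 : / Re (c + z)%C <= 20) by (replace 20 with (/ (1 / 20)) by field; apply Rinv_le_contravar; lra).
  assert (P7 : 2 * (Cmod (c + z)%C * Cmod (c + z - 1)%C) * (1 + / Re (c + z)%C) <= 2 * ((Rabs t + 4) * (59 / 20 * A))
    * 21) by est.
  assert (P8 : 249 * (Rabs t + 4) * (A / 2) <= 249 * (Rabs t + 4) * Cmod (fz c)) by est.
  assert (P9 : 4 * 1 <= (Rabs t + 4) * A) by est. est.
Qed.

Lemma exp6_ge : 250 <= exp 6.
Proof.
  assert (H : 27 / 10 <= exp 1).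
  { assert (Q := exp_partial_le 1 6 ltac:(lra)). simpl in Q. lra. }
  replace 6 with (1 + 1 + 1 + 1 + 1 + 1) by lra. rewrite !exp_plus.
  replace (exp 1 * exp 1 * exp 1 * exp 1 * exp 1 * exp 1) with (exp 1 ^ 6) by lra.
  apply Rle_trans with ((27 / 10) ^ 6); [lra|]. est.
Qed.

Section InvZeta.
Variables (t al : R) (K : nat).
Hypothesis RH : RiemannHypothesis.
Hypothesis Hal : 0 < al <= 1 / 2.
Hypothesis HK : (0 < K)%nat.
Let c : C := (2, t).
(** The circle about $2+it$ stops at $\Re s=1/2+al/100$. This margin is needed because zeros of
    Taylor polynomials only approximate those of [fz]; it is small enough to keep the ratio of
    $3/2-al$ to [R1] away from $1$. *)
Let R1 : R := 3 / 2 - al / 100.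

(** The degree is so large that the truncation error stays below the modulus of [fz] on the compact
    region right of $1/2+al/100$; a zero of the polynomial there would contradict this. To the right
    of $\Re s=2$ the lower bound is [fz_lower_ge2]. *)
Lemma taylor_zeros (N0 : nat) (eta : R) : 0 < eta ->
  exists N ws, (N0 <= N)%nat /\ (forall w, In w ws -> w <> RtoC 0) /\
    (forall k, (if Nat.leb k N then fcoef c k else RtoC 0) = (fcoef c 0 * ecoef ws k)%C) /\
    (forall z, Cmod z <= 39 / 20 -> Cmod (fz (c + z) - fz c * prodz ws z)%C <= eta) /\
    (forall w, In w ws -> Cmod w <= 39 / 20 -> Re w < - R1).
Proof.
  intros Heta. assert (Hc : 1 < Re c) by (simpl; lra). assert (Hc1 : (c - 1)%C <> RtoC 0).
  { intros E2. apply (f_equal Re) in E2. simpl in E2. lra. }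
  assert (Hf0 : fcoef c 0 = fz c) by (now apply fcoef_0).
  assert (Hf0' : fcoef c 0 <> RtoC 0) by (rewrite Hf0; now apply fz_neq0_gt1).
  destruct (fz_min_rect (2 - R1) (Rabs t + 2) RH ltac:(unfold R1; lra)) as [m [Hm Hmin]].
  set (m' := Rmin (Rmin (m / 2) (1 / 4)) eta). assert (Hm' : 0 < m') by (unfold m'; repeat apply Rmin_glb_lt; lra).
  assert (Hm1 : m' <= m / 2) by (eapply Rle_trans; [apply Rmin_l|apply Rmin_l]).
  assert (Hm2 : m' <= 1 / 4) by (eapply Rle_trans; [apply Rmin_l|apply Rmin_r]).
  assert (Hm3 : m' <= eta) by apply Rmin_r. set (rho := 79 / 40). set (q := 39 / 20 / rho).
  assert (Hq : 0 <= q < 1) by (unfold q, rho; lra).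
  set (D := 4 * ((Cmod c + rho) * (Cmod c + rho + 1)) * (1 + / (Re c - rho))). assert (HD : 0 <= D).
  { assert (0 < / (Re c - rho)) by (apply Rinv_0_lt_compat; unfold rho; simpl; lra). assert (0 <= Cmod c) by est.
    apply Rmult_le_pos; [|lra]. unfold rho. nra. }
  assert (Hlim : is_lim_seq (fun n => D * / (1 - q) * q ^ S n) 0).
  { replace (Finite 0) with (Rbar_mult (D * / (1 - q)) 0) by (simpl; f_equal; ring). apply is_lim_seq_scal_l.
    apply (is_lim_seq_incr_1 (fun n => q ^ n)). apply is_lim_seq_geom. rewrite Rabs_pos_eq; lra. }
  apply is_lim_seq_spec in Hlim. destruct (Hlim (mkposreal _ Hm')) as [N1 HN1]. set (N := Nat.max N0 N1).
  assert (HN := HN1 N ltac:(lia)). rewrite Rminus_0_r in HN. apply Rabs_lt_between in HN.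
  destruct (Factorization.poly_factor (fcoef c) N Hf0') as [ws [Hws He]].
  assert (Hlen : forall z, csum (fun k => fcoef c k * z ^ k)%C (S N) = (fz c * prodz ws z)%C).
  { intros z. rewrite <- Hf0. now apply taylor_prodz. }
  assert (Err : forall z, Cmod z <= 39 / 20 -> Cmod (fz (c + z) - fz c * prodz ws z)%C < m').
  { intros z Hz. rewrite <- Hlen.
    assert (Q := fz_power_series_err c rho ltac:(simpl; unfold rho; lra) z N ltac:(unfold rho; lra)).
    eapply Rle_lt_trans; [exact Q|]. fold D. eapply Rle_lt_trans; [|apply HN]. assert (Hz1 : 0 <= Cmod z / rho <= q).
    { split; [apply Rdiv_le_0_compat; [est|unfold rho; lra]|]. apply Rmult_le_compat_r; [unfold rho; lra|exact Hz]. }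
    rewrite Rmult_assoc. apply Rmult_le_compat_l; [exact HD|]. rewrite (Rmult_comm (/ (1 - q))).
    apply Rmult_le_compat.
    - est.
    - est.
    - est.
    - est. }
  exists N, ws. split; [lia|]. split; [exact Hws|]. split; [exact He|]. split.
  - intros z Hz. specialize (Err z Hz). lra.
  - intros w Hw Hwr. apply Rnot_le_lt. intros Hre. assert (Q := Err w Hwr). assert (Z := prodz_root ws w Hw Hws).
    rewrite Z in Q. replace (fz (c + w) - fz c * 0)%C with (fz (c + w)%C) in Q by alg. assert (Hiw := Im_le_Cmod w).
    assert (Re (c + w)%C = 2 + Re w) by est. assert (Im (c + w)%C = t + Im w) by est.
    destruct (Rle_lt_dec (Re (c + w)%C) 2) as [H2|H2].
    + assert (m <= Cmod (fz (c + w)%C)); [|lra]. apply Hmin. split; [lra|]. rewrite H0. est.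
    + assert (L := fz_lower_ge2 (c + w)%C ltac:(lra)). assert (1 <= Cmod (c + w - 1)%C).
      { eapply Rle_trans; [|apply Re_le_Cmod]. rewrite Re_minus. change (Re (RtoC 1)) with 1.
        rewrite Rabs_pos_eq; lra. }
      lra.
Qed.

(** [log_growth] for a Taylor polynomial normalised to $1$ at the centre. On the disc of radius
    $39/20$ it is at most $e^M$, where $e^6\ge250$ absorbs the constant $249$ and the truncation
    error. [logder_lower] gives $B=32M$, and $2\cdot32\cdot\frac32=96$. The summand $\log2$ pays for
    the passage from the polynomial to [fz] at the end point. *)
Lemma log_fz_bound (r0 : R) : 0 < r0 <= 3 / 2 - al ->
  let Q := (r0 / R1) ^ K in
  ln (Cmod (fz c) / Cmod (fz (2 - r0, t))) <=
   ln 2 + 96 * (ln (Rabs t + 4) + 6) * Q / (INR (S K) * (1 - Q))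
   + rsum (fun k => Cmod (gcoef c k) * (r0 ^ S k / INR (S k))) K / (1 - Q) ^ 2.
Proof.
  intros Hr0 Q. assert (HR1 : 149 / 100 < R1 < 3 / 2) by (unfold R1; lra). assert (Hr1 : r0 < R1) by (unfold R1; lra).
  assert (HQ : 0 <= Q < 1).
  { assert (0 <= r0 / R1 < 1) by est. apply pow_lt_1_compat; [lra|exact HK]. }
  assert (Hc : 1 < Re c) by (simpl; lra). assert (Hc1 : (c - 1)%C <> RtoC 0).
  { intros E2. apply (f_equal Re) in E2. simpl in E2. lra. }
  set (F := Cmod (fz (2 - r0, t))).
  assert (HF : 0 < F) by (apply Cmod_gt_0, fz_neq0; [exact RH|unfold R1 in *; simpl; lra]).
  assert (Hfc : 0 < Cmod (fz c)) by (apply Cmod_gt_0; now apply fz_neq0_gt1).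
  destruct (taylor_zeros K (Rmin F (Cmod (fz c))) ltac:(now apply Rmin_glb_lt)) as [N [ws [HN [Hws [He [Herr Hz]]]]]].
  assert (Hm1 := Rmin_l F (Cmod (fz c))). assert (Hm2 := Rmin_r F (Cmod (fz c))). set (M := ln (Rabs t + 4) + 6).
  assert (Ht := Rabs_pos t). assert (HM : exp M = (Rabs t + 4) * exp 6) by (unfold M; rewrite exp_plus, exp_ln; lra).
  assert (HM0 : 0 <= M).
  { unfold M. est. }
  assert (Gr : forall z, Cmod z <= 39 / 20 -> Cmod (prodz ws z) <= exp M).
  { intros z Hz'. apply Rmult_le_reg_l with (Cmod (fz c)); [exact Hfc|]. rewrite <- Cmod_mult.
    specialize (Herr z Hz'). assert (B := fz_ratio_bound t z Hz'). fold c in B.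
    replace (fz c * prodz ws z)%C with (fz (c + z) - (fz (c + z) - fz c * prodz ws z))%C by alg.
    assert (Tr := Cmod_triangle (fz (c + z)) (- (fz (c + z) - fz c * prodz ws z))%C). rewrite Cmod_opp in Tr. via Tr.
    rewrite HM. assert (E6 : 250 <= exp 6) by apply exp6_ge.
    assert (Cmod (fz c) * ((Rabs t + 4) * 250) <= Cmod (fz c) * ((Rabs t + 4) * exp 6)) by est.
    assert (4 * Cmod (fz c) <= (Rabs t + 4) * Cmod (fz c)) by est. lra. }
  destruct (avoid_radius ws (389 / 200) (39 / 20) ltac:(lra)) as [r [Hr Hrw]].
  assert (Low : forall z, Cmod z = R1 -> - (32 * M) <= Re (logder ws z)).
  { intros z Hzr. apply logder_lower with (r := r) (r1 := R1); try lra.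
    - est.
    - intros z' Hz'. apply Gr. lra.
    - apply Rle_div_l; [nra|]. nra.
    - intros w Hw Hwr. apply blaschke_term; try lra; [now apply Hws|]. specialize (Hz w Hw ltac:(lra)).
      assert (Hq := Re_le_Cmod z). apply Rabs_le_between in Hq. lra. }
  assert (Far : forall w, In w ws -> R1 < Cmod w).
  { intros w Hw. destruct (Rle_lt_dec (Cmod w) (39 / 20)) as [H|H]; [|lra]. specialize (Hz w Hw H).
    assert (Hq := Re_le_Cmod w). apply Rabs_le_between in Hq. lra. }
  assert (LG := log_growth ws R1 (32 * M) K ltac:(lra) ltac:(lra) HK Far Low r0 ltac:(lra)). fold Q in LG.
  assert (E1 : ((2 - r0)%R, t) = (c + - RtoC r0)%C) by (unfold c, RtoC, Cplus, Copp; simpl; f_equal; ring).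
  assert (Hr0' : Cmod (- RtoC r0)%C <= 39 / 20) by (rewrite Cmod_opp, Cmod_R, Rabs_pos_eq; lra).
  assert (Herr0 := Herr _ Hr0'). rewrite <- E1 in Herr0. assert (P0 : prodz ws (- RtoC r0)%C <> RtoC 0).
  { intros E.
    apply (proj1 (ln_prodz ws (- RtoC r0)%C (fun w h => ltac:(rewrite Cmod_opp, Cmod_R, Rabs_pos_eq by lra; specialize
      (Far w h); lra)))).
    exact E. }
  assert (P1 : Cmod (fz c) * Cmod (prodz ws (- RtoC r0)%C) <= 2 * F).
  { rewrite <- Cmod_mult.
    replace (fz c * prodz ws (- RtoC r0))%C with (fz ((2 - r0)%R, t) - (fz ((2 - r0)%R, t) - fz c * prodz ws (- RtoC
      r0)))%C by alg.
    assert (Tr := Cmod_triangle (fz ((2 - r0)%R, t)) (- (fz ((2 - r0)%R, t) - fz c * prodz ws (- RtoC r0)))%C).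
    rewrite Cmod_opp in Tr. via Tr. fold F. lra. }
  assert (P2 : 0 < Cmod (prodz ws (- RtoC r0)%C)) by est.
  assert (P3 : ln (Cmod (fz c) / F) <= ln 2 - ln (Cmod (prodz ws (- RtoC r0)%C))).
  { rewrite <- ln_div by lra. apply ln_le; [now apply Rdiv_lt_0_compat|]. apply (proj1 (Rle_div_r _ _ _ P2)).
    replace (Cmod (fz c) / F * Cmod (prodz ws (- RtoC r0)%C)) with (Cmod (fz c) * Cmod (prodz ws (- RtoC r0)%C) / F)
      by lra.
    apply (proj2 (Rle_div_l _ _ _ HF)). lra. }
  rewrite (rsum_ext _ (fun k => Cmod (gcoef c k) * (r0 ^ S k / INR (S k)))) in LG.
  2:{ intros k Hk. rewrite (psum_gcoef c ws N Hc Hc1 Hws He k) by lia. now rewrite Cmod_opp. }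
  assert (P4 : 2 * (32 * M) * R1 * (r0 / R1) ^ S K / (INR (S K) * (1 - Q)) <= 96 * M * Q / (INR (S K) * (1 - Q))).
  { apply Rmult_le_compat_r.
    - est.
    - simpl pow. fold Q. replace (2 * (32 * M) * R1 * (r0 / R1 * Q)) with (64 * (M * Q) * r0) by alg.
      replace (96 * M * Q) with (64 * (M * Q) * (3 / 2)) by lra. est. }
  lra.
Qed.
End InvZeta.

Lemma sum_three_halves K : (0 < K)%nat -> rsum (fun k => (3 / 2) ^ S k / INR (S k)) K <= 6 / 5 * (3 / 2) ^ K.
Proof.
  induction K as [|K IH]; [lia|]. rewrite rsum_S. destruct K as [|[|K]]; [simpl; lra|simpl; lra|].
  specialize (IH ltac:(lia)). set (k := S (S K)) in *.
  assert (Hk : 3 <= INR (S k)) by (replace 3 with (INR 3) by (simpl; ring); apply le_INR; unfold k; lia).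
  assert (P : 0 < (3 / 2) ^ k) by est. assert (I : / INR (S k) <= / 3) by est.
  change ((3 / 2) ^ S k) with (3 / 2 * (3 / 2) ^ k).
  assert (3 / 2 * (3 / 2) ^ k / INR (S k) <= 3 / 2 * (3 / 2) ^ k * / 3) by nra. lra.
Qed.

Lemma three_halves_pow_ge j : 1 + INR j / 2 <= (3 / 2) ^ j.
Proof.
  induction j as [|j IH]; [simpl; lra|]. rewrite S_INR. change ((3 / 2) ^ S j) with (3 / 2 * (3 / 2) ^ j).
  generalize (pos_INR j). lra.
Qed.

(** Bernoulli's inequality $(3/2)^j\ge1+j/2$ for the $j$ steps up to the last index. It is too weak
    only for $k=0$, where $(3/2)^j\ge1+j$ is needed; this holds from $j=5$ on, whence $K\ge6$. *)
Lemma pow_div_index_le (X : R) (k K : nat) : 3 / 2 <= X -> (6 <= K)%nat -> (k < K)%nat ->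
  INR K * X ^ k <= INR (S k) * X ^ (K - 1).
Proof.
  intros HX HK Hk. set (j := (K - 1 - k)%nat). replace (K - 1)%nat with (k + j)%nat by lia.
  rewrite pow_add, (Rmult_comm (INR K)), <- Rmult_assoc, (Rmult_comm (INR (S k))), Rmult_assoc.
  apply Rmult_le_compat_l; [est|].
  assert (HKj : INR K = INR (S k) + INR j) by (rewrite <- plus_INR; f_equal; unfold j; lia).
  apply Rle_trans with (INR (S k) * (3 / 2) ^ j); [|est]. assert (Hg := three_halves_pow_ge j). destruct k as [|k].
  - replace (INR 1) with 1 in * by est. rewrite HKj. assert (H5 : (5 <= j)%nat) by lia. clear -H5.
    induction H5 as [|m Hm IH]; [simpl; lra|]. rewrite S_INR. change ((3 / 2) ^ S m) with (3 / 2 * (3 / 2) ^ m).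
    assert (5 <= INR m) by (replace 5 with (INR 5) by (simpl; ring); now apply le_INR). lra.
  - assert (2 <= INR (S (S k))) by (rewrite !S_INR; generalize (pos_INR k); lra). set (a := INR (S (S k))) in *.
    assert (a * (1 + INR j / 2) <= a * (3 / 2) ^ j) by est. assert (0 <= (a - 2) * INR j) by est. lra.
Qed.

Lemma exp_pow_nat (a : R) n : exp a ^ n = exp (INR n * a).
Proof.
  induction n as [|n IH]; [simpl; now rewrite Rmult_0_l, exp_0|]. change (exp a ^ S n) with (exp a * exp a ^ n).
  rewrite IH, <- exp_plus, S_INR. f_equal. ring.
Qed.

(** With $e=1/K$ the sum in [lcoef_sum_bound] is at most $K+1$, the division by the index gains
    $1/K$, and removing the weight $(1-e)^k$ costs at most $(1-1/K)^{-(K-1)}\le3$; this yields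
    $3.3$. The coefficients [ucoef], of modulus at most $1$, add $1.2$ by [sum_three_halves]. *)
Lemma gcoef_sum_bound (t r0 : R) (K : nat) : (10 <= K)%nat -> 0 <= r0 <= 3 / 2 ->
  rsum (fun k => Cmod (gcoef (2, t) k) * (r0 ^ S k / INR (S k))) K <= 9 / 2 * (3 / 2) ^ K.
Proof.
  intros HK Hr0. set (c := (2, t) : C).
  assert (HKr : 10 <= INR K) by (replace 10 with (INR 10) by (simpl; ring); now apply le_INR). set (e := / INR K).
  assert (He : 0 < e <= / 10).
  { unfold e. est. }
  set (X := 3 / 2 / (1 - e)).
  assert (HX : 3 / 2 <= X) by (unfold X; apply (proj1 (Rle_div_r (3 / 2) (3 / 2) (1 - e) ltac:(lra))); lra).
  assert (Hu : forall k, Cmod (ucoef c k) <= 1).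
  { intros k. assert (Hc1 : (c - 1)%C <> RtoC 0).
    { intros E2. apply (f_equal Re) in E2. simpl in E2. lra. }
    unfold ucoef. rewrite Cmod_div by (now apply Cpow_nz). rewrite Cmod_R, <- RPow_abs.
    replace (Rabs (-1)) with 1 by (rewrite Rabs_left; lra). rewrite pow1, Cmod_pow. assert (1 <= Cmod (c - 1)%C).
    { eapply Rle_trans; [|apply Re_le_Cmod]. simpl. rewrite Rabs_pos_eq; lra. }
    assert (1 <= Cmod (c - 1)%C ^ S k) by (now apply pow_R1_Rle). est. }
  assert (T : forall k, (k < K)%nat -> Cmod (gcoef c k) * (r0 ^ S k / INR (S k)) <=
    (3 / 2 * X ^ (K - 1) / INR K) * (Cmod (lcoef c k) * (1 - e) ^ k) + (3 / 2) ^ S k / INR (S k)).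
  { intros k Hk. assert (Hsk : 0 < INR (S k)) by est. assert (H1 : Cmod (gcoef c k) <= Cmod (lcoef c k) + 1).
    { unfold gcoef. est. }
    assert (H3 : (3 / 2) ^ S k / INR (S k) <= 3 / 2 * X ^ (K - 1) / INR K * (1 - e) ^ k).
    { assert (Q := pow_div_index_le X k K HX ltac:(lia) Hk).
      assert (E : (3 / 2) ^ k = X ^ k * (1 - e) ^ k) by (unfold X; rewrite <- Rpow_mult_distr; f_equal; field; lra).
      change ((3 / 2) ^ S k) with (3 / 2 * (3 / 2) ^ k). rewrite E. apply Rle_div_l; [exact Hsk|].
      replace (3 / 2 * X ^ (K - 1) / INR K * (1 - e) ^ k * INR (S k)) with (3 / 2 * (1 - e) ^ k / INR K * (INR (S k) *
        X ^ (K - 1))) by lra.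
      replace (3 / 2 * (X ^ k * (1 - e) ^ k)) with (3 / 2 * (1 - e) ^ k / INR K * (INR K * X ^ k)) by alg. est. }
    assert (0 <= Cmod (lcoef c k)) by est.
    apply Rle_trans with ((Cmod (lcoef c k) + 1) * ((3 / 2) ^ S k / INR (S k))); [est|].
    rewrite Rmult_plus_distr_r, Rmult_1_l. apply Rplus_le_compat_r.
    eapply Rle_trans; [apply Rmult_le_compat_l; [lra|exact H3]|]. est. }
  eapply Rle_trans; [apply rsum_le, T|]. rewrite rsum_plus, rsum_scal.
  assert (S1 := lcoef_sum_bound c e K eq_refl ltac:(lra)). assert (S2 := sum_three_halves K ltac:(lia)).
  replace (/ e) with (INR K) in S1 by (unfold e; now rewrite Rinv_inv).
  assert (S3 : 3 / 2 * X ^ (K - 1) / INR K * (INR K + 1) <= 33 / 10 * (3 / 2) ^ K).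
  { assert (E : X ^ (K - 1) <= (3 / 2) ^ (K - 1) * 3).
    { unfold X, Rdiv at 1. rewrite Rpow_mult_distr. apply Rmult_le_compat_l; [est|].
      apply Rle_trans with (exp (/ INR (K - 1)) ^ (K - 1)).
      - apply pow_incr. split; [est|]. eapply Rle_trans; [|apply exp_ineq1_le]. rewrite minus_INR by lia.
        simpl (INR 1). right. unfold e. field. lra.
      - rewrite exp_pow_nat, Rinv_r; [apply exp_le_3|]. est. }
    assert (E3 : (3 / 2) ^ K = 3 / 2 * (3 / 2) ^ (K - 1)) by (replace K with (S (K - 1)) at 1 by lia; reflexivity).
    replace (3 / 2 * X ^ (K - 1) / INR K * (INR K + 1)) with (3 / 2 * (1 + e) * X ^ (K - 1)) by (unfold e; field;
      lra).
    apply Rle_trans with (3 / 2 * (1 + e) * ((3 / 2) ^ (K - 1) * 3)); [est|].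
    assert (0 <= (/ 10 - e) * (3 / 2) ^ (K - 1)) by est. lra. }
  assert (H : 0 <= 3 / 2 * X ^ (K - 1) / INR K) by est.
  eapply Rle_trans; [apply Rplus_le_compat; [apply Rmult_le_compat_l; [exact H|exact S1]|exact S2]|]. lra.
Qed.

(** [log_fz_bound] with $r_0=2-\sigma$, all terms being replaced by their values at the largest
    $r_0=3/2-al$. The factor $4$ combines the summand $\log2$ there with the bound of [fz_lower_ge2]
    at $2+it$. The case $\sigma=2$, where $r_0=0$, is separate. *)
Theorem inv_fz_bound (t sg al : R) (K : nat) :
  RiemannHypothesis -> 0 < al <= 1 / 2 -> (10 <= K)%nat -> 1 / 2 + al <= sg <= 2 ->
  let Q := ((3 / 2 - al) / (3 / 2 - al / 100)) ^ K in
  Cmod ((sg, t) - 1)%C <= Cmod (fz (sg, t)) *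
    (4 * exp (96 * (ln (Rabs t + 4) + 6) * Q / (INR (S K) * (1 - Q)) + 9 / 2 * (3 / 2) ^ K / (1 - Q) ^ 2)).
Proof.
  intros RH Hal HK Hsg Q. set (c := (2, t) : C). assert (HQ : 0 <= Q < 1).
  { assert (0 <= (3 / 2 - al) / (3 / 2 - al / 100) < 1) by est. apply pow_lt_1_compat; [lra|lia]. }
  set (M := ln (Rabs t + 4) + 6). set (E := 96 * M * Q / (INR (S K) * (1 - Q)) + 9 / 2 * (3 / 2) ^ K / (1 - Q) ^ 2).
  assert (HM0 : 0 <= M).
  { unfold M. assert (ln 1 <= ln (Rabs t + 4)) by (apply ln_le; generalize (Rabs_pos t); lra). rewrite ln_1 in H. lra. }
  assert (HE : 0 <= E).
  { apply Rplus_le_le_0_compat; apply Rdiv_le_0_compat.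
    - est.
    - est.
    - est.
    - est. }
  assert (HFs : 0 < Cmod (fz (sg, t))) by (apply Cmod_gt_0, fz_neq0; [exact RH|simpl; lra]).
  assert (Hcs : Cmod ((sg, t) - 1)%C <= Cmod (c - 1)%C).
  { apply sqrt_le_1_alt. simpl. nra. }
  assert (HL := fz_lower_ge2 c ltac:(simpl; lra)). assert (Ex : 1 <= exp E) by (rewrite <- exp_0; now apply exp_le).
  destruct (Req_dec sg 2) as [->|Hsg2].
  { unfold c in HL. apply Rle_trans with (Cmod (fz (2, t)) * 4); [lra|]. est. }
  assert (LB := log_fz_bound t al K RH Hal ltac:(lia) (2 - sg) ltac:(lra)).
  replace (2 - (2 - sg)) with sg in LB by lra. fold c M in LB. set (Q1 := ((2 - sg) / (3 / 2 - al / 100)) ^ K) in LB.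
  assert (HQ1 : 0 <= Q1 <= Q).
  { unfold Q1, Q. est. }
  assert (G := gcoef_sum_bound t (2 - sg) K HK ltac:(lra)). set (S0 := rsum _ K) in *.
  assert (T1 : 96 * M * Q1 / (INR (S K) * (1 - Q1)) <= 96 * M * Q / (INR (S K) * (1 - Q))) by est.
  assert (T2 : S0 / (1 - Q1) ^ 2 <= 9 / 2 * (3 / 2) ^ K / (1 - Q) ^ 2).
  { apply Rle_trans with (9 / 2 * (3 / 2) ^ K / (1 - Q1) ^ 2).
    - est.
    - est. }
  assert (LB2 : ln (Cmod (fz c) / Cmod (fz (sg, t))) <= ln 2 + E) by (unfold E; lra). assert (Hfc : 0 < Cmod (fz c)) by (apply Cmod_gt_0, fz_neq0; [exact RH|simpl; lra]).
  assert (LB3 : Cmod (fz c) / Cmod (fz (sg, t)) <= 2 * exp E).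
  { rewrite <- (exp_ln (Cmod (fz c) / Cmod (fz (sg, t)))) by est. rewrite <- (exp_ln 2) at 1 by lra.
    rewrite <- exp_plus. est. }
  apply (proj1 (Rle_div_l _ _ _ HFs)) in LB3. lra.
Qed.

(** * Euler-Maclaurin summation *)

Definition cder (G : R -> C) (x : R) (D : C) : Prop :=
  is_derive (fun x => Re (G x)) x (Re D) /\ is_derive (fun x => Im (G x)) x (Im D).

Lemma cder_const c x : cder (fun _ => c) x (RtoC 0).
Proof. split; apply (is_derive_const (V := R_NormedModule)). Qed.

Lemma cder_plus G H x D E : cder G x D -> cder H x E -> cder (fun x => G x + H x)%C x (D + E)%C.
Proof.
  intros [G1 G2] [H1 H2]. split.
  - apply (is_derive_plus (V := R_NormedModule) _ _ _ _ _ G1 H1).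
  - apply (is_derive_plus (V := R_NormedModule) _ _ _ _ _ G2 H2).
Qed.

Lemma cder_rmult (f : R -> R) G x f' D : is_derive f x f' -> cder G x D ->
  cder (fun x => RtoC (f x) * G x)%C x (RtoC f' * G x + RtoC (f x) * D)%C.
Proof.
  intros Hf [G1 G2].
  assert (Mul : forall g dg, is_derive g x dg -> is_derive (fun x => f x * g x) x (f' * g x + f x * dg)).
  { intros g dg Hg. apply (is_derive_mult f g x f' dg Hf Hg). intros; apply Rmult_comm. }
  split.
  - apply (is_derive_ext (fun x => f x * Re (G x))); [intros; symmetry; apply Re_scal|]. rewrite Re_plus, !Re_scal.
    est.
  -
    apply (is_derive_ext (fun x => f x * Im (G x))); [intros y; match goal with |- ?a = ?b => change (@eq R a b) end;
      unfold RtoC; destruct (G y); simpl; ring|].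
    replace (Im (RtoC f' * G x + RtoC (f x) * D)%C) with (f' * Im (G x) + f x * Im D) by (unfold RtoC; destruct (G x),
      D; simpl; ring).
    est.
Qed.

Lemma cder_scal c G x D : cder G x D -> cder (fun x => c * G x)%C x (c * D)%C.
Proof.
  intros [G1 G2]. split.
  - apply (is_derive_minus (V := R_NormedModule)); now apply is_derive_scal.
  - apply (is_derive_plus (V := R_NormedModule)); now apply is_derive_scal.
Qed.

Lemma cder_ext G H x D E : (forall x, G x = H x) -> D = E -> cder G x D -> cder H x E.
Proof.
  intros EG <- [G1 G2]. split.
  - apply (is_derive_ext _ _ _ _ (fun t => f_equal Re (EG t)) G1).
  - apply (is_derive_ext _ _ _ _ (fun t => f_equal Im (EG t)) G2).
Qed.

Lemma cder_cpow (x h : R) (s : C) : 0 < x + h ->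
  cder (fun h => cpow_neg (x + h) s) h (- s * cpow_neg (x + h) (s + 1))%C.
Proof.
  assert (D1 : is_derive (fun h => x + h) h 1) by (auto_derive; auto). split.
  - assert (Q := is_derive_comp (fun y => Re (cpow_neg y s)) (fun h => x + h) h _ _ (is_derive_cpow_Re _ s H) D1).
    rewrite <- (Rmult_1_l (Re _)). exact Q.
  - assert (Q := is_derive_comp (fun y => Im (cpow_neg y s)) (fun h => x + h) h _ _ (is_derive_cpow_Im _ s H) D1).
    rewrite <- (Rmult_1_l (Im _)). exact Q.
Qed.

(** The real bound is applied to the projection on the direction of $G(t)$ itself, so no factor $2$
    is lost to real and imaginary parts. *)
Lemma Cmod_MVT_pow (G dG : R -> C) (t M : R) (n : nat) :
  0 <= t -> G 0 = RtoC 0 -> (forall x, 0 <= x <= t -> cder G x (dG x)) ->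
  (forall x, 0 <= x <= t -> Cmod (dG x) <= M * x ^ n) -> Cmod (G t) <= M * (t ^ S n / INR (S n)).
Proof.
  intros Ht G0 Hd HM. assert (Key : forall u, Cmod u <= 1 -> Rabs (Re (u * G t)%C) <= M * (t ^ S n / INR (S n))).
  { intros u Hu. apply (MVT_pow (fun x => Re (u * G x)%C) (fun x => Re (u * dG x)%C)); [exact Ht| | |].
    - rewrite G0, Cmult_0_r. reflexivity.
    - intros x Hx. apply (cder_scal u G x (dG x)). est.
    - intros x Hx. via Re_le_Cmod. rewrite Cmod_mult. specialize (HM x Hx).
      generalize (Cmod_ge_0 (dG x)) (Cmod_ge_0 u). nra. }
  destruct (Req_dec (Cmod (G t)) 0) as [E|E].
  - rewrite E. assert (Q := Key (RtoC 0) ltac:(rewrite Cmod_0; lra)). eapply Rle_trans; [|exact Q]. est.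
  - assert (P : 0 < Cmod (G t)) by (generalize (Cmod_ge_0 (G t)); lra).
    assert (Q := Key (RtoC (/ Cmod (G t)) * Cconj (G t))%C).
    replace (RtoC (/ Cmod (G t)) * Cconj (G t) * G t)%C with (RtoC (Cmod (G t))) in Q.
    + eapply Rle_trans; [|apply Q]; [simpl; apply Rle_abs|]. rewrite Cmod_mult, Cmod_R, Cmod_conj, Rabs_pos_eq by est.
      right. field. lra.
    + rewrite <- Cmult_assoc, (Cmult_comm (Cconj (G t))), <- Cmod2_conj, <- RtoC_mult. f_equal. field. lra.
Qed.

Section EulerMaclaurin.
Variables (x : R) (s : C).
Hypothesis Hx : 0 < x.
Hypothesis Hs : -4 <= Re s.

Let f (k : nat) (h : R) : C := cpow_neg (x + h) (s + RtoC (INR k)).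

(** For $y^{-s}$ on $[x,x+h]$, this is $s-1$ times the error of the trapezoidal rule corrected by
    derivatives at the end points; the first two terms are the integral. *)
Definition em_step (h : R) : C :=
  (cpow_neg (x + h) (s - 1) - cpow_neg x (s - 1)
   + (s - 1) * (RtoC (h / 2) * (cpow_neg x s + cpow_neg (x + h) s)
                + s * (RtoC (h ^ 2 / 12) * (cpow_neg (x + h) (s + 1) - cpow_neg x (s + 1)))))%C.

(* The first three derivatives of [em_step]. The third is a single term, and [em_step], [E1], [E2]
   vanish at [0], so three integrations bound [em_step]. *)
Let E1 (h : R) : C :=
  ((s - 1) * (RtoC (1 / 2) * (f 0 0 - f 0 h) - s * (RtoC (h / 2) * f 1 h) + s * (RtoC (h / 6) * (f 1 h - f 1 0))
    - s * (s + 1) * (RtoC (h ^ 2 / 12) * f 2 h)))%C.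
Let E2 (h : R) : C :=
  ((s - 1) * s * (RtoC (1 / 6) * (f 1 h - f 1 0) + (s + 1) * (RtoC (h / 6) * f 2 h) + (s + 1) * (s + 2) * (RtoC (h ^ 2 / 12) * f 3 h)))%C.
Let E3 (h : R) : C := (- ((s - 1) * s * (s + 1) * (s + 2) * (s + 3)) * (RtoC (h ^ 2 / 12) * f 4 h))%C.

Lemma cder_f k h : 0 <= h -> cder (f k) h (- (s + RtoC (INR k)) * f (S k) h)%C.
Proof.
  intros Hh.
  apply (cder_ext (f k) _ _ _ _ (fun _ => eq_refl)) with (2 := cder_cpow x h (s + RtoC (INR k)) ltac:(lra)). unfold f.
  do 2 f_equal. rewrite S_INR, RtoC_plus. ring.
Qed.

Lemma cder_rf (g : R -> R) (g' : R) k h : 0 <= h -> is_derive g h g' ->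
  cder (fun h => RtoC (g h) * f k h)%C h (RtoC g' * f k h + RtoC (g h) * (- (s + RtoC (INR k)) * f (S k) h))%C.
Proof. intros Hh Hg. apply cder_rmult; [exact Hg|now apply cder_f]. Qed.

Lemma cder_rc (g : R -> R) (g' : R) (c : C) h : is_derive g h g' ->
  cder (fun h => RtoC (g h) * c)%C h (RtoC g' * c)%C.
Proof.
  intros Hg. apply cder_ext with (3 := cder_rmult g (fun _ => c) h g' _ Hg (cder_const c h)); [reflexivity|ring].
Qed.

Lemma em_der1 h : 0 <= h -> cder em_step h (E1 h).
Proof.
  intros Hh. assert (Dh : is_derive (fun h => h / 2) h (1 / 2)) by (auto_derive; [auto|lra]).
  assert (Dh2 : is_derive (fun h => h ^ 2 / 12) h (h / 6)) by (auto_derive; [auto|lra]).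
  assert (A0 := cder_cpow x h (s - 1)%C ltac:(lra)).
  assert (A1 := cder_plus _ _ _ _ _ A0 (cder_const (- cpow_neg x (s - 1))%C h)).
  assert (A2 := cder_plus _ _ _ _ _ (cder_rc _ _ (cpow_neg x s) h Dh) (cder_rf _ _ 0 h Hh Dh)).
  assert (A3 := cder_plus _ _ _ _ _ (cder_rf _ _ 1 h Hh Dh2) (cder_rc _ _ (- cpow_neg x (s + 1))%C h Dh2)).
  assert (A4 := cder_plus _ _ _ _ _ A1 (cder_scal (s - 1)%C _ _ _ (cder_plus _ _ _ _ _ A2 (cder_scal s _ _ _ A3)))).
  eapply cder_ext; [| |exact A4].
  - intros y. unfold em_step, f. simpl INR. rewrite Cplus_0_r. ring.
  - unfold E1, f. rewrite !Rplus_0_r. simpl INR. rewrite !Cplus_0_r. replace (s - 1 + 1)%C with s by alg.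
    assert (I2 : RtoC (1 / 2) = (/ RtoC 2)%C) by (rewrite <- RtoC_inv; [f_equal; lra|lra]). rewrite I2. field.
Qed.

Lemma em_der2 h : 0 <= h -> cder E1 h (E2 h).
Proof.
  intros Hh. assert (Dh : is_derive (fun h => h / 2) h (1 / 2)) by (auto_derive; [auto|lra]).
  assert (Dh6 : is_derive (fun h => h / 6) h (1 / 6)) by (auto_derive; [auto|lra]).
  assert (Dh2 : is_derive (fun h => h ^ 2 / 12) h (h / 6)) by (auto_derive; [auto|lra]).
  assert (B1 := cder_scal (RtoC (1 / 2)) _ _ _ (cder_plus _ _ _ _ _ (cder_const (f 0 0) h) (cder_scal (- RtoC 1)%C _ _
    _ (cder_f 0 h Hh)))).
  assert (B2 := cder_scal (- s)%C _ _ _ (cder_rf _ _ 1 h Hh Dh)).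
  assert (B3 := cder_scal s _ _ _ (cder_plus _ _ _ _ _ (cder_rf _ _ 1 h Hh Dh6) (cder_rc _ _ (- f 1 0)%C h Dh6))).
  assert (B4 := cder_scal (- (s * (s + 1)))%C _ _ _ (cder_rf _ _ 2 h Hh Dh2)).
  assert (B := cder_scal (s - 1)%C _ _ _ (cder_plus _ _ _ _ _ (cder_plus _ _ _ _ _ (cder_plus _ _ _ _ _ B1 B2) B3)
    B4)).
  eapply cder_ext; [| |exact B].
  - intros y. unfold E1. ring.
  - unfold E2. simpl INR. replace (RtoC (1 + 1)) with (RtoC 2) by est.
    replace (RtoC (h / 2)) with (RtoC (h / 6) * RtoC 3)%C by (rewrite <- RtoC_mult; f_equal; field). field.
Qed.

Lemma em_der3 h : 0 <= h -> cder E2 h (E3 h).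
Proof.
  intros Hh. assert (Dh6 : is_derive (fun h => h / 6) h (1 / 6)) by (auto_derive; [auto|lra]).
  assert (Dh2 : is_derive (fun h => h ^ 2 / 12) h (h / 6)) by (auto_derive; [auto|lra]).
  assert (B1 := cder_scal (RtoC (1 / 6)) _ _ _ (cder_plus _ _ _ _ _ (cder_f 1 h Hh) (cder_const (- f 1 0)%C h))).
  assert (B2 := cder_scal (s + 1)%C _ _ _ (cder_rf _ _ 2 h Hh Dh6)).
  assert (B3 := cder_scal ((s + 1) * (s + 2))%C _ _ _ (cder_rf _ _ 3 h Hh Dh2)).
  assert (B := cder_scal ((s - 1) * s)%C _ _ _ (cder_plus _ _ _ _ _ (cder_plus _ _ _ _ _ B1 B2) B3)).
  eapply cder_ext; [| |exact B].
  - est.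
  - unfold E3. simpl INR. replace (RtoC (1 + 1 + 1)) with (RtoC 3) by alg.
    replace (RtoC (1 + 1)) with (RtoC 2) by est. ring.
Qed.

(** [E3] carries $h^2/12$, and three integrations divide by $3$, $4$ and $5$:
    $12\cdot3\cdot4\cdot5=720$. *)
Lemma em_step_bound :
  Cmod (em_step 1) <= Cmod ((s - 1) * s * (s + 1) * (s + 2) * (s + 3))%C / 720 * Rpower x (- Re s - 4).
Proof.
  set (A := Cmod ((s - 1) * s * (s + 1) * (s + 2) * (s + 3))%C). set (B := A / 12 * Rpower x (- Re s - 4)).
  assert (HA : 0 <= A) by apply Cmod_ge_0. assert (F3 : forall h, 0 <= h -> Cmod (E3 h) <= B * h ^ 2).
  { intros h Hh. unfold E3. rewrite !Cmod_mult. rewrite <- !Cmod_mult. rewrite Cmod_mult, Cmod_opp. fold A.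
    rewrite Cmod_mult, Cmod_R, Rabs_pos_eq by est. unfold f. rewrite Cmod_cpow_neg. unfold B.
    replace (A / 12 * Rpower x (- Re s - 4) * h ^ 2) with (A * (h ^ 2 / 12 * Rpower x (- Re s - 4))) by lra.
    apply Rmult_le_compat_l; [exact HA|]. apply Rmult_le_compat_l; [est|].
    replace (- Re (s + RtoC (INR 4))%C) with (- Re s - 4) by (rewrite Re_plus; simpl; ring).
    apply Rpower_le_base; lra. }
  assert (F2 : forall h, 0 <= h -> Cmod (E2 h) <= B / 3 * h ^ 3).
  { intros h Hh. replace (B / 3 * h ^ 3) with (B * (h ^ 3 / INR 3)) by alg.
    apply (Cmod_MVT_pow E2 E3); [exact Hh| |intros; apply em_der3; lra|intros; apply F3; lra]. unfold E2.
    replace (0 / 6) with 0 by lra. replace (0 ^ 2 / 12) with 0 by lra. ring. }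
  assert (F1 : forall h, 0 <= h -> Cmod (E1 h) <= B / 12 * h ^ 4).
  { intros h Hh. replace (B / 12 * h ^ 4) with (B / 3 * (h ^ 4 / INR 4)) by alg.
    apply (Cmod_MVT_pow E1 E2); [exact Hh| |intros; apply em_der2; lra|intros; apply F2; lra]. unfold E1.
    replace (0 / 2) with 0 by lra. replace (0 ^ 2 / 12) with 0 by lra. ring. }
  replace (A / 720 * Rpower x (- Re s - 4)) with (B / 12 * (1 ^ 5 / INR 5)) by (unfold B; simpl; field).
  apply (Cmod_MVT_pow em_step E1); [lra| |intros; apply em_der1; lra|intros; apply F1; lra]. unfold em_step.
  rewrite Rplus_0_r. replace (0 / 2) with 0 by lra. ring.
Qed.
End EulerMaclaurin.

(** The cut-off point is $N=M+1$: the term $N^{-s}$ is not in [zpart s M] and enters with weight one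
    half. *)
Definition em_approx (s : C) (M : nat) : C :=
  ((s - 1) * zpart s M + cpow_neg (INR M + 1) (s - 1)
   + (s - 1) * (RtoC (1 / 2) * cpow_neg (INR M + 1) s + s * (RtoC (1 / 12) * cpow_neg (INR M + 1) (s + 1))))%C.

Lemma em_approx_S (s : C) M : (em_approx s (S M) - em_approx s M)%C = em_step (INR M + 1) s 1.
Proof.
  unfold em_approx, em_step. change (zpart s (S M)) with (zpart s M + cpow_neg (INR M + 1) s)%C. rewrite S_INR.
  replace (1 ^ 2 / 12) with (1 / 12) by lra.
  replace (cpow_neg (INR M + 1) s) with (RtoC (1 / 2) * cpow_neg (INR M + 1) s + RtoC (1 / 2) * cpow_neg (INR M + 1)
    s)%C at 1.
  - ring.
  - rewrite <- Cmult_plus_distr_r, <- RtoC_plus. replace (1 / 2 + 1 / 2) with 1 by lra. ring.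
Qed.

Lemma pseries_tail (a : R) (m n : nat) : 0 < a ->
  rsum (fun k => Rpower (INR (m + k) + 1) (- a - 1)) n <= Rpower (INR m + 1) (- a - 1) + Rpower (INR m + 1) (- a) / a.
Proof.
  intros Ha.
  assert (St : forall y, 1 <= y -> Rpower (y + 1) (- a - 1) <= (Rpower y (- a) - Rpower (y + 1) (- a)) / a).
  { intros y Hy. apply (proj1 (Rle_div_r _ _ _ Ha)).
    destruct (MVT_cor2 (fun x => Rpower x (- a)) (fun x => - a * Rpower x (- a - 1)) y (y + 1)) as [c [E Hc]].
    - lra.
    - intros c Hc. apply derivable_pt_lim_power. lra.
    - assert (Rpower (y + 1) (- a - 1) <= Rpower c (- a - 1)) by (apply Rpower_le_base; lra). nra. }
  assert (B : forall j, rsum (fun k => Rpower (INR (m + k) + 1) (- a - 1)) (S j) <=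
    Rpower (INR m + 1) (- a - 1) + (Rpower (INR m + 1) (- a) - Rpower (INR (m + j) + 1) (- a)) / a).
  { induction j as [|j IH].
    - simpl. rewrite Nat.add_0_r, Rminus_diag. lra.
    - rewrite rsum_S. assert (Q := St (INR (m + j) + 1) (INR1_ge (m + j))). rewrite Nat.add_succ_r, S_INR. lra. }
  assert (P : forall y, 0 < Rpower y (- a)) by est. destruct n as [|n].
  - simpl. est.
  - eapply Rle_trans; [est|]. apply Rplus_le_compat_l. apply Rmult_le_compat_r; [est|].
    generalize (P (INR (m + n) + 1)). lra.
Qed.

(** Consecutive approximations differ by [em_step], and they converge to [fz] because the added
    boundary terms decay; the error is the sum of all later steps. *)
Theorem euler_maclaurin (s : C) (M : nat) : 0 < Re s ->
  Cmod (fz s - em_approx s M)%C <= Cmod ((s - 1) * s * (s + 1) * (s + 2) * (s + 3))%C / 720 *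
    (Rpower (INR M + 1) (- (Re s + 3) - 1) + Rpower (INR M + 1) (- (Re s + 3)) / (Re s + 3)).
Proof.
  intros Hs. set (A := Cmod ((s - 1) * s * (s + 1) * (s + 2) * (s + 3))%C / 720).
  assert (HA : 0 <= A) by (apply Rdiv_le_0_compat; [est|lra]).
  set (B := Rpower (INR M + 1) (- (Re s + 3) - 1) + Rpower (INR M + 1) (- (Re s + 3)) / (Re s + 3)).
  assert (L : Clim (em_approx s) (fz s)).
  { replace (fz s) with (fz s + RtoC 0)%C by alg. apply Clim_plus; [now apply zpart_lim|].
    apply Clim_dom with (fun n => Cmod (s - 1)%C * (1 + Cmod s) * Rpower (INR n + 1) (- Re s)).
    - intros n. match goal with |- Cmod (?w - RtoC 0)%C <= _ => replace (w - RtoC 0)%C with w by ring end.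
      rewrite Cmod_mult, Rmult_assoc. apply Rmult_le_compat_l; [est|]. via Cmod_triangle.
      rewrite !Cmod_mult, !Cmod_R, !Cmod_cpow_neg, !Rabs_pos_eq by lra.
      replace (- Re (s + 1)%C) with (- Re s + - (1)) by (rewrite Re_plus; simpl; ring).
      assert (Rpower (INR n + 1) (- Re s + - (1)) <= Rpower (INR n + 1) (- Re s)) by (apply Rle_Rpower; [apply
        INR1_ge|lra]).
      assert (P := Rpower_pos (INR n + 1) (- Re s)). rewrite Rmult_plus_distr_r. est.
    - replace (Finite 0) with (Rbar_mult (Cmod (s - 1)%C * (1 + Cmod s)) 0) by (simpl; f_equal; ring).
      apply is_lim_seq_scal_l. now apply is_lim_seq_Rpower_neg. }
  assert (St : forall k, Cmod (em_approx s (M + k) - em_approx s M)%C <= A * rsum (fun k => Rpower (INR (M + k) + 1)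
    (- (Re s + 3) - 1)) k).
  { induction k as [|k IH].
    - rewrite Nat.add_0_r. replace (em_approx s M - em_approx s M)%C with (RtoC 0) by alg. rewrite Cmod_0. est.
    - rewrite Nat.add_succ_r, rsum_S, Rmult_plus_distr_l.
      replace (em_approx s (S (M + k)) - em_approx s M)%C with ((em_approx s (M + k) - em_approx s M) + (em_approx s
        (S (M + k)) - em_approx s (M + k)))%C by alg.
      via Cmod_triangle. apply Rplus_le_compat; [exact IH|]. rewrite em_approx_S.
      eapply Rle_trans; [apply em_step_bound; [est|lra]|]. right. do 2 f_equal. ring. }
  assert (Bd : forall k, Cmod (em_approx s (M + k) - em_approx s M)%C <= A * B).
  { intros k. eapply Rle_trans; [est|]. apply Rmult_le_compat_l; [exact HA|]. apply pseries_tail. lra. }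
  apply (Cmod_Clim_le (fun k => em_approx s (M + k) - em_approx s M)%C); [|exact Bd].
  apply Clim_plus; [|apply Clim_const].
  apply (is_lim_seq_subseq_le (fun n => Cmod (em_approx s n - fz s)%C) (fun k => (M + k)%nat)); [lia|exact L].
Qed.

(** * A smoothed Perron formula *)

Lemma qd_pser (S : C -> Prop) (a : nat -> C) (A r rho : R) (s0 : C) :
  0 < r < rho -> 0 <= A -> (forall k, Cmod (a k) * rho ^ k <= A) -> (forall s, S s -> Cmod (s - s0)%C <= r) ->
  exists dG, qd S (fun s => pser a (s - s0)) dG.
Proof.
  intros Hr HA Ha HS. destruct (pser_quad A rho r Hr HA) as [K [HK HP]]. destruct (HP a Ha) as [P1 P2].
  exists (fun s => dpser a (s - s0)), K, 1. split; [lra|]. split; [exact HK|]. split.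
  - intros s s' Hs Hs' _. assert (Q := P2 (s - s0)%C (s' - s)%C (HS s Hs)).
    replace (s - s0 + (s' - s))%C with (s' - s0)%C in Q by alg. est.
  - est.
Qed.

(** Taylor coefficients of the entire function $(e^{Lz}-1)/z$. As a power series it has no point to
    exclude, so [qd] applies across $z=0$. *)
Definition ediv (L : R) (k : nat) : C := RtoC (L ^ S k / INR (fact (S k))).

Lemma ediv_bound (L rho : R) k : 0 <= rho -> Cmod (ediv L k) * rho ^ k <= Rabs L * exp (Rabs L * rho).
Proof.
  intros Hr. unfold ediv. rewrite Cmod_R. unfold Rdiv. rewrite Rabs_mult, <- RPow_abs.
  rewrite (Rabs_pos_eq (/ _)) by est. assert (I : / INR (fact (S k)) <= / INR (fact k)).
  { apply Rinv_le_contravar; [est|]. apply le_INR. rewrite fact_simpl. lia. }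
  assert (P : 0 <= Rabs L) by est. assert (E := exp_term_le (Rabs L * rho) k ltac:(est)).
  change (Rabs L ^ S k) with (Rabs L * Rabs L ^ k).
  replace (Rabs L * Rabs L ^ k * / INR (fact (S k)) * rho ^ k) with (Rabs L * ((Rabs L * rho) ^ k * / INR (fact (S
    k)))) by (rewrite Rpow_mult_distr; ring).
  apply Rmult_le_compat_l; [exact P|]. eapply Rle_trans; [|exact E]. unfold Rdiv. est.
Qed.

Lemma cexp_R (a : R) : cexp (RtoC a) = RtoC (exp a).
Proof. unfold cexp. change (Re (RtoC a)) with a. change (Im (RtoC a)) with 0. rewrite cis_0. ring. Qed.

Lemma ediv_pser (L : R) (z : C) : (z * pser (ediv L) z = cexp (RtoC L * z) - 1)%C.
Proof.
  assert (Sm : abs_summable (fun k => ediv L k * z ^ k)%C).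
  { set (r := Cmod z + 1). set (rho := 2 * r). assert (Hr : 1 <= r) by (unfold r; generalize (Cmod_ge_0 z); lra).
    apply abs_summable_le with (fun k => Rabs L * exp (Rabs L * rho) * (1 / 2) ^ k).
    - intros k. rewrite Cmod_mult, Cmod_pow. assert (Q := ediv_bound L rho k ltac:(unfold rho; lra)).
      apply Rle_trans with (Cmod (ediv L k) * (rho ^ k * (1 / 2) ^ k)).
      + apply Rmult_le_compat_l; [est|]. rewrite <- Rpow_mult_distr. apply pow_incr. split; [est|unfold rho, r; lra].
      + rewrite <- Rmult_assoc. est.
    - apply (ex_series_scal (V := R_NormedModule) (Rabs L * exp (Rabs L * rho)) (fun k => (1 / 2) ^ k)).
      apply ex_series_geom_R. lra. }
  assert (C1 := Clim_scal z _ _ (csum_Clim _ Sm)). apply (Clim_unique _ _ _ C1).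
  assert (C2 := cexp_series (RtoC L * z)%C). apply is_lim_seq_incr_1 in C2. eapply is_lim_seq_ext; [|exact C2].
  intros n. cbv beta. f_equal. rewrite csum_shift. simpl (fact 0). simpl (INR 1). rewrite Rinv_1.
  replace (z * csum (fun k => ediv L k * z ^ k) n)%C with (csum (fun k => RtoC (/ INR (fact (S k))) * (RtoC L * z) ^ S
    k)%C n).
  - ring.
  - rewrite <- csum_scal. apply csum_ext. intros k _. unfold ediv, Rdiv.
    rewrite Cpow_mult_l, RtoC_mult, RtoC_pow, Cpow_S. rewrite (Cpow_S z). ring.
Qed.

(** On $\Re s=2$ the denominator $s(4-s)$ is $4+t^2$, real and even; this symmetric choice of the
    second pole reduces the transform to a cosine integral. *)
Definition Phi (V v : R) : R := RInt (fun t => cos (t * v) / (4 + t ^ 2)) (- V) V.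

Lemma cont_Phi v t : continuous (fun t => cos (t * v) / (4 + t ^ 2)) t.
Proof. apply (ex_derive_continuous (fun t => cos (t * v) / (4 + t ^ 2))). auto_derive. nra. Qed.

Lemma ex_RInt_Phi V v : ex_RInt (fun t => cos (t * v) / (4 + t ^ 2)) (- V) V.
Proof. apply (ex_RInt_continuous (V := R_CompleteNormedModule)). intros. apply cont_Phi. Qed.

Lemma Phi_0 V : is_RInt (fun t => 1 / (4 + t ^ 2)) (- V) V (atan (V / 2)).
Proof.
  replace (atan (V / 2)) with (/ 2 * atan (V / 2) - / 2 * atan (- V / 2)).
  - apply (is_RInt_derive (V := R_CompleteNormedModule) (fun t => / 2 * atan (t / 2)) (fun t => 1 / (4 + t ^ 2))).
    + intros t _. auto_derive; [auto|]. field. apply Rgt_not_eq; nra.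
    + intros t _. apply (ex_derive_continuous (fun t => 1 / (4 + t ^ 2))). auto_derive. nra.
  - replace (- V / 2) with (- (V / 2)) by lra. rewrite atan_opp. field.
Qed.

Lemma atan_near (V : R) : 0 < V -> 0 <= PI / 2 - atan (V / 2) <= 2 / V.
Proof.
  intros HV. assert (P : 0 < V / 2) by lra. rewrite <- (atan_inv (V / 2) P). replace (/ (V / 2)) with (2 / V) by alg.
  assert (Q : 0 < 2 / V) by est. split; [rewrite <- atan_0; apply Rlt_le, atan_increasing; exact Q|].
  destruct (MVT_cor2 atan (fun t => / (1 + t ^ 2)) 0 (2 / V) Q) as [c [E Hc]].
  - intros c _. apply derivable_pt_lim_atan.
  - rewrite atan_0 in E. assert (/ (1 + c ^ 2) <= 1) by (rewrite <- Rinv_1 at 2; apply Rinv_le_contravar; nra). nra.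
Qed.

(** The integrand $4(y^s-y^4)/(s(4-s))$ has no pole at $4$ and is moved from $\Re s=2$ to $\Re
    s=V+4$, where the denominator makes it small. On $\Re s=2$ the subtracted term integrates to
    nearly $2\pi y^4$. The errors of the far line, of the horizontal sides and of the arctangent are
    $16$, $24$ and $8$, in total $48$. *)
Lemma Phi_bound (V y : R) : 4 <= V -> 0 < y <= 1 ->
  Rabs (4 * y ^ 2 * Phi V (ln y) - 2 * PI * y ^ 4) <= 48 * y ^ 2 / V.
Proof.
  intros HV Hy. set (L := ln y). set (B := V + 4). set (r := B + V + 6).
  assert (HL : L <= 0) by (unfold L; rewrite <- ln_1; apply ln_le; lra). assert (Hy4 : exp (L * 4) = y ^ 4).
  { replace (L * 4) with (L + L + L + L) by lra. rewrite !exp_plus. unfold L. rewrite exp_ln by lra. ring. }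
  assert (Hy2 : exp (L * 2) = y ^ 2).
  { replace (L * 2) with (L + L) by lra. rewrite !exp_plus. unfold L. rewrite exp_ln by lra. ring. }
  assert (HS : forall s, rect 2 B (V + 1) s -> Cmod (s - RtoC 4)%C <= r /\ 2 <= Cmod s /\ Cmod s <= r).
  { intros s [H1 H2]. split; [|split].
    - via Cmod_le_Re_Im. rewrite Re_minus. replace (Im (s - RtoC 4)%C) with (Im s) by (destruct s; simpl; ring).
      change (Re (RtoC 4)) with 4. unfold r. assert (Rabs (Re s - 4) <= B) by est. lra.
    - eapply Rle_trans; [|apply Re_le_Cmod]. rewrite Rabs_pos_eq; lra.
    - via Cmod_le_Re_Im. rewrite (Rabs_pos_eq (Re s)) by lra. unfold r. lra. }
  destruct (qd_pser (rect 2 B (V + 1)) (ediv L) (Rabs L * exp (Rabs L * (r + 1))) r (r + 1) (RtoC 4)) as [dG HdG].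
  { unfold r, B; lra. }
  { est. }
  { intros k. apply ediv_bound. unfold r, B; lra. }
  { intros s Hs. exact (proj1 (HS s Hs)). }
  assert (Hinv := qd_inv _ _ _ 2 ltac:(lra) (fun s Hs => proj1 (proj2 (HS s Hs))) (qd_id _ r (fun s Hs => proj2 (proj2
    (HS s Hs))))).
  assert (HG := qd_mult _ _ _ _ _ (qd_const _ (RtoC (- (4) * y ^ 4))) (qd_mult _ _ _ _ _ HdG Hinv)).
  set (G := fun s => (RtoC (- (4) * y ^ 4) * (pser (ediv L) (s - RtoC 4) * / s))%C).
  assert (GE : forall s, s <> RtoC 0 -> (s - RtoC 4)%C <> RtoC 0 -> G s = (RtoC 4 * (cexp (RtoC L * s) - RtoC (y ^ 4))
    / (s * (RtoC 4 - s)))%C).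
  { intros s Hs Hs4. unfold G.
    replace (pser (ediv L) (s - RtoC 4)) with ((cexp (RtoC L * (s - RtoC 4)) - 1) / (s - RtoC 4))%C.
    2:{ rewrite <- ediv_pser. field. exact Hs4. }
    assert (E : cexp (RtoC L * s)%C = (RtoC (y ^ 4) * cexp (RtoC L * (s - RtoC 4)))%C).
    { replace (RtoC L * s)%C with (RtoC (L * 4) + RtoC L * (s - RtoC 4))%C by (rewrite RtoC_mult; ring).
      rewrite cexp_plus, cexp_R, Hy4. reflexivity. }
    rewrite E, RtoC_mult. replace (RtoC (- (4))) with (- RtoC 4)%C by (now rewrite RtoC_opp). field.
    split; [|split]; auto. intros E4. apply Hs4. replace (s - RtoC 4)%C with (- (RtoC 4 - s))%C by alg. rewrite E4.
    ring. }
  assert (GB : forall s, 2 <= Re s -> s <> RtoC 0 -> (s - RtoC 4)%C <> RtoC 0 -> Cmod (G s) <= 8 * y ^ 2 / (Cmod s *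
    Cmod (s - RtoC 4)%C)).
  { intros s Hre Hs Hs4. rewrite GE by est. assert (Hs4' : (RtoC 4 - s)%C <> RtoC 0).
    { intros E4. apply Hs4. replace (s - RtoC 4)%C with (- (RtoC 4 - s))%C by alg. rewrite E4. ring. }
    rewrite Cmod_div by est. rewrite !Cmod_mult, Cmod_R, (Rabs_pos_eq 4) by lra.
    replace (Cmod (RtoC 4 - s)%C) with (Cmod (s - RtoC 4)%C) by (rewrite <- Cmod_opp; f_equal; ring).
    apply Rmult_le_compat_r.
    - est.
    - assert (Cmod (cexp (RtoC L * s) - RtoC (y ^ 4))%C <= y ^ 2 + y ^ 2); [|lra]. via Cmod_triangle.
      rewrite Cmod_opp, Cmod_R, Cmod_cexp, Re_scal. apply Rplus_le_compat.
      + rewrite <- Hy2. apply exp_le. nra.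
      + rewrite Rabs_pos_eq by est. assert (y * y <= 1) by nra. nra. }
  destruct (rect_shift G _ 2 B V (8 * y ^ 2 / V ^ 2) ltac:(unfold B; lra) ltac:(lra) HG) as [I1 [I2 I3]].
  { assert (E : forall x v, 2 <= x -> Rabs v = V -> Cmod (G (x, v)) <= 8 * y ^ 2 / V ^ 2).
    { intros x v Hx Hv. assert (A1 : V <= Cmod (x, v)) by (rewrite <- Hv; apply (Im_le_Cmod (x, v))).
      assert (A2 : V <= Cmod ((x, v) - RtoC 4)%C).
      { rewrite <- Hv. eapply Rle_trans; [|apply Im_le_Cmod]. right. simpl. f_equal. ring. }
      eapply Rle_trans; [apply GB; [exact Hx| |]; apply Cmod_gt_neq0; lra|]. simpl. est. }
    split; apply E; try lra; [apply Rabs_pos_eq; lra|rewrite Rabs_Ropp; apply Rabs_pos_eq; lra]. }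
  assert (V1 : Rabs (RInt (fun t => Re (G (B, t))) (- V) V) <= (V - - V) * (8 * y ^ 2 / V ^ 2)).
  {
    apply (norm_RInt_le_const (V := R_NormedModule) (fun t => Re (G (B, t))) (- V) V _ (8 * y ^ 2 / V ^ 2)); [lra|
      |apply (RInt_correct (V := R_CompleteNormedModule)); exact I1].
    intros t _. via Re_le_Cmod. assert (A1 : V <= Cmod (B, t)).
    { eapply Rle_trans; [|apply Re_le_Cmod]. simpl. rewrite Rabs_pos_eq; unfold B; lra. }
    assert (A2 : V <= Cmod ((B, t) - RtoC 4)%C).
    { eapply Rle_trans; [|apply Re_le_Cmod]. simpl. rewrite Rabs_pos_eq; unfold B; lra. }
    eapply Rle_trans; [apply GB; [simpl; unfold B; lra| |]; apply Cmod_gt_neq0; lra|]. simpl. est. }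
  assert (V2 : RInt (fun t => Re (G (2, t))) (- V) V = 4 * y ^ 2 * Phi V L - 4 * y ^ 4 * atan (V / 2)).
  { apply is_RInt_unique.
    apply (is_RInt_ext (V := R_NormedModule) (fun t => (4 * y ^ 2) * (cos (t * L) / (4 + t ^ 2)) - (4 * y ^ 4) * (1 /
      (4 + t ^ 2)))).
    - intros t _. assert (Pt : 0 < 4 + t ^ 2) by nra. rewrite GE.
      +
        replace ((2, t) * (RtoC 4 - (2, t)))%C with (RtoC (4 + t ^ 2)) by (unfold RtoC, Cmult, Cminus, Cplus, Copp;
          simpl; f_equal; ring).
        replace (RtoC 4 * (cexp (RtoC L * (2, t)) - RtoC (y ^ 4)) / RtoC (4 + t ^ 2))%C with (RtoC (4 / (4 + t ^ 2)) *
          (cexp (RtoC L * (2, t)) - RtoC (y ^ 4)))%C.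
        2:{ rewrite RtoC_div by lra. field. intros E. apply (f_equal Re) in E. unfold RtoC in E; simpl in E; lra. }
        rewrite Re_scal, Re_minus. unfold cexp. rewrite Re_scal. change (Re (RtoC (y ^ 4))) with (y ^ 4).
        replace (Re (RtoC L * (2, t))%C) with (L * 2) by alg. rewrite Hy2.
        replace (Re (cis (Im (RtoC L * (2, t))%C))) with (cos (t * L)) by (unfold cis; simpl; f_equal; ring). lra.
      + intros E. apply (f_equal Re) in E. simpl in E. lra.
      + intros E. apply (f_equal Re) in E. simpl in E. lra.
    - apply (is_RInt_minus (V := R_NormedModule)).
      + apply (is_RInt_scal (V := R_NormedModule) (fun t => cos (t * L) / (4 + t ^ 2)) (- V) V (4 * y ^ 2)).
        apply (RInt_correct (V := R_CompleteNormedModule)), ex_RInt_Phi.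
      + apply (is_RInt_scal (V := R_NormedModule) (fun t => 1 / (4 + t ^ 2)) (- V) V (4 * y ^ 4)). apply Phi_0. }
  destruct (atan_near V ltac:(lra)) as [A1 A2]. assert (E1 : (V - - V) * (8 * y ^ 2 / V ^ 2) = 16 * y ^ 2 / V) by alg.
  assert (E2 : 2 * (8 * y ^ 2 / V ^ 2) * (B - 2) <= 24 * y ^ 2 / V).
  { replace (2 * (8 * y ^ 2 / V ^ 2) * (B - 2)) with (y ^ 2 / V ^ 2 * (16 * (V + 2))) by (unfold B; field; lra).
    replace (24 * y ^ 2 / V) with (y ^ 2 / V ^ 2 * (24 * V)) by lra. est. }
  assert (E3 : 0 <= y ^ 4 * (4 * (PI / 2 - atan (V / 2))) <= 8 * y ^ 2 / V).
  { split; [est|]. replace (8 * y ^ 2 / V) with (y ^ 2 * (4 * (2 / V))) by lra.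
    apply Rmult_le_compat; [est|lra| |lra]. assert (y * y <= 1) by nra. nra. }
  apply Rabs_le_between in V1. apply Rabs_le_between in I3. est.
Qed.

Definition clip4 (y : R) : R := if Rle_dec y 1 then y ^ 4 else 1.

(** For $y>1$ the evenness of the cosine exchanges $y$ and $1/y$. *)
Lemma Phi_clip4 (V y : R) : 4 <= V -> 0 < y ->
  Rabs (4 * y ^ 2 * Phi V (ln y) - 2 * PI * clip4 y) <= 48 * y ^ 2 / V.
Proof.
  intros HV Hy. unfold clip4. destruct (Rle_dec y 1) as [H|H]; [apply Phi_bound; lra|].
  assert (Hz : 0 < / y <= 1) by est. assert (Q := Phi_bound V (/ y) HV Hz). rewrite ln_Rinv in Q by lra.
  replace (Phi V (- ln y)) with (Phi V (ln y)) in Q.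
  2:{ apply RInt_ext. intros t _. replace (t * - ln y) with (- (t * ln y)) by lra. now rewrite cos_neg. }
  assert (Py : 0 < y ^ 4) by est. apply (Rmult_le_compat_l (y ^ 4)) in Q; [|lra].
  rewrite <- (Rabs_pos_eq (y ^ 4)) in Q at 1 by lra. rewrite <- Rabs_mult in Q.
  replace (y ^ 4 * (4 * (/ y) ^ 2 * Phi V (ln y) - 2 * PI * (/ y) ^ 4)) with (4 * y ^ 2 * Phi V (ln y) - 2 * PI * 1)
    in Q by alg.
  replace (y ^ 4 * (48 * (/ y) ^ 2 / V)) with (48 * y ^ 2 / V) in Q by alg. exact Q.
Qed.

(** The numerator vanishes at $s=4$, so the only pole is at $0$, and the decay is quadratic.
    Differences are written as sums with [RtoC (-1)] to fit [qd_plus] and [qd_mult]. *)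
Definition kern (d : R) (s : C) : C :=
  (RtoC (4 / (exp (4 * d) - 1)) * ((RtoC (exp (4 * d)) + RtoC (-1) * cexp (RtoC d * s)) * / (s * (RtoC 4 + RtoC (-1) * s))))%C.

(* [window d y] is [1] for [1 <= y] and [0] for [y <= exp (- d)]; its Mellin transform is [kern d]. *)
Definition window (d y : R) : R := (exp (4 * d) * clip4 y - clip4 (y * exp d)) / (exp (4 * d) - 1).

Lemma exp4_gap (d : R) : 0 < d -> 4 * d <= exp (4 * d) - 1.
Proof. generalize (exp_ineq1_le (4 * d)). lra. Qed.

Lemma exp4_pow (d : R) : exp d ^ 4 = exp (4 * d).
Proof. rewrite exp_pow_nat. f_equal. simpl. ring. Qed.

Lemma window_ge1 (d y : R) : 0 < d -> 1 <= y -> window d y = 1.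
Proof.
  intros Hd Hy. assert (G := exp4_gap d Hd). assert (E : 1 < exp d) by (rewrite <- exp_0; apply exp_increasing; lra).
  unfold window. replace (clip4 y) with 1.
  - replace (clip4 (y * exp d)) with 1; [alg|]. unfold clip4. destruct (Rle_dec (y * exp d) 1); [nra|reflexivity].
  - unfold clip4. destruct (Rle_dec y 1); [|reflexivity]. replace y with 1 by lra. ring.
Qed.

Lemma window_small (d y : R) : 0 < d -> 0 < y -> y * exp d <= 1 -> window d y = 0.
Proof.
  intros Hd Hy H. assert (E : 1 < exp d) by (rewrite <- exp_0; apply exp_increasing; lra). unfold window, clip4.
  destruct (Rle_dec y 1); [|nra]. destruct (Rle_dec (y * exp d) 1); [|lra]. rewrite Rpow_mult_distr, exp4_pow. lra.
Qed.

Lemma window_range (d y : R) : 0 < d -> 0 < y -> 0 <= window d y <= 1.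
Proof.
  intros Hd Hy. destruct (Rle_lt_dec 1 y) as [H|H]; [rewrite window_ge1; lra|].
  destruct (Rle_lt_dec (y * exp d) 1) as [H1|H1]; [rewrite window_small; lra|]. assert (G := exp4_gap d Hd).
  unfold window, clip4. destruct (Rle_dec y 1); [|lra]. destruct (Rle_dec (y * exp d) 1); [lra|].
  assert (P1 : 1 ^ 4 <= (y * exp d) ^ 4) by est. assert (P2 : y ^ 4 <= 1 ^ 4) by est.
  rewrite Rpow_mult_distr, exp4_pow, pow1 in P1. split.
  - est.
  - apply Rle_div_l; [lra|]. assert (0 <= exp (4 * d) * (1 - y ^ 4)) by est. lra.
Qed.

Lemma mertens_rsum K : mertens_nat K = rsum (fun n => mobius (S n)) K.
Proof. induction K as [|K IH]; [reflexivity|]. simpl mertens_nat. now rewrite IH. Qed.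

(** The smoothed sum differs from $M(x)$ only in the terms with $x<n<xe^d$, each of modulus at most
    $1$. *)
Lemma window_sum (d x : R) (N : nat) : 0 < d -> 1 <= x -> x <= INR N ->
  Rabs (rsum (fun n => mobius (S n) * window d (x / (INR n + 1))) N - Mertens x) <= x * (exp d - 1) + 1.
Proof.
  intros Hd Hx HN. unfold Mertens. destruct (base_Int_part x) as [I1 I2].
  assert (I0 : (0 <= Int_part x)%Z) by (apply le_IZR; assert (-1 < IZR (Int_part x)) by lra; apply IZR_le; assert (-1
    < Int_part x)%Z by (now apply lt_IZR); lia).
  set (K := Z.to_nat (Int_part x)).
  assert (HK : INR K = IZR (Int_part x)) by (unfold K; rewrite INR_IZR_INZ, Z2Nat.id; auto). rewrite mertens_rsum.
  assert (Ex : 1 < exp d) by (rewrite <- exp_0; apply exp_increasing; lra).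
  (* Both bounds are carried along: a new term that does not vanish has its index below $xe^d$, and
     then the count of terms implies the second bound. *)
  assert (Ind : forall j, Rabs (rsum (fun n => mobius (S n) * window d (x / (INR n + 1))) (K + j) - rsum (fun n => mobius (S n)) K) <= INR j /\
    Rabs (rsum (fun n => mobius (S n) * window d (x / (INR n + 1))) (K + j) - rsum (fun n => mobius (S n)) K) <= x * (exp d - 1) + 1).
  { induction j as [|j [J1 J2]].
    - rewrite Nat.add_0_r. rewrite (rsum_ext _ (fun n => mobius (S n))).
      + rewrite Rminus_diag, Rabs_R0. est.
      + intros n Hn. rewrite window_ge1; [ring|exact Hd|].
        assert (INR n + 1 <= INR K) by (rewrite <- S_INR; apply le_INR; lia).
        apply (proj1 (Rle_div_r _ _ _ (INR1_pos n))). lra.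
    - rewrite Nat.add_succ_r, rsum_S. set (n := (K + j)%nat) in *. assert (Hn := INR1_pos n).
      assert (Hy : 0 < x / (INR n + 1)) by est. assert (HnK : INR n = INR K + INR j) by (unfold n; apply plus_INR).
      set (A := rsum _ n) in *. set (B := rsum (fun n => mobius (S n)) K) in *.
      destruct (Rle_lt_dec (x / (INR n + 1) * exp d) 1) as [H|H].
      + rewrite (window_small d _ Hd Hy H), Rmult_0_r, Rplus_0_r. rewrite S_INR. lra.
      + assert (T : Rabs (A + mobius (S n) * window d (x / (INR n + 1)) - B) <= INR (S j)).
        {
          replace (A + mobius (S n) * window d (x / (INR n + 1)) - B) with ((A - B) + mobius (S n) * window d (x /
            (INR n + 1))) by lra.
          via Rabs_triang. rewrite S_INR, Rabs_mult. destruct (window_range d _ Hd Hy) as [W1 W2].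
          rewrite (Rabs_pos_eq (window _ _)) by lra. assert (Mb := Arithmetic.mobius_bound (S n)). nra. }
        split; [exact T|]. via T. rewrite S_INR. apply (Rmult_lt_compat_r (INR n + 1)) in H; [|exact Hn].
        replace (x / (INR n + 1) * exp d * (INR n + 1)) with (x * exp d) in H by alg. lra. }
  assert (HKN : (K <= N)%nat) by (apply INR_le; lra). replace N with (K + (N - K))%nat by lia. apply Ind.
Qed.

Lemma RInt_term (d V x n : R) : 0 < d -> 0 < x -> 0 < n ->
  is_RInt (fun t => Re (cexp (RtoC (ln x) * (2, t)) * kern d (2, t) * cpow_neg n (2, t))%C) (- V) V
    ((exp (4 * d) * (4 * (x / n) ^ 2 * Phi V (ln (x / n))) - 4 * (x / n * exp d) ^ 2 * Phi V (ln (x / n * exp d))) / (exp (4 * d) - 1)).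
Proof.
  intros Hd Hx Hn. set (y := x / n). assert (Hy : 0 < y) by (now apply Rdiv_lt_0_compat).
  assert (Ey : ln (y * exp d) = ln y + d) by (rewrite ln_mult by (auto using exp_pos); now rewrite ln_exp).
  assert (Ly : ln y = ln x - ln n) by (unfold y; now apply ln_div).
  apply (is_RInt_ext (V := R_NormedModule) (fun t =>
    (4 * exp (4 * d) * y ^ 2 / (exp (4 * d) - 1)) * (cos (t * ln y) / (4 + t ^ 2)) -
    (4 * (y * exp d) ^ 2 / (exp (4 * d) - 1)) * (cos (t * ln (y * exp d)) / (4 + t ^ 2)))).
  - intros t _. assert (Pt : 0 < 4 + t ^ 2) by nra. unfold kern. rewrite cpow_neg_cexp.
    replace ((2, t) * (RtoC 4 + RtoC (-1) * (2, t)))%C with (RtoC (4 + t ^ 2)) by (unfold RtoC, Cmult, Cminus, Cplus,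
      Copp; simpl; f_equal; ring).
    replace (cexp (RtoC (ln x) * (2, t)) * (RtoC (4 / (exp (4 * d) - 1)) * ((RtoC (exp (4 * d)) + RtoC (-1) * cexp (RtoC d * (2, t))) * / RtoC (4 + t ^ 2))) * cexp (RtoC (- ln n) * (2, t)))%C
      with (RtoC (4 / (exp (4 * d) - 1) / (4 + t ^ 2)) * (RtoC (exp (4 * d)) * (cexp (RtoC (ln x) * (2, t)) * cexp (RtoC (- ln n) * (2, t))) + RtoC (-1) * (cexp (RtoC (ln x) * (2, t)) * cexp (RtoC (- ln n) * (2, t)) * cexp (RtoC d * (2, t)))))%C.
    2:{ rewrite (RtoC_div (4 / (exp (4 * d) - 1)) (4 + t ^ 2)) by lra. unfold Cdiv. ring. }
    rewrite <- !cexp_plus.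
    replace (RtoC (ln x) * (2, t) + RtoC (- ln n) * (2, t) + RtoC d * (2, t))%C with (RtoC (ln (y * exp d)) * (2,
      t))%C by (rewrite Ey, Ly, RtoC_plus, RtoC_minus, RtoC_opp; ring).
    replace (RtoC (ln x) * (2, t) + RtoC (- ln n) * (2, t))%C with (RtoC (ln y) * (2, t))%C by (rewrite Ly,
      RtoC_minus, RtoC_opp; ring).
    assert (Rc : forall z, 0 < z -> Re (cexp (RtoC (ln z) * (2, t)))%C = z ^ 2 * cos (t * ln z)).
    { intros z Hz. unfold cexp. rewrite Re_scal. f_equal.
      - replace (Re (RtoC (ln z) * (2, t))%C) with (ln z + ln z) by alg. rewrite exp_plus, exp_ln by lra. ring.
      - unfold cis; simpl. f_equal. ring. }
    rewrite Re_scal, Re_plus, !Re_scal, !Rc by est. lra.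
  - replace ((exp (4 * d) * (4 * y ^ 2 * Phi V (ln y)) - 4 * (y * exp d) ^ 2 * Phi V (ln (y * exp d))) / (exp (4 * d) - 1))
      with ((4 * exp (4 * d) * y ^ 2 / (exp (4 * d) - 1)) * Phi V (ln y) - (4 * (y * exp d) ^ 2 / (exp (4 * d) - 1)) * Phi V (ln (y * exp d))) by lra.
    apply (is_RInt_minus (V := R_NormedModule)).
    +
      apply (is_RInt_scal (V := R_NormedModule) (fun t => cos (t * ln y) / (4 + t ^ 2)) (- V) V (4 * exp (4 * d) * y ^
        2 / (exp (4 * d) - 1))).
      apply (RInt_correct (V := R_CompleteNormedModule)), ex_RInt_Phi.
    +
      apply (is_RInt_scal (V := R_NormedModule) (fun t => cos (t * ln (y * exp d)) / (4 + t ^ 2)) (- V) V (4 * (y *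
        exp d) ^ 2 / (exp (4 * d) - 1))).
      apply (RInt_correct (V := R_CompleteNormedModule)), ex_RInt_Phi.
Qed.

Lemma term_window (d V y : R) : 0 < d -> 4 <= V -> 0 < y ->
  Rabs ((exp (4 * d) * (4 * y ^ 2 * Phi V (ln y)) - 4 * (y * exp d) ^ 2 * Phi V (ln (y * exp d))) / (exp (4 * d) - 1) - 2 * PI * window d y)
  <= 24 * exp (4 * d) / (d * V) * y ^ 2.
Proof.
  intros Hd HV Hy. assert (G := exp4_gap d Hd). assert (E := exp_pos d). assert (Q1 := Phi_clip4 V y HV Hy).
  assert (Q2 := Phi_clip4 V (y * exp d) HV ltac:(now apply Rmult_lt_0_compat)).
  set (A := 4 * y ^ 2 * Phi V (ln y)) in *. set (B := 4 * (y * exp d) ^ 2 * Phi V (ln (y * exp d))) in *.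
  unfold window. set (c1 := clip4 y) in *. set (c2 := clip4 (y * exp d)) in *.
  replace ((exp (4 * d) * A - B) / (exp (4 * d) - 1) - 2 * PI * ((exp (4 * d) * c1 - c2) / (exp (4 * d) - 1)))
    with ((exp (4 * d) * (A - 2 * PI * c1) - (B - 2 * PI * c2)) / (exp (4 * d) - 1)) by lra.
  unfold Rdiv at 1. rewrite Rabs_mult, (Rabs_pos_eq (/ _)) by est.
  assert (E4 : exp d ^ 2 <= exp (4 * d)) by (rewrite exp_pow_nat; apply exp_le; simpl; lra).
  assert (N : Rabs (exp (4 * d) * (A - 2 * PI * c1) - (B - 2 * PI * c2)) <= 96 * exp (4 * d) * y ^ 2 / V).
  { via Rabs_triang. rewrite Rabs_Ropp, Rabs_mult, (Rabs_pos_eq (exp (4 * d))) by lra.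
    replace (96 * exp (4 * d) * y ^ 2 / V) with (exp (4 * d) * (48 * y ^ 2 / V) + exp (4 * d) * (48 * y ^ 2 / V)) by
      lra.
    apply Rplus_le_compat; [est|]. via Q2. rewrite Rpow_mult_distr.
    replace (48 * (y ^ 2 * exp d ^ 2) / V) with (exp d ^ 2 * (48 * y ^ 2 / V)) by lra. est. }
  replace (24 * exp (4 * d) / (d * V) * y ^ 2) with (96 * exp (4 * d) * y ^ 2 / V * / (4 * d)) by alg. est.
Qed.

(** A finite sum is integrated term by term; the errors, proportional to $(x/n)^2$, are summed with
    $\sum n^{-2}\le2$. *)
Lemma window_integral (d V x : R) (N : nat) : 0 < d -> 4 <= V -> 1 <= x ->
  is_RInt (fun t => Re (cexp (RtoC (ln x) * (2, t)) * kern d (2, t) * csum (mterm (2, t)) N)%C) (- V) V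
     (RInt (fun t => Re (cexp (RtoC (ln x) * (2, t)) * kern d (2, t) * csum (mterm (2, t)) N)%C) (- V) V) /\
  Rabs (RInt (fun t => Re (cexp (RtoC (ln x) * (2, t)) * kern d (2, t) * csum (mterm (2, t)) N)%C) (- V) V
    - 2 * PI * rsum (fun n => mobius (S n) * window d (x / (INR n + 1))) N)
  <= 48 * exp (4 * d) * x ^ 2 / (d * V).
Proof.
  intros Hd HV Hx.
  set (I := fun n => (exp (4 * d) * (4 * (x / (INR n + 1)) ^ 2 * Phi V (ln (x / (INR n + 1)))) - 4 * (x / (INR n + 1)
    * exp d) ^ 2 * Phi V (ln (x / (INR n + 1) * exp d))) / (exp (4 * d) - 1)).
  assert (H : is_RInt (fun t => Re (cexp (RtoC (ln x) * (2, t)) * kern d (2, t) * csum (mterm (2, t)) N)%C) (- V) V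
    (rsum (fun n => mobius (S n) * I n) N)).
  { induction N as [|N IH].
    - apply (is_RInt_ext (V := R_NormedModule) (fun _ => 0)).
      + intros t _. rewrite Cmult_0_r. reflexivity.
      +
        replace (rsum (fun n => mobius (S n) * I n) 0) with (scal (V - - V) 0) by (unfold scal; simpl; unfold mult;
          simpl; ring).
        apply (is_RInt_const (V := R_NormedModule)).
    -
      apply (is_RInt_ext (V := R_NormedModule) (fun t => Re (cexp (RtoC (ln x) * (2, t)) * kern d (2, t) * csum (mterm
        (2, t)) N)%C + mobius (S N) * Re (cexp (RtoC (ln x) * (2, t)) * kern d (2, t) * cpow_neg (INR N + 1) (2,
        t))%C)).
      + intros t _. rewrite csum_S, <- Re_scal, <- Re_plus. f_equal. unfold mterm. ring.
      + apply (is_RInt_plus (V := R_NormedModule) _ _ _ _ _ _ IH).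
        apply (is_RInt_scal (V := R_NormedModule) _ (- V) V (mobius (S N))). apply RInt_term; [exact Hd|lra|est]. }
  rewrite (is_RInt_unique _ _ _ _ H). split; [exact H|]. rewrite <- rsum_scal.
  replace (rsum (fun n => mobius (S n) * I n) N - rsum (fun k => 2 * PI * (mobius (S k) * window d (x / (INR k + 1)))) N)
    with (rsum (fun n => mobius (S n) * (I n - 2 * PI * window d (x / (INR n + 1)))) N).
  2:{ clear. induction N as [|N IH]; [alg|]. rewrite !rsum_S, IH. ring. }
  via rsum_abs. assert (Sp : rsum (fun k => Rpower (INR k + 1) (- (1) - 1)) N <= 2) by (eapply Rle_trans; [apply pseries_partial; lra|lra]).
  assert (P : 0 <= 24 * exp (4 * d) / (d * V) * x ^ 2) by est.
  apply Rle_trans with (rsum (fun k => 24 * exp (4 * d) / (d * V) * x ^ 2 * Rpower (INR k + 1) (- (1) - 1)) N).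
  - apply rsum_le. intros n _. rewrite Rabs_mult. assert (Hn := INR1_pos n). assert (Hy : 0 < x / (INR n + 1)) by est.
    assert (T := term_window d V (x / (INR n + 1)) Hd HV Hy). fold (I n) in T.
    assert (ER : Rpower (INR n + 1) (- (1) - 1) = / (INR n + 1) ^ 2).
    { replace (- (1) - 1) with (- (INR 2)) by alg. rewrite Rpower_Ropp, Rpower_pow by lra. reflexivity. }
    rewrite ER.
    replace (24 * exp (4 * d) / (d * V) * x ^ 2 * / (INR n + 1) ^ 2) with (24 * exp (4 * d) / (d * V) * (x / (INR n +
      1)) ^ 2) by alg.
    eapply Rle_trans; [|exact T]. rewrite <- (Rmult_1_l (Rabs (I n - _))) at 2.
    apply Rmult_le_compat_r; [est|apply Arithmetic.mobius_bound].
  - rewrite rsum_scal. eapply Rle_trans; [apply Rmult_le_compat_l; [exact P|exact Sp]|]. lra.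
Qed.

(** * Bounds for the smoothing kernel *)

Lemma cexp_m1_bound (w : C) : Re w <= 0 -> Cmod (1 - cexp w)%C <= 6 * Cmod w.
Proof.
  intros H. destruct (Rle_lt_dec (Cmod w) 1) as [H1|H1].
  - assert (Q := exp_rem_bound w 1 1 ltac:(lra)). unfold exp_rem in Q. rewrite csum_S in Q. simpl csum in Q.
    replace (RtoC 1 * w)%C with w in Q by alg. replace (RtoC (1 ^ 0 / INR (fact 0))) with (RtoC 1) in Q by alg.
    replace (cexp w - (0 + 1 * w ^ 0))%C with (- (1 - cexp w))%C in Q by alg. rewrite Cmod_opp in Q. via Q.
    replace ((2 * Cmod w) ^ 1 * 1 ^ 1 / INR (fact 1)) with (2 * Cmod w) by alg.
    assert (exp (Cmod w) <= 3) by (eapply Rle_trans; [apply exp_le, H1|apply exp_le_3]). generalize (Cmod_ge_0 w).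
    nra.
  - via Cmod_triangle. rewrite Cmod_opp, Cmod_cexp, Cmod_1. assert (exp (Re w) <= exp 0) by est. rewrite exp_0 in H0.
    lra.
Qed.

Lemma four_minus_neq0 (s : C) : Re s <= 2 -> (RtoC 4 + RtoC (-1) * s)%C <> RtoC 0.
Proof. intros H E. apply (f_equal Re) in E. rewrite Re_plus, Re_scal in E. simpl in E. lra. Qed.

Lemma Re_pos_neq0 (s : C) : 0 < Re s -> s <> RtoC 0.
Proof. intros H E. rewrite E in H. simpl in H. lra. Qed.

Lemma kern_bound_decay (d : R) (s : C) : 0 < d -> 0 < Re s <= 2 ->
  Cmod (kern d s) <= 2 * exp (4 * d) / d / (Cmod s * Cmod (RtoC 4 + RtoC (-1) * s)%C).
Proof.
  intros Hd Hs. assert (G := exp4_gap d Hd). assert (N1 := four_minus_neq0 s ltac:(lra)).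
  assert (N2 := Re_pos_neq0 s ltac:(lra)). unfold kern. rewrite !Cmod_mult, Cmod_inv, Cmod_mult by est.
  rewrite Cmod_R, Rabs_pos_eq by est. rewrite <- Rmult_assoc. unfold Rdiv at 2.
  assert (B : Cmod (RtoC (exp (4 * d)) + RtoC (-1) * cexp (RtoC d * s))%C <= 2 * exp (4 * d)).
  { via Cmod_triangle. rewrite Cmod_mult, !Cmod_R, Cmod_cexp, Re_scal, (Rabs_pos_eq (exp _)) by lra.
    rewrite Rabs_left by lra. assert (exp (d * Re s) <= exp (4 * d)) by (apply exp_le; nra). lra. }
  replace (2 * exp (4 * d) / d) with (4 / (4 * d) * (2 * exp (4 * d))) by alg. est.
Qed.

(** The numerator $e^{4d}-e^{ds}$ is of size $d|4-s|$, which removes the factor $1/d$ together with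
    one factor of the denominator. *)
Lemma kern_bound_near (d : R) (s : C) : 0 < d -> 0 < Re s <= 2 -> Cmod (kern d s) <= 6 * exp (4 * d) / Cmod s.
Proof.
  intros Hd Hs. assert (G := exp4_gap d Hd). assert (N1 := four_minus_neq0 s ltac:(lra)).
  assert (N2 := Re_pos_neq0 s ltac:(lra)). unfold kern.
  replace (RtoC (exp (4 * d)) + RtoC (-1) * cexp (RtoC d * s))%C with (RtoC (exp (4 * d)) * (1 - cexp (RtoC (- d) *
    (RtoC 4 + RtoC (-1) * s))))%C.
  2:{ rewrite <- cexp_R. replace (RtoC d * s)%C with (RtoC (4 * d) + RtoC (- d) * (RtoC 4 + RtoC (-1) * s))%C.
    - rewrite cexp_plus. ring.
    - rewrite RtoC_mult, RtoC_opp. ring. }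
  set (w := (RtoC 4 + RtoC (-1) * s)%C) in *. assert (B := cexp_m1_bound (RtoC (- d) * w)%C). rewrite Re_scal in B.
  assert (Hw : Re w = 4 - Re s) by (unfold w; rewrite Re_plus, Re_scal; simpl; ring). specialize (B ltac:(nra)).
  rewrite (Cmod_mult (RtoC (- d))), Cmod_R, Rabs_Ropp, Rabs_pos_eq in B by lra.
  rewrite !Cmod_mult, Cmod_inv, Cmod_mult by est. rewrite !Cmod_R, (Rabs_pos_eq (exp _)) by lra.
  rewrite Rabs_pos_eq by est.
  apply Rle_trans with (4 / (4 * d) * (exp (4 * d) * (6 * (d * Cmod w)) * / (Cmod s * Cmod w))).
  - est.
  - right. field. est.
Qed.

(** Interpolates between the two bounds for [kern], so that the growth $(|t|+4)^c$ of $1/\zeta$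
    costs $T^c$ instead of a power of the height of integration. *)
Lemma min_le_Rpower (r c : R) : 0 < r -> 0 <= c <= 1 -> Rmin 1 r <= Rpower r c.
Proof.
  intros Hr Hc. destruct (Rle_lt_dec r 1) as [H|H].
  - apply Rle_trans with r; [apply Rmin_r|]. rewrite <- (Rpower_1 r) at 1 by lra. apply exp_le.
    assert (ln r <= 0) by (rewrite <- ln_1; now apply ln_le). nra.
  - apply Rle_trans with 1; [apply Rmin_l|]. rewrite <- (Rpower_O r) by lra. est.
Qed.

Section Perron.
(** [T] is the reciprocal of the width of smoothing, [V] the height of truncation, [a] the abscissa
    of the shifted line; [D] and [c] express that $1/\zeta$ is at most $D(|t|+4)^c$. *)
Variables (x T V a D c : R).
Hypothesis RH : RiemannHypothesis.
Hypothesis Hx : 1 <= x.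
Hypothesis HT : 4 <= T.
Hypothesis HV : 4 <= V.
Hypothesis Ha : 1 / 2 < a <= 1.
Hypothesis HD : 0 <= D.
Hypothesis Hc : 0 <= c <= 1.
Hypothesis Hz : forall sg t, a <= sg <= 2 ->
  Cmod ((sg, t) - 1)%C <= Cmod (fz (sg, t)) * (D * Rpower (Rabs t + 4) c).
Let d := / T.

Lemma d_pos : 0 < d <= / 4.
Proof. unfold d. est. Qed.

Lemma exp4d_le3 : exp (4 * d) <= 3.
Proof. eapply Rle_trans; [apply exp_le|apply exp_le_3]. generalize d_pos. lra. Qed.

Let G (s : C) : C := (cexp (RtoC (ln x) * s) * kern d s * ((s - 1) * / fz s))%C.

Lemma ratio_bound (sg t : R) : a <= sg <= 2 -> Cmod (((sg, t) - 1) * / fz (sg, t))%C <= D * Rpower (Rabs t + 4) c.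
Proof.
  intros H. assert (N : fz (sg, t) <> RtoC 0) by (apply fz_neq0; [exact RH|simpl; lra]).
  rewrite Cmod_mult, Cmod_inv by est. assert (P := proj1 (Cmod_gt_0 _) N). apply (proj2 (Rle_div_l _ _ _ P)).
  rewrite (Rmult_comm (D * _)). est.
Qed.

Lemma x_pow_bound (s : C) : Re s <= 2 -> Cmod (cexp (RtoC (ln x) * s)) <= x ^ 2.
Proof.
  intros H. rewrite Cmod_cexp, Re_scal. assert (0 <= ln x) by est.
  apply Rle_trans with (exp (ln x + ln x)); [apply exp_le; nra|]. rewrite exp_plus, exp_ln by lra. est.
Qed.

Lemma qd_G : exists dG, qd (rect a 2 (V + 1)) G dG.
Proof.
  assert (Hd := d_pos). assert (Hx0 : 0 <= ln x) by est. set (S := rect a 2 (V + 1)).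
  assert (SB : forall s, S s -> Cmod s <= V + 3).
  { intros s [H1 H2]. via Cmod_le_Re_Im. rewrite (Rabs_pos_eq (Re s)); lra. }
  destruct (qd_fz a (V + 1) ltac:(lra) ltac:(lra)) as [dF HF].
  destruct (fz_min_rect a (V + 1) RH ltac:(lra)) as [m [Hm Hmin]]. assert (Q1 := qd_cexp S (RtoC (ln x)) (ln x * 2)).
  assert (Q2 := qd_cexp S (RtoC d) (d * 2)). assert (QI := qd_id S (V + 3) SB).
  assert (Q3 : qd S (fun s => RtoC 4 + RtoC (-1) * s)%C (fun s => RtoC 0 + (RtoC 0 * s + RtoC (-1) * 1))%C).
  { apply (qd_plus S (fun _ => RtoC 4) _ (fun s => RtoC (-1) * s)%C); [apply qd_const|].
    apply (qd_mult S (fun _ => RtoC (-1)) _ (fun s => s)); [apply qd_const|exact QI]. }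
  assert (Q4 := qd_mult S _ _ _ _ QI Q3). assert (L4 : forall s, S s -> 1 <= Cmod (s * (RtoC 4 + RtoC (-1) * s))%C).
  { intros s [H1 H2]. rewrite Cmod_mult.
    assert (1 / 2 <= Cmod s) by (eapply Rle_trans; [|apply Re_le_Cmod]; rewrite Rabs_pos_eq; lra).
    assert (2 <= Cmod (RtoC 4 + RtoC (-1) * s)%C).
    { eapply Rle_trans; [|apply Re_le_Cmod]. rewrite Re_plus, Re_scal. simpl. rewrite Rabs_pos_eq; lra. }
    nra. }
  assert (Q5 := qd_inv S _ _ 1 Rlt_0_1 L4 Q4). assert (Q6 := qd_inv S fz dF m Hm Hmin HF).
  assert (E1 : forall s, S s -> Re (RtoC (ln x) * s)%C <= ln x * 2) by (intros s [H1 H2]; rewrite Re_scal; apply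
    Rmult_le_compat_l; lra).
  assert (E2 : forall s, S s -> Re (RtoC d * s)%C <= d * 2) by (intros s [H1 H2]; rewrite Re_scal; apply
    Rmult_le_compat_l; lra).
  specialize (Q1 E1). specialize (Q2 E2).
  assert (Q7 := qd_plus S _ _ _ _ (qd_const S (RtoC (exp (4 * d)))) (qd_mult S _ _ _ _ (qd_const S (RtoC (-1))) Q2)).
  assert (Q8 := qd_mult S _ _ _ _ (qd_const S (RtoC (4 / (exp (4 * d) - 1)))) (qd_mult S _ _ _ _ Q7 Q5)).
  assert (Q9 := qd_plus S _ _ _ _ QI (qd_const S (- RtoC 1)%C)).
  assert (Q := qd_mult S _ _ _ _ (qd_mult S _ _ _ _ Q1 Q8) (qd_mult S _ _ _ _ Q9 Q6)). eexists. exact Q.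
Qed.

(** On $\Re s=2$ the factor $1/\zeta$ is a Möbius series converging uniformly in $t$. For its
    partial sums the integral is that of [window_integral], and the tail disappears in the limit. *)
Lemma G_line2 : ex_RInt (fun t => Re (G (2, t))) (- V) V ->
  Rabs (RInt (fun t => Re (G (2, t))) (- V) V - 2 * PI * Mertens x) <=
  2 * PI * (x * (exp d - 1) + 1) + 144 * x ^ 2 * T / V.
Proof.
  intros Ex. assert (Hd := d_pos). assert (H3 := exp4d_le3). set (J := RInt (fun t => Re (G (2, t))) (- V) V).
  set (A := fun N t => Re (cexp (RtoC (ln x) * (2, t)) * kern d (2, t) * csum (mterm (2, t)) N)%C).
  set (tau := fun N => Series (fun k => Cmod (mterm (2, 0) k)) - rsum (fun k => Cmod (mterm (2, 0) k)) N).
  set (CC := x ^ 2 * (3 * exp (4 * d))). assert (Tail : forall N t, Rabs (Re (G (2, t)) - A N t) <= CC * tau N).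
  { intros N t. set (s := (2, t) : C). assert (Hs : 1 < Re s) by (simpl; lra).
    assert (Ns : fz s <> RtoC 0) by (apply fz_neq0; [exact RH|lra]). assert (E := fz_mobius s Hs).
    assert (E2 : ((s - 1) * / fz s)%C = CSeries (mterm s)) by (rewrite <- E; field; exact Ns). unfold A, G. fold s.
    rewrite E2, <- Re_minus.
    replace (cexp (RtoC (ln x) * s) * kern d s * CSeries (mterm s) - cexp (RtoC (ln x) * s) * kern d s * csum (mterm s) N)%C
      with (cexp (RtoC (ln x) * s) * kern d s * (CSeries (mterm s) - csum (mterm s) N))%C by alg.
    via Re_le_Cmod. rewrite !Cmod_mult. assert (T1 := CSeries_tail (mterm s) N (mterm_summable s Hs)).
    assert (EM : forall k, Cmod (mterm s k) = Cmod (mterm (2, 0) k)).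
    { intros k. unfold mterm. rewrite !Cmod_mult, !Cmod_cpow_neg. reflexivity. }
    rewrite (Series_ext _ _ EM), (rsum_ext _ _ N (fun k _ => EM k)) in T1.
    apply Rmult_le_compat; [est|est| |exact T1]. apply Rmult_le_compat; [est|est|apply x_pow_bound; simpl; lra|].
    eapply Rle_trans; [apply kern_bound_near; [lra|simpl; lra]|].
    assert (2 <= Cmod s) by (eapply Rle_trans; [|apply Re_le_Cmod]; simpl; rewrite Rabs_pos_eq; lra).
    apply Rle_div_l; [lra|]. generalize (exp_pos (4 * d)). nra. }
  assert (Ltau : is_lim_seq (fun N => (V - - V) * (CC * tau N)) 0).
  { replace (Finite 0) with (Rbar_mult ((V - - V) * CC) 0) by (simpl; f_equal; ring).
    apply (is_lim_seq_ext (fun N => ((V - - V) * CC) * tau N)); [est|]. apply is_lim_seq_scal_l.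
    apply Series_tail_lim. apply (mterm_summable (2, 0)). simpl. lra. }
  set (E0 := 2 * PI * (x * (exp d - 1) + 1) + 48 * exp (4 * d) * x ^ 2 / (d * V)).
  assert (Main : Rabs (J - 2 * PI * Mertens x) <= E0).
  {
    apply (is_lim_seq_le_loc (fun _ => Rabs (J - 2 * PI * Mertens x)) (fun N => (V - - V) * (CC * tau N) + E0) (Rabs
      (J - 2 * PI * Mertens x)) E0).
    - destruct (nfloor_ex x ltac:(lra)) as [n0 Hn0]. exists (S n0). intros N HN.
      assert (HxN : x <= INR N) by (apply le_INR in HN; rewrite S_INR in HN; lra).
      destruct (window_integral d V x N ltac:(lra) HV Hx) as [W1 W2].
      assert (W3 := window_sum d x N ltac:(lra) Hx HxN). set (IA := RInt (A N) (- V) V) in *.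
      assert (W4 : Rabs (J - IA) <= (V - - V) * (CC * tau N)).
      {
        apply (norm_RInt_le_const (V := R_NormedModule) (fun t => Re (G (2, t)) - A N t) (- V) V _ (CC * tau N));
          [lra| |].
        - est.
        -
          apply (is_RInt_minus (V := R_NormedModule) (fun t => Re (G (2, t))) (A N)); [apply (RInt_correct (V :=
            R_CompleteNormedModule)), Ex|exact W1]. }
      set (SW := rsum _ N) in *.
      replace (J - 2 * PI * Mertens x) with ((J - IA) + ((IA - 2 * PI * SW) + 2 * PI * (SW - Mertens x))) by lra.
      via Rabs_triang. apply Rplus_le_compat; [exact W4|]. unfold E0. rewrite Rplus_comm. assert (PP := PI_RGT_0).
      est.
    - apply is_lim_seq_const.
    - replace (Finite E0) with (Finite (0 + E0)) by alg. apply is_lim_seq_plus'; [exact Ltau|apply is_lim_seq_const]. }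
  via Main. unfold E0.
  replace (48 * exp (4 * d) * x ^ 2 / (d * V)) with (exp (4 * d) * (48 * x ^ 2 * T / V)) by (unfold d; field; lra).
  replace (144 * x ^ 2 * T / V) with (3 * (48 * x ^ 2 * T / V)) by lra. est.
Qed.

(** With $j=\sqrt{1+t^2}$, the interpolated kernel bound is of order $j^{-1}(T/j)^c$ and $1/\zeta$
    of order $j^c$. The product is $T^c/j$, whose integral is only logarithmic in $V$. *)
Lemma G_line_a t : Rabs (Re (G (a, t))) <= Rpower x a * (180 * D * Rpower T c) * / sqrt (1 + t ^ 2).
Proof.
  assert (Hd := d_pos). assert (H3 := exp4d_le3). set (j := sqrt (1 + t ^ 2)).
  assert (Hj2 : j ^ 2 = 1 + t ^ 2) by (unfold j; rewrite pow2_sqrt; nra).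
  assert (Hj : 1 <= j) by (unfold j; rewrite <- sqrt_1 at 1; apply sqrt_le_1_alt; generalize (pow2_ge_0 t); lra).
  set (s := (a, t) : C). assert (S1 : j / 2 <= Cmod s).
  { apply Rsqr_incr_0_var; [|est]. rewrite !Rsqr_pow2, Cmod_sqr. simpl Re. simpl Im. assert (1 / 4 <= a ^ 2) by nra.
    assert (0 <= t ^ 2) by nra. lra. }
  assert (S2 : j <= Cmod (RtoC 4 + RtoC (-1) * s)%C).
  { apply Rsqr_incr_0_var; [|est]. rewrite !Rsqr_pow2, Cmod_sqr.
    replace (Re (RtoC 4 + RtoC (-1) * s)%C) with (4 - a) by alg.
    replace (Im (RtoC 4 + RtoC (-1) * s)%C) with (- t) by alg. assert (1 <= (4 - a) ^ 2) by nra. lra. }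
  assert (K1 : Cmod (kern d s) <= 36 * (/ j * 1)).
  { eapply Rle_trans; [apply kern_bound_near; [lra|simpl; lra]|]. apply Rle_trans with (18 * / (j / 2)).
    - unfold Rdiv at 1. est.
    - right. field. lra. }
  assert (K2 : Cmod (kern d s) <= 36 * (/ j * (T / j))).
  { eapply Rle_trans; [apply kern_bound_decay; [lra|simpl; lra]|].
    replace (2 * exp (4 * d) / d) with (2 * exp (4 * d) * T) by (unfold d; field; lra).
    apply Rle_trans with (6 * T * / (j / 2 * j)).
    - unfold Rdiv at 1. est.
    - replace (6 * T * / (j / 2 * j)) with (12 * (/ j * (T / j))) by alg. est. }
  assert (K : Cmod (kern d s) <= 36 * (/ j * Rpower (T / j) c)).
  { assert (Tj : 0 < T / j) by est. assert (Q := min_le_Rpower (T / j) c Tj Hc).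
    apply Rle_trans with (36 * (/ j * Rmin 1 (T / j))).
    - unfold Rmin. destruct (Rle_dec 1 (T / j)); assumption.
    - est. }
  assert (Z := ratio_bound a t ltac:(lra)). assert (R5 : Rpower (Rabs t + 4) c <= 5 * Rpower j c).
  { assert (Rabs t <= j).
    { rewrite <- (sqrt_Rsqr_abs t). apply sqrt_le_1_alt. unfold Rsqr. nra. }
    assert (0 <= Rabs t) by est. apply Rle_trans with (Rpower (5 * j) c); [apply Rle_Rpower_l; lra|].
    rewrite <- Rpower_mult_distr by lra. rewrite <- (Rpower_1 5) at 2 by lra. est. }
  assert (RT : Rpower (T / j) c * Rpower j c = Rpower T c).
  { rewrite Rpower_mult_distr by est. f_equal. field. lra. }
  via Re_le_Cmod. unfold G. rewrite !Cmod_mult. rewrite <- (Cmod_mult (s - 1)).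
  assert (EX : Cmod (cexp (RtoC (ln x) * s)) = Rpower x a).
  { rewrite Cmod_cexp, Re_scal. unfold Rpower. f_equal. simpl. ring. }
  rewrite EX. rewrite !Rmult_assoc. apply Rmult_le_compat_l; [est|].
  apply Rle_trans with ((36 * (/ j * Rpower (T / j) c)) * (D * (5 * Rpower j c))).
  - apply Rmult_le_compat; [est|est|exact K|]. via Z. est.
  - nra.
Qed.

Lemma RInt_inv_sqrt : is_RInt (fun t => / sqrt (1 + t ^ 2)) (- V) V (2 * arcsinh V).
Proof.
  replace (2 * arcsinh V) with (arcsinh V - arcsinh (- V)).
  - apply (is_RInt_derive (V := R_CompleteNormedModule) arcsinh (fun t => / sqrt (1 + t ^ 2))).
    + intros t _. apply is_derive_Reals. replace (1 + t ^ 2) with (t ^ 2 + 1) by lra. apply derivable_pt_lim_arcsinh.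
    + intros t _. apply (ex_derive_continuous (fun t => / sqrt (1 + t ^ 2))). assert (0 < 1 + t ^ 2) by nra.
      auto_derive. est.
  - assert (arcsinh (- V) = - arcsinh V); [|lra]. unfold arcsinh. rewrite <- ln_Rinv.
    + f_equal. assert (Hs := sqrt_sqrt (V ^ 2 + 1) ltac:(nra)). assert (Hs0 := sqrt_pos (V ^ 2 + 1)).
      replace ((- V) ^ 2) with (V ^ 2) by lra. apply Rmult_eq_reg_r with (V + sqrt (V ^ 2 + 1)); [|lra].
      rewrite Rinv_l by lra. nra.
    + est.
Qed.

(** In this order the terms come from smoothing, from truncation on $\Re s=2$, from the horizontal
    sides and from the shifted line. *)
Theorem perron_bound :
  2 * PI * Rabs (Mertens x) <=
  2 * PI * (x * (exp (/ T) - 1) + 1) + 144 * x ^ 2 * T / V + 144 * x ^ 2 * T * D / V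
  + 360 * Rpower x a * D * Rpower T c * arcsinh V.
Proof.
  assert (Hd := d_pos). assert (H3 := exp4d_le3). destruct qd_G as [dG HG].
  destruct (rect_shift G dG a 2 V (x ^ 2 * (6 * T / V ^ 2) * (D * (2 * V))) ltac:(lra) ltac:(lra) HG) as [I1 [I2 I3]].
  { assert (E : forall y v, a <= y <= 2 -> Rabs v = V -> Cmod (G (y, v)) <= x ^ 2 * (6 * T / V ^ 2) * (D * (2 * V))).
    { intros y v Hy Hv. unfold G. rewrite Cmod_mult. apply Rmult_le_compat; [est|est| |].
      - rewrite Cmod_mult. apply Rmult_le_compat; [est|est|apply x_pow_bound; simpl; lra|].
        eapply Rle_trans; [apply kern_bound_decay; [lra|simpl; lra]|].
        assert (A1 : V <= Cmod (y, v)) by (rewrite <- Hv; apply (Im_le_Cmod (y, v))).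
        assert (A2 : V <= Cmod (RtoC 4 + RtoC (-1) * (y, v))%C).
        { rewrite <- Hv, <- Rabs_Ropp. eapply Rle_trans; [|apply Im_le_Cmod]. right. simpl. f_equal. ring. }
        replace (2 * exp (4 * d) / d) with (2 * exp (4 * d) * T) by (unfold d; field; lra). simpl. est.
      - eapply Rle_trans; [apply ratio_bound; lra|]. apply Rmult_le_compat_l; [exact HD|]. rewrite Hv.
        apply Rle_trans with (Rpower (V + 4) 1); [est|rewrite Rpower_1; lra]. }
    split; apply E; try lra; [apply Rabs_pos_eq; lra|rewrite Rabs_Ropp; apply Rabs_pos_eq; lra]. }
  assert (M2 := G_line2 I1). fold d.
  assert (La : Rabs (RInt (fun t => Re (G (a, t))) (- V) V) <= Rpower x a * (180 * D * Rpower T c) * (2 * arcsinh V)).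
  {
    apply (norm_RInt_le (V := R_NormedModule) (fun t => Re (G (a, t))) (fun t => Rpower x a * (180 * D * Rpower T c) *
      / sqrt (1 + t ^ 2)) (- V) V _ _ ltac:(lra)).
    - intros t _. apply G_line_a.
    - apply (RInt_correct (V := R_CompleteNormedModule)), I2.
    - apply (is_RInt_scal (V := R_NormedModule) (fun t => / sqrt (1 + t ^ 2)) (- V) V). apply RInt_inv_sqrt. }
  set (J2 := RInt (fun t => Re (G (2, t))) (- V) V) in *. set (Ja := RInt (fun t => Re (G (a, t))) (- V) V) in *.
  assert (I4 : 2 * (x ^ 2 * (6 * T / V ^ 2) * (D * (2 * V))) * (2 - a) <= 144 * x ^ 2 * T * D / V).
  {
    replace (2 * (x ^ 2 * (6 * T / V ^ 2) * (D * (2 * V))) * (2 - a)) with (24 * (x ^ 2 * T * D / V) * (2 - a)) by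
      alg.
    replace (144 * x ^ 2 * T * D / V) with (24 * (x ^ 2 * T * D / V) * 6) by lra. est. }
  assert (PP := PI_RGT_0).
  replace (2 * PI * Rabs (Mertens x)) with (Rabs (2 * PI * Mertens x)) by (rewrite Rabs_mult, (Rabs_pos_eq (2 * PI));
    lra).
  replace (2 * PI * Mertens x) with (- (J2 - 2 * PI * Mertens x) + ((J2 - Ja) + Ja)) by lra. via Rabs_triang.
  rewrite Rabs_Ropp. assert (Tr := Rabs_triang (J2 - Ja) Ja). lra.
Qed.
End Perron.

(** * A bound for M(x) *)

Lemma exp_ge_partial (y b : R) n : 0 <= y -> b <= rsum (fun k => y ^ k / INR (fact k)) n -> b <= exp y.
Proof. intros Hy H. via H. now apply exp_partial_le. Qed.

Lemma exp_ge_pow (z b : R) m : 0 <= z -> b <= (1 + z + z ^ 2 / 2 + z ^ 3 / 6 + z ^ 4 / 24) ^ m -> b <= exp (INR m * z).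
Proof.
  intros Hz H. via H. rewrite <- exp_pow_nat. apply pow_incr. split.
  - est.
  - apply (exp_ge_partial _ _ 5 Hz). simpl. lra.
Qed.

Lemma Mertens_le (x : R) : 0 <= x -> Rabs (Mertens x) <= x.
Proof.
  intros Hx. unfold Mertens. destruct (base_Int_part x) as [I1 I2].
  assert (I0 : (0 <= Int_part x)%Z) by (assert (-1 < Int_part x)%Z by (apply lt_IZR; simpl; lra); lia).
  apply Rle_trans with (INR (Z.to_nat (Int_part x))).
  - rewrite mertens_rsum. via rsum_abs. rewrite <- (Rmult_1_r (INR _)), <- rsum_const. apply rsum_le. intros.
    apply Arithmetic.mobius_bound.
  - rewrite INR_IZR_INZ, Z2Nat.id by est. exact I1.
Qed.

Lemma ln_three_halves : ln (3 / 2) <= 4055 / 10000.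
Proof. rewrite <- (ln_exp (4055 / 10000)). apply ln_le; [lra|]. apply (exp_ge_partial _ _ 7); [lra|]. simpl. lra. Qed.

Lemma exp_minus_le (y b : R) : 0 < b -> b <= exp y -> exp (- y) <= / b.
Proof. rewrite exp_Ropp. est. Qed.

(* The line of integration is moved to [Re s = 1 / 2 + al]; the constants [3.4] in [al] and
   [1.6] in [K] make the exponent of [main_bound] smaller than [4.45 / u]. *)
Section ContourShift.
Variables (u : R) (K : nat).
Hypothesis Hu : 89 / 10 <= u.
Hypothesis HK : INR K <= 16 / 10 * u < INR K + 1.
Let al : R := 34 / 10 / u.
Let Q : R := ((3 / 2 - al) / (3 / 2 - al / 100)) ^ K.
Let c : R := 96 * Q / (INR (S K) * (1 - Q)).
Let P : R := 9 / 2 * (3 / 2) ^ K / (1 - Q) ^ 2.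
Let v : R := u - 89 / 10.

Lemma al_range : 0 < al <= 4 / 10.
Proof. unfold al. split; [est|]. apply Rle_div_l; lra. Qed.

(** The base of the power is at most $1-0.66\,al\le e^{-0.66\,al}$ and $K>1.6u-1$, so the exponent
    is $(1.6u-1)\cdot0.66\cdot3.4/u$. *)
Lemma Q_exp : 0 <= Q <= exp (- (35904 / 10000 - 2244 / 1000 / u)).
Proof.
  assert (Ha := al_range). set (q := (3 / 2 - al) / (3 / 2 - al / 100)). assert (Hq : 0 <= q <= 1 - 66 / 100 * al).
  { unfold q. split; [est|]. apply Rle_div_l; [lra|]. nra. }
  fold q in Q. unfold Q. split; [est|]. apply Rle_trans with (exp (- (66 / 100 * al)) ^ K).
  - apply pow_incr. generalize (exp_ineq1_le (- (66 / 100 * al))). lra.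
  - rewrite exp_pow_nat. apply exp_le.
    replace (35904 / 10000 - 2244 / 1000 / u) with ((16 / 10 * u - 1) * (66 / 100 * al)) by (unfold al; field; lra).
    assert ((16 / 10 * u - 1) * (66 / 100 * al) <= INR K * (66 / 100 * al)) by est. lra.
Qed.

Lemma Q_le_1 : Q <= 356 / 10000.
Proof.
  destruct Q_exp as [_ H]. via H. apply Rle_trans with (exp (- (3338 / 1000))).
  - apply exp_le. assert (2244 / 1000 / u <= 2244 / 1000 / (89 / 10)) by est. lra.
  - eapply Rle_trans; [apply (exp_minus_le _ (281 / 10)); [lra|]|lra].
    replace (3338 / 1000) with (INR 16 * (3338 / 16000)) by (simpl; lra). apply exp_ge_pow; lra.
Qed.

Lemma Q_le_2 : 20 <= u -> Q <= 31 / 1000.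
Proof.
  intros Hu2. destruct Q_exp as [_ H]. via H. apply Rle_trans with (exp (- (3478 / 1000))).
  - apply exp_le. assert (2244 / 1000 / u <= 2244 / 1000 / 20) by est. lra.
  - eapply Rle_trans; [apply (exp_minus_le _ (3226 / 100)); [lra|]|lra].
    replace (3478 / 1000) with (INR 16 * (3478 / 16000)) by (simpl; lra). apply exp_ge_pow; lra.
Qed.

(** $K+1>1.6u$ turns $96$ into $60$. *)
Lemma cu_bound (q : R) : Q <= q -> q < 1 -> c * u <= 60 * q / (1 - q).
Proof.
  intros H H1. destruct Q_exp as [H0 _]. unfold c. rewrite S_INR.
  assert (E : 96 * Q / ((INR K + 1) * (1 - Q)) * u <= 60 * Q / (1 - Q)).
  { replace (60 * Q / (1 - Q)) with (96 * Q / ((INR K + 1) * (1 - Q)) * ((INR K + 1) / (16 / 10))) by alg. est. }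
  via E. est.
Qed.

(** $K\le1.6u$ gives $(3/2)^K\le e^{0.6488u}$. The remaining $e^{-0.3512u}$ absorbs the factor $u$
    and still leaves decay in $v=u-8.9$, which is kept as $1/(1+0.2388v)$. *)
Lemma uP_bound : u * P <= 19 / 10 / (1 + 2388 / 10000 * v) * exp u.
Proof.
  assert (H1 := Q_le_1). assert (Hv : 0 <= v) by (unfold v; lra). assert (I : / (1 - Q) ^ 2 <= 10752 / 10000).
  { apply Rle_trans with (/ (9644 / 10000) ^ 2); [|lra]. est. }
  assert (B : (3 / 2) ^ K <= exp (6488 / 10000 * u)).
  { rewrite <- (exp_ln (3 / 2)) at 1 by lra. rewrite exp_pow_nat. apply exp_le. assert (L := ln_three_halves).
    apply Rle_trans with (16 / 10 * u * (4055 / 10000)); [est|lra]. }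
  assert (U : u <= 89 / 10 * exp (10 / 89 * v)).
  { generalize (exp_ineq1_le (10 / 89 * v)). unfold v. lra. }
  assert (C : exp (6488 / 10000 * u) * exp (10 / 89 * v) <= exp u * (exp (- (3125 / 1000)) * exp (- (2388 / 10000 *
    v)))).
  { rewrite <- !exp_plus. apply exp_le. unfold v. lra. }
  assert (E1 : exp (- (3125 / 1000)) <= / (2275 / 100)).
  { apply exp_minus_le; [lra|]. replace (3125 / 1000) with (INR 16 * (3125 / 16000)) by (simpl; lra).
    apply exp_ge_pow; lra. }
  assert (E2 : exp (- (2388 / 10000 * v)) <= / (1 + 2388 / 10000 * v)) by (apply exp_minus_le; [lra|apply exp_ineq1_le]).
  assert (Eu := exp_pos u). assert (Pp : 0 < (3 / 2) ^ K) by est. assert (PP : P <= 4839 / 1000 * (3 / 2) ^ K).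
  { unfold P, Rdiv at 1. apply Rle_trans with (9 / 2 * (3 / 2) ^ K * (10752 / 10000)); [est|lra]. }
  assert (P0 : 0 <= P) by (unfold P; apply Rdiv_le_0_compat; [lra|est]).
  apply Rle_trans with (89 / 10 * exp (10 / 89 * v) * (4839 / 1000 * exp (6488 / 10000 * u))).
  - est.
  - apply Rle_trans with (43068 / 1000 * (exp u * (/ (2275 / 100) * / (1 + 2388 / 10000 * v)))).
    + apply Rle_trans with (43068 / 1000 * (exp (6488 / 10000 * u) * exp (10 / 89 * v))).
      * nra.
      * apply Rmult_le_compat_l; [lra|]. via C. est.
    +
      replace (43068 / 1000 * (exp u * (/ (2275 / 100) * / (1 + 2388 / 10000 * v)))) with (43068 / 1000 / (2275 / 100)
        * / (1 + 2388 / 10000 * v) * exp u) by lra.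
      apply Rmult_le_compat_r; [lra|]. apply Rmult_le_compat_r; [est|lra].
Qed.
End ContourShift.

(** [q] is the cost of [P], decreasing in $v$; [A] stands for $cu$, the cost of $T^c$, whose weight
    $v/u$ vanishes at $u=8.9$, where $T=1$. The first dominates for small $v$ and the second for
    large $v$; beyond $v=60$ the smaller bound on [A] is needed, since $2.215$ alone exceeds
    $2.085$. *)
Lemma tradeoff (v q A : R) : 0 <= v ->
  A <= 60 * (356 / 10000) / (1 - 356 / 10000) -> (60 <= v -> A <= 60 * (31 / 1000) / (1 - 31 / 1000)) ->
  0 <= A -> q <= 1911 / 1000 / (1 + 2388 / 10000 * v) -> q + A * (v / (v + 89 / 10)) <= 2085 / 1000.
Proof.
  intros Hv H1 H2 HA Hq. destruct (Rle_lt_dec 60 v) as [H|H].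
  - assert (A * (v / (v + 89 / 10)) <= 192 / 100 * 1) by est.
    assert (1911 / 1000 / (1 + 2388 / 10000 * v) <= 13 / 100) by (apply Rle_div_l; lra). lra.
  - assert (A * (v / (v + 89 / 10)) <= 2215 / 1000 * (v / (v + 89 / 10))) by est.
    assert (1911 / 1000 / (1 + 2388 / 10000 * v) + 2215 / 1000 * (v / (v + 89 / 10)) <= 2085 / 1000); [|lra].
    replace (1911 / 1000 / (1 + 2388 / 10000 * v) + 2215 / 1000 * (v / (v + 89 / 10))) with
      ((1911 / 1000 * (v + 89 / 10) + 2215 / 1000 * v * (1 + 2388 / 10000 * v)) / ((1 + 2388 / 10000 * v) * (v + 89 / 10))) by alg.
    apply Rle_div_l; nra.
Qed.

Lemma ln_le_minus1 (y : R) : 0 < y -> ln y <= y - 1.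
Proof. intros Hy. generalize (exp_ineq1_le (ln y)). rewrite exp_ln by lra. lra. Qed.

Lemma arcsinh_le (V : R) : 1 <= V -> arcsinh V <= ln (3 * V).
Proof.
  intros HV. assert (S0 : 0 <= sqrt (V ^ 2 + 1)) by est. apply ln_le; [lra|].
  assert (sqrt (V ^ 2 + 1) <= 2 * V); [|lra]. rewrite <- (sqrt_pow2 (2 * V)) by lra. apply sqrt_le_1_alt. nra.
Qed.

(** $T=x^{1/2-4.45/u}$ makes the smoothing error $x/T$ equal to the target power $Y$, and $V=x^6$
    makes the truncation errors negligible. The shifted line may then use half of $Y\log x$. *)
Theorem main_bound (x u : R) :
  RiemannHypothesis -> 89 / 10 <= u -> 199 / 100 * exp u <= ln x -> 0 < x ->
  2 * PI * Rabs (Mertens x) <= ln x * Rpower x (1 / 2 + 445 / 100 / u).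
Proof.
  intros RH Hu HL Hx. set (L := ln x) in *. assert (PP := PI_RGT_0). assert (P4 := PI_4). assert (Eu : 7000 <= exp u).
  { apply Rle_trans with (exp (89 / 10)); [|now apply exp_le].
    replace (89 / 10) with (INR 16 * (89 / 160)) by (simpl; lra). apply exp_ge_pow; lra. }
  assert (HxL : x = exp L) by (unfold L; now rewrite exp_ln).
  assert (Hx1 : 13000 <= x) by (rewrite HxL; generalize (exp_ineq1_le L); lra).
  assert (Iu : 0 < 445 / 100 / u) by est. set (T := Rpower x (1 / 2 - 445 / 100 / u)).
  set (Y := Rpower x (1 / 2 + 445 / 100 / u)). assert (PY : 0 < Y) by apply Rpower_pos. assert (TY : T * Y = x).
  { unfold T, Y. rewrite <- Rpower_plus. replace (1 / 2 - 445 / 100 / u + (1 / 2 + 445 / 100 / u)) with 1 by lra.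
    now apply Rpower_1. }
  assert (MX := Mertens_le x ltac:(lra)). destruct (Rlt_le_dec T 4) as [T4|T4].
  (* Here $x<4Y$, and the trivial bound suffices because $\log x$ exceeds $8\pi$. *)
  { nra. }
  assert (HTx : T <= x).
  { unfold T. rewrite <- (Rpower_1 x) at 2 by lra. est. }
  assert (HY1 : 1 <= Y) by nra. destruct (nfloor_ex (16 / 10 * u) ltac:(lra)) as [K HK].
  assert (HK10 : (10 <= K)%nat).
  { assert (9 < INR K) by lra. replace 9 with (INR 9) in H by alg. apply INR_lt in H. lia. }
  set (al := 34 / 10 / u). assert (Hal : 0 < al <= 4 / 10) by (apply al_range; exact Hu).
  set (Q := ((3 / 2 - al) / (3 / 2 - al / 100)) ^ K). assert (Q1 : Q <= 356 / 10000) by (apply (Q_le_1 u K Hu HK)).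
  assert (Q0 : 0 <= Q) by (apply (Q_exp u K Hu HK)). set (c := 96 * Q / (INR (S K) * (1 - Q))).
  set (P := 9 / 2 * (3 / 2) ^ K / (1 - Q) ^ 2).
  assert (cu1 : c * u <= 60 * (356 / 10000) / (1 - 356 / 10000)) by (apply (cu_bound u K Hu HK); [exact Q1|lra]).
  assert (cu2 : 20 <= u -> c * u <= 60 * (31 / 1000) / (1 - 31 / 1000)).
  { intros H20. apply (cu_bound u K Hu HK); [apply (Q_le_2 u K Hu HK H20)|lra]. }
  assert (uP := uP_bound u K Hu HK). assert (c0 : 0 <= c).
  { unfold c. est. }
  assert (c1 : c <= 1 / 4) by nra.
  assert (P0 : 0 <= P).
  { unfold P. est. }
  set (D := 4 * exp (6 * c + P)). assert (D0 : 4 <= D).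
  { unfold D. assert (exp 0 <= exp (6 * c + P)) by est. rewrite exp_0 in H. lra. }
  set (a := 1 / 2 + al). assert (PB := perron_bound x T (x ^ 6) a D c RH ltac:(lra) T4).
  specialize (PB ltac:(apply Rle_trans with (13000 ^ 6); [lra|est]) ltac:(unfold a; lra) ltac:(lra) ltac:(lra)).
  assert (Hz : forall sg t, a <= sg <= 2 -> Cmod ((sg, t) - 1)%C <= Cmod (fz (sg, t)) * (D * Rpower (Rabs t + 4) c)).
  { intros sg t Hs. assert (B := inv_fz_bound t sg al K RH ltac:(lra) HK10 Hs). cbv zeta in B. fold Q P in B. via B.
    right. f_equal. unfold D, Rpower. rewrite (Rmult_assoc 4 (exp (6 * c + P))), <- (exp_plus (6 * c + P)). f_equal.
    f_equal. unfold c, Rdiv. ring. }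
  specialize (PB Hz). set (Z := Rpower x a * D * Rpower T c). assert (Z1 : D <= Z).
  { unfold Z. assert (1 <= Rpower x a) by (rewrite <- (Rpower_O x) by lra; apply Rle_Rpower; unfold a; lra).
    assert (1 <= Rpower T c) by (rewrite <- (Rpower_O T) by lra; apply Rle_Rpower; lra).
    assert (1 * D * 1 <= Rpower x a * D * Rpower T c) by est. lra. }
  assert (As : arcsinh (x ^ 6) <= 7 * L).
  { assert (X6 : 0 < x ^ 6) by est. via arcsinh_le.
    - apply Rle_trans with (13000 ^ 6); [lra|est].
    - rewrite ln_mult by lra. rewrite <- Rpower_pow by lra. unfold Rpower. rewrite ln_exp. fold L.
      assert (ln 3 <= 2) by (via ln_le_minus1; lra). simpl (INR 6). lra. }
  assert (T1 : x * (exp (/ T) - 1) + 1 <= 3 * Y).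
  { assert (It : 0 < / T <= / 4) by est. assert (E2 : exp (/ T) - 1 <= 2 * / T).
    { assert (Hm := exp_ineq1_le (- / T)). rewrite exp_Ropp in Hm. assert (exp (/ T) <= / (1 - / T)).
      { rewrite <- (Rinv_inv (exp (/ T))). est. }
      assert (/ (1 - / T) <= 1 + 2 * / T); [|lra]. apply Rmult_le_reg_r with (1 - / T); [lra|]. rewrite Rinv_l by lra.
      nra. }
    assert (x * (exp (/ T) - 1) <= x * (2 * / T)) by est.
    replace (x * (2 * / T)) with (2 * Y) in H by (rewrite <- TY; field; lra). lra. }
  assert (T2 : 144 * x ^ 2 * T / x ^ 6 <= 1).
  { apply Rle_trans with (144 * x ^ 2 * x / x ^ 6).
    - est.
    - replace (144 * x ^ 2 * x / x ^ 6) with (144 / x ^ 3) by alg. apply Rle_div_l; [apply pow_lt; lra|].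
      apply Rle_trans with (13000 ^ 3); [lra|]. rewrite Rmult_1_l. est. }
  assert (T3 : 144 * x ^ 2 * T * D / x ^ 6 <= Z) by nra.
  assert (T5 : 360 * Rpower x a * D * Rpower T c * arcsinh (x ^ 6) <= 2520 * L * Z).
  {
    replace (360 * Rpower x a * D * Rpower T c * arcsinh (x ^ 6)) with (360 * Z * arcsinh (x ^ 6)) by (unfold Z;
      ring).
    apply Rle_trans with (360 * Z * (7 * L)); [est|lra]. }
  (* $5042=2(360\cdot7+1)$ makes the shifted line and the horizontal sides cost at most half of
     $LY$. After taking logarithms and multiplying by $2u$ the budget is $8.9-6.8=2.1$ times $L$:
     $2.085$ for [tradeoff] and $0.015$ for the constant $12$. *)
  assert (ZY : 5042 * Z <= Y).
  { assert (E : 5042 * Z <= exp (12 + P + (a + c * (1 / 2 - 445 / 100 / u)) * L)).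
    {
      assert (E1 : Rpower T c = exp (c * (1 / 2 - 445 / 100 / u) * L)) by (unfold T, Rpower; rewrite ln_exp; fold L;
        f_equal; ring).
      assert (E2 : Rpower x a = exp (a * L)) by est. unfold Z. rewrite E1, E2. unfold D.
      replace (exp (12 + P + (a + c * (1 / 2 - 445 / 100 / u)) * L)) with
        (exp (12 - 6 * c) * (exp (a * L) * exp (6 * c + P) * exp (c * (1 / 2 - 445 / 100 / u) * L))) by (rewrite <- !exp_plus; f_equal; ring).
      set (W := exp (a * L) * exp (6 * c + P) * exp (c * (1 / 2 - 445 / 100 / u) * L)).
      replace (5042 * (exp (a * L) * (4 * exp (6 * c + P)) * exp (c * (1 / 2 - 445 / 100 / u) * L))) with (20168 * W)
        by (unfold W; ring).
      apply Rmult_le_compat_r.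
      - unfold W. est.
      - apply Rle_trans with (exp 10); [|est]. replace 10 with (INR 16 * (10 / 16)) by (simpl; lra).
        apply exp_ge_pow; lra. }
    via E. unfold Y, Rpower. fold L. apply exp_le. set (v := u - 89 / 10) in *.
    assert (Hv : 0 <= v) by (unfold v; lra). assert (W := tradeoff v (u * P / (995 / 1000 * exp u)) (c * u) Hv cu1).
    specialize (W ltac:(intros; apply cu2; unfold v in *; lra) ltac:(est)).
    assert (W1 : u * P / (995 / 1000 * exp u) <= 1911 / 1000 / (1 + 2388 / 10000 * v)).
    { apply Rle_div_l; [lra|]. via uP.
      replace (1911 / 1000 / (1 + 2388 / 10000 * v) * (995 / 1000 * exp u)) with (1911 * 995 / 1000000 * (/ (1 + 2388
        / 10000 * v) * exp u)) by lra.
      replace (19 / 10 / (1 + 2388 / 10000 * v) * exp u) with (19 / 10 * (/ (1 + 2388 / 10000 * v) * exp u)) by lra.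
      est. }
    replace (v + 89 / 10) with u in W by (unfold v; ring).
    assert (W2 : 2 * u * (12 + P) <= (15 / 1000 + u * P / (995 / 1000 * exp u)) * L).
    { assert (A1 : 2 * u * P <= u * P / (995 / 1000 * exp u) * L).
      { replace (2 * u * P) with (u * P / (995 / 1000 * exp u) * (199 / 100 * exp u)) by alg. est. }
      assert (A2 : 24 * u <= 15 / 1000 * L).
      { assert (Ee : 7300 * (1 + v) <= exp u).
        { replace u with (89 / 10 + v) by (unfold v; ring). rewrite exp_plus. apply Rmult_le_compat; [lra|lra| |].
          - replace (89 / 10) with (INR 32 * (89 / 320)) by (simpl; lra). apply exp_ge_pow; lra.
          - apply exp_ineq1_le. }
        unfold v in Ee. lra. }
      lra. }
    assert (W3 : 2 * u * (12 + P) + (c * u * (u - 89 / 10) / u) * L <= 2085 / 1000 * L + 15 / 1000 * L).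
    { replace (c * u * (u - 89 / 10) / u) with (c * u * (v / u)) by (unfold v; field; lra).
      assert ((u * P / (995 / 1000 * exp u) + c * u * (v / u)) * L <= 2085 / 1000 * L) by est. lra. }
    apply Rmult_le_reg_l with (2 * u); [lra|].
    replace (2 * u * (12 + P + (a + c * (1 / 2 - 445 / 100 / u)) * L)) with
      (2 * u * (12 + P) + (c * u * (u - 89 / 10) / u) * L + (u + 68 / 10) * L) by (unfold a, al; field; lra).
    replace (2 * u * ((1 / 2 + 445 / 100 / u) * L)) with ((u + 89 / 10) * L) by alg. lra. }
  assert (LZ : L * (5042 * Z) <= L * Y) by est. assert (13000 * Y <= L * Y) by est.
  assert (2 * PI * (x * (exp (/ T) - 1) + 1) <= 2 * 4 * (3 * Y)).
  { apply Rmult_le_compat; try lra. assert (0 <= x * (exp (/ T) - 1)); [|lra]. apply Rmult_le_pos; [lra|].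
    assert (0 < / T) by est. generalize (exp_ineq1_le (/ T)). lra. }
  lra.
Qed.

(** * Ball arithmetic *)

Definition SC : Z := (10 ^ 30)%Z.
(* [(a, b, e)] is the disc of centre [(a + b i) / SC] and radius [e / SC]. *)
Definition ball : Type := (Z * Z * Z)%type.

Definition cz (a b : Z) : C := (IZR a / IZR SC, IZR b / IZR SC).
Definition bctr (B : ball) : C := let '(a, b, _) := B in cz a b.
Definition near (z : C) (B : ball) : Prop := Cmod (z - bctr B)%C <= IZR (snd B) / IZR SC.

Definition bnorm (B : ball) : Z := let '(a, b, _) := B in (Z.sqrt (a * a + b * b) + 1)%Z.
Definition badd (B B' : ball) : ball :=
  let '(a, b, e) := B in let '(a', b', e') := B' in (a + a', b + b', e + e')%Z.
(** The added $3$ covers the two floored components of the centre and the floored radius. *)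
Definition bmul (B B' : ball) : ball :=
  let '(a, b, e) := B in let '(a', b', e') := B' in
  ((a * a' - b * b') / SC, (a * b' + b * a') / SC, (bnorm B * e' + bnorm B' * e + e * e') / SC + 3)%Z.
Definition bsq (B : ball) : ball := bmul B B.

Lemma SC_pos : 0 < IZR SC.
Proof. apply IZR_lt. reflexivity. Qed.

Lemma bnorm_ge B : Cmod (bctr B) <= IZR (bnorm B) / IZR SC.
Proof.
  destruct B as [[a b] e]. unfold bctr, bnorm. assert (P := SC_pos). set (n := (a * a + b * b)%Z).
  assert (Hn : (0 <= n)%Z) by (apply Z.add_nonneg_nonneg; apply Z.square_nonneg). assert (Hq := Z.sqrt_spec n Hn).
  assert (Hq0 := Z.sqrt_nonneg n).
  assert (Hq1 : (n <= (Z.sqrt n + 1) * (Z.sqrt n + 1))%Z) by (rewrite Z.add_1_r; apply Z.lt_le_incl, Hq).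
  set (w := Z.sqrt n) in *. apply Rsqr_incr_0_var; [|apply Rdiv_le_0_compat; [apply IZR_le; lia|exact P]].
  rewrite !Rsqr_pow2, Cmod_sqr. simpl Re. simpl Im.
  replace ((IZR a / IZR SC) ^ 2 + (IZR b / IZR SC) ^ 2) with (IZR n / IZR SC ^ 2) by (unfold n; rewrite plus_IZR,
    !mult_IZR; field; lra).
  replace ((IZR (w + 1) / IZR SC) ^ 2) with (IZR ((w + 1) * (w + 1)) / IZR SC ^ 2) by (rewrite mult_IZR; field; lra).
  apply Rmult_le_compat_r; [est|]. apply IZR_le. exact Hq1.
Qed.

Lemma div_SC n : IZR (n / SC) <= IZR n / IZR SC <= IZR (n / SC) + 1.
Proof.
  assert (P := SC_pos). assert (H := Z.div_mod n SC ltac:(discriminate)).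
  assert (M := Z.mod_pos_bound n SC ltac:(reflexivity)). split.
  - apply (proj1 (Rle_div_r _ _ _ P)). rewrite <- mult_IZR. apply IZR_le. lia.
  - apply Rle_div_l; [exact P|]. rewrite <- plus_IZR, <- mult_IZR. apply IZR_le. lia.
Qed.

Lemma near_add z z' B B' : near z B -> near z' B' -> near (z + z')%C (badd B B').
Proof.
  destruct B as [[a b] e], B' as [[a' b'] e']. unfold near, badd, bctr; cbn [snd]. intros H H'. assert (P := SC_pos).
  replace (z + z' - cz (a + a') (b + b'))%C with ((z - cz a b) + (z' - cz a' b'))%C.
  - via Cmod_triangle. rewrite plus_IZR. lra.
  - apply C_ext; unfold cz; rewrite !plus_IZR; destruct z, z'; simpl; field; lra.
Qed.

Lemma near_mul z z' B B' : near z B -> near z' B' -> near (z * z')%C (bmul B B').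
Proof.
  intros H H'. assert (N := bnorm_ge B). assert (N' := bnorm_ge B'). assert (P := SC_pos). unfold near in *.
  set (q := bctr B) in *. set (q' := bctr B') in *.
  assert (Prod : Cmod (z * z' - q * q')%C <= IZR (bnorm B * snd B' + bnorm B' * snd B + snd B * snd B') / IZR SC / IZR
    SC).
  { replace (z * z' - q * q')%C with ((z - q) * (z' - q') + q * (z' - q') + (z - q) * q')%C by alg.
    rewrite !plus_IZR, !mult_IZR.
    replace ((IZR (bnorm B) * IZR (snd B') + IZR (bnorm B') * IZR (snd B) + IZR (snd B) * IZR (snd B')) / IZR SC / IZR SC) with
      (IZR (snd B) / IZR SC * (IZR (snd B') / IZR SC) + IZR (bnorm B) / IZR SC * (IZR (snd B') / IZR SC) + IZR (snd B) / IZR SC * (IZR (bnorm B') / IZR SC)) by lra.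
    est. }
  set (X := (bnorm B * snd B' + bnorm B' * snd B + snd B * snd B')%Z) in *.
  destruct B as [[a b] e], B' as [[a' b'] e']. unfold bmul, bctr; cbn [snd] in *. fold X.
  replace (z * z' - cz ((a * a' - b * b') / SC) ((a * b' + b * a') / SC))%C with
    ((z * z' - q * q') + (q * q' - cz ((a * a' - b * b') / SC) ((a * b' + b * a') / SC)))%C by alg.
  via Cmod_triangle.
  assert (Rd : Cmod (q * q' - cz ((a * a' - b * b') / SC) ((a * b' + b * a') / SC))%C <= 2 / IZR SC).
  { via Cmod_le_Re_Im. destruct (div_SC (a * a' - b * b')) as [R1 R2]. destruct (div_SC (a * b' + b * a')) as [I1 I2].
    rewrite minus_IZR, !mult_IZR in R1, R2. rewrite plus_IZR, !mult_IZR in I1, I2.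
    replace (Re (q * q' - cz ((a * a' - b * b') / SC) ((a * b' + b * a') / SC))%C) with
      (((IZR a * IZR a' - IZR b * IZR b') / IZR SC - IZR ((a * a' - b * b') / SC)) * / IZR SC) by alg.
    replace (Im (q * q' - cz ((a * a' - b * b') / SC) ((a * b' + b * a') / SC))%C) with
      (((IZR a * IZR b' + IZR b * IZR a') / IZR SC - IZR ((a * b' + b * a') / SC)) * / IZR SC) by alg.
    assert (IP : 0 < / IZR SC) by est. rewrite !Rabs_mult, (Rabs_pos_eq (/ _)), !Rabs_pos_eq by lra. nra. }
  assert (D := div_SC X). rewrite plus_IZR.
  assert (Y : IZR X / IZR SC / IZR SC <= (IZR (X / SC) + 1) / IZR SC) by est. lra.
Qed.

Lemma near_const (x y : R) (a b e : Z) :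
  Rabs (x * IZR SC - IZR a) + Rabs (y * IZR SC - IZR b) <= IZR e -> near (x, y) (a, b, e).
Proof.
  intros H. assert (P := SC_pos). unfold near, bctr; cbn [snd]. via Cmod_le_Re_Im.
  replace (Re ((x, y) - cz a b)%C) with ((x * IZR SC - IZR a) * / IZR SC) by alg.
  replace (Im ((x, y) - cz a b)%C) with ((y * IZR SC - IZR b) * / IZR SC) by alg.
  rewrite !Rabs_mult, (Rabs_pos_eq (/ _)) by est. unfold Rdiv. rewrite <- Rmult_plus_distr_r. est.
Qed.

Definition bhalf (B : ball) : ball := bmul (SC / 2, 0, 0)%Z B.

(** A second-order Taylor polynomial. Its remainder is at most $4|h|^3$; the cube is scaled back by
    two floored divisions, whose rounding is absorbed by the added $5$. *)
Definition bexp0 (H : ball) : ball :=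
  let r := (bnorm H + snd H)%Z in
  badd (badd (SC, 0, 0)%Z (badd H (bhalf (bmul H H)))) (0, 0, 4 * r * r * r / SC / SC + 5)%Z.

Fixpoint biter (k : nat) (B : ball) : ball := match k with O => B | S j => biter j (bsq B) end.
(** [H] encloses the argument already divided by $2^k$; the $k$ squarings undo this. *)
Definition bexp (k : nat) (H : ball) : ball := biter k (bexp0 H).

Lemma near_biter k : forall w B, near (cexp w) B -> near (cexp (RtoC (2 ^ k) * w)%C) (biter k B).
Proof.
  induction k as [|k IH]; intros w B H.
  - rewrite Cmult_1_l. exact H.
  - replace (RtoC (2 ^ S k) * w)%C with (RtoC (2 ^ k) * (w + w))%C.
    + apply IH. rewrite cexp_plus. now apply near_mul.
    + change (2 ^ S k) with (2 * 2 ^ k). rewrite RtoC_mult. ring.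
Qed.

Lemma near_norm z B : near z B -> Cmod z <= IZR (bnorm B + snd B) / IZR SC.
Proof.
  intros H. assert (N := bnorm_ge B). unfold near in H. replace z with ((z - bctr B) + bctr B)%C by alg.
  via Cmod_triangle. rewrite plus_IZR. lra.
Qed.

Lemma near_bexp0 h H : near h H -> (bnorm H + snd H <= SC)%Z -> near (cexp h) (bexp0 H).
Proof.
  intros Hn Hle. assert (P := SC_pos). assert (Nh := near_norm h H Hn). set (r := (bnorm H + snd H)%Z) in *.
  assert (R1 : IZR r / IZR SC <= 1) by (apply Rle_div_l; [exact P|]; rewrite Rmult_1_l; now apply IZR_le).
  assert (N1 : near (RtoC 1) (SC, 0, 0)%Z) by (apply near_const; rewrite Rmult_1_l, Rmult_0_l, !Rminus_diag, Rabs_R0;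
    lra).
  assert (N2 : near (RtoC (1 / 2)) (SC / 2, 0, 0)%Z).
  { apply near_const. replace (IZR (SC / 2)) with (1 / 2 * IZR SC).
    - rewrite Rmult_0_l, !Rminus_diag, Rabs_R0; lra.
    - replace SC with (2 * (SC / 2))%Z at 1 by est. rewrite mult_IZR. field. }
  assert (N3 := near_add _ _ _ _ N1 (near_add _ _ _ _ Hn (near_mul _ _ _ _ N2 (near_mul _ _ _ _ Hn Hn)))).
  set (T := (RtoC 1 + (h + RtoC (1 / 2) * (h * h)))%C) in *. assert (Er : Cmod (cexp h - T)%C <= 4 * Cmod h ^ 3).
  { assert (Q := exp_rem_bound h 3 1 ltac:(lra)). unfold exp_rem in Q. rewrite !csum_S in Q. simpl csum in Q.
    replace (RtoC 1 * h)%C with h in Q by alg. replace (RtoC (1 ^ 0 / INR (fact 0))) with (RtoC 1) in Q by alg.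
    replace (RtoC (1 ^ 1 / INR (fact 1))) with (RtoC 1) in Q by alg.
    replace (RtoC (1 ^ 2 / INR (fact 2))) with (RtoC (1 / 2)) in Q by alg.
    replace (cexp h - (0 + 1 * h ^ 0 + 1 * h ^ 1 + RtoC (1 / 2) * h ^ 2))%C with (cexp h - T)%C in Q by (unfold T;
      simpl; ring).
    via Q. replace ((2 * Cmod h) ^ 3 * 1 ^ 3 / INR (fact 3)) with (4 / 3 * Cmod h ^ 3) by alg.
    assert (exp (Cmod h) <= 3) by (eapply Rle_trans; [apply exp_le|apply exp_le_3]; lra).
    assert (0 <= Cmod h ^ 3) by est. nra. }
  assert (N4 : near (cexp h - T)%C (0, 0, 4 * r * r * r / SC / SC + 5)%Z).
  { unfold near, bctr; cbn [snd]. replace (cexp h - T - cz 0 0)%C with (cexp h - T)%C.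
    2:{ unfold cz, Rdiv. rewrite !Rmult_0_l. change (0, 0) with (RtoC 0). ring. }
    assert (C3 : Cmod h ^ 3 <= (IZR r / IZR SC) ^ 3) by est. destruct (div_SC (4 * r * r * r)) as [_ D1].
    destruct (div_SC (4 * r * r * r / SC)) as [_ D2].
    assert (D3 : IZR (4 * r * r * r) / IZR SC / IZR SC <= IZR (4 * r * r * r / SC) / IZR SC + 1 / IZR SC) by (apply (Rmult_le_compat_r (/ IZR SC)) in D1; [lra|now apply Rlt_le, Rinv_0_lt_compat]).
    assert (S1 : 1 / IZR SC <= 1).
    { apply Rle_div_l; [exact P|]. rewrite Rmult_1_l. apply IZR_le. discriminate. }
    rewrite plus_IZR. apply Rle_trans with (4 * (IZR r / IZR SC) ^ 3); [lra|].
    replace (4 * (IZR r / IZR SC) ^ 3) with (IZR (4 * r * r * r) / IZR SC / IZR SC * / IZR SC) by (rewrite !mult_IZR;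
      field; lra).
    unfold Rdiv at 3. est. }
  assert (N5 := near_add _ _ _ _ N3 N4). replace (T + (cexp h - T))%C with (cexp h) in N5 by alg. exact N5.
Qed.

Lemma near_bexp k w B : near (RtoC (/ 2 ^ k) * w)%C B -> (bnorm B + snd B <= SC)%Z -> near (cexp w) (bexp k B).
Proof.
  intros H H1. assert (Q := near_biter k _ _ (near_bexp0 _ _ H H1)).
  replace (RtoC (2 ^ k) * (RtoC (/ 2 ^ k) * w))%C with w in Q; [exact Q|].
  rewrite Cmult_assoc, <- RtoC_mult, Rinv_r by est. ring.
Qed.

Definition b2k : ball := (SC / 2 ^ 24, 0, 1)%Z.

Lemma near_b2k : near (RtoC (/ 2 ^ 24)) b2k.
Proof.
  apply near_const. rewrite Rmult_0_l, Rminus_diag, Rabs_R0, Rplus_0_r.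
  assert (Q : (SC = 2 ^ 24 * (SC / 2 ^ 24) + SC mod 2 ^ 24)%Z) by est.
  assert (M := Z.mod_pos_bound SC (2 ^ 24) ltac:(reflexivity)). rewrite Q at 1. rewrite plus_IZR, mult_IZR.
  destruct M as [M1 M2]. apply IZR_le in M1. apply IZR_lt in M2. est.
Qed.

(** Certifies a proposed logarithm $l$ through the exponential: [B] encloses $e^{-l}$, and $pe^{-l}$
    must be within $d$ of $1$, all in units of [SC]. *)
Definition ln_check (p d : Z) (B : ball) : bool :=
  let '(a, b, e) := B in
  (Z.leb (p * (a + e)) (SC + d) && Z.leb (SC - d) (p * (a - e)) && Z.leb (2 * d) SC)%bool.

(** For $|y-1|\le\delta\le1/2$ one has $|\log y|\le2\delta$, applied to $y=pe^{-l}$; this is the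
    origin of the radius [2 * d]. *)
Lemma ln_check_sound (p l d : Z) (B : ball) : (0 < p)%Z -> (0 <= d)%Z ->
  near (RtoC (exp (- IZR l / IZR SC))) B -> ln_check p d B = true -> near (RtoC (ln (IZR p))) (l, 0, 2 * d)%Z.
Proof.
  intros Hp Hd NE H. assert (P := SC_pos). destruct B as [[a b] e]. apply andb_prop in H. destruct H as [H H4].
  apply andb_prop in H. destruct H as [H2 H3]. apply Z.leb_le in H2, H3, H4. unfold near, bctr in NE; cbn [snd] in NE.
  assert (Q := Re_le_Cmod (RtoC (exp (- IZR l / IZR SC)) - cz a b)%C).
  replace (Re (RtoC (exp (- IZR l / IZR SC)) - cz a b)%C) with (exp (- IZR l / IZR SC) - IZR a / IZR SC) in Q by est.
  set (E := exp (- IZR l / IZR SC)) in *. assert (Q1 : Rabs (E - IZR a / IZR SC) <= IZR e / IZR SC) by lra.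
  apply Rabs_le_between in Q1. apply IZR_le in H2, H3, H4. rewrite !mult_IZR, !plus_IZR in H2.
  rewrite !mult_IZR, !minus_IZR in H3. rewrite mult_IZR in H4. assert (Pp : 0 < IZR p) by now apply IZR_lt.
  set (y := IZR p * E). set (dl := IZR d / IZR SC). assert (Hdl : 0 <= dl <= 1 / 2) by (split; [apply Rdiv_le_0_compat; [now apply IZR_le|exact P]|apply Rle_div_l; lra]).
  assert (Y1 : y <= 1 + dl).
  { apply Rmult_le_reg_r with (IZR SC); [exact P|]. unfold y, dl.
    replace ((1 + IZR d / IZR SC) * IZR SC) with (IZR SC + IZR d) by alg.
    apply Rle_trans with (IZR p * (IZR a + IZR e)); [|exact H2]. rewrite Rmult_assoc. apply Rmult_le_compat_l; [lra|].
    apply Rle_trans with ((IZR a + IZR e) / IZR SC * IZR SC); [est|right; field; lra]. }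
  assert (Y2 : 1 - dl <= y).
  { apply Rmult_le_reg_r with (IZR SC); [exact P|]. unfold y, dl.
    replace ((1 - IZR d / IZR SC) * IZR SC) with (IZR SC - IZR d) by alg.
    apply Rle_trans with (IZR p * (IZR a - IZR e)); [exact H3|]. rewrite Rmult_assoc. apply Rmult_le_compat_l; [lra|].
    apply Rle_trans with ((IZR a - IZR e) / IZR SC * IZR SC); [right; field; lra|est]. }
  assert (Ly : ln y = ln (IZR p) - IZR l / IZR SC).
  { unfold y, E. rewrite ln_mult, ln_exp by est. est. }
  assert (L1 : ln y <= dl) by (generalize (exp_ineq1_le (ln y)); rewrite exp_ln by lra; lra).
  assert (L2 : - (2 * dl) <= ln y).
  { assert (Hy := exp_ineq1_le (- ln y)). rewrite exp_Ropp, exp_ln in Hy by lra. assert (/ y <= 1 + 2 * dl); [|lra].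
    apply Rmult_le_reg_r with y; [lra|]. rewrite Rinv_l by lra. nra. }
  apply near_const. rewrite Rmult_0_l, Rminus_diag, Rabs_R0, Rplus_0_r.
  replace (ln (IZR p) * IZR SC - IZR l) with (ln y * IZR SC) by (rewrite Ly; field; lra). rewrite mult_IZR.
  replace (2 * IZR d) with (2 * dl * IZR SC) by (unfold dl; field; lra). est.
Qed.

Definition bneg (l : Z) : ball := (- l, 0, 0)%Z.

Lemma near_ln (p l d : Z) : (0 < p)%Z -> (0 <= d)%Z ->
  Z.leb (bnorm (bmul b2k (bneg l)) + snd (bmul b2k (bneg l))) SC = true ->
  ln_check p d (bexp 24 (bmul b2k (bneg l))) = true -> near (RtoC (ln (IZR p))) (l, 0, 2 * d)%Z.
Proof.
  intros Hp Hd H1 H2. assert (P := SC_pos). assert (Nl : near (RtoC (- IZR l / IZR SC)) (bneg l)).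
  { apply near_const. rewrite Rmult_0_l, Rminus_diag, Rabs_R0, opp_IZR.
    replace (- IZR l / IZR SC * IZR SC - - IZR l) with 0 by alg. rewrite Rabs_R0. lra. }
  assert (N := near_mul _ _ _ _ near_b2k Nl). apply Z.leb_le in H1. assert (NE := near_bexp 24 _ _ N H1).
  rewrite cexp_R in NE. exact (ln_check_sound p l d _ Hp Hd NE H2).
Qed.

Definition bcpow (C0 L : ball) : ball := bexp 24 (bmul b2k (bmul (bmul (- SC, 0, 0)%Z L) C0)).
Definition bcpow_ok (C0 L : ball) : bool :=
  let H := bmul b2k (bmul (bmul (- SC, 0, 0)%Z L) C0) in Z.leb (bnorm H + snd H) SC.

Lemma near_cpow (x : R) (c : C) (C0 L : ball) : near c C0 -> near (RtoC (ln x)) L -> bcpow_ok C0 L = true -> near (cpow_neg x c) (bcpow C0 L).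
Proof.
  intros Hc HL H. apply Z.leb_le in H. rewrite cpow_neg_cexp. assert (N1 : near (RtoC (-1)) (- SC, 0, 0)%Z).
  { apply near_const. rewrite Rmult_0_l, Rminus_diag, Rabs_R0, opp_IZR.
    replace (-1 * IZR SC - - IZR SC) with 0 by lra. rewrite Rabs_R0. lra. }
  assert (N := near_mul _ _ _ _ near_b2k (near_mul _ _ _ _ (near_mul _ _ _ _ N1 HL) Hc)).
  replace (RtoC (- ln x) * c)%C with (RtoC (-1) * RtoC (ln x) * c)%C by (rewrite <- RtoC_mult; do 2 f_equal; ring).
  exact (near_bexp 24 _ _ N H).
Qed.

(** * A zero near 1/2 + 14.135 i *)

Lemma two_pow_neq1 (s : C) : Re s < 1 -> (1 - two_pow_1ms s)%C <> RtoC 0.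
Proof.
  intros H E.
  assert (E2 : two_pow_1ms s = RtoC 1) by (replace (two_pow_1ms s) with (1 - (1 - two_pow_1ms s))%C by ring; rewrite
    E; ring).
  assert (E3 : Cmod (two_pow_1ms s) = Rpower 2 (1 - Re s)).
  { replace (two_pow_1ms s) with (RtoC (Rpower 2 (1 - Re s)) * cis (- (Im s * ln 2)))%C.
    - rewrite Cmod_mult, Cmod_cis, Cmod_R, Rabs_pos_eq; [ring|est].
    - unfold two_pow_1ms, cis, RtoC, Cmult; simpl. rewrite cos_neg, sin_neg. f_equal; ring. }
  rewrite E2, Cmod_1 in E3. assert (1 < Rpower 2 (1 - Re s)); [|lra]. rewrite <- (Rpower_O 2) at 1 by lra.
  apply Rpower_lt; lra.
Qed.

(** In the strip neither $s-1$ nor $1-2^{1-s}$ vanishes, so the division in [zeta] is a genuine one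
    and [eta_fz] carries zeros in both directions. *)
Lemma zeta_zero_fz (s : C) : 0 < Re s < 1 -> (zeta s = RtoC 0 <-> fz s = RtoC 0).
Proof.
  intros Hs. assert (E := eta_fz s ltac:(lra)). assert (N := two_pow_neq1 s ltac:(lra)).
  assert (N1 : (s - 1)%C <> RtoC 0).
  { intros E2. apply (f_equal Re) in E2. rewrite Re_minus in E2. simpl in E2. lra. }
  unfold zeta. split; intros Z.
  - assert (Ee : eta s = RtoC 0).
    { replace (eta s) with ((eta s / (1 - two_pow_1ms s)) * (1 - two_pow_1ms s))%C by alg. rewrite Z. ring. }
    replace (fz s) with (/ (1 - two_pow_1ms s) * ((1 - two_pow_1ms s) * fz s))%C by alg. rewrite <- E, Ee. ring.
  - assert (Ee : eta s = RtoC 0).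
    { replace (eta s) with (/ (s - 1) * ((s - 1) * eta s))%C by alg. rewrite E, Z. ring. }
    rewrite Ee. unfold Cdiv. ring.
Qed.

Lemma Cmod_le_abs (s : C) (A B : R) : Rabs (Re s) <= A -> Rabs (Im s) <= B -> Cmod s <= A + B.
Proof. intros. via Cmod_le_Re_Im. lra. Qed.

(** With $M=0$ the Euler-Maclaurin approximation is $1+(s-1)(1/2+s/12)$. At $s=1/2+it$ with $0<t<1$
    its real part is at least $0.6$, while the remainder is below $0.16$. *)
Lemma zeros_above_1 (s : C) : RiemannHypothesis -> nontrivial_zero s -> 0 < Im s -> 1 <= Im s.
Proof.
  intros RH Hz Hi. assert (Hr := RH s Hz). destruct Hz as [Hs Z]. apply (zeta_zero_fz s Hs) in Z. apply Rnot_lt_le.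
  intros Hlt. assert (EM := euler_maclaurin s 0 ltac:(lra)). rewrite Z in EM.
  assert (P1 : forall y, Rpower (INR 0 + 1) y = 1).
  { intros. rewrite Rplus_0_l. unfold Rpower. rewrite ln_1, Rmult_0_r. apply exp_0. }
  rewrite !P1 in EM. set (A := em_approx s 0) in *. assert (HA : 6 / 10 <= Re A).
  { unfold A, em_approx. rewrite !Rplus_0_l, !cpow_neg_1. destruct s as [x t]. simpl in *. nra. }
  assert (HA2 : Re A <= Cmod (0 - A)%C).
  { replace (0 - A)%C with (- A)%C by alg. rewrite Cmod_opp. eapply Rle_trans; [apply Rle_abs|apply Re_le_Cmod]. }
  assert (Q : forall n, Cmod (s + RtoC n)%C <= Rabs (1 / 2 + n) + 1).
  { intros n. apply Cmod_le_abs; [rewrite Re_plus, Hr; simpl; lra|].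
    replace (Im (s + RtoC n)%C) with (Im s) by (destruct s; simpl; ring). est. }
  assert (C1 : Cmod (s - 1)%C <= 3 / 2).
  { assert (H := Q (-1)).
    replace (s + RtoC (-1))%C with (s - 1)%C in H by (replace (RtoC (-1)) with (- RtoC 1)%C by (ring); ring).
    rewrite Rabs_left in H by lra. lra. }
  assert (C0 : Cmod s <= 3 / 2).
  { assert (H := Q 0). rewrite Cplus_0_r in H. rewrite Rabs_pos_eq in H by lra. lra. }
  assert (C2 := Q 1). assert (C3 := Q 2). assert (C4 := Q 3). rewrite Rabs_pos_eq in C2, C3, C4 by lra.
  assert (PB : Cmod ((s - 1) * s * (s + 1) * (s + 2) * (s + 3))%C <= 3 / 2 * (3 / 2) * (5 / 2) * (7 / 2) * (9 / 2)) by
    est.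
  rewrite Hr in EM. lra.
Qed.

(** The logarithm of the modulus has mean $\log1=0$ over the circle, so its lower bound $\log b$
    cannot be positive. *)
Lemma prodz_min_modulus (ws : list C) (r b : R) :
  0 < r -> (forall w, In w ws -> r < Cmod w) -> 0 < b -> (forall z, Cmod z = r -> b <= Cmod (prodz ws z)) -> b <= 1.
Proof.
  intros Hr Hws Hb H. set (m := ln b).
  set (a := fun k => match k with O => RtoC m | S _ => (psum ws k * RtoC (r ^ k / INR k))%C end).
  assert (Sa : abs_summable a) by (apply zero_free_summable; auto). assert (Sn := abs_summable_scal (- RtoC 1) _ Sa).
  assert (F : 0 <= Re (- RtoC 1 * a O)%C).
  { apply (fourier_coef0 (fun k => - RtoC 1 * a k)%C Sn). intros t. set (z := (RtoC r * cis t)%C).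
    assert (Hz : Cmod z = r) by (unfold z; rewrite Cmod_mult, Cmod_cis, Cmod_R, Rabs_pos_eq; lra).
    destruct (ln_prodz ws z) as [N L]; [intros; rewrite Hz; auto|].
    assert (Hs : abs_summable (fun k => - RtoC 1 * a k * cis (INR k * t))%C).
    { apply ex_series_ext with (2 := Sn). intros k. now rewrite (Cmod_mult _ (cis _)), Cmod_cis, Rmult_1_r. }
    rewrite Series_incr_1 by (now apply abs_summable_Re). rewrite (is_series_unique _ (ln (Cmod (prodz ws z)))).
    - replace (Re (- RtoC 1 * a O * cis (INR 0 * t))%C) with (- m).
      + assert (m <= ln (Cmod (prodz ws z))); [|lra]. apply ln_le; [exact Hb|now apply H].
      + rewrite Rmult_0_l, cis_0. simpl. ring.
    - rewrite <- (Ropp_involutive (ln _)). apply is_series_ext with (2 := is_series_opp _ _ L). intros k.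
      assert (E : (- RtoC 1 * a (S k) * cis (INR (S k) * t))%C = (RtoC (- / INR (S k)) * (psum ws (S k) * z ^ S
        k))%C).
      { unfold a, z. rewrite Cpow_mult_l, cis_pow, <- RtoC_pow. unfold Rdiv. rewrite RtoC_mult, RtoC_opp. ring. }
      rewrite E, Re_scal. unfold opp; simpl. est. }
  assert (m <= 0) by (unfold a in F; simpl in F; lra). rewrite <- (exp_ln b) by lra. rewrite <- exp_0. est.
Qed.

(** If [fz c] had modulus below $b$, a Taylor polynomial of high degree would be free of zeros in
    the disc and, divided by its value at the centre, of modulus above $1$ on the whole circle,
    against [prodz_min_modulus]. The error [eta] is half of the gap, or half of the minimum of the
    modulus if that is smaller. *)
Theorem min_modulus (c : C) (r b : R) :
  0 < r < Re c -> Re c + r <= 2 -> 0 < b ->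
  (forall s, Re c - r <= Re s <= Re c + r -> Im c - r <= Im s <= Im c + r -> fz s <> RtoC 0) ->
  (forall z, Cmod z = r -> b <= Cmod (fz (c + z)%C)) -> b <= Cmod (fz c).
Proof.
  intros Hr Hc2 Hb Hnz Hb2.
  destruct (fz_min_box (Re c - r) (Re c + r) (Im c - r) (Im c + r) ltac:(lra) Hc2 Hnz) as [m [Hm Hmin]].
  assert (Box : forall z, Cmod z <= r -> m <= Cmod (fz (c + z)%C)).
  { intros z Hz. assert (A1 := Re_le_Cmod z). assert (A2 := Im_le_Cmod z). apply Rabs_le_between in A1.
    apply Rabs_le_between in A2. apply Hmin.
    - rewrite Re_plus. lra.
    - replace (Im (c + z)%C) with (Im c + Im z) by est. lra. }
  assert (Hfc : fz c <> RtoC 0).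
  { intros E. assert (Q := Box (RtoC 0) ltac:(rewrite Cmod_0; lra)). rewrite Cplus_0_r, E, Cmod_0 in Q. lra. }
  assert (Hf0 : fcoef c 0 = fz c).
  { assert (P := fz_pser c (RtoC 0) r Hr ltac:(rewrite Cmod_0; lra)). rewrite Cplus_0_r in P. rewrite P. symmetry.
    apply CSeries_unique. apply is_lim_seq_incr_1. apply is_lim_seq_ext with (fun _ => 0); [|apply is_lim_seq_const].
    intros n. rewrite csum_shift. rewrite (csum_ext _ (fun _ => RtoC 0)).
    -
      assert (Z0 : csum (fun _ => RtoC 0) n = RtoC 0) by (clear; induction n as [|n IH]; [reflexivity|rewrite csum_S,
        IH; ring]).
      rewrite Z0. replace (fcoef c 0 * RtoC 0 ^ 0 + 0 - fcoef c 0)%C with (RtoC 0) by alg. now rewrite Cmod_0.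
    - intros k _. rewrite Cpow_S. ring. }
  assert (Hf0' : fcoef c 0 <> RtoC 0) by now rewrite Hf0. apply Rnot_lt_le. intros Hlt.
  set (eta := Rmin (m / 2) ((b - Cmod (fz c)) / 2)). assert (Heta : 0 < eta) by (unfold eta; apply Rmin_glb_lt; lra).
  assert (He1 : eta <= m / 2) by apply Rmin_l. assert (He2 : eta <= (b - Cmod (fz c)) / 2) by apply Rmin_r.
  set (rho := (r + Re c) / 2). set (q := r / rho). assert (Hrho : r < rho < Re c) by (unfold rho; lra).
  assert (Hq : 0 <= q < 1).
  { unfold q. est. }
  set (D := 4 * ((Cmod c + rho) * (Cmod c + rho + 1)) * (1 + / (Re c - rho))). assert (HD : 0 <= D).
  { unfold D. est. }
  assert (Hlim : is_lim_seq (fun n => D * / (1 - q) * q ^ S n) 0).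
  { replace (Finite 0) with (Rbar_mult (D * / (1 - q)) 0) by (simpl; f_equal; ring). apply is_lim_seq_scal_l.
    apply (is_lim_seq_incr_1 (fun n => q ^ n)). apply is_lim_seq_geom. rewrite Rabs_pos_eq; lra. }
  apply is_lim_seq_spec in Hlim. destruct (Hlim (mkposreal _ Heta)) as [N HN0]. assert (HN := HN0 N (le_n N)).
  rewrite Rminus_0_r in HN. apply Rabs_lt_between in HN.
  destruct (Factorization.poly_factor (fcoef c) N Hf0') as [ws [Hws He]].
  assert (Err : forall z, Cmod z <= r -> Cmod (fz (c + z) - fz c * prodz ws z)%C < eta).
  { intros z Hz. rewrite <- Hf0, <- (taylor_prodz _ _ _ _ He).
    assert (Q := fz_power_series_err c rho ltac:(lra) z N ltac:(lra)). eapply Rle_lt_trans; [exact Q|]. fold D.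
    eapply Rle_lt_trans; [|apply HN]. assert (Hz1 : 0 <= Cmod z / rho <= q).
    { unfold q, Rdiv. est. }
    rewrite Rmult_assoc. apply Rmult_le_compat_l; [exact HD|]. rewrite (Rmult_comm (/ (1 - q))).
    apply Rmult_le_compat.
    - est.
    - est.
    - est.
    - est. }
  assert (Pfc := proj1 (Cmod_gt_0 _) Hfc). assert (Far : forall w, In w ws -> r < Cmod w).
  { intros w Hw. apply Rnot_le_lt. intros Hwr. assert (Q := Err w Hwr). rewrite (prodz_root ws w Hw Hws) in Q.
    replace (fz (c + w) - fz c * 0)%C with (fz (c + w)%C) in Q by alg. specialize (Box w Hwr). lra. }
  assert (B := prodz_min_modulus ws r ((b - eta) / Cmod (fz c)) ltac:(lra) Far).
  assert (B' : (b - eta) / Cmod (fz c) <= 1).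
  { apply B; [est|]. intros z Hz. apply Rle_div_l; [exact Pfc|]. rewrite Rmult_comm, <- Cmod_mult.
    assert (Q := Err z ltac:(lra)). specialize (Hb2 z Hz).
    assert (Tr := Cmod_triangle (fz (c + z) - fz c * prodz ws z)%C (fz c * prodz ws z)%C).
    replace (fz (c + z) - fz c * prodz ws z + fz c * prodz ws z)%C with (fz (c + z)%C) in Tr by alg. lra. }
  apply (proj1 (Rle_div_l _ _ _ Pfc)) in B'. lra.
Qed.

Lemma cder_cexp (w : C) (t : R) : cder (fun t => cexp (RtoC t * w)) t (w * cexp (RtoC t * w))%C.
Proof.
  split.
  - apply (is_derive_ext (fun t => Re (RtoC 1 * cexp (RtoC t * w))%C)); [intros; now rewrite Cmult_1_l|].
    rewrite <- (Cmult_1_l (w * cexp (RtoC t * w))). apply is_derive_Re_cexp.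
  - assert (E : forall z : C, Re (- Ci * z)%C = Im z) by (intros [p q]; simpl; ring).
    apply (is_derive_ext (fun t => Re (- Ci * cexp (RtoC t * w))%C)); [est|]. rewrite <- E. apply is_derive_Re_cexp.
Qed.

Lemma cexp_t_bound (w : C) (t : R) : 0 <= t <= 1 -> Cmod (cexp (RtoC t * w)) <= exp (Cmod w).
Proof.
  intros Ht. rewrite Cmod_cexp, Re_scal. apply exp_le. assert (H := Re_le_Cmod w). assert (H2 := Rle_abs (Re w)).
  generalize (Cmod_ge_0 w). nra.
Qed.

(** Based on [Cmod_MVT_pow], hence without the factor $2$ of [exp_rem_bound]; the numerical margin
    around the zero is too narrow for coarse constants. *)
Lemma cexp_rem1 (w : C) (t : R) : 0 <= t <= 1 -> Cmod (cexp (RtoC t * w) - 1)%C <= Cmod w * exp (Cmod w) * t.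
Proof.
  intros Ht. replace (Cmod w * exp (Cmod w) * t) with (Cmod w * exp (Cmod w) * (t ^ 1 / INR 1)) by alg.
  apply (Cmod_MVT_pow (fun t => cexp (RtoC t * w) - 1)%C (fun t => w * cexp (RtoC t * w))%C); [lra| | |].
  - rewrite Cmult_0_l, cexp_R, exp_0. ring.
  - intros x _.
    apply cder_ext with (3 := cder_plus _ _ _ _ _ (cder_cexp w x) (cder_const (- RtoC 1)%C x)); [reflexivity|ring].
  - intros x Hx. rewrite Cmod_mult. rewrite Rmult_1_r. apply Rmult_le_compat_l; [est|]. apply cexp_t_bound. lra.
Qed.

Lemma cexp_rem2 (w : C) : Cmod (cexp w - 1 - w)%C <= Cmod w ^ 2 / 2 * exp (Cmod w).
Proof.
  assert (H := Cmod_MVT_pow (fun t => cexp (RtoC t * w) - 1 - RtoC t * w)%C (fun t => w * (cexp (RtoC t * w) - 1))%C 1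
    (Cmod w * (Cmod w * exp (Cmod w))) 1 ltac:(lra)).
  cbv beta in H. rewrite !Cmult_1_l in H. via H.
  - rewrite Cmult_0_l, cexp_R, exp_0. ring.
  - intros x _. assert (D : is_derive (fun t : R => t) x 1) by (auto_derive; auto).
    assert (Q := cder_plus _ _ _ _ _ (cder_plus _ _ _ _ _ (cder_cexp w x) (cder_const (- RtoC 1)%C x)) (cder_scal (-
      RtoC 1)%C _ _ _ (cder_rmult _ _ x _ _ D (cder_const w x)))).
    eapply cder_ext; [| |exact Q]; [alg|cbv beta; ring].
  - intros x Hx. rewrite Cmod_mult. simpl. rewrite Rmult_1_r, Rmult_assoc. apply Rmult_le_compat_l; [est|].
    apply cexp_rem1. lra.
  - right. simpl. field.
Qed.

(** The error of linearising a term $p(z)n^{-z}$ with $L=\log n$ and $p$ quadratic. For $|z|\le1/20$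
    the exponent is at most $1/8$ in modulus, and $e^{1/8}\le8/7$. *)
Lemma poly_exp_err (p0 p1 p2 z : C) (L : R) : 0 <= L <= 5 / 2 -> Cmod z <= 1 / 20 ->
  Cmod ((p0 + p1 * z + p2 * (z * z)) * cexp (RtoC (- L) * z) - (p0 + (p1 - RtoC L * p0) * z))%C
  <= 8 / 7 * (1 / 20) ^ 2 * (Cmod p0 * (L ^ 2 / 2) + Cmod p1 * L + Cmod p2).
Proof.
  intros HL Hz. set (w := (RtoC (- L) * z)%C). set (r := Cmod z) in *. assert (Hr0 : 0 <= r) by apply Cmod_ge_0.
  assert (Hw : Cmod w = L * r) by (unfold w; rewrite Cmod_mult, Cmod_R, Rabs_Ropp, Rabs_pos_eq; [reflexivity|lra]).
  assert (Hw8 : Cmod w <= 1 / 8) by nra. assert (Ee : exp (Cmod w) <= 8 / 7).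
  { assert (Q := exp_ineq1_le (- Cmod w)). rewrite exp_Ropp in Q. assert (Pe := exp_pos (Cmod w)).
    apply (Rmult_le_compat_r (exp (Cmod w))) in Q; [|lra]. rewrite Rinv_l in Q by lra. nra. }
  assert (R1 := cexp_rem1 w 1 ltac:(lra)). rewrite Cmult_1_l, Rmult_1_r in R1. assert (R2 := cexp_rem2 w).
  assert (R0 : Cmod (cexp w) <= 8 / 7) by (assert (Q := cexp_t_bound w 1 ltac:(lra)); rewrite Cmult_1_l in Q; lra).
  replace ((p0 + p1 * z + p2 * (z * z)) * cexp w - (p0 + (p1 - RtoC L * p0) * z))%C with
    (p0 * (cexp w - 1 - w) + p1 * z * (cexp w - 1) + p2 * (z * z) * cexp w)%C by (unfold w; rewrite RtoC_opp; ring).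
  via Cmod_triangle. eapply Rle_trans; [apply Rplus_le_compat_r, Cmod_triangle|]. rewrite !Cmod_mult. fold r.
  assert (P0 := Cmod_ge_0 p0). assert (P1 := Cmod_ge_0 p1). assert (P2 := Cmod_ge_0 p2).
  assert (r2 : r * r <= (1 / 20) ^ 2) by nra.
  assert (T0 : Cmod (cexp w - 1 - w)%C <= 8 / 7 * (1 / 20) ^ 2 * (L ^ 2 / 2)) by nra.
  assert (T1 : r * Cmod (cexp w - 1)%C <= 8 / 7 * (1 / 20) ^ 2 * L).
  { apply Rle_trans with (r * (L * r * (8 / 7))).
    - apply Rmult_le_compat_l; [exact Hr0|]. via R1. est.
    - nra. }
  assert (T2 : r * r * Cmod (cexp w) <= 8 / 7 * (1 / 20) ^ 2) by nra.
  apply (Rmult_le_compat_l (Cmod p0)) in T0; [|exact P0]. apply (Rmult_le_compat_l (Cmod p1)) in T1; [|exact P1].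
  apply (Rmult_le_compat_l (Cmod p2)) in T2; [|exact P2]. lra.
Qed.

(** * Linearisation of the Euler-Maclaurin approximation at 1/2 + 14.135 i *)

Definition c0 : C := (1 / 2, 2827 / 200).
Definition c1 : C := (c0 - 1)%C.
(** In [em_approx s 11] the power $12^{-s}$ has the factor $12+(s-1)/2+s(s-1)/144$, which at
    $s=c_0+z$ is $q_0+q_1z+z^2/144$. *)
Definition q0 : C := (RtoC 12 + RtoC (1 / 2) * c1 + RtoC (1 / 144) * (c1 * c0))%C.
Definition q1 : C := (RtoC (1 / 2) + RtoC (1 / 144) * (c1 + c0))%C.
Definition Pn (k : nat) : C := cpow_neg (INR k + 1) c0.
Definition Ln (k : nat) : R := ln (INR k + 1).
(** [A0] and [A1] are the value and the derivative at $c_0$ of the approximation with $M=11$. *)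
Definition A0 : C := (c1 * csum Pn 11 + Pn 11 * q0)%C.
Definition A1 : C := (csum (fun k => Pn k * (1 - RtoC (Ln k) * c1)) 11 + Pn 11 * (q1 - RtoC (Ln 11) * q0))%C.

Lemma em_approx_c0 (z : C) :
  em_approx (c0 + z)%C 11 = (csum (fun k => Pn k * ((c1 + 1 * z + 0 * (z * z)) * cexp (RtoC (- Ln k) * z))) 11
    + Pn 11 * ((q0 + q1 * z + RtoC (1 / 144) * (z * z)) * cexp (RtoC (- Ln 11) * z)))%C.
Proof.
  unfold em_approx. assert (E : forall k, cpow_neg (INR k + 1) (c0 + z) = (Pn k * cexp (RtoC (- Ln k) * z))%C).
  { intros k. rewrite cpow_neg_plus. now rewrite (cpow_neg_cexp _ z). }
  assert (E12 : INR 11 + 1 = 12) by alg.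
  assert (Em : cpow_neg (INR 11 + 1) (c0 + z - 1) = (RtoC 12 * (Pn 11 * cexp (RtoC (- Ln 11) * z)))%C).
  { rewrite cpow_neg_minus1 by lra. rewrite E. now rewrite E12. }
  assert (Ep : cpow_neg (INR 11 + 1) (c0 + z + 1) = (RtoC (1 / 12) * (Pn 11 * cexp (RtoC (- Ln 11) * z)))%C).
  { assert (Q := cpow_neg_minus1 (INR 11 + 1) (c0 + z + 1)%C ltac:(lra)).
    replace (c0 + z + 1 - 1)%C with (c0 + z)%C in Q by alg. rewrite E, E12 in Q. rewrite E12, Q.
    rewrite Cmult_assoc, <- RtoC_mult. replace (1 / 12 * 12) with 1 by lra. ring. }
  rewrite Em, Ep, E. unfold zpart.
  rewrite (csum_ext (fun n => cpow_neg (INR n + 1) (c0 + z)) (fun k => (Pn k * cexp (RtoC (- Ln k) * z))%C)) by est.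
  rewrite <- csum_scal.
  rewrite (csum_ext _ (fun k => Pn k * ((c1 + 1 * z + 0 * (z * z)) * cexp (RtoC (- Ln k) * z)))%C) by (intros; unfold
    c1; ring).
  unfold q0, q1, c1.
  replace (RtoC (1 / 144)) with (RtoC (1 / 12) * RtoC (1 / 12))%C by (rewrite <- RtoC_mult; f_equal; field). ring.
Qed.

Lemma Rpower_half_le (n u : R) : 0 < n -> 0 < u -> 1 <= u ^ 2 * n -> Rpower n (- (1 / 2)) <= u.
Proof.
  intros Hn Hu H. rewrite Rpower_Ropp. replace (1 / 2) with (/ 2) by lra. rewrite Rpower_sqrt by lra.
  assert (Hs := sqrt_lt_R0 n Hn). apply Rmult_le_reg_r with (sqrt n); [exact Hs|]. rewrite Rinv_l by lra.
  rewrite <- sqrt_1. rewrite <- (sqrt_pow2 u) by lra. rewrite <- sqrt_mult by nra. apply sqrt_le_1_alt. exact H.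
Qed.

Lemma ln_le_exp_pow (n v : R) : 0 < n -> 0 <= v ->
  n <= (1 + v / 16 + (v / 16) ^ 2 / 2 + (v / 16) ^ 3 / 6 + (v / 16) ^ 4 / 24) ^ 16 -> ln n <= v.
Proof.
  intros Hn Hv H. rewrite <- (ln_exp v). apply ln_le; [exact Hn|]. replace v with (INR 16 * (v / 16)) by alg.
  apply exp_ge_pow; [clear H; lra|exact H].
Qed.

(** Rational upper bounds of $n^{-1/2}$ and, in [vn], of $\log n$, for $n=k+1\le12$. *)
Definition un (k : nat) : R := match k with
  | 0 => 1 | 1 => 708 / 1000 | 2 => 578 / 1000 | 3 => 500 / 1000 | 4 => 448 / 1000 | 5 => 409 / 1000 | 6 => 378 / 1000
  | 7 => 354 / 1000 | 8 => 334 / 1000 | 9 => 317 / 1000 | 10 => 302 / 1000 | _ => 289 / 1000 end.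
Definition vn (k : nat) : R := match k with
  | 0 => 0 | 1 => 694 / 1000 | 2 => 1099 / 1000 | 3 => 1387 / 1000 | 4 => 1610 / 1000 | 5 => 1792 / 1000 | 6 => 1946 / 1000
  | 7 => 2080 / 1000 | 8 => 2198 / 1000 | 9 => 2303 / 1000 | 10 => 2398 / 1000 | _ => 2485 / 1000 end.

Lemma Pn_le k : (k < 12)%nat -> Cmod (Pn k) <= un k.
Proof.
  intros Hk. unfold Pn. rewrite Cmod_cpow_neg. do 12 (destruct k as [|k]; [simpl; apply Rpower_half_le; lra|]). lia.
Qed.

Lemma Ln_le k : (k < 12)%nat -> 0 <= Ln k <= vn k.
Proof.
  unfold Ln. split.
  - rewrite <- ln_1. apply ln_le; [lra|apply INR1_ge].
  - destruct k as [|k]; [simpl; rewrite Rplus_0_l, ln_1; lra|].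
    do 11 (destruct k as [|k]; [simpl; apply ln_le_exp_pow; lra|]). lia.
Qed.

Lemma vn_le k : vn k <= 5 / 2.
Proof. do 12 (destruct k as [|k]; [simpl; lra|]). simpl; lra. Qed.

Lemma em_taylor (z : C) : Cmod z <= 1 / 20 -> Cmod (em_approx (c0 + z) 11 - (A0 + A1 * z))%C <= 35 / 100.
Proof.
  intros Hz. rewrite em_approx_c0.
  assert (C1 : Cmod c1 <= 14635 / 1000) by (via Cmod_le_Re_Im; unfold c1, c0; simpl; rewrite Rabs_left, Rabs_pos_eq by
    lra; lra).
  assert (Q0 : Cmod q0 <= 1744 / 100) by (via Cmod_le_Re_Im; unfold q0, c1, c0; simpl; rewrite !Rabs_pos_eq by lra;
    lra).
  assert (Q1 : Cmod q1 <= 7 / 10) by (via Cmod_le_Re_Im; unfold q1, c1, c0; simpl; rewrite !Rabs_pos_eq by lra; lra).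
  replace (csum (fun k => Pn k * ((c1 + 1 * z + 0 * (z * z)) * cexp (RtoC (- Ln k) * z)))%C 11
    + Pn 11 * ((q0 + q1 * z + RtoC (1 / 144) * (z * z)) * cexp (RtoC (- Ln 11) * z)) - (A0 + A1 * z))%C with
    (csum (fun k => Pn k * ((c1 + 1 * z + 0 * (z * z)) * cexp (RtoC (- Ln k) * z) - (c1 + (1 - RtoC (Ln k) * c1) * z)))%C 11
     + Pn 11 * ((q0 + q1 * z + RtoC (1 / 144) * (z * z)) * cexp (RtoC (- Ln 11) * z) - (q0 + (q1 - RtoC (Ln 11) * q0) * z)))%C.
  2:{ rewrite (csum_ext (fun k => Pn k * ((c1 + 1 * z + 0 * (z * z)) * cexp (RtoC (- Ln k) * z) - (c1 + (1 - RtoC (Ln k) * c1) * z)))%C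
      (fun k => Pn k * ((c1 + 1 * z + 0 * (z * z)) * cexp (RtoC (- Ln k) * z)) + (- c1 * Pn k + - z * (Pn k * (1 - RtoC (Ln k) * c1))))%C) by alg.
    rewrite csum_plus, csum_plus, !csum_scal. unfold A0, A1. ring. }
  via Cmod_triangle.
  assert (T : forall k, (k < 11)%nat -> Cmod (Pn k * ((c1 + 1 * z + 0 * (z * z)) * cexp (RtoC (- Ln k) * z) - (c1 + (1 - RtoC (Ln k) * c1) * z)))%C
    <= un k * (8 / 7 * (1 / 20) ^ 2 * (14635 / 1000 * (vn k ^ 2 / 2) + vn k))).
  { intros k Hk. rewrite Cmod_mult. destruct (Ln_le k ltac:(lia)) as [L1 L2]. assert (L3 := vn_le k).
    apply Rmult_le_compat; [est|est|apply Pn_le; lia|]. eapply Rle_trans; [apply poly_exp_err; lra|].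
    rewrite Cmod_0, Cmod_1. assert (Cmod c1 * (Ln k ^ 2 / 2) <= 14635 / 1000 * (vn k ^ 2 / 2)) by est. lra. }
  assert (T12 : Cmod (Pn 11 * ((q0 + q1 * z + RtoC (1 / 144) * (z * z)) * cexp (RtoC (- Ln 11) * z) - (q0 + (q1 - RtoC (Ln 11) * q0) * z)))%C
    <= un 11 * (8 / 7 * (1 / 20) ^ 2 * (1744 / 100 * (vn 11 ^ 2 / 2) + 7 / 10 * vn 11 + 1 / 144))).
  { rewrite Cmod_mult. destruct (Ln_le 11 ltac:(lia)) as [L1 L2]. assert (L3 := vn_le 11).
    apply Rmult_le_compat; [est|est|apply Pn_le; lia|]. eapply Rle_trans; [apply poly_exp_err; lra|].
    rewrite Cmod_R, (Rabs_pos_eq (1 / 144)) by lra. est. }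
  eapply Rle_trans; [apply Rplus_le_compat; [eapply Rle_trans; [apply csum_Cmod|apply rsum_le, T]|exact T12]|].
  simpl rsum. simpl un. simpl vn. lra.
Qed.

Lemma em_error_c0 (z : C) : Cmod z <= 1 / 20 -> Cmod (fz (c0 + z) - em_approx (c0 + z) 11)%C <= 62 / 1000.
Proof.
  intros Hz. set (s := (c0 + z)%C). assert (A := Re_le_Cmod z). apply Rabs_le_between in A.
  assert (Hs : 45 / 100 <= Re s) by (unfold s, c0; rewrite Re_plus; simpl; lra).
  eapply Rle_trans; [apply euler_maclaurin; lra|]. replace (INR 11 + 1) with 12 by alg.
  assert (N : forall n b, 0 <= b -> (1 / 2 + n) ^ 2 + (2827 / 200) ^ 2 <= b ^ 2 -> Cmod (s + RtoC n)%C <= b + 1 / 20).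
  { intros n b Hb H. unfold s. replace (c0 + z + RtoC n)%C with ((c0 + RtoC n) + z)%C by alg. via Cmod_triangle.
    apply Rplus_le_compat; [|exact Hz]. apply Rsqr_incr_0_var; [|exact Hb]. rewrite !Rsqr_pow2, Cmod_sqr. simpl Re.
    simpl Im. est. }
  assert (N0 := N 0 (14145 / 1000) ltac:(lra) ltac:(lra)). rewrite Cplus_0_r in N0.
  assert (Nm : Cmod (s - 1)%C <= 14145 / 1000 + 1 / 20).
  { replace (s - 1)%C with (s + RtoC (-1))%C by (replace (RtoC (-1)) with (- RtoC 1)%C by (ring); ring). apply N; lra. }
  assert (N1 := N 1 (14216 / 1000) ltac:(lra) ltac:(lra)). assert (N2 := N 2 (14356 / 1000) ltac:(lra) ltac:(lra)).
  assert (N3 := N 3 (14563 / 1000) ltac:(lra) ltac:(lra)).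
  assert (Pi : Cmod ((s - 1) * s * (s + 1) * (s + 2) * (s + 3))%C <= 606000).
  {
    apply Rle_trans with ((14145 / 1000 + 1 / 20) * (14145 / 1000 + 1 / 20) * (14216 / 1000 + 1 / 20) * (14356 / 1000
      + 1 / 20) * (14563 / 1000 + 1 / 20)); [|lra].
    est. }
  assert (P45 : Rpower 12 (- (45 / 100)) <= 1 / 3).
  { rewrite Rpower_Ropp. replace (1 / 3) with (/ 3) by lra. apply Rinv_le_contravar; [lra|].
    rewrite <- (exp_ln 3) at 1 by lra. apply exp_le. assert (Q : ln (3 ^ 20) <= ln (12 ^ 9)) by est.
    rewrite !ln_pow in Q by lra. simpl INR in Q. lra. }
  assert (Pw : forall n, Rpower 12 (- (45 / 100) - INR n) <= 1 / 3 * / 12 ^ n).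
  { intros n. unfold Rminus. rewrite Rpower_plus, (Rpower_Ropp 12 (INR n)), Rpower_pow by lra. est. }
  assert (B1 : Rpower 12 (- (Re s + 3) - 1) <= 1 / 3 * / 12 ^ 4).
  { eapply Rle_trans; [|est]. replace (INR 4) with 4 by alg. est. }
  assert (B2 : Rpower 12 (- (Re s + 3)) / (Re s + 3) <= 1 / 3 * / 12 ^ 3 * / (345 / 100)).
  { apply Rmult_le_compat; [est|est| |est]. eapply Rle_trans; [|est]. replace (INR 3) with 3 by alg. est. }
  apply Rle_trans with (606000 / 720 * (1 / 3 * / 12 ^ 4 + 1 / 3 * / 12 ^ 3 * / (345 / 100))); [|lra]. est.
Qed.

Fixpoint bsum (F : nat -> ball) (n : nat) : ball := match n with O => (0, 0, 0)%Z | S k => badd (bsum F k) (F k) end.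

Lemma near_IZR (a s : Z) : s = (a * SC)%Z -> near (RtoC (IZR a)) (s, 0, 0)%Z.
Proof. intros ->. apply near_const. rewrite mult_IZR, Rmult_0_l, !Rminus_diag, Rabs_R0. lra. Qed.

Ltac int_ball a := apply (near_IZR a); vm_compute; reflexivity.

Lemma near_csum (f : nat -> C) (F : nat -> ball) n : (forall k, (k < n)%nat -> near (f k) (F k)) -> near (csum f n) (bsum F n).
Proof. induction n as [|n IH]; intros H; [cbn; int_ball 0%Z|]. apply near_add; auto. Qed.

(* [0.693147...] and its successors are [ln 2, ln 3, ln 5, ln 7, ln 11], scaled by [SC = 10^30];
   [bc0] is the point [1/2 + 14.135 i]. *)
Definition bln (l : Z) : ball := (l, 0, 2 * 10 ^ 20)%Z.
Definition L2 : ball := bln 693147180559945309417232121458%Z.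
Definition L3 : ball := bln 1098612288668109691395245236922%Z.
Definition L5 : ball := bln 1609437912434100374600759333226%Z.
Definition L7 : ball := bln 1945910149055313305105352743443%Z.
Definition L11 : ball := bln 2397895272798370544061943577965%Z.
Definition bc0 : ball := (SC / 2, 14135 * 10 ^ 27, 0)%Z.
Definition bone : ball := (SC, 0, 0)%Z.
Definition bm1 : ball := (- SC, 0, 0)%Z.
Definition bc1 : ball := badd bc0 bm1.
Definition P2 : ball := Eval vm_compute in bcpow bc0 L2.
Definition P3 : ball := Eval vm_compute in bcpow bc0 L3.
Definition P5 : ball := Eval vm_compute in bcpow bc0 L5.
Definition P7 : ball := Eval vm_compute in bcpow bc0 L7.
Definition P11 : ball := Eval vm_compute in bcpow bc0 L11.

(** The integers up to $12$ factor over $2,3,5,7,11$, so five certified logarithms and five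
    certified powers suffice. *)
Definition Pb (k : nat) : ball := match k with
  | 0 => bone | 1 => P2 | 2 => P3 | 3 => bmul P2 P2 | 4 => P5 | 5 => bmul P2 P3 | 6 => P7
  | 7 => bmul P2 (bmul P2 P2) | 8 => bmul P3 P3 | 9 => bmul P2 P5 | 10 => P11 | _ => bmul P3 (bmul P2 P2) end.
Definition Lb (k : nat) : ball := match k with
  | 0 => (0, 0, 0)%Z | 1 => L2 | 2 => L3 | 3 => badd L2 L2 | 4 => L5 | 5 => badd L2 L3 | 6 => L7
  | 7 => badd L2 (badd L2 L2) | 8 => badd L3 L3 | 9 => badd L2 L5 | 10 => L11 | _ => badd L3 (badd L2 L2) end.

Lemma near_bone : near (RtoC 1) bone.
Proof. int_ball 1%Z. Qed.

Lemma near_bm1 : near (- RtoC 1)%C bm1.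
Proof. rewrite <- RtoC_opp. int_ball (-1)%Z. Qed.

Lemma SC_val : IZR SC = 10 ^ 30.
Proof. unfold SC. est. Qed.

Lemma half_SC : IZR (SC / 2) = 1 / 2 * IZR SC.
Proof. replace SC with (2 * (SC / 2))%Z at 2 by est. rewrite mult_IZR. field. Qed.

Lemma near_bc0 : near c0 bc0.
Proof. apply near_const. rewrite half_SC, mult_IZR. rewrite SC_val, !Rabs_pos_eq by lra. lra. Qed.

Lemma near_bc1 : near c1 bc1.
Proof. apply near_add; [apply near_bc0|apply near_bm1]. Qed.

Lemma near_prime (p l : Z) (P : ball) : (0 < p)%Z ->
  Z.leb (bnorm (bmul b2k (bneg l)) + snd (bmul b2k (bneg l))) SC = true ->
  ln_check p (10 ^ 20) (bexp 24 (bmul b2k (bneg l))) = true ->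
  bcpow_ok bc0 (bln l) = true -> P = bcpow bc0 (bln l) ->
  near (RtoC (ln (IZR p))) (bln l) /\ near (cpow_neg (IZR p) c0) P.
Proof.
  intros Hp H1 H2 H3 ->. assert (N := near_ln p l (10 ^ 20) Hp ltac:(discriminate) H1 H2).
  split; [exact N|exact (near_cpow _ _ _ _ near_bc0 N H3)].
Qed.

Ltac by_vm := apply near_prime; vm_compute; reflexivity.
Lemma near_2 : near (RtoC (ln 2)) L2 /\ near (cpow_neg 2 c0) P2.
Proof. by_vm. Qed.
Lemma near_3 : near (RtoC (ln 3)) L3 /\ near (cpow_neg 3 c0) P3.
Proof. by_vm. Qed.
Lemma near_5 : near (RtoC (ln 5)) L5 /\ near (cpow_neg 5 c0) P5.
Proof. by_vm. Qed.
Lemma near_7 : near (RtoC (ln 7)) L7 /\ near (cpow_neg 7 c0) P7.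
Proof. by_vm. Qed.
Lemma near_11 : near (RtoC (ln 11)) L11 /\ near (cpow_neg 11 c0) P11.
Proof. by_vm. Qed.

Lemma near_mult (x y : R) A A' B B' : 0 < x -> 0 < y ->
  near (RtoC (ln x)) A /\ near (cpow_neg x c0) B -> near (RtoC (ln y)) A' /\ near (cpow_neg y c0) B' ->
  near (RtoC (ln (x * y))) (badd A A') /\ near (cpow_neg (x * y) c0) (bmul B B').
Proof.
  intros Hx Hy [] []. rewrite ln_mult, RtoC_plus, cpow_neg_mult by lra.
  split; [now apply near_add|now apply near_mul].
Qed.

Opaque bmul badd P2 P3 P5 P7 P11 L2 L3 L5 L7 L11 SC.

Ltac at_n n := match goal with |- context [cpow_neg ?x c0] => replace x with n by (simpl; lra) end;
  repeat (apply near_mult; [lra|lra| |]);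
  first [apply near_2 | apply near_3 | apply near_5 | apply near_7 | apply near_11].

Lemma near_PL k : (k < 12)%nat -> near (RtoC (Ln k)) (Lb k) /\ near (Pn k) (Pb k).
Proof.
  intros Hk. unfold Pn, Ln.
  destruct k as [|[|[|[|[|[|[|[|[|[|[|[|k]]]]]]]]]]]]; simpl Pb; simpl Lb.
  { replace (INR 0 + 1) with 1 by alg. rewrite cpow_neg_1, ln_1. split; [int_ball 0%Z|apply near_bone]. }
  at_n 2. at_n 3. at_n (2 * 2). at_n 5. at_n (2 * 3). at_n 7. at_n (2 * (2 * 2)). at_n (3 * 3). at_n (2 * 5). at_n 11.
  at_n (3 * (2 * 2)). lia.
Qed.

Transparent bmul badd P2 P3 P5 P7 P11 L2 L3 L5 L7 L11 SC.

Definition b144 : ball := (SC / 144, 0, 1)%Z.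
Definition b12 : ball := (12 * SC, 0, 0)%Z.
Definition bhalf1 : ball := (SC / 2, 0, 0)%Z.
Definition bq0 : ball := badd (badd b12 (bmul bhalf1 bc1)) (bmul b144 (bmul bc1 bc0)).
Definition bq1 : ball := badd bhalf1 (bmul b144 (badd bc1 bc0)).
Definition bA0 : ball := badd (bmul bc1 (bsum Pb 11)) (bmul (Pb 11) bq0).
Definition bA1 : ball :=
  badd (bsum (fun k => bmul (Pb k) (badd bone (bmul bm1 (bmul (Lb k) bc1)))) 11)
       (bmul (Pb 11) (badd bq1 (bmul bm1 (bmul (Lb 11) bq0)))).

Lemma near_bhalf1 : near (RtoC (1 / 2)) bhalf1.
Proof. apply near_const. rewrite half_SC, Rmult_0_l, !Rminus_diag, Rabs_R0. lra. Qed.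

Lemma near_b144 : near (RtoC (1 / 144)) b144.
Proof.
  apply near_const. rewrite Rmult_0_l, Rminus_diag, Rabs_R0, Rplus_0_r.
  assert (E : SC = (144 * (SC / 144) + 64)%Z) by est. rewrite E at 1. rewrite plus_IZR, mult_IZR. est.
Qed.

Lemma near_one_minus (a b u : C) A B U : near a A -> near b B -> near u U ->
  near (u - a * b)%C (badd U (bmul bm1 (bmul A B))).
Proof.
  intros Ha Hb Hu. replace (u - a * b)%C with (u + - RtoC 1 * (a * b))%C by alg. apply near_add; [exact Hu|].
  apply near_mul; [apply near_bm1|now apply near_mul].
Qed.

Ltac near_tac := lazymatch goal with
  | |- near _ bc0 => apply near_bc0
  | |- near _ bc1 => apply near_bc1
  | |- near _ bone => apply near_bone
  | |- near _ b12 => unfold b12; int_ball 12%Z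
  | |- near _ bhalf1 => apply near_bhalf1
  | |- near _ b144 => apply near_b144
  | |- near _ (Pb _) => apply near_PL; lia
  | |- near _ (Lb _) => apply near_PL; lia
  | |- near (Cminus _ _) _ => apply near_one_minus; near_tac
  | |- near _ (badd _ _) => apply near_add; near_tac
  | |- near _ (bmul _ _) => apply near_mul; near_tac
  | |- near _ (bsum ?F _) => apply (near_csum _ F); intros; near_tac
  end.

Lemma near_A0 : near A0 bA0.
Proof. unfold A0, q0, bA0, bq0. near_tac. Qed.

Lemma near_A1 : near A1 bA1.
Proof. unfold A1, q1, q0, bA1, bq1, bq0. near_tac. Qed.

Lemma A0_small : Cmod A0 <= 2 / 100.
Proof.
  via ((near_norm _ _ near_A0)). apply Rle_div_l; [apply SC_pos|].
  assert (H : (100 * (bnorm bA0 + snd bA0) <= 2 * SC)%Z) by (apply Z.leb_le; vm_compute; reflexivity).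
  apply IZR_le in H. rewrite !mult_IZR in H. lra.
Qed.

Lemma near_norm_lower z B : near z B -> IZR (bnorm B - 1 - snd B) / IZR SC <= Cmod z.
Proof.
  assert (P := SC_pos). destruct B as [[a b] e]. unfold near.
  assert (Ct : IZR (bnorm (a, b, e) - 1) / IZR SC <= Cmod (bctr (a, b, e))).
  { unfold bnorm, bctr. set (n := (a * a + b * b)%Z).
    assert (Hn : (0 <= n)%Z) by (apply Z.add_nonneg_nonneg; apply Z.square_nonneg). assert (Hq := Z.sqrt_spec n Hn).
    destruct Hq as [Hq _]. rewrite Z.add_simpl_r. set (w := Z.sqrt n) in *. apply Rsqr_incr_0_var; [|est].
    rewrite !Rsqr_pow2, Cmod_sqr. simpl Re. simpl Im.
    replace ((IZR a / IZR SC) ^ 2 + (IZR b / IZR SC) ^ 2) with (IZR n / IZR SC ^ 2) by (unfold n; rewrite plus_IZR,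
      !mult_IZR; field; lra).
    replace ((IZR w / IZR SC) ^ 2) with (IZR (w * w) / IZR SC ^ 2) by (rewrite mult_IZR; field; lra).
    apply IZR_le in Hq. est. }
  set (c := bctr _) in *. assert (Tr := Cmod_triangle z (- (z - c))%C). rewrite Cmod_opp in Tr.
  replace (z + - (z - c))%C with c in Tr by alg. rewrite minus_IZR. lra.
Qed.

Lemma A1_large : 1099 / 100 <= Cmod A1.
Proof.
  apply Rle_trans with (2 := near_norm_lower _ _ near_A1). apply (Rle_div_r (1099 / 100) _ (IZR SC)); [apply SC_pos|].
  assert (H : (1099 * SC <= 100 * (bnorm bA1 - 1 - snd bA1))%Z) by (apply Z.leb_le; vm_compute; reflexivity).
  apply IZR_le in H. rewrite !mult_IZR in H. lra.
Qed.

Lemma em_taylor_0 : em_approx c0 11 = A0.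
Proof.
  assert (Q := em_approx_c0 (RtoC 0)). rewrite Cplus_0_r in Q. rewrite Q. unfold A0.
  assert (E : forall k, cexp (RtoC (- Ln k) * RtoC 0) = RtoC 1) by (intros; rewrite Cmult_0_r, cexp_R, exp_0;
    reflexivity).
  rewrite E. rewrite <- csum_scal. rewrite (csum_ext _ (fun k => c1 * Pn k)%C) by (intros; rewrite E; ring). ring.
Qed.

(** Without a zero the minimum modulus principle holds on the disc of radius $1/20$ about $c_0$. On
    its boundary the modulus of [fz] is at least $10.99/20-0.02-0.35-0.062>0.11$, with $0.35$ for
    linearisation and $0.062$ for Euler-Maclaurin; at the centre it is at most
    $0.02+0.062=0.082$. *)
Theorem zero_exists : exists s, nontrivial_zero s /\ 0 < Im s.
Proof.
  destruct (Classical_Prop.classic (exists s, nontrivial_zero s /\ 0 < Im s)) as [H|H]; [exact H|exfalso].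
  assert (Nz : forall s, 0 < Re s < 1 -> 0 < Im s -> fz s <> RtoC 0).
  { intros s Hs Hi E. apply H. exists s. split; [|exact Hi]. split; [exact Hs|]. now apply zeta_zero_fz. }
  assert (MM := min_modulus c0 (1 / 20) (11 / 100)). simpl Re in MM. simpl Im in MM.
  specialize (MM ltac:(lra) ltac:(lra) ltac:(lra)). assert (B : 11 / 100 <= Cmod (fz c0)).
  { apply MM; [intros s H1 H2; apply Nz; lra|]. intros z Hz. assert (E1 := em_error_c0 z ltac:(lra)).
    assert (E2 := em_taylor z ltac:(lra)). assert (A0s := A0_small). assert (A1l := A1_large).
    assert (E3 : Cmod (A1 * z)%C = Cmod A1 * (1 / 20)) by (rewrite Cmod_mult, Hz; ring).
    set (X := em_approx (c0 + z) 11) in *. assert (T1 := Cmod_triangle (A0 + A1 * z)%C (- A0)%C).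
    replace (A0 + A1 * z + - A0)%C with (A1 * z)%C in T1 by alg. rewrite Cmod_opp in T1.
    assert (T2 := Cmod_triangle X (- (X - (A0 + A1 * z)))%C).
    replace (X + - (X - (A0 + A1 * z)))%C with (A0 + A1 * z)%C in T2 by alg. rewrite Cmod_opp in T2.
    assert (T3 := Cmod_triangle (fz (c0 + z)) (- (fz (c0 + z) - X))%C).
    replace (fz (c0 + z) + - (fz (c0 + z) - X))%C with X in T3 by alg. rewrite Cmod_opp in T3. lra. }
  assert (E1 := em_error_c0 (RtoC 0) ltac:(rewrite Cmod_0; lra)). assert (E2 := em_taylor_0). rewrite Cplus_0_r in E1.
  assert (A0s := A0_small). rewrite E2 in E1. assert (T3 := Cmod_triangle (fz c0 - A0)%C A0).
  replace (fz c0 - A0 + A0)%C with (fz c0) in T3 by alg. lra.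
Qed.

(** The zero of [zero_exists] bounds the infimum above and [zeros_above_1] bounds it below; being
    finite, it is returned unchanged by [real]. *)
Lemma gamma1_bounds : RiemannHypothesis -> 1 <= gamma1.
Proof.
  intros RH. unfold gamma1. set (E := fun t => 0 < t /\ exists s, nontrivial_zero s /\ Im s = t).
  destruct zero_exists as [s0 [Z0 I0]]. destruct (Glb_Rbar_correct E) as [L1 L2].
  assert (H1 : Rbar_le 1 (Glb_Rbar E)).
  { apply L2. intros t [Ht [s [Zs <-]]]. now apply zeros_above_1. }
  assert (H2 : Rbar_le (Glb_Rbar E) (Im s0)) by (apply L1; split; [exact I0|exists s0; auto]).
  destruct (Glb_Rbar E) as [g| |]; simpl in *; [exact H1|contradiction|contradiction].
Qed.

(** * Comparison with the claimed bound *)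

(** The upper counterpart of [exp_ge_pow]: on $[0,1]$ the remainder $e^z(2z)^6/720$ of
    [exp_rem_bound] is at most $\frac4{15}z^6$, since $e^z\le3$. *)
Lemma exp_le_poly (z b : R) m : 0 <= z <= 1 ->
  (1 + z + z ^ 2 / 2 + z ^ 3 / 6 + z ^ 4 / 24 + z ^ 5 / 120 + 4 / 15 * z ^ 6) ^ m <= b -> exp (INR m * z) <= b.
Proof.
  intros Hz H. eapply Rle_trans; [|exact H]. rewrite <- exp_pow_nat. apply pow_incr. split; [est|].
  assert (Q := exp_rem_bound (RtoC z) 6 1 ltac:(lra)). assert (Q2 := Re_le_Cmod (exp_rem (RtoC z) 6 1)).
  rewrite Cmod_R, Rabs_pos_eq in Q by lra.
  replace (Re (exp_rem (RtoC z) 6 1)) with (exp z - (1 + z + z ^ 2 / 2 + z ^ 3 / 6 + z ^ 4 / 24 + z ^ 5 / 120)) in Q2.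
  - assert (exp z <= 3) by (eapply Rle_trans; [apply exp_le|apply exp_le_3]; lra).
    replace ((2 * z) ^ 6 * 1 ^ 6 / INR (fact 6)) with (4 / 45 * z ^ 6) in Q by alg.
    assert (exp z * (4 / 45 * z ^ 6) <= 3 * (4 / 45 * z ^ 6)) by est.
    apply Rle_trans with (1 + z + z ^ 2 / 2 + z ^ 3 / 6 + z ^ 4 / 24 + z ^ 5 / 120 + Rabs (exp z - (1 + z + z ^ 2 / 2
      + z ^ 3 / 6 + z ^ 4 / 24 + z ^ 5 / 120))).
    + generalize (Rle_abs (exp z - (1 + z + z ^ 2 / 2 + z ^ 3 / 6 + z ^ 4 / 24 + z ^ 5 / 120))). lra.
    + lra.
  - unfold exp_rem. rewrite Re_minus, csum_Re. replace (RtoC 1 * RtoC z)%C with (RtoC z) by alg.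
    rewrite (rsum_ext _ (fun k => 1 ^ k / INR (fact k) * z ^ k)).
    + simpl. rewrite cos_0. field.
    + intros k _. rewrite Re_scal, <- RtoC_pow. reflexivity.
Qed.

Lemma exp_mult_le (z b B : R) m : exp z <= b -> b ^ m <= B -> exp (INR m * z) <= B.
Proof. intros H H2. rewrite <- exp_pow_nat. apply Rle_trans with (b ^ m); est. Qed.

Lemma ln_ge_of_exp (y b : R) : exp b <= y -> b <= ln y.
Proof. intros H. rewrite <- (ln_exp b). est. Qed.

Lemma ln10_ge : 23 / 10 <= ln 10.
Proof. apply ln_ge_of_exp. replace (23 / 10) with (INR 8 * (23 / 80)) by (simpl; lra). apply exp_le_poly; lra. Qed.

Lemma ln_pow10_ge n : 23 / 10 * INR n <= ln (10 ^ n).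
Proof. rewrite ln_pow by lra. assert (H := ln10_ge). generalize (pos_INR n). nra. Qed.

(** All numerical input enters through lower bounds $v$ of $\log\log t$ and $p$ of $(\log t)^c$. *)
Lemma Mcal_le (a b c t v p X : R) :
  0 < v -> exp v <= ln t -> 0 < c -> 0 < b -> 0 < p -> p <= exp (c * v) -> b <= X * (p * v) -> Mcal a b c t <= a + X.
Proof.
  intros Hv Ht Hc Hb Hp Hpe HX. apply Rplus_le_compat_l. assert (L : v <= ln (ln t)) by now apply ln_ge_of_exp.
  assert (P : p <= Rpower (ln t) c).
  { via Hpe. apply exp_le. est. }
  assert (Q : p * v <= Rpower (ln t) c * ln (ln t)) by est. assert (0 < p * v) by est. assert (0 <= X) by nra.
  apply Rle_div_l; [lra|]. via HX. est.
Qed.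

(** Together with [M2_le] this leaves $1.719282-0.959282=0.76$ and $3.144-2.494=0.65$ as lower
    bounds of [phi1] and [phi2] beyond their constant ranges. *)
Lemma M1_le : M1 (10 ^ 2465) <= 759282 / 1000000 + 2 / 10.
Proof.
  apply Mcal_le with (8637 / 1000) (1170 / 100); try lra.
  - eapply Rle_trans; [|apply (ln_pow10_ge 2465)]. rewrite INR_IZR_INZ. change (Z.of_nat 2465) with 2465%Z.
    replace (8637 / 1000) with (INR 8 * (INR 4 * (8637 / 32000))) by (simpl; lra).
    apply exp_mult_le with (2945 / 1000); [apply exp_le_poly; lra|lra].
  - replace (0.285 * (8637 / 1000)) with (INR 8 * (2461545 / 8000000)) by (simpl; lra). apply exp_ge_pow; lra.
Qed.

Lemma M2_le : M2 (10 ^ 208) <= 653 / 1000 + 1841 / 1000.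
Proof.
  apply Mcal_le with (6166 / 1000) (5299 / 1000); try lra.
  - eapply Rle_trans; [|apply (ln_pow10_ge 208)]. rewrite INR_IZR_INZ. change (Z.of_nat 208) with 208%Z.
    replace (6166 / 1000) with (INR 8 * (INR 4 * (6166 / 32000))) by (simpl; lra).
    apply exp_mult_le with (2162 / 1000); [apply exp_le_poly; lra|lra].
  - replace (0.2705 * (6166 / 1000)) with (INR 8 * (1667903 / 8000000)) by (simpl; lra). apply exp_ge_pow; lra.
Qed.

Lemma phi1_ge (u : R) : 0 < u -> 76 / 100 <= phi1 u.
Proof.
  intros Hu. unfold phi1. assert (H := M1_le). set (l := ln (ln (10 ^ 2465))).
  destruct (Rlt_dec u l); unfold ssrbool.is_left; [lra|]. assert (0 < 20.1911 / (u * exp (0.285 * u))); [|lra]. est.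
Qed.

Lemma phi2_ge (u : R) : 0 < u -> 65 / 100 <= phi2 u.
Proof.
  intros Hu. unfold phi2. assert (H := M2_le). set (l := ln (ln (10 ^ 208))).
  destruct (Rlt_dec u l); unfold ssrbool.is_left; [lra|]. assert (0 < 60.12 / (u * exp (0.2705 * u))); [|lra]. est.
Qed.

Lemma ee_bounds : 27 / 10 <= ee <= 272 / 100.
Proof.
  unfold ee. split.
  - replace 1 with (INR 4 * (1 / 4)) by (simpl; lra). apply exp_ge_pow; lra.
  - replace 1 with (INR 4 * (1 / 4)) by (simpl; lra). apply exp_le_poly; lra.
Qed.

Lemma delta_ge (t0 : R) : 0 < t0 <= 50 -> 10404 / 10000 <= delta t0.
Proof. intros Ht. unfold delta. apply Rle_trans with ((1 + 1 / 50) ^ 2); [lra|]. est. Qed.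

Lemma a1_ge (t0 : R) : 0 < t0 <= 50 -> 424 / 10 <= a1 t0.
Proof.
  intros Ht. unfold a1. assert (D := delta_ge t0 Ht). destruct ee_bounds as [E1 E2].
  assert (T : 0 < t0 / exp (exp 2)) by est.
  assert (F : 21 / 10 <= (3 + ee) / ee) by (apply (proj1 (Rle_div_r (21 / 10) (3 + ee) ee ltac:(lra))); lra).
  apply Rle_trans with (10404 / 10000 * (117 / 4 + 3 * (10404 / 10000) + (3 + 10404 / 10000) * (21 / 10))); [lra|].
  est.
Qed.

Lemma lambda_pos (t0 : R) : 2 <= t0 -> 0 < lambda t0.
Proof.
  intros Ht. apply Rmult_lt_0_compat; [lra|]. rewrite <- ln_1. apply ln_increasing; [lra|]. rewrite <- (ln_exp 1).
  apply ln_increasing; [est|]. assert (H := ee_bounds). unfold ee in H. lra.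
Qed.

(* Equality in the bounds [ln v <= v - 1] used here is at [y = 0.76] and [l = 13.78 / 0.76]. *)
Lemma separable_min (y l : R) : 0 < y -> 0 < l -> 445 / 100 <= y + 76 / 100 * ln (1 + 2 * l / y) + 1378 / 100 / l.
Proof.
  intros Hy Hl. assert (A := ln_le_minus1 (y / (76 / 100)) ltac:(lra)).
  assert (B := ln_le_minus1 (1378 / 76 / l) ltac:(est)). assert (P : 0 < 2 * l / y) by est.
  assert (C : ln (2 * l / y) <= ln (1 + 2 * l / y)) by est.
  assert (E : ln (2 * l / y) + ln (y / (76 / 100)) + ln (1378 / 76 / l) = ln (275600 / 5776)).
  { rewrite <- !ln_mult.
    - f_equal. field. lra.
    - est.
    - est.
    - exact P.
    - est. }
  assert (F : 3856 / 1000 <= ln (275600 / 5776)).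
  { apply ln_ge_of_exp. replace (3856 / 1000) with (INR 16 * (3856 / 16000)) by (simpl; lra). apply exp_le_poly; lra. }
  lra.
Qed.

(** Of [omega1] only the logarithm and the term with [a1] are kept. Multiplied by $u$, the second
    bound is [separable_min] at $y=(\sigma_0-1/2)u$, where $13.78=42.4\cdot0.65/2$. The bound on
    [gamma1] serves to make [a2] nonnegative. *)
Lemma omega1_lower (sigma0 t0 u : R) :
  1 <= gamma1 -> 1 / 2 < sigma0 < 1 -> 2 <= t0 <= 50 -> 0 < u ->
  0 <= omega1 sigma0 t0 u /\ 445 / 100 / u <= sigma0 - 1 / 2 + omega1 sigma0 t0 u / 2.
Proof.
  intros Hg Hs Ht Hu. assert (Hl := lambda_pos t0 ltac:(lra)). set (l := lambda t0) in *. assert (P1 := phi1_ge u Hu).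
  assert (P2 := phi2_ge u Hu). assert (Ha := a1_ge t0 ltac:(lra)). assert (Hd := delta_ge t0 ltac:(lra)).
  destruct ee_bounds as [E1 E2]. set (eta := sigma0 - 1 / 2) in *. assert (Heta : 0 < eta) by (unfold eta; lra).
  assert (Om : 424 / 10 * (65 / 100) / (l * u) <= omega t0 u).
  { unfold omega. fold l. assert (T1 : 424 / 10 * (65 / 100) / (l * u) <= a1 t0 * phi2 u / (l * u)) by est.
    assert (T2 : 0 <= a2 t0 * u / (l * exp u)).
    { unfold a2. est. }
    assert (T3 : 0 <= 15.83 / exp u) by est.
    assert (T4 : 0 <= 12 * l / (u * exp (exp u)) * (3 * phi1 u / (2 * u) + 3 / (100 * exp (u + exp u)))) by est.
    assert (T5 : 0 <= a4 t0 * phi2 u / (u ^ 2 * exp u)).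
    { unfold a4. est. }
    lra. }
  assert (Lr : 0 <= ln (1 + 2 * l / (eta * u))).
  { rewrite <- ln_1. apply ln_le; [lra|]. assert (0 <= 2 * l / (eta * u)); [|lra]. est. }
  assert (Ph : 76 / 100 / u <= phi1 u / u + 1 / (50 * exp (u + exp u))).
  { assert (0 <= 1 / (50 * exp (u + exp u))) by est. assert (76 / 100 / u <= phi1 u / u) by est. lra. }
  assert (Pr : 76 / 100 / u * ln (1 + 2 * l / (eta * u)) <= (phi1 u / u + 1 / (50 * exp (u + exp u))) * ln (1 + 2 * l
    / (eta * u))) by est.
  assert (M := separable_min (eta * u) l ltac:(now apply Rmult_lt_0_compat) Hl). unfold omega1. fold eta l.
  assert (Z2 : 0 <= 76 / 100 / u * ln (1 + 2 * l / (eta * u))) by est.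
  assert (Z3 : 0 <= 424 / 10 * (65 / 100) / (l * u)) by est. split; [lra|].
  apply Rle_trans with ((eta * u + 76 / 100 * ln (1 + 2 * l / (eta * u)) + 1378 / 100 / l) / u).
  - est.
  - replace ((eta * u + 76 / 100 * ln (1 + 2 * l / (eta * u)) + 1378 / 100 / l) / u) with
      (eta + 76 / 100 / u * ln (1 + 2 * l / (eta * u)) + 424 / 10 * (65 / 100) / (l * u) / 2) by alg.
    lra.
Qed.

Theorem theorem5 (sigma0 t0 x0 x : R) :
  RiemannHypothesis ->
  1 / 2 < sigma0 < 1 ->
  2 * gamma1 <= t0 <= 50 ->
  4 * exp (2 * exp 1 ^ 2) <= x0 ->
  x0 <= x ->
  Rabs (Mertens x) <=
    N1 sigma0 t0 x0 * Rpower x (sigma0 + 1 / 2 * omega01 sigma0 t0 x0) * ln x.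
Proof.
  intros RH Hs Ht Hx0 Hx. assert (Hg := gamma1_bounds RH). assert (PP := PI_RGT_0). assert (P4 := PI_4).
  destruct ee_bounds as [E1 E2]. assert (Lx0 : 145 / 10 <= ln x0).
  { assert (Q : ln (4 * exp (2 * exp 1 ^ 2)) <= ln x0) by est. rewrite ln_mult, ln_exp in Q by est. fold ee in Q.
    assert (0 <= ln 4) by est. assert ((27 / 10) ^ 2 <= ee ^ 2) by est. lra. }
  assert (Px0 : 0 < x0) by (generalize (exp_pos (2 * exp 1 ^ 2)); lra). assert (Lx : ln x0 <= ln x) by est.
  assert (L32 : 0 <= ln (3 / 2)) by est. assert (L32' := ln_three_halves).
  assert (UL : forall z, 0 < z -> ln (3 * ee * sqrt z / 2) = ln (3 / 2) + 1 + ln z / 2).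
  { intros z Hz. assert (Hsz := sqrt_lt_R0 z Hz). replace (3 * ee * sqrt z / 2) with (3 / 2 * ee * sqrt z) by lra.
    rewrite !ln_mult by lra. unfold ee. rewrite ln_exp.
    assert (ln z = ln (sqrt z) + ln (sqrt z)) by (rewrite <- ln_mult by auto; now rewrite sqrt_sqrt by lra). lra. }
  set (u0 := ln (ln (3 * ee * sqrt x0 / 2))). set (u := ln (ln (3 * ee * sqrt x / 2))). assert (V0 := UL x0 Px0).
  assert (V := UL x ltac:(lra)). assert (Eu : exp u = ln (3 / 2) + 1 + ln x / 2) by (unfold u; rewrite exp_ln; lra).
  assert (Hu0 : 0 < u0) by (unfold u0; rewrite <- ln_1; apply ln_increasing; lra).
  assert (Huu : u0 <= u) by (unfold u0, u; apply ln_le; lra). set (w := omega01 sigma0 t0 x0).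
  assert (HW : 0 <= w /\ 445 / 100 / u0 <= sigma0 - 1 / 2 + w / 2) by (apply omega1_lower; lra).
  set (nn := N1 sigma0 t0 x0). assert (Hn : / (2 * PI) <= nn).
  (* Only the summand $\frac12$ of the first bracket is kept; $w\ge0$ and $3e/2>1$ make the power in
     front at least $1$. *)
  { unfold nn, N1. fold w.
    assert (R1 : 1 <= Rpower (3 * ee / 2) w) by (rewrite <- (Rpower_O (3 * ee / 2)) by lra; apply Rle_Rpower; lra).
    assert (A1 : 0 <= 1 / ln x0) by est.
    assert (A2 : 0 <= (1.1 - sigma0) / (Rpower x0 (sigma0 - 1 / 2) * ln x0)) by est.
    assert (B1 : 1 / PI * 1 * (1 / 2) <= 1 / PI * Rpower (3 * ee / 2) w * (1 / 2 + 1 / ln x0 + (1.1 - sigma0) /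
      (Rpower x0 (sigma0 - 1 / 2) * ln x0))) by est.
    assert (B2 : 0 <= 1 / Rpower x0 (w / 2) * (8 * exp (exp 2) / (PI * sigma0 * (sigma0 - 1 / 2) * ln x0) + 23.6 /
      Rpower x0 (sigma0 - 1 / 2))) by est.
    replace (/ (2 * PI)) with (1 / PI * 1 * (1 / 2)) by alg. lra. }
  (* The claimed exponent is fixed by $x_0$, and $4.45/u$ only decreases from $u_0$ to $u$. *)
  assert (Mexp : Rpower x (1 / 2 + 445 / 100 / u) <= Rpower x (sigma0 + 1 / 2 * w)).
  { apply Rle_Rpower.
    - apply Rle_trans with (exp 0); [rewrite exp_0; lra|]. rewrite <- (exp_ln x) by lra. est.
    - assert (445 / 100 / u <= 445 / 100 / u0) by est. lra. }
  set (Y := Rpower x (1 / 2 + 445 / 100 / u)) in *. assert (HY : 0 < Y) by apply Rpower_pos.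
  assert (Main : 2 * PI * Rabs (Mertens x) <= ln x * Y).
  { destruct (Rle_lt_dec (89 / 10) u) as [H|H].
    (* $\log x=2e^u-2-2\log(3/2)$, which is at least $1.99e^u$ once $e^u\ge7000$. *)
    - apply main_bound; [exact RH|exact H| |lra]. assert (7000 <= exp u).
      { apply Rle_trans with (exp (89 / 10)); [|now apply exp_le].
        replace (89 / 10) with (INR 16 * (89 / 160)) by (simpl; lra). apply exp_ge_pow; lra. }
      lra.
    (* For $u<8.9$ the exponent is at least $1$, and $2\pi\le8<14.5\le\log x$. *)
    - assert (HxY : x <= Y).
      { rewrite <- (Rpower_1 x) at 1 by lra. apply Rle_Rpower.
        - apply Rle_trans with (exp 0); [rewrite exp_0; lra|]. rewrite <- (exp_ln x) by lra. est.
        - assert (1 / 2 <= 445 / 100 / u) by (apply (proj1 (Rle_div_r (1 / 2) (445 / 100) u ltac:(lra))); lra). lra. }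
      assert (MX := Mertens_le x ltac:(lra)). est. }
  apply Rle_trans with (/ (2 * PI) * Y * ln x).
  - apply Rmult_le_reg_l with (2 * PI); [lra|]. replace (2 * PI * (/ (2 * PI) * Y * ln x)) with (ln x * Y) by alg.
    exact Main.
  - est.
Qed.
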